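(* Let $D$ be a simply connected hyperbolic domain and $\{g_t\}_{t\ge0}$ a normalized slit Löwner chain in $D$ driven by $b,\sigma,u_t$. Let $(\tilde b,\tilde\sigma)$ be any other pair of normalized fields, $\tilde b=2\ell_{-2}+\tilde b_{-1}\ell_{-1}+\tilde b_0\ell_0+\tilde b_1\ell_1$, $\tilde\sigma=\ell_{-1}+\tilde\sigma_0\ell_0+\tilde\sigma_1\ell_1$ (real coefficients). Then for some $T_{\max}>0$ there exist a unique $C^1$ time reparameterization $\lambda:[0,T_{\max})\to[0,\tilde T_{\max})$ (with $\lambda(0)=0$) and a unique continuous driving function $\tilde u:[0,\tilde T_{\max})\to\mathbb{R}$ (with $\tilde u_0=0$) such that the slit Löwner chain $\{\tilde g_{\tilde t}\}_{\tilde t\in[0,\tilde T_{\max})}$ driven by $\tilde b,\tilde\sigma,\tilde u$ satisfies $$\tilde g_{\lambda(t)}^{-1}(D)=g_t^{-1}(D)\qquad\text{for all }t\in[0,T_{\max}).$$ Moreover $\dot\lambda(t)>0$ for all $t\in[0,T_{\max})$.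
   Context: Pushforward: $(\phi_*V)(z)=\phi'(\phi^{-1}(z))V(\phi^{-1}(z))$. With $\ell_n^{\mathbb{H}}(z)=-z^{n+1}$ on the upper half-plane and a fixed conformal $\phi:\mathbb{H}\to D$, $\ell_n:=\phi_*\ell_n^{\mathbb{H}}$ (in $\mathbb{D}$: $\ell_n(z)=-2^{n-1}(-i)^n(z-1)^{n+1}(z+1)^{1-n}$). A normalized slit Löwner chain in $D$ driven by $b,\sigma,u$: $b=2\ell_{-2}+b_{-1}\ell_{-1}+b_0\ell_0+b_1\ell_1$, $\sigma=\ell_{-1}+\sigma_0\ell_0+\sigma_1\ell_1$, real coefficients; $\{h_t\}_{t\in\mathbb{R}}$ the flow of automorphisms of $D$ generated by $\sigma$; $u$ continuous real with $u_0=0$; $g_t$ solves $\partial_tg_t(z)=-\frac{1}{h'_{u_t}(g_t(z))}b(h_{u_t}(g_t(z)))$, $g_0(z)=z$; $g_t$ maps the set $D_t$ of points whose solution survives to time $t$ conformally onto $D$, so $g_t^{-1}(D)=D_t$. *)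

(* Defs.v *)
From Stdlib Require Import Reals Lra ZArith ClassicalEpsilon.
Open Scope R_scope.

Definition CC : Type := (R * R)%type.
Definition Cre (z : CC) : R := fst z.
Definition Cim (z : CC) : R := snd z.
Definition C0 : CC := (0, 0).
Definition RtoC (a : R) : CC := (a, 0).
Definition Cadd (z w : CC) : CC := (fst z + fst w, snd z + snd w).
Definition Copp (z : CC) : CC := (- fst z, - snd z).
Definition Csub (z w : CC) : CC := Cadd z (Copp w).
Definition Cmul (z w : CC) : CC :=
  (fst z * fst w - snd z * snd w, fst z * snd w + snd z * fst w).
Definition Cscal (a : R) (z : CC) : CC := (a * fst z, a * snd z).
Definition Cinv (z : CC) : CC :=
  (fst z / (fst z ^ 2 + snd z ^ 2), - snd z / (fst z ^ 2 + snd z ^ 2)).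
Definition Cdiv (z w : CC) : CC := Cmul z (Cinv w).
Definition Cnorm (z : CC) : R := sqrt (fst z ^ 2 + snd z ^ 2).

Fixpoint Cpow (z : CC) (n : nat) : CC :=
  match n with O => (1, 0) | S k => Cmul z (Cpow z k) end.
Definition Cpowz (z : CC) (n : Z) : CC :=
  match n with
  | Z0 => (1, 0)
  | Zpos p => Cpow z (Pos.to_nat p)
  | Zneg p => Cinv (Cpow z (Pos.to_nat p))
  end.

Definition UHP (z : CC) : Prop := 0 < Cim z.

Definition open_set (U : CC -> Prop) : Prop :=
  forall z, U z -> exists r, 0 < r /\ forall w, Cnorm (Csub w z) < r -> U w.

Definition connected_set (U : CC -> Prop) : Prop :=
  ~ exists A B : CC -> Prop,
      open_set A /\ open_set B /\
      (exists a, U a /\ A a) /\ (exists b, U b /\ B b) /\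
      (forall z, U z -> A z \/ B z) /\
      (forall z, U z -> A z -> B z -> False).

Definition cont_path_on (a b : R) (g : R -> CC) : Prop :=
  forall s, a <= s <= b -> forall eps, 0 < eps -> exists del, 0 < del /\
    forall r, a <= r <= b -> Rabs (r - s) < del -> Cnorm (Csub (g r) (g s)) < eps.

Definition cont_square (H : R -> R -> CC) : Prop :=
  forall s t, 0 <= s <= 1 -> 0 <= t <= 1 -> forall eps, 0 < eps ->
    exists del, 0 < del /\ forall s' t', 0 <= s' <= 1 -> 0 <= t' <= 1 ->
      Rabs (s' - s) < del -> Rabs (t' - t) < del ->
      Cnorm (Csub (H s' t') (H s t)) < eps.

Definition simply_connected (U : CC -> Prop) : Prop :=
  forall g : R -> CC, cont_path_on 0 1 g -> (forall s, 0 <= s <= 1 -> U (g s)) ->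
    g 0 = g 1 ->
    exists (H : R -> R -> CC) (c : CC), cont_square H /\
      (forall s t, 0 <= s <= 1 -> 0 <= t <= 1 -> U (H s t)) /\
      (forall s, 0 <= s <= 1 -> H s 0 = g s) /\
      (forall s, 0 <= s <= 1 -> H s 1 = c) /\
      (forall t, 0 <= t <= 1 -> H 0 t = H 1 t).

Definition sc_hyperbolic_domain (D : CC -> Prop) : Prop :=
  open_set D /\ connected_set D /\ (exists z, D z) /\ simply_connected D /\
  exists a b, a <> b /\ ~ D a /\ ~ D b.

Definition has_cderiv (f : CC -> CC) (z w : CC) : Prop :=
  forall eps, 0 < eps -> exists del, 0 < del /\ forall k : CC,
    0 < Cnorm k < del ->
    Cnorm (Csub (Csub (f (Cadd z k)) (f z)) (Cmul w k)) <= eps * Cnorm k.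

Definition holomorphic_on (U : CC -> Prop) (f : CC -> CC) : Prop :=
  forall z, U z -> exists w, has_cderiv f z w.

(** the complex derivative f'(z) (meaningful where it exists) *)
Definition cderiv (f : CC -> CC) (z : CC) : CC :=
  epsilon (inhabits C0) (fun w => has_cderiv f z w).

Definition conformal_onto (phi : CC -> CC) (U V : CC -> Prop) : Prop :=
  holomorphic_on U phi /\
  (forall z1 z2, U z1 -> U z2 -> phi z1 = phi z2 -> z1 = z2) /\
  (forall z, U z -> V (phi z)) /\
  (forall w, V w -> exists z, U z /\ phi z = w).

(** inverse of phi on U (meaningful on the image of U) *)
Definition finv (phi : CC -> CC) (U : CC -> Prop) (w : CC) : CC :=
  epsilon (inhabits C0) (fun z => U z /\ phi z = w).

Definition ellH (n : Z) (z : CC) : CC := Copp (Cpowz z (n + 1)).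

Definition pushforward (phi : CC -> CC) (U : CC -> Prop) (V : CC -> CC) (z : CC) : CC :=
  Cmul (cderiv phi (finv phi U z)) (V (finv phi U z)).

Definition ell (phi : CC -> CC) (n : Z) : CC -> CC := pushforward phi UHP (ellH n).

Definition b_field (phi : CC -> CC) (bm1 b0 b1 : R) (z : CC) : CC :=
  Cadd (Cscal 2 (ell phi (-2) z))
   (Cadd (Cscal bm1 (ell phi (-1) z))
     (Cadd (Cscal b0 (ell phi 0 z)) (Cscal b1 (ell phi 1 z)))).

Definition sigma_field (phi : CC -> CC) (s0 s1 : R) (z : CC) : CC :=
  Cadd (ell phi (-1) z) (Cadd (Cscal s0 (ell phi 0 z)) (Cscal s1 (ell phi 1 z))).

Definition has_tderiv_on (I : R -> Prop) (g : R -> CC) (s : R) (v : CC) : Prop :=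
  forall eps, 0 < eps -> exists del, 0 < del /\ forall r, I r ->
    0 < Rabs (r - s) < del ->
    Cnorm (Csub (Csub (g r) (g s)) (Cscal (r - s) v)) <= eps * Rabs (r - s).

Definition is_flow (D : CC -> Prop) (sigma : CC -> CC) (h : R -> CC -> CC) : Prop :=
  (forall t z, D z -> D (h t z)) /\
  (forall z, D z -> h 0 z = z) /\
  (forall z, D z -> forall t,
     has_tderiv_on (fun _ => True) (fun s => h s z) t (sigma (h t z))).

Definition loewner_rhs (b : CC -> CC) (h : R -> CC -> CC) (u : R -> R)
  (t : R) (w : CC) : CC :=
  Copp (Cdiv (b (h (u t) w)) (cderiv (h (u t)) w)).

(** D_t : the set of z in D whose solution of the Loewner equation
    d/ds g_s(z) = loewner_rhs s (g_s(z)), g_0(z) = z, survives (stays in D)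
    up to time t.  This is g_t^{-1}(D). *)
Definition loewner_domain (D : CC -> Prop) (b : CC -> CC) (h : R -> CC -> CC)
  (u : R -> R) (t : R) (z : CC) : Prop :=
  0 <= t /\ D z /\
  exists g : R -> CC, g 0 = z /\
    (forall s, 0 <= s <= t -> D (g s)) /\
    (forall s, 0 <= s <= t ->
       has_tderiv_on (fun r => 0 <= r <= t) g s (loewner_rhs b h u s (g s))).

Definition continuous_on_set (I : R -> Prop) (f : R -> R) : Prop :=
  forall t, I t -> forall eps, 0 < eps -> exists del, 0 < del /\
    forall s, I s -> Rabs (s - t) < del -> Rabs (f s - f t) < eps.

Definition has_deriv_on_set (I : R -> Prop) (f df : R -> R) : Prop :=
  forall t, I t -> forall eps, 0 < eps -> exists del, 0 < del /\
    forall s, I s -> 0 < Rabs (s - t) < del ->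
      Rabs ((f s - f t) / (s - t) - df t) < eps.

Definition C1_on_set (I : R -> Prop) (f : R -> R) : Prop :=
  exists df, has_deriv_on_set I f df /\ continuous_on_set I df.

(* Main.v *)
Require Import Defs.
From Stdlib Require Import Reals Lra Psatz ClassicalEpsilon Classical List ZArith.
From mathcomp Require Import ssreflect.
From Coquelicot Require Import Coquelicot.
Open Scope R_scope.

(** The map [phi] has no critical points, so both chains can be pulled back to the upper half-plane, where every
  [sigma] generates Moebius maps and the Loewner field at time [t] is the sum of a quadratic polynomial and of
  [A / (z - y)], with [A > 0] and a real pole [y] that determines the value of the driving function.

  Existence: look for the new chain in the form [m_t o g_t] with [m_t] Moebius. The pole and the residue of the new
  field must be the images of the old ones under [m_t], which gives the new driving function and [lambda'] in terms
  of [m_t]; the remaining quadratic polynomial prescribes [m_t' o m_t^-1], an ordinary differential equation for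
  [m_t] that is solvable for a short time.

  Uniqueness: if two chains have the same domains, the transition maps between them are automorphisms of the
  half-plane, hence Moebius maps by the Schwarz-Pick lemma. Their coefficients are differentiable in time, and
  comparing poles and residues shows that they solve the same differential equation. *)

(** Forward trajectories may die, so everything is read off the inverse Loewner maps: backwards in
    time the height stays bounded, hence [bflow k t] is defined on the whole half-plane, is
    injective and holomorphic, and its image is the set of surviving points. Their analysis rests on
    a maximum principle that tolerates isolated points of mere continuity, so that it applies to
    difference quotients completed by the derivative.

    The delicate point of uniqueness is differentiability in time. A Moebius map is determined by
    its value and its derivative at one point, and along one surviving trajectory both are explicit
    differentiable functions of time.

    All is local near the start: [mrad] bounds the poles and the deviation of the matrices from the
    identity, which keeps denominators away from 0, and clamping turns local data into global data.
    A competitor in the uniqueness part is not known to be small; a continuity argument shows that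
    it never leaves the region of validity. Relations between chains are known only for times from 0
    on, so the equations come from left derivatives and hold at positive times. *)

Lemma C_ext (z w : C) : fst z = fst w -> snd z = snd w -> z = w.
Proof. by case: z => a b; case: w => c d /= -> ->. Qed.

Lemma Cmod_fst (z : C) : Rabs (fst z) <= Cmod z.
Proof. exact: (Rle_trans _ _ _ (Rmax_l _ _) (Rmax_Cmod z)). Qed.

Lemma Cmod_snd (z : C) : Rabs (snd z) <= Cmod z.
Proof. exact: (Rle_trans _ _ _ (Rmax_r _ _) (Rmax_Cmod z)). Qed.

Lemma Cmod_le_sum (z : C) : Cmod z <= Rabs (fst z) + Rabs (snd z).
Proof.
rewrite /Cmod; apply: Rle_trans (sqrt_le_1_alt _ ((Rabs (fst z) + Rabs (snd z)) ^ 2) _) _.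
  rewrite -(pow2_abs (fst z)) -(pow2_abs (snd z)).
  have := Rabs_pos (fst z); have := Rabs_pos (snd z); nra.
rewrite sqrt_pow2; first lra.
have := Rabs_pos (fst z); have := Rabs_pos (snd z); lra.
Qed.

Lemma Cmod_sq (z : C) : Cmod z ^ 2 = fst z ^ 2 + snd z ^ 2.
Proof. rewrite /Cmod pow2_sqrt //; nra. Qed.

Lemma Cmod_minus_sym (z w : C) : Cmod (z - w) = Cmod (w - z).
Proof. by rewrite -Cmod_opp; congr Cmod; ring. Qed.

Lemma Cmod_triangle_rev (z w : C) : Cmod z - Cmod w <= Cmod (z - w).
Proof.
have -> : z = ((z - w) + w)%C by ring.
have := Cmod_triangle (z - w + w - w) w.
have -> : ((z - w + w - w) + w = (z - w) + w)%C by ring.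
lra.
Qed.

Lemma Cmod_pos_neq (z : C) : z <> 0%C -> 0 < Cmod z.
Proof. by move=> h; apply/Cmod_gt_0. Qed.

(** * Complex differentiability *)

Definition cder (f : C -> C) (z w : C) : Prop := has_cderiv f z w.

(** Bridge from the epsilon-delta derivative of the statement to the derivative over the normed
    field [C], from which the algebraic rules below are inherited. *)
Lemma cderE (f : C -> C) (z w : C) :
  cder f z w <-> @is_derive C_AbsRing (AbsRing_NormedModule C_AbsRing) f z w.
Proof.
split.
- move=> h; split; first exact: is_linear_scal_l.
  move=> x hx eps.
  (* The derivative is required at every limit of the neighbourhood filter of [z]; such a limit is
     [z] itself. *)
  have <- : z = x := @is_filter_lim_locally_unique C_AbsRing (AbsRing_NormedModule C_AbsRing) _ _ hx.
  have [d [d0 hd]] := h eps (cond_pos eps).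
  suff key : forall y : C, Cmod (y - z) < d ->
      Cmod ((f y - f z) - (y - z) * w)%C <= eps * Cmod (y - z)%C.
    by exists (mkposreal d d0) => y hy; exact: key.
  move=> y hy'.
  case: (Req_dec (Cmod (y - z)) 0) => [e0|n0].
    have e1 : y = z.
      have := Cmod_eq_0 _ e0 => e; have -> : y = (y - z + z)%C by ring.
      by rewrite e; ring.
    subst y; have -> : (f z - f z - (z - z) * w = 0)%C by ring.
    rewrite Cmod_0 e0; lra.
  have hp : 0 < Cmod (y - z)%C < d by have := Cmod_ge_0 (y - z); lra.
  have := hd (y - z)%C hp.
  change (Cmod ((f (z + (y - z)) - f z) - w * (y - z))%C <= eps * Cmod (y - z)%C ->
          Cmod ((f y - f z) - (y - z) * w)%C <= eps * Cmod (y - z)%C).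
  have -> : (z + (y - z) = y)%C by ring.
  by rewrite (Cmult_comm w).
- move=> [_ h] eps e0.
  have [|d hd] := h z _ (mkposreal eps e0).
    by move=> P hP; exact: hP.
  exists d; split; first exact: cond_pos.
  move=> k [k0 kd].
  have := hd (z + k)%C.
  change ((Cmod ((z + k) - z)%C < d -> Cmod ((f (z + k)%C - f z) - ((z + k) - z) * w)%C <= eps * Cmod ((z + k) - z)%C) -> Cmod ((f (z + k)%C - f z) - w * k)%C <= eps * Cmod k).
  have -> : ((z + k) - z = k)%C by ring.
  rewrite (Cmult_comm w) => H; exact: H.
Qed.

Lemma cderiv_const (c z : C) : cder (fun _ => c) z 0%C.
Proof. by apply/cderE; exact: is_derive_const. Qed.

Lemma cderiv_id (z : C) : cder (fun x => x) z 1%C.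
Proof. by apply/cderE; exact: is_derive_id. Qed.

Lemma cderiv_eq (f : C -> C) (z w v : C) : cder f z w -> w = v -> cder f z v.
Proof. by move=> h <-. Qed.

Lemma cderiv_plus (f g : C -> C) (z a b : C) :
  cder f z a -> cder g z b -> cder (fun x => f x + g x)%C z (a + b)%C.
Proof. by move=> /cderE h /cderE k; apply/cderE; exact: is_derive_plus. Qed.

Lemma cderiv_minus (f g : C -> C) (z a b : C) :
  cder f z a -> cder g z b -> cder (fun x => f x - g x)%C z (a - b)%C.
Proof. by move=> /cderE h /cderE k; apply/cderE; exact: is_derive_minus. Qed.

Lemma cderiv_mult (f g : C -> C) (z a b : C) :
  cder f z a -> cder g z b ->
  cder (fun x => f x * g x)%C z (a * g z + f z * b)%C.
Proof.
move=> /cderE h /cderE k; apply/cderE.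
by apply: is_derive_mult => // n m; exact: Cmult_comm.
Qed.

Lemma cderiv_comp (f g : C -> C) (z a b : C) :
  cder f (g z) a -> cder g z b -> cder (fun x => f (g x)) z (a * b)%C.
Proof.
move=> /cderE h /cderE k; apply/cderE.
rewrite Cmult_comm; exact: is_derive_comp h k.
Qed.

Definition ccont (f : C -> C) (z : C) : Prop :=
  forall eps, 0 < eps -> exists del, 0 < del /\
    forall w, Cmod (w - z) < del -> Cmod (f w - f z) < eps.

Lemma cderiv_ccont (f : C -> C) (z a : C) : cder f z a -> ccont f z.
Proof.
move=> h eps e0.
have [d [d0 hd]] := h 1 Rlt_0_1.
have ha := Cmod_ge_0 a.
exists (Rmin d (eps / (Cmod a + 2))); split.
  apply: Rmin_pos => //; apply: Rdiv_lt_0_compat; lra.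
move=> w hw.
have hw1 := Rlt_le_trans _ _ _ hw (Rmin_l _ _).
have hw2 := Rlt_le_trans _ _ _ hw (Rmin_r _ _).
case: (Req_dec (Cmod (w - z)) 0) => [e|n].
  have -> : w = z.
    by have := Cmod_eq_0 _ e => e'; have -> : w = (w - z + z)%C; [ring| rewrite e'; ring].
  have -> : (f z - f z = 0)%C by ring.
  by rewrite Cmod_0.
have hp : 0 < Cmod (w - z)%C < d by have := Cmod_ge_0 (w - z); lra.
have := hd (w - z)%C hp.
change (Cmod ((f (z + (w - z)) - f z) - a * (w - z))%C <= 1 * Cmod (w - z)%C -> Cmod (f w - f z) < eps).
have -> : (z + (w - z) = w)%C by ring.
move=> h1.
have h2 : Cmod (f w - f z) <= (Cmod a + 1) * Cmod (w - z).
  have -> : (f w - f z = (f w - f z - a * (w - z)) + a * (w - z))%C by ring.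
  apply: Rle_trans (Cmod_triangle _ _) _; rewrite Cmod_mult; lra.
apply: Rle_lt_trans h2 _.
apply: Rlt_trans (_ : (Cmod a + 2) * Cmod (w - z) < _); first nra.
have -> : eps = (Cmod a + 2) * (eps / (Cmod a + 2)) by field; lra.
apply: Rmult_lt_compat_l => //; lra.
Qed.

Lemma cderiv_inv_id (z : C) : z <> 0%C -> cder (fun x => / x)%C z (- / (z * z))%C.
Proof.
move=> hz eps e0.
have mz := Cmod_pos_neq _ hz.
have m3 : 0 < Cmod z ^ 3 by apply: pow_lt.
(* The remainder is [k^2 / (z^2 (z + k))]: the first radius gives [|z + k| >= |z| / 2], and the
   second then makes the remainder at most [eps |k|]. *)
exists (Rmin (Cmod z / 2) (eps * Cmod z ^ 3 / 2)); split.
  apply: Rmin_pos; nra.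
move=> k [k0 kd].
change (Cmod (/ (z + k) - / z - - / (z * z) * k)%C <= eps * Cmod k).
have k1 : Cmod k < Cmod z / 2 := Rlt_le_trans _ _ _ kd (Rmin_l _ _).
have k2 : Cmod k < eps * Cmod z ^ 3 / 2 := Rlt_le_trans _ _ _ kd (Rmin_r _ _).
have mk : Cmod z / 2 <= Cmod (z + k).
  have := Cmod_triangle_rev z (- k)%C; rewrite Cmod_opp.
  have -> : (z - - k = z + k)%C by ring.
  lra.
have nzk : (z + k)%C <> 0%C by apply/Cmod_gt_0; lra.
have -> : (/ (z + k) - / z - - / (z * z) * k = k * k * / (z * z * (z + k)))%C by field.
rewrite !Cmod_mult Cmod_inv; last by do ! apply: Cmult_neq_0 => //.
rewrite !Cmod_mult.
apply: (Rmult_le_reg_r (Cmod z * Cmod z * Cmod (z + k))); first by nra.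
rewrite Rmult_assoc Rinv_l; last by nra.
rewrite Rmult_1_r.
have : Cmod k <= eps * (Cmod z * Cmod z * Cmod (z + k)).
  apply: Rle_trans (Rlt_le _ _ k2) _.
  have -> : eps * Cmod z ^ 3 / 2 = eps * (Cmod z * Cmod z * (Cmod z / 2)) by field.
  by apply: Rmult_le_compat_l; [lra|]; apply: Rmult_le_compat_l => //; nra.
by have := Cmod_ge_0 k => k2' hk; have := Rmult_le_compat_l _ _ _ k2' hk; lra.
Qed.

Lemma cderiv_inv (f : C -> C) (z a : C) : cder f z a -> f z <> 0%C ->
  cder (fun x => / f x)%C z (- a / (f z * f z))%C.
Proof.
move=> h n; apply: cderiv_eq (cderiv_comp _ f _ _ _ (cderiv_inv_id _ n) h) _.
by field.
Qed.

Lemma cderiv_div (f g : C -> C) (z a b : C) :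
  cder f z a -> cder g z b -> g z <> 0%C ->
  cder (fun x => f x / g x)%C z ((a * g z - f z * b) / (g z * g z))%C.
Proof.
move=> h k n; apply: cderiv_eq (cderiv_mult _ _ _ _ _ h (cderiv_inv _ _ _ k n)) _.
by field.
Qed.

Lemma cderiv_ext_loc (f g : C -> C) (z a : C) (r : R) : 0 < r ->
  (forall w, Cmod (w - z) < r -> f w = g w) -> cder f z a -> cder g z a.
Proof.
move=> r0 e h eps e0; have [d [d0 hd]] := h eps e0.
exists (Rmin d r); split; first exact: Rmin_pos.
move=> k [k0 kd].
change (Cmod (g (z + k)%C - g z - a * k)%C <= eps * Cmod k).
rewrite -!e.
- by apply: hd; split => //; exact: Rlt_le_trans kd (Rmin_l d r).
- have -> : (z - z = 0)%C by ring.
  by rewrite Cmod_0.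
- have -> : (z + k - z = k)%C by ring.
  exact: Rlt_le_trans kd (Rmin_r d r).
Qed.

Lemma cderiv_unique (f : C -> C) (z a b : C) : cder f z a -> cder f z b -> a = b.
Proof.
move=> ha hb; case: (Req_dec (Cmod (a - b)) 0) => [e|n].
  have := Cmod_eq_0 _ e => e'; have -> : a = (a - b + b)%C by ring.
  by rewrite e'; ring.
exfalso; have p : 0 < Cmod (a - b) by have := Cmod_ge_0 (a - b); lra.
have e0 : 0 < Cmod (a - b) / 3 by lra.
have [d1 [d10 h1]] := ha _ e0; have [d2 [d20 h2]] := hb _ e0.
have dm := Rmin_pos _ _ d10 d20.
set k : C := RtoC (Rmin d1 d2 / 2).
have mk : Cmod k = Rmin d1 d2 / 2 by rewrite Cmod_R Rabs_pos_eq //; lra.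
have l1 := Rmin_l d1 d2; have l2 := Rmin_r d1 d2.
have {}h1 : Cmod (f (z + k)%C - f z - a * k)%C <= Cmod (a - b) / 3 * Cmod k.
  apply: h1; change (0 < Cmod k < d1); lra.
have {}h2 : Cmod (f (z + k)%C - f z - b * k)%C <= Cmod (a - b) / 3 * Cmod k.
  apply: h2; change (0 < Cmod k < d2); lra.
have := Cmod_triangle (f (z + k)%C - f z - b * k)%C (- (f (z + k)%C - f z - a * k))%C.
rewrite Cmod_opp.
have -> : (f (z + k)%C - f z - b * k + - (f (z + k)%C - f z - a * k) = (a - b) * k)%C by ring.
rewrite Cmod_mult; nra.
Qed.

(** * Differentiable curves *)

(** Coordinatewise, so that the mean value theorem, integrals and comparison arguments apply to each
    part; [tder_eps] recovers the complex estimate. *)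
Definition tder (g : R -> C) (s : R) (v : C) : Prop :=
  is_derive (fun r => fst (g r)) s (fst v) /\ is_derive (fun r => snd (g r)) s (snd v).

Lemma is_derive_eps (f : R -> R) (s l : R) :
  is_derive f s l <-> forall eps, 0 < eps -> exists del, 0 < del /\
    forall r, Rabs (r - s) < del -> Rabs (f r - f s - (r - s) * l) <= eps * Rabs (r - s).
Proof.
split.
- move=> [_ h] eps e0.
  have [|d hd] := h s _ (mkposreal eps e0); first by move=> P hP; exact: hP.
  exists d; split; [exact: cond_pos|]; move=> r hr; exact: hd.
- move=> h; split; first exact: is_linear_scal_l.
  move=> x hx eps.
  have <- : s = x := @is_filter_lim_locally_unique R_AbsRing R_NormedModule _ _ hx.
  have [d [d0 hd]] := h eps (cond_pos eps).
  exists (mkposreal d d0) => y hy; exact: hd.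
Qed.

Lemma tder_eps (g : R -> C) (s : R) (v : C) :
  tder g s v <-> forall eps, 0 < eps -> exists del, 0 < del /\
    forall r, Rabs (r - s) < del -> Cmod (g r - g s - RtoC (r - s) * v) <= eps * Rabs (r - s).
Proof.
split.
- move=> [/is_derive_eps h1 /is_derive_eps h2] eps e0.
  have [d1 [d10 k1]] := h1 (eps / 2) ltac:(lra); have [d2 [d20 k2]] := h2 (eps / 2) ltac:(lra).
  exists (Rmin d1 d2); split; first exact: Rmin_pos.
  move=> r hr; apply: Rle_trans (Cmod_le_sum _) _ => /=.
  have := k1 r (Rlt_le_trans _ _ _ hr (Rmin_l _ _)).
  have := k2 r (Rlt_le_trans _ _ _ hr (Rmin_r _ _)).
  have -> : fst (g r) + - fst (g s) + - ((r - s) * fst v - 0 * snd v) = fst (g r) - fst (g s) - (r - s) * fst v by ring.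
  have -> : snd (g r) + - snd (g s) + - ((r - s) * snd v + 0 * fst v) = snd (g r) - snd (g s) - (r - s) * snd v by ring.
  lra.
- move=> h; split; apply/is_derive_eps => eps e0; have [d [d0 hd]] := h eps e0; exists d; split => // r hr.
    apply: Rle_trans (hd r hr); apply: Rle_trans (Cmod_fst _) => /=.
    by right; congr Rabs; ring.
  apply: Rle_trans (hd r hr); apply: Rle_trans (Cmod_snd _) => /=.
  by right; congr Rabs; ring.
Qed.

Lemma tder_tderiv_on (I : R -> Prop) (g : R -> C) (s : R) (v : C) :
  tder g s v -> has_tderiv_on I g s v.
Proof.
move=> /tder_eps h eps e0; have [d [d0 hd]] := h eps e0; exists d; split => // r _ [hr1 hr2].
have := hd r hr2.
change (Cmod (g r - g s - RtoC (r - s) * v) <= eps * Rabs (r - s) ->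
        Cmod ((g r - g s) - Cscal (r - s) v)%C <= eps * Rabs (r - s)).
have -> // : Cscal (r - s) v = (RtoC (r - s) * v)%C.
by apply: C_ext => /=; ring.
Qed.

Lemma tderiv_on_tder (g : R -> C) (s : R) (v : C) (I : R -> Prop) (e : R) : 0 < e ->
  (forall r, Rabs (r - s) < e -> I r) -> has_tderiv_on I g s v -> tder g s v.
Proof.
move=> e1 hI h; apply/tder_eps => eps e0; have [d [d0 hd]] := h eps e0.
exists (Rmin d e); split; first exact: Rmin_pos.
move=> r hr.
have hr1 := Rlt_le_trans _ _ _ hr (Rmin_l _ _); have hr2 := Rlt_le_trans _ _ _ hr (Rmin_r _ _).
case: (Req_dec r s) => [->|n].
  have -> : (g s - g s - RtoC (s - s) * v = 0)%C.
    by rewrite Rminus_diag_eq //; ring.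
  rewrite Cmod_0 Rminus_diag_eq // Rabs_R0; lra.
have p : 0 < Rabs (r - s) < d by split => //; apply: Rabs_pos_lt; lra.
have := hd r (hI r hr2) p.
change (Cmod ((g r - g s) - Cscal (r - s) v)%C <= eps * Rabs (r - s) -> Cmod (g r - g s - RtoC (r - s) * v) <= eps * Rabs (r - s)).
have -> // : Cscal (r - s) v = (RtoC (r - s) * v)%C.
by apply: C_ext => /=; ring.
Qed.

Lemma tder_eq (g : R -> C) (s : R) (v w : C) : tder g s v -> v = w -> tder g s w.
Proof. by move=> h <-. Qed.

Lemma tder_const (c : C) (s : R) : tder (fun _ => c) s 0%C.
Proof. by split => /=; exact: is_derive_const. Qed.

Lemma tder_plus (f g : R -> C) (s : R) (a b : C) :
  tder f s a -> tder g s b -> tder (fun r => f r + g r)%C s (a + b)%C.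
Proof. by move=> [h1 h2] [k1 k2]; split => /=; exact: (is_derive_plus (K := R_AbsRing)). Qed.

Lemma tder_minus (f g : R -> C) (s : R) (a b : C) :
  tder f s a -> tder g s b -> tder (fun r => f r - g r)%C s (a - b)%C.
Proof. by move=> [h1 h2] [k1 k2]; split => /=; exact: (is_derive_minus (K := R_AbsRing)). Qed.

Lemma is_derive_eq (f : R -> R) (x a b : R) : is_derive f x a -> a = b -> is_derive f x b.
Proof. by move=> h <-. Qed.

Lemma is_derive_Rmult (f g : R -> R) (x a b : R) : is_derive f x a -> is_derive g x b ->
  is_derive (fun t => f t * g t) x (a * g x + f x * b).
Proof. by move=> h k; apply: (is_derive_mult (K := R_AbsRing)) => // n m; exact: Rmult_comm. Qed.

Lemma tder_mult (f g : R -> C) (s : R) (a b : C) :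
  tder f s a -> tder g s b -> tder (fun r => f r * g r)%C s (a * g s + f s * b)%C.
Proof.
move=> [h1 h2] [k1 k2]; split => /=.
- apply: is_derive_eq.
    by apply: (is_derive_minus (K := R_AbsRing)); apply: is_derive_Rmult; eassumption.
  by rewrite /minus /plus /opp /=; ring.
- apply: is_derive_eq.
    by apply: (is_derive_plus (K := R_AbsRing)); apply: is_derive_Rmult; eassumption.
  by rewrite /plus /=; ring.
Qed.

Lemma tder_comp (g : R -> C) (l : R -> R) (s dl : R) (v : C) :
  tder g (l s) v -> is_derive l s dl -> tder (fun r => g (l r)) s (RtoC dl * v)%C.
Proof.
move=> [h1 h2] k; split => /=.
- apply: is_derive_eq (is_derive_comp _ _ _ _ _ h1 k) _.
  by rewrite /scal /= /mult /=; ring.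
- apply: is_derive_eq (is_derive_comp _ _ _ _ _ h2 k) _.
  by rewrite /scal /= /mult /=; ring.
Qed.

Lemma tder_real (l : R -> R) (s dl : R) : is_derive l s dl -> tder (fun r => RtoC (l r)) s (RtoC dl).
Proof. by move=> h; split => //=; exact: is_derive_const. Qed.

Lemma tder_cont (g : R -> C) (s : R) (v : C) : tder g s v ->
  forall eps, 0 < eps -> exists del, 0 < del /\ forall r, Rabs (r - s) < del -> Cmod (g r - g s) < eps.
Proof.
move=> /tder_eps h eps e0; have [d [d0 hd]] := h 1 Rlt_0_1.
have hv := Cmod_ge_0 v.
exists (Rmin d (eps / (Cmod v + 2))); split.
  by apply: Rmin_pos => //; apply: Rdiv_lt_0_compat; lra.
move=> r hr.
have hr1 := Rlt_le_trans _ _ _ hr (Rmin_l _ _); have hr2 := Rlt_le_trans _ _ _ hr (Rmin_r _ _).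
have {}hd := hd r hr1.
have h2 : Cmod (g r - g s) <= (Cmod v + 1) * Rabs (r - s).
  have -> : (g r - g s = (g r - g s - RtoC (r - s) * v) + RtoC (r - s) * v)%C by ring.
  apply: Rle_trans (Cmod_triangle _ _) _; rewrite Cmod_mult Cmod_R; lra.
have ra := Rabs_pos (r - s).
apply: Rle_lt_trans h2 _; apply: Rle_lt_trans (_ : (Cmod v + 2) * Rabs (r - s) < _); first nra.
have -> : eps = (Cmod v + 2) * (eps / (Cmod v + 2)) by field; lra.
apply: Rmult_lt_compat_l => //; lra.
Qed.

Lemma tder_cderiv (F : C -> C) (g : R -> C) (s : R) (v w : C) :
  tder g s v -> cder F (g s) w -> tder (fun r => F (g r)) s (w * v)%C.
Proof.
move=> hg hF.
have hc := tder_cont _ _ _ hg.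
move: hg => /tder_eps hg; apply/tder_eps => eps e0.
have mv := Cmod_ge_0 v; have mw := Cmod_ge_0 w.
have e1 : 0 < eps / (2 * (Cmod v + 1)) by apply: Rdiv_lt_0_compat; lra.
have [d1 [d10 h1]] := hF _ e1.
have [d2 [d20 h2]] := hc d1 d10.
have e2 : 0 < eps / (2 * (Cmod w + 1)) by apply: Rdiv_lt_0_compat; lra.
have [d3 [d30 h3]] := hg _ e2.
have [d4 [d40 h4]] := hg 1 Rlt_0_1.
exists (Rmin d2 (Rmin d3 d4)); split; first by do ! apply: Rmin_pos.
move=> r hr.
have hr2 := Rlt_le_trans _ _ _ hr (Rmin_l _ _).
have hr' := Rlt_le_trans _ _ _ hr (Rmin_r _ _).
have hr3 := Rlt_le_trans _ _ _ hr' (Rmin_l _ _).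
have hr4 := Rlt_le_trans _ _ _ hr' (Rmin_r _ _).
have ra := Rabs_pos (r - s).
have {}h2 := h2 r hr2; have {}h3 := h3 r hr3; have {}h4 := h4 r hr4.
have b4 : Cmod (g r - g s) <= (Cmod v + 1) * Rabs (r - s).
  have -> : (g r - g s = (g r - g s - RtoC (r - s) * v) + RtoC (r - s) * v)%C by ring.
  apply: Rle_trans (Cmod_triangle _ _) _; rewrite Cmod_mult Cmod_R; lra.
have b1 : Cmod (F (g r) - F (g s) - w * (g r - g s)) <= eps / (2 * (Cmod v + 1)) * Cmod (g r - g s).
  case: (Req_dec (Cmod (g r - g s)) 0) => [e|n].
    have -> : g r = g s.
      by have := Cmod_eq_0 _ e => e'; have -> : g r = (g r - g s + g s)%C; [ring|rewrite e'; ring].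
    have -> : (F (g s) - F (g s) - w * (g s - g s) = 0)%C by ring.
    rewrite Cmod_0; have := Cmod_ge_0 (g s - g s); nra.
  have p : 0 < Cmod (g r - g s)%C < d1 by have := Cmod_ge_0 (g r - g s); lra.
  have := h1 (g r - g s)%C p.
  change (Cmod (F (g s + (g r - g s))%C - F (g s) - w * (g r - g s))%C <= eps / (2 * (Cmod v + 1)) * Cmod (g r - g s)%C ->
   Cmod (F (g r) - F (g s) - w * (g r - g s)) <= eps / (2 * (Cmod v + 1)) * Cmod (g r - g s)).
  by have -> : (g s + (g r - g s) = g r)%C by ring.
have -> : (F (g r) - F (g s) - RtoC (r - s) * (w * v) = (F (g r) - F (g s) - w * (g r - g s)) + w * (g r - g s - RtoC (r - s) * v))%C by ring.
apply: Rle_trans (Cmod_triangle _ _) _; rewrite Cmod_mult.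
have c1 : eps / (2 * (Cmod v + 1)) * Cmod (g r - g s) <= eps / 2 * Rabs (r - s).
  have -> : eps / 2 * Rabs (r - s) = eps / (2 * (Cmod v + 1)) * ((Cmod v + 1) * Rabs (r - s)) by field; lra.
  apply: Rmult_le_compat_l => //; lra.
have c2 : Cmod w * Cmod (g r - g s - RtoC (r - s) * v) <= eps / 2 * Rabs (r - s).
  apply: Rle_trans (_ : (Cmod w + 1) * (eps / (2 * (Cmod w + 1)) * Rabs (r - s)) <= _).
    by apply: Rmult_le_compat; try lra; exact: Cmod_ge_0.
  by right; field; lra.
lra.
Qed.

Lemma tder_inv (g : R -> C) (s : R) (v : C) : tder g s v -> g s <> 0%C ->
  tder (fun r => / g r)%C s (- v / (g s * g s))%C.
Proof.
move=> h n; apply: tder_eq (tder_cderiv _ _ _ _ _ h (cderiv_inv_id _ n)) _.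
by field.
Qed.

Lemma tder_div (f g : R -> C) (s : R) (a b : C) : tder f s a -> tder g s b -> g s <> 0%C ->
  tder (fun r => f r / g r)%C s ((a * g s - f s * b) / (g s * g s))%C.
Proof.
move=> h k n; apply: tder_eq (tder_mult _ _ _ _ _ h (tder_inv _ _ _ k n)) _.
by field.
Qed.

(** The mean value theorem fails for complex values, but holds for the real and the imaginary part
    along the segment, and these suffice when the derivative vanishes. *)
Lemma cderiv_zero_segment (f : C -> C) (z w : C) :
  (forall t, 0 <= t <= 1 -> cder f (z + RtoC t * (w - z))%C 0%C) -> f z = f w.
Proof.
move=> h.
have hd : forall t, 0 <= t <= 1 -> tder (fun r => f (z + RtoC r * (w - z))%C) t 0%C.
  move=> t ht.
  have hg : tder (fun r => z + RtoC r * (w - z))%C t (w - z)%C.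
    apply: tder_eq.
      apply: tder_plus; first exact: tder_const.
      apply: tder_mult; last exact: tder_const.
      by apply: tder_real; apply: (is_derive_id (K := R_AbsRing)).
    by rewrite /one /=; ring.
  by apply: tder_eq (tder_cderiv _ _ _ _ _ hg (h t ht)) _; ring.
have e : forall (u : R -> R), (forall t, 0 <= t <= 1 -> is_derive u t 0) -> u 0 = u 1.
  move=> u hu.
  have [c [hc1 hc2]] := MVT_gen u 0 1 (fun _ => 0)
    (fun x hx => hu x ltac:(rewrite Rmin_left ?Rmax_right in hx; lra))
    (fun x hx => proj2 (continuity_pt_filterlim u x) (ex_derive_continuous u x (ex_intro _ 0 (hu x ltac:(rewrite Rmin_left ?Rmax_right in hx; lra))))).
  lra.
have -> : f z = f (z + RtoC 0 * (w - z))%C by congr f; ring.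
have -> : f w = f (z + RtoC 1 * (w - z))%C by congr f; ring.
apply: C_ext.
- by apply: (e (fun r => fst (f (z + RtoC r * (w - z))%C))) => t /hd [].
- by apply: (e (fun r => snd (f (z + RtoC r * (w - z))%C))) => t /hd [].
Qed.

(** * Bisection of rectangles *)

Definition rect : Type := ((R * R) * (R * R))%type.
Definition wf_rect (r : rect) : Prop := fst (fst r) <= snd (fst r) /\ fst (snd r) <= snd (snd r).
Definition in_rect (r : rect) (z : C) : Prop :=
  fst (fst r) <= fst z <= snd (fst r) /\ fst (snd r) <= snd z <= snd (snd r).
Definition half (i : bool) (p : R * R) : R * R :=
  if i then (fst p, (fst p + snd p) / 2) else ((fst p + snd p) / 2, snd p).
Definition quarter (r : rect) (ij : bool * bool) : rect :=
  (half (fst ij) (fst r), half (snd ij) (snd r)).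
Definition width (p : R * R) : R := snd p - fst p.

Lemma half_width (i : bool) (p : R * R) : width (half i p) = width p / 2.
Proof. by case: i; rewrite /width /=; field. Qed.

Lemma half_sub (i : bool) (p : R * R) : fst p <= snd p ->
  fst p <= fst (half i p) /\ fst (half i p) <= snd (half i p) /\ snd (half i p) <= snd p.
Proof. by case: i => /= h; repeat split; lra. Qed.

Lemma nested_intervals (I : nat -> R * R) :
  (forall n, fst (I n) <= fst (I (S n)) /\ fst (I (S n)) <= snd (I (S n)) /\ snd (I (S n)) <= snd (I n)) ->
  fst (I O) <= snd (I O) -> exists x, forall n, fst (I n) <= x <= snd (I n).
Proof.
move=> h h0.
have mono : forall n k, fst (I n) <= fst (I (n + k)%nat) /\ snd (I (n + k)%nat) <= snd (I n).
  move=> n; elim => [|k [ih1 ih2]]; first by rewrite Nat.add_0_r; lra.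
  rewrite -plus_n_Sm; have [? [? ?]] := h (n + k)%nat; lra.
have le : forall n, fst (I n) <= snd (I n) by case => // n; have [? [? ?]] := h n.
have cross : forall n m, fst (I n) <= snd (I m).
  move=> n m; have [h1 h2] := mono n m; have [h3 h4] := mono m n.
  rewrite (Nat.add_comm m n) in h3 h4; have := le (n + m)%nat; lra.
have [x [ub lub]] := completeness (fun y => exists n, y = fst (I n))
  ltac:(exists (snd (I O)) => y [n ->]; exact: cross) (ex_intro _ _ (ex_intro _ O eq_refl)).
exists x => n; split; first by apply: ub; exists n.
by apply: lub => y [m ->].
Qed.

(** One quartering argument serves both compactness and Goursat's theorem. [P] may depend on the
    depth, so that it can carry a bound such as [K / 4 ^ n]. *)
Lemma bisection (P : nat -> rect -> Prop) (r0 : rect) : wf_rect r0 -> P O r0 ->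
  (forall n r, wf_rect r -> P n r -> exists ij, P (S n) (quarter r ij)) ->
  exists z : C, forall n, exists r, wf_rect r /\ P n r /\ in_rect r z /\
    width (fst r) = width (fst r0) / 2 ^ n /\ width (snd r) = width (snd r0) / 2 ^ n.
Proof.
move=> w0 p0 st.
pose sel n r := epsilon (inhabits (true, true)) (fun ij => P (S n) (quarter r ij)).
pose s := fix s n := match n with O => r0 | S k => quarter (s k) (sel k (s k)) end.
have wfq : forall r ij, wf_rect r -> wf_rect (quarter r ij).
  move=> r ij [h1 h2]; have [? [? ?]] := half_sub (fst ij) _ h1.
  by have [? [? ?]] := half_sub (snd ij) _ h2; split.
have hs : forall n, wf_rect (s n) /\ P n (s n).
  elim => [//|n [ih1 ih2]] /=; split; first exact: wfq.
  exact: (epsilon_spec (inhabits (true, true)) _ (st _ _ ih1 ih2)).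
have [x hx] := nested_intervals (fun n => fst (s n))
  (fun n => half_sub _ _ (proj1 (proj1 (hs n)))) (proj1 w0).
have [y hy] := nested_intervals (fun n => snd (s n))
  (fun n => half_sub _ _ (proj2 (proj1 (hs n)))) (proj2 w0).
exists (x, y) => n; exists (s n); have [h1 h2] := hs n; split => //; split => //; split; first by split.
have p2 : forall n, 2 ^ n <> 0 by move=> m; apply: pow_nonzero; lra.
elim: n {h1 h2} => [|n [ih1 ih2]]; first by split => /=; field.
by rewrite /= !half_width ih1 ih2; split; field; apply: p2.
Qed.

Lemma pow2_arch (a eps : R) : 0 < eps -> exists n : nat, a / 2 ^ n < eps.
Proof.
move=> e0; have [n hn] := Pow_x_infinity 2 ltac:(rewrite Rabs_pos_eq; lra) (Rabs a / eps + 1).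
exists n; have p : 0 < 2 ^ n by apply: pow_lt; lra.
have := hn n (le_n n); rewrite Rabs_pos_eq; last lra.
move=> h; apply: (Rmult_lt_reg_r (2 ^ n)) => //.
have -> : a / 2 ^ n * 2 ^ n = a by field; lra.
have : eps * (Rabs a / eps + 1) <= eps * 2 ^ n by apply: Rmult_le_compat_l; lra.
have -> : eps * (Rabs a / eps + 1) = Rabs a + eps by field; lra.
have := Rle_abs a; lra.
Qed.

Lemma in_rect_dist (r : rect) (z w : C) : in_rect r z -> in_rect r w ->
  Cmod (w - z) <= width (fst r) + width (snd r).
Proof.
move=> [h1 h2] [k1 k2]; apply: Rle_trans (Cmod_le_sum _) _; rewrite /width /=.
by apply: Rplus_le_compat; apply: Rabs_le; lra.
Qed.

(** Bisection with the property that the points of [S] in the rectangle dominate all of [S]. If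
    every quarter failed, the best of the four witnesses of failure would be dominated by a point of
    some quarter, against the choice of the witness for that quarter. *)
Lemma compact_max (S : C -> Prop) (s : C -> R) (B : R) :
  (exists p, S p) -> (forall z, S z -> Cmod z <= B) ->
  (forall z, (forall eps, 0 < eps -> exists w, S w /\ Cmod (w - z) < eps) -> S z) ->
  (forall z, S z -> forall eps, 0 < eps -> exists del, 0 < del /\
     forall w, S w -> Cmod (w - z) < del -> Rabs (s w - s z) < eps) ->
  exists p, S p /\ forall q, S q -> s q <= s p.
Proof.
move=> [p0 hp0] hb hc hs.
pose P (n : nat) (r : rect) := forall q, S q -> exists p, S p /\ in_rect r p /\ s q <= s p.
have B0 : 0 <= B by have := hb _ hp0; have := Cmod_ge_0 p0; lra.
have [||n r wr pr|z hz] := bisection P ((- B, B), (- B, B)).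
- by split => /=; lra.
- move=> q hq; exists q; split => //; split; last lra.
  have := Cmod_fst q; have := Cmod_snd q; have := hb _ hq => b1 b2 b3.
  have [l1 l2] := proj1 (Rabs_le_between _ _) (Rle_trans _ _ _ b3 b1) .
  by have [l3 l4] := proj1 (Rabs_le_between _ _) (Rle_trans _ _ _ b2 b1); split => /=.
- apply: NNPP => hn.
  have ex : forall ij, exists q, S q /\ forall p, S p -> in_rect (quarter r ij) p -> s p < s q.
    move=> ij; apply: NNPP => h; apply: hn; exists ij => q hq.
    apply: NNPP => k; apply: h; exists q; split => // p hp hi.
    by apply: Rnot_le_lt => l; apply: k; exists p.
  have [qa [sa ha]] := ex (true, true); have [qb [sb hb']] := ex (true, false).
  have [qc [sc hc']] := ex (false, true); have [qd [sd hd]] := ex (false, false).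
  have [q [sq [l1 [l2 [l3 l4]]]]] : exists q, S q /\ s qa <= s q /\ s qb <= s q /\ s qc <= s q /\ s qd <= s q.
    have m2 : forall a b, S a -> S b -> exists q, S q /\ s a <= s q /\ s b <= s q.
      move=> a b ha1 hb1; case: (Rle_dec (s a) (s b)) => h; [exists b|exists a]; repeat split => //; lra.
    have [x [x1 [x2 x3]]] := m2 _ _ sa sb; have [y [y1 [y2 y3]]] := m2 _ _ sc sd.
    have [q [q1 [q2 q3]]] := m2 _ _ x1 y1; exists q; repeat split => //; lra.
  have [p [sp [[[i1 i2] [i3 i4]] le]]] := pr q sq.
  case: (Rle_dec (fst p) ((fst (fst r) + snd (fst r)) / 2)) => c1;
  case: (Rle_dec (snd p) ((fst (snd r) + snd (snd r)) / 2)) => c2.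
  + have := ha p sp ltac:(split => /=; lra); lra.
  + have := hb' p sp ltac:(split => /=; lra); lra.
  + have := hc' p sp ltac:(split => /=; lra); lra.
  + have := hd p sp ltac:(split => /=; lra); lra.
(* Points of [S] at least as good as [q] exist arbitrarily close to [z]. Closedness puts [z] into
   [S], and continuity of [s] passes the comparison to [z]. *)
have near : forall q, S q -> forall eps, 0 < eps -> exists p, S p /\ Cmod (p - z) < eps /\ s q <= s p.
  move=> q hq eps e0; have [n hn] := pow2_arch (4 * B) eps e0.
  have [r [wr [pr [ir [w1 w2]]]]] := hz n.
  have [p [sp [ip le]]] := pr q hq; exists p; split => //; split => //.
  apply: Rle_lt_trans (in_rect_dist _ _ _ ir ip) _; rewrite w1 w2 /width /=.
  have -> : (B - - B) / 2 ^ n + (B - - B) / 2 ^ n = 4 * B / 2 ^ n; last lra.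
  by field; apply: pow_nonzero; lra.
have Sz : S z.
  by apply: hc => eps e0; have [p [sp [l _]]] := near _ hp0 eps e0; exists p.
exists z; split => // q hq; apply: Rnot_lt_le => lt.
have [d [d0 hd]] := hs z Sz (s q - s z) ltac:(lra).
have [p [sp [l le]]] := near _ hq d d0.
have := Rle_abs (s p - s z); have := hd p sp l; lra.
Qed.

(** * Goursat's theorem on rectangles *)

Definition cRInt (f : R -> C) (a b : R) : C :=
  (RInt (fun t => fst (f t)) a b, RInt (fun t => snd (f t)) a b).

Definition ccurve (f : R -> C) (s : R) : Prop :=
  continuous (fun t => fst (f t)) s /\ continuous (fun t => snd (f t)) s.

Lemma continuous_eps (f : R -> R) (x : R) : continuous f x <->
  forall eps, 0 < eps -> exists del, 0 < del /\ forall y, Rabs (y - x) < del -> Rabs (f y - f x) < eps.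
Proof.
split.
- move=> h eps e0.
  have [d hd] := h (fun y => Rabs (y - f x) < eps) ltac:(by exists (mkposreal eps e0)).
  by exists d; split; [exact: cond_pos|]; move=> y hy; exact: hd.
- move=> h P [e he]; have [d [d0 hd]] := h e (cond_pos e).
  by exists (mkposreal d d0) => y hy; apply: he; exact: hd.
Qed.

Lemma ccurve_eps (f : R -> C) (s : R) : ccurve f s <->
  forall eps, 0 < eps -> exists del, 0 < del /\ forall y, Rabs (y - s) < del -> Cmod (f y - f s) < eps.
Proof.
split.
- move=> [/continuous_eps h1 /continuous_eps h2] eps e0.
  have [d1 [d10 k1]] := h1 (eps / 2) ltac:(lra); have [d2 [d20 k2]] := h2 (eps / 2) ltac:(lra).
  exists (Rmin d1 d2); split; first exact: Rmin_pos.
  move=> r hr; apply: Rle_lt_trans (Cmod_le_sum _) _ => /=.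
  have := k1 r (Rlt_le_trans _ _ _ hr (Rmin_l _ _)).
  have := k2 r (Rlt_le_trans _ _ _ hr (Rmin_r _ _)); rewrite /Rminus; lra.
- move=> h; split; apply/continuous_eps => eps e0; have [d [d0 hd]] := h eps e0; exists d; split => // y hy.
    exact: Rle_lt_trans (Cmod_fst _) (hd y hy).
  exact: Rle_lt_trans (Cmod_snd _) (hd y hy).
Qed.

Lemma tder_ccurve (f : R -> C) (s : R) (v : C) : tder f s v -> ccurve f s.
Proof. by move=> h; apply/ccurve_eps; exact: tder_cont h. Qed.

Lemma ccont_comp_curve (f : C -> C) (g : R -> C) (s : R) :
  ccont f (g s) -> ccurve g s -> ccurve (fun t => f (g t)) s.
Proof.
move=> h /ccurve_eps k; apply/ccurve_eps => eps e0.
have [d [d0 hd]] := h eps e0; have [d' [d'0 hd']] := k d d0.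
by exists d'; split => // y hy; apply: hd; apply: hd'.
Qed.

Lemma ccurve_ex_RInt (f : R -> C) (a b : R) : (forall s, Rmin a b <= s <= Rmax a b -> ccurve f s) ->
  ex_RInt (fun t => fst (f t)) a b /\ ex_RInt (fun t => snd (f t)) a b.
Proof. by move=> h; split; apply: (ex_RInt_continuous (V := R_CompleteNormedModule)) => s /h []. Qed.

Lemma ccurve_hor (f : C -> C) (x y : R) : ccont f (x, y) -> ccurve (fun t => f (t, y)) x.
Proof.
move=> h; apply: (ccont_comp_curve f (fun t => (t, y)) x) => //.
by split => /=; [exact: continuous_id|exact: continuous_const].
Qed.

Lemma ccurve_ver (f : C -> C) (x y : R) : ccont f (x, y) -> ccurve (fun t => f (x, t)) y.
Proof.
move=> h; apply: (ccont_comp_curve f (fun t => (x, t)) y) => //.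
by split => /=; [exact: continuous_const|exact: continuous_id].
Qed.

(** The counterclockwise contour integral: bottom minus top, plus right minus left with the factor
    [Ci] from [dz = i dy]. *)
Definition bdry (f : C -> C) (r : rect) : C :=
  let a := fst (fst r) in let b := snd (fst r) in let c := fst (snd r) in let d := snd (snd r) in
  (cRInt (fun x => f (x, c)) a b - cRInt (fun x => f (x, d)) a b
   + Ci * (cRInt (fun y => f (b, y)) c d - cRInt (fun y => f (a, y)) c d))%C.

Lemma cRInt_Chasles (f : R -> C) (a b c : R) : a <= b <= c ->
  (forall s, a <= s <= c -> ccurve f s) -> (cRInt f a b + cRInt f b c)%C = cRInt f a c.
Proof.
move=> abc h.
have [h1 h2] := ccurve_ex_RInt f a b ltac:(move=> s; rewrite Rmin_left ?Rmax_right => *; try apply: h; lra).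
have [k1 k2] := ccurve_ex_RInt f b c ltac:(move=> s; rewrite Rmin_left ?Rmax_right => *; try apply: h; lra).
by apply: C_ext => /=; exact: (RInt_Chasles (V := R_CompleteNormedModule)).
Qed.

(** The inner sides are traversed twice in opposite directions and cancel. *)
Lemma bdry_split (f : C -> C) (r : rect) : wf_rect r -> (forall z, in_rect r z -> ccont f z) ->
  bdry f r = (bdry f (quarter r (true, true)) + bdry f (quarter r (true, false))
    + bdry f (quarter r (false, true)) + bdry f (quarter r (false, false)))%C.
Proof.
case: r => [[a b] [c d]] [/= hab hcd] h; rewrite /bdry /=.
set m := (a + b) / 2; set n := (c + d) / 2.
have hm : a <= m <= b by rewrite /m; lra.
have hn : c <= n <= d by rewrite /n; lra.
have H : forall y, c <= y <= d -> cRInt (fun x => f (x, y)) a b = (cRInt (fun x => f (x, y)) a m + cRInt (fun x => f (x, y)) m b)%C.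
  move=> y hy; rewrite cRInt_Chasles // => s hs; apply: ccurve_hor; apply: h; split => //=.
have V : forall x, a <= x <= b -> cRInt (fun y => f (x, y)) c d = (cRInt (fun y => f (x, y)) c n + cRInt (fun y => f (x, y)) n d)%C.
  move=> x hx; rewrite cRInt_Chasles // => s hs; apply: ccurve_ver; apply: h; split => //=.
rewrite (H c) ?(H d) ?(V a) ?(V b); try lra.
ring.
Qed.

(** The factor 2 comes from bounding the real and the imaginary part separately; it only affects
    constants. *)
Lemma cRInt_bound (f : R -> C) (a b M : R) : a <= b -> (forall s, a <= s <= b -> ccurve f s) ->
  (forall s, a <= s <= b -> Cmod (f s) <= M) -> Cmod (cRInt f a b) <= 2 * (b - a) * M.
Proof.
move=> ab h hM.
have [h1 h2] := ccurve_ex_RInt f a b ltac:(move=> s; rewrite Rmin_left ?Rmax_right => *; try apply: h; lra).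
apply: Rle_trans (Cmod_le_sum _) _ => /=.
have -> : 2 * (b - a) * M = (b - a) * M + (b - a) * M by ring.
apply: Rplus_le_compat; apply: abs_RInt_le_const => // t ht.
  exact: Rle_trans (Cmod_fst _) (hM t ht).
exact: Rle_trans (Cmod_snd _) (hM t ht).
Qed.

Lemma cRInt_minus (f g : R -> C) (a b : R) : a <= b -> (forall s, a <= s <= b -> ccurve f s) ->
  (forall s, a <= s <= b -> ccurve g s) -> cRInt (fun t => f t - g t)%C a b = (cRInt f a b - cRInt g a b)%C.
Proof.
move=> ab hf hg.
have [h1 h2] := ccurve_ex_RInt f a b ltac:(move=> s; rewrite Rmin_left ?Rmax_right => *; try apply: hf; lra).
have [k1 k2] := ccurve_ex_RInt g a b ltac:(move=> s; rewrite Rmin_left ?Rmax_right => *; try apply: hg; lra).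
by apply: C_ext => /=; exact: (RInt_minus (V := R_CompleteNormedModule)).
Qed.

Lemma cRInt_derive (F f : R -> C) (a b : R) : a <= b -> (forall s, a <= s <= b -> tder F s (f s)) ->
  (forall s, a <= s <= b -> ccurve f s) -> cRInt f a b = (F b - F a)%C.
Proof.
move=> ab hF hf; apply: C_ext => /=; apply: is_RInt_unique.
- change (is_RInt (V := R_CompleteNormedModule) (fun t => fst (f t)) a b (minus (fst (F b)) (fst (F a)))).
  apply: (is_RInt_derive (V := R_CompleteNormedModule) (fun t => fst (F t))) => s; rewrite Rmin_left // Rmax_right // => hs.
    by have [] := hF s hs.
  by have [] := hf s hs.
- change (is_RInt (V := R_CompleteNormedModule) (fun t => snd (f t)) a b (minus (snd (F b)) (snd (F a)))).
  apply: (is_RInt_derive (V := R_CompleteNormedModule) (fun t => snd (F t))) => s; rewrite Rmin_left // Rmax_right // => hs.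
    by have [] := hF s hs.
  by have [] := hf s hs.
Qed.

Lemma bdry_primitive (F f : C -> C) (r : rect) : wf_rect r ->
  (forall z, cder F z (f z)) -> (forall z, ccont f z) -> bdry f r = 0%C.
Proof.
case: r => [[a b] [c d]] [/= hab hcd] hF hf; rewrite /bdry /=.
have H : forall y, cRInt (fun x => f (x, y)) a b = (F (b, y) - F (a, y))%C.
  move=> y; apply: (cRInt_derive (fun x => F (x, y))) => // s _; last by apply: ccurve_hor.
  apply: tder_eq (tder_cderiv F (fun x => (x, y)) s 1%C _ _ (hF _)) _; last by ring.
  by split => /=; [exact: (is_derive_id (K := R_AbsRing))|exact: is_derive_const].
have V : forall x, (Ci * cRInt (fun y => f (x, y)) c d)%C = (F (x, d) - F (x, c))%C.
  move=> x; have -> : cRInt (fun y => f (x, y)) c d = ((- Ci * F (x, d)) - (- Ci * F (x, c)))%C.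
    apply: (cRInt_derive (fun y => - Ci * F (x, y))%C) => // s _; last by apply: ccurve_ver.
    apply: tder_eq.
      apply: tder_mult; first exact: tder_const.
      apply: (tder_cderiv F (fun y => (x, y)) s Ci) (hF _).
      by split => /=; [exact: is_derive_const|exact: (is_derive_id (K := R_AbsRing))].
    by apply: C_ext => /=; ring.
  have -> : (Ci * (- Ci * F (x, d) - - Ci * F (x, c)) = (- (Ci * Ci)) * (F (x, d) - F (x, c)))%C by ring.
  have -> : (- (Ci * Ci) = 1)%C by apply: C_ext => /=; ring.
  ring.
have -> : (Ci * (cRInt (fun y => f (b, y)) c d - cRInt (fun y => f (a, y)) c d) =
  Ci * cRInt (fun y => f (b, y)) c d - Ci * cRInt (fun y => f (a, y)) c d)%C by ring.
rewrite !H !V; ring.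
Qed.

(** If the integral were [K > 0] in modulus, quartering would yield rectangles of depth [n] with
    integral at least [K / 4 ^ n]. Near the limit point [f] is affine up to a small multiple of the
    distance. The affine part has a primitive and integrates to 0, and the error is small times
    perimeter times diameter, again of order [4 ^ - n]. *)
Lemma goursat (f : C -> C) (r0 : rect) : wf_rect r0 ->
  (forall z, in_rect r0 z -> exists w, cder f z w) -> bdry f r0 = 0%C.
Proof.
move=> wf0 hd; apply: NNPP => hn.
set K := Cmod (bdry f r0); have K0 : 0 < K by exact: Cmod_pos_neq.
have hc : forall z, in_rect r0 z -> ccont f z by move=> z /hd [w]; exact: cderiv_ccont.
pose P n r := K / 4 ^ n <= Cmod (bdry f r) /\ (forall z, in_rect r z -> in_rect r0 z).
have p4 : forall n, 0 < 4 ^ n by move=> n; apply: pow_lt; lra.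
have p2 : forall n, 0 < 2 ^ n by move=> n; apply: pow_lt; lra.
have [//||n r wr [pr sr]|z hz] := bisection P r0.
- by split => //; rewrite -/K /=; lra.
- have sub : forall ij z, in_rect (quarter r ij) z -> in_rect r0 z.
    move=> ij z [h1 h2]; apply: sr; case: wr => w1 w2.
    have [? [? ?]] := half_sub (fst ij) _ w1; have [? [? ?]] := half_sub (snd ij) _ w2.
    by move: h1 h2 => /= h1 h2; split; lra.
  apply: NNPP => hN.
  have lt : forall ij, Cmod (bdry f (quarter r ij)) < K / 4 ^ S n.
    move=> ij; apply: Rnot_le_lt => le; apply: hN; exists ij; split => //; exact: sub.
  have := bdry_split f r wr (fun z hz => hc z (sr z hz)) => e.
  have : Cmod (bdry f r) < 4 * (K / 4 ^ S n).
    rewrite e; apply: Rle_lt_trans (Cmod_triangle _ _) _.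
    apply: Rle_lt_trans (Rplus_le_compat_r _ _ _ (Cmod_triangle _ _)) _.
    apply: Rle_lt_trans (Rplus_le_compat_r _ _ _ (Rplus_le_compat_r _ _ _ (Cmod_triangle _ _))) _.
    have := lt (true, true); have := lt (true, false); have := lt (false, true); have := lt (false, false); lra.
  have -> : 4 * (K / 4 ^ S n) = K / 4 ^ n by rewrite /=; field; have := p4 n; lra.
  lra.
have z0 : in_rect r0 z by have [r [_ [[_ s] [i _]]]] := hz O; exact: s.
have [w hw] := hd z z0.
set L := width (fst r0) + width (snd r0).
have L0 : 0 <= L by case: wf0; rewrite /L /width; lra.
(* With this tolerance the error is at most [K / 4 ^ n] times [L ^ 2 / (2 (L + 1) ^ 2)], a factor
   below 1. Using [L + 1] also covers a degenerate rectangle. *)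
have [del [d0 hdel]] := hw (K / (8 * (L + 1) ^ 2)) ltac:(apply: Rdiv_lt_0_compat => //; nra).
have [n hn'] := pow2_arch (L + 1) del d0.
have [r [wr [[pr sr] [ir [w1 w2]]]]] := hz n.
set eps := K / (8 * (L + 1) ^ 2) in hdel.
have e0 : 0 < eps by apply: Rdiv_lt_0_compat => //; nra.
set ln := L / 2 ^ n.
have ewl : width (fst r) + width (snd r) = ln by rewrite w1 w2 /ln /L; field; have := p2 n; lra.
have l0 : 0 <= ln by rewrite /ln; apply: Rdiv_le_0_compat.
have ld : ln < del.
  apply: Rle_lt_trans hn'; rewrite /ln; apply: Rmult_le_compat_r; last lra.
  by left; apply: Rinv_0_lt_compat.
(* The affine approximation of [f] at [z]; its primitive is written out in [gF]. *)
pose g (x : C) := (f z + w * (x - z))%C.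
have gF : forall x, cder (fun x => f z * x + w * RtoC (/ 2) * ((x - z) * (x - z)))%C x (g x).
  move=> x; apply: cderiv_eq.
    apply: cderiv_plus.
      by apply: cderiv_mult; [exact: cderiv_const|exact: cderiv_id].
    apply: cderiv_mult; first exact: cderiv_const.
    by apply: cderiv_mult; apply: cderiv_minus; (exact: cderiv_id || exact: cderiv_const).
  have h2 : (RtoC (/ 2) + RtoC (/ 2) = 1)%C by apply: C_ext => /=; field.
  have -> : g x = (f z + w * (RtoC (/ 2) + RtoC (/ 2)) * (x - z))%C by rewrite h2 /g; ring.
  by cbv beta; ring.
have gc : forall x, ccont g x.
  move=> x; apply: (cderiv_ccont _ _ w); apply: cderiv_eq.
    apply: cderiv_plus; first exact: cderiv_const.
    apply: cderiv_mult; first exact: cderiv_const.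
    by apply: cderiv_minus; (exact: cderiv_id || exact: cderiv_const).
  by cbv beta; ring.
have b0 := bdry_primitive _ g r wr gF gc.
pose e (x : C) := (f x - g x)%C.
have be : bdry e r = bdry f r.
  have -> : bdry f r = (bdry f r - bdry g r)%C by rewrite b0; ring.
  move: wr ir sr {w1 w2 pr ewl b0}; case: r => [[a b] [c d]] [/= hab hcd] _ sr.
  rewrite /bdry /= /e !cRInt_minus //; try by move=> s hs; (apply: ccurve_ver || apply: ccurve_hor).
  - ring.
  - by move=> s hs; apply: ccurve_ver; apply: hc; apply: sr; split => /=; lra.
  - by move=> s hs; apply: ccurve_ver; apply: hc; apply: sr; split => /=; lra.
  - by move=> s hs; apply: ccurve_hor; apply: hc; apply: sr; split => /=; lra.
  - by move=> s hs; apply: ccurve_hor; apply: hc; apply: sr; split => /=; lra.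
have ec : forall x, in_rect r x -> ccont e x.
  move=> x /sr /hd [v hv]; apply: (cderiv_ccont _ _ (v - w)%C); apply: cderiv_minus => //.
  apply: cderiv_eq.
    apply: cderiv_plus; first exact: cderiv_const.
    apply: cderiv_mult; first exact: cderiv_const.
    by apply: cderiv_minus; (exact: cderiv_id || exact: cderiv_const).
  by cbv beta; ring.
have eb : forall x, in_rect r x -> Cmod (e x) <= eps * ln.
  move=> x ix; have dx := in_rect_dist _ _ _ ir ix; rewrite ewl in dx.
  case: (Req_dec (Cmod (x - z)) 0) => [e1|n1].
    have -> : x = z.
      by have := Cmod_eq_0 _ e1 => e'; have -> : x = (x - z + z)%C; [ring|rewrite e'; ring].
    have -> : e z = 0%C by rewrite /e /g; ring.
    rewrite Cmod_0; nra.
  have px : 0 < Cmod (x - z)%C < del by have := Cmod_ge_0 (x - z); lra.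
  have := hdel (x - z)%C px.
  change (Cmod (f (z + (x - z))%C - f z - w * (x - z))%C <= eps * Cmod (x - z)%C -> Cmod (e x) <= eps * ln).
  have -> : (z + (x - z) = x)%C by ring.
  have -> : (f x - f z - w * (x - z) = e x)%C by rewrite /e /g; ring.
  nra.
have fin : Cmod (bdry e r) <= 4 * ln * (eps * ln).
  move: wr ec eb ewl {w1 w2 pr ir be b0 sr}; case: r => [[a b] [c d]] [/= hab hcd] ec eb; rewrite /width /= => ewl.
  rewrite /bdry /=.
  have t : forall p q s t : C, Cmod (p - q + Ci * (s - t)) <= Cmod p + Cmod q + Cmod s + Cmod t.
    move=> p q s t; apply: Rle_trans (Cmod_triangle _ _) _; rewrite Cmod_mult.
    have -> : Cmod Ci = 1 by rewrite /Cmod /= ?Rmult_0_l ?Rmult_1_r ?Rplus_0_l sqrt_1.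
    have := Cmod_triangle p (- q)%C; have := Cmod_triangle s (- t)%C; rewrite !Cmod_opp; rewrite /Cminus; lra.
  apply: Rle_trans (t _ _ _ _) _.
  have H : forall y, c <= y <= d -> Cmod (cRInt (fun x => e (x, y)) a b) <= 2 * (b - a) * (eps * ln).
    move=> y hy; apply: cRInt_bound => // s hs.
      by apply: ccurve_hor; apply: ec; split.
    by apply: eb; split.
  have V : forall x, a <= x <= b -> Cmod (cRInt (fun y => e (x, y)) c d) <= 2 * (d - c) * (eps * ln).
    move=> x hx; apply: cRInt_bound => // s hs.
      by apply: ccurve_ver; apply: ec; split.
    by apply: eb; split.
  have := H c ltac:(lra); have := H d ltac:(lra); have := V a ltac:(lra); have := V b ltac:(lra).
  nra.
rewrite be in fin.
have : K / 4 ^ n <= 4 * ln * (eps * ln) by lra.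
have -> : 4 * ln * (eps * ln) = (K / 4 ^ n) * (L ^ 2 / (2 * (L + 1) ^ 2)).
  rewrite /ln /eps; have -> : 4 ^ n = 2 ^ n * 2 ^ n by rewrite -Rpow_mult_distr; congr pow; ring.
  by field; split; have := p2 n; lra.
have q : L ^ 2 / (2 * (L + 1) ^ 2) < 1.
  apply: (Rmult_lt_reg_r (2 * (L + 1) ^ 2)); first nra.
  have -> : L ^ 2 / (2 * (L + 1) ^ 2) * (2 * (L + 1) ^ 2) = L ^ 2 by field; lra.
  nra.
have : 0 < K / 4 ^ n by apply: Rdiv_lt_0_compat.
nra.
Qed.

(** * Mean values and the maximum principle *)

Definition cexp (z : C) : C := (exp (fst z) * cos (snd z), exp (fst z) * sin (snd z)).

Lemma cexp_plus (z w : C) : cexp (z + w) = (cexp z * cexp w)%C.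
Proof. by apply: C_ext => /=; rewrite exp_plus ?cos_plus ?sin_plus; ring. Qed.

Lemma cexp_0 : cexp 0 = 1%C.
Proof. by apply: C_ext => /=; rewrite exp_0 ?cos_0 ?sin_0; ring. Qed.

Lemma Cmod_cexp (z : C) : Cmod (cexp z) = exp (fst z).
Proof.
rewrite /Cmod /=.
have -> : exp (fst z) * cos (snd z) * (exp (fst z) * cos (snd z) * 1) +
  exp (fst z) * sin (snd z) * (exp (fst z) * sin (snd z) * 1) =
  (exp (fst z) * exp (fst z)) * (Rsqr (sin (snd z)) + Rsqr (cos (snd z))) by rewrite /Rsqr; ring.
by rewrite sin2_cos2 Rmult_1_r sqrt_square //; left; exact: exp_pos.
Qed.

Lemma cexp_neq0 (z : C) : cexp z <> 0%C.
Proof. by apply/Cmod_gt_0; rewrite Cmod_cexp; exact: exp_pos. Qed.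

Lemma cder_cexp_0 : cder cexp 0%C 1%C.
Proof.
move=> eps e0.
have hexp := proj1 (is_derive_eps exp 0 1) (is_derive_eq _ _ _ _ (is_derive_exp 0) exp_0).
have hcos := proj1 (is_derive_eps cos 0 0) (is_derive_eq _ _ _ _ (is_derive_cos 0) (eq_trans (f_equal Ropp sin_0) Ropp_0)).
have hsin := proj1 (is_derive_eps sin 0 1) (is_derive_eq _ _ _ _ (is_derive_sin 0) cos_0).
(* The minimum with 1 yields [|exp x - 1| <= 2 |x|] and [exp x <= 3]. The two coordinates of the
   remainder then add up to at most nine sixteenths of [eps |k|]. *)
have [d1 [d10 h1]] := hexp (Rmin 1 (eps / 16)) ltac:(apply: Rmin_pos; lra).
have [d2 [d20 h2]] := hcos (eps / 16) ltac:(lra).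
have [d3 [d30 h3]] := hsin (eps / 16) ltac:(lra).
exists (Rmin (Rmin d1 (Rmin d2 d3)) (Rmin 1 (eps / 16))); split; first by do ! apply: Rmin_pos; lra.
move=> k [k0 kd]; change (Cmod k < Rmin (Rmin d1 (Rmin d2 d3)) (Rmin 1 (eps / 16))) in kd.
change (Cmod (cexp (0 + k) - cexp 0 - 1 * k) <= eps * Cmod k).
have a1 := Rlt_le_trans _ _ _ kd (Rmin_l _ _); have a2 := Rlt_le_trans _ _ _ kd (Rmin_r _ _).
have b1 := Rlt_le_trans _ _ _ a1 (Rmin_l _ _); have b' := Rlt_le_trans _ _ _ a1 (Rmin_r _ _).
have b2 := Rlt_le_trans _ _ _ b' (Rmin_l _ _); have b3 := Rlt_le_trans _ _ _ b' (Rmin_r _ _).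
have c1 := Rlt_le_trans _ _ _ a2 (Rmin_l _ _); have c2 := Rlt_le_trans _ _ _ a2 (Rmin_r _ _).
have fx := Cmod_fst k; have fy := Cmod_snd k; have mk := Cmod_ge_0 k.
rewrite cexp_0 Cplus_0_l.
apply: Rle_trans (Cmod_le_sum _) _ => /=.
set x := fst k in fx *; set y := snd k in fy *.
have E1 := h1 x ltac:(rewrite Rminus_0_r; lra).
have E2 := h2 y ltac:(rewrite Rminus_0_r; lra).
have E3 := h3 y ltac:(rewrite Rminus_0_r; lra).
rewrite exp_0 !Rminus_0_r in E1; rewrite cos_0 !Rminus_0_r in E2; rewrite sin_0 !Rminus_0_r in E3.
have m1 := Rmin_l 1 (eps / 16); have m2 := Rmin_r 1 (eps / 16).
have m0 : 0 < Rmin 1 (eps / 16) by apply: Rmin_pos; lra.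
have rx := Rabs_pos x; have ry := Rabs_pos y.
have ex : 0 < exp x by exact: exp_pos.
have ex1 : Rabs (exp x - 1) <= 2 * Rabs x.
  have -> : exp x - 1 = (exp x - 1 - x * 1) + x by ring.
  apply: Rle_trans (Rabs_triang _ _) _; nra.
have ex3 : exp x <= 3 by have := Rle_abs (exp x - 1); lra.
have -> : exp x * cos y + -1 + - (1 * x - 0 * y) = (exp x - 1 - x * 1) + exp x * (cos y - 1 - y * 0) by ring.
have -> : exp x * sin y + - 0 + - (1 * y + 0 * x) = exp x * (sin y - y * 1) + (exp x - 1) * y by ring.
have t1 := Rabs_triang (exp x - 1 - x * 1) (exp x * (cos y - 1 - y * 0)).
have t2 := Rabs_triang (exp x * (sin y - y * 1)) ((exp x - 1) * y).
rewrite !Rabs_mult (Rabs_pos_eq (exp x)) in t1 t2; try lra.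
have p1 : exp x * Rabs (cos y - 1 - y * 0) <= 3 * (eps / 16 * Rabs y) by apply: Rmult_le_compat; try lra; exact: Rabs_pos.
have p2 : exp x * Rabs (sin y - y * 1) <= 3 * (eps / 16 * Rabs y) by apply: Rmult_le_compat; try lra; exact: Rabs_pos.
have p3 : Rabs (exp x - 1) * Rabs y <= 2 * (eps / 16) * Rabs y by apply: Rmult_le_compat_r => //; lra.
have p4 : Rmin 1 (eps / 16) * Rabs x <= eps / 16 * Rabs x by apply: Rmult_le_compat_r.
have q1 : eps * Rabs x <= eps * Cmod k by apply: Rmult_le_compat_l; lra.
have q2 : eps * Rabs y <= eps * Cmod k by apply: Rmult_le_compat_l; lra.
have q3 : 0 <= eps * Cmod k by apply: Rmult_le_pos => //; lra.
lra.
Qed.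

(** The functional equation carries the derivative at 0 to every point. *)
Lemma cder_cexp (z : C) : cder cexp z (cexp z).
Proof.
have h : cder (fun w => cexp z * cexp (w - z))%C z (cexp z).
  apply: cderiv_eq.
    apply: cderiv_mult; first exact: cderiv_const.
    apply: (cderiv_comp cexp (fun w => w - z)%C z 1%C 1%C).
      have -> : (z - z = 0)%C by ring.
      exact: cder_cexp_0.
    apply: cderiv_eq; first by apply: cderiv_minus; [exact: cderiv_id|exact: cderiv_const].
    ring.
  by cbv beta; ring.
apply: cderiv_ext_loc Rlt_0_1 _ h => w _; rewrite -cexp_plus; congr cexp; ring.
Qed.

(** The circle as the image of a vertical segment under [cexp], so that circles about [p] become the
    vertical sides of a rectangle. *)
Definition circ (p : C) (r t : R) : C := (p + cexp (ln r, t))%C.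

Lemma circ_dist (p : C) (r t : R) : 0 < r -> Cmod (circ p r t - p) = r.
Proof.
move=> r0; have -> : (circ p r t - p = cexp (ln r, t))%C by rewrite /circ; ring.
by rewrite Cmod_cexp /= exp_ln.
Qed.

Lemma circ_tder (p : C) (r t : R) : ccurve (circ p r) t.
Proof.
apply: tder_ccurve; apply: tder_plus; first exact: tder_const.
apply: (tder_cderiv cexp (fun t => (ln r, t)) t Ci) (cder_cexp _).
by split => /=; [exact: is_derive_const|exact: (is_derive_id (K := R_AbsRing))].
Qed.

(** Goursat's theorem for [z |-> f (p + cexp z)] on the rectangle [[ln e, ln r] x [0, 2 PI]]. The
    horizontal sides cancel by periodicity, so the vertical ones agree. Differentiability at [p]
    never enters, as [cexp] omits 0. *)
Lemma circle_integral_invariant (f : C -> C) (p : C) (e r : R) : 0 < e <= r ->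
  (forall z, 0 < Cmod (z - p) <= r -> exists w, cder f z w) ->
  cRInt (fun t => f (circ p e t)) 0 (2 * PI) = cRInt (fun t => f (circ p r t)) 0 (2 * PI).
Proof.
move=> er hf.
have pi := PI_RGT_0.
pose G z := f (p + cexp z)%C.
have lee : ln e <= ln r by apply: ln_le; lra.
have g := goursat G ((ln e, ln r), (0, 2 * PI)).
have : bdry G ((ln e, ln r), (0, 2 * PI)) = 0%C.
  apply: g; first by split => /=; lra.
  move=> z [/= hz1 hz2].
  have [|w hw] := hf (p + cexp z)%C.
    have -> : (p + cexp z - p = cexp z)%C by ring.
    rewrite Cmod_cexp; split; first exact: exp_pos.
    have -> : r = exp (ln r) by rewrite exp_ln //; lra.
    by case: (Rle_lt_or_eq_dec _ _ (proj2 hz1)) => [l|->]; [left; exact: exp_increasing|right].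
  eexists; apply: (cderiv_comp f (fun z => p + cexp z)%C) hw _.
  by apply: cderiv_plus; [exact: cderiv_const|exact: cder_cexp].
rewrite /bdry /=.
have -> : cRInt (fun x => G (x, 2 * PI)) (ln e) (ln r) = cRInt (fun x => G (x, 0)) (ln e) (ln r).
  have ee : forall x, G (x, 2 * PI) = G (x, 0).
    move=> x; rewrite /G; congr f; congr Cplus; apply: C_ext => /=.
      by rewrite cos_2PI cos_0.
    by rewrite sin_2PI sin_0.
  by rewrite /cRInt; congr pair; apply: RInt_ext => x _; rewrite ee.
move=> h.
have h2 : (Ci * (cRInt (fun t => f (circ p r t)) 0 (2 * PI) - cRInt (fun t => f (circ p e t)) 0 (2 * PI)) = 0)%C.
  by rewrite -h /G /circ; ring.
have h3 : (- Ci * (Ci * (cRInt (fun t => f (circ p r t)) 0 (2 * PI) - cRInt (fun t => f (circ p e t)) 0 (2 * PI))) = 0)%C.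
  by rewrite h2; ring.
have i2 : (Ci * Ci = - (1))%C by apply: C_ext => /=; ring.
have : (- (Ci * Ci) * (cRInt (fun t => f (circ p r t)) 0 (2 * PI) - cRInt (fun t => f (circ p e t)) 0 (2 * PI)) = 0)%C.
  by rewrite -h3; ring.
rewrite i2 => h4.
set u := cRInt _ _ _ in h4 *; set v := cRInt _ _ _ in h4 *.
have -> : u = (v + - - (1) * (u - v))%C by ring.
rewrite h4; ring.
Qed.

(** The circle mean does not depend on the radius, and it tends to the value at [p] by continuity.
    The centre may thus be a point of mere continuity, as it is for completed difference
    quotients. *)
Lemma mean_value_re (f : C -> C) (p : C) (r : R) : 0 < r -> ccont f p ->
  (forall z, 0 < Cmod (z - p) <= r -> exists w, cder f z w) ->
  ex_RInt (fun t => fst (f (circ p r t))) 0 (2 * PI) /\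
  RInt (fun t => fst (f (circ p r t))) 0 (2 * PI) = 2 * PI * fst (f p).
Proof.
move=> r0 cp hf; have pi := PI_RGT_0.
have cc : forall e, 0 < e <= r -> forall t, ccurve (fun t => f (circ p e t)) t.
  move=> e he t; apply: ccont_comp_curve; last exact: circ_tder.
  have [|w hw] := hf (circ p e t); first by rewrite circ_dist; lra.
  exact: cderiv_ccont hw.
have ex : forall e, 0 < e <= r -> ex_RInt (fun t => fst (f (circ p e t))) 0 (2 * PI).
  by move=> e he; have [] := ccurve_ex_RInt (fun t => f (circ p e t)) 0 (2 * PI) (fun s _ => cc e he s).
split; first by apply: ex; lra.
apply: cond_eq => eps e0.
have [d [d0 hd]] := cp (eps / (4 * PI)) ltac:(apply: Rdiv_lt_0_compat; lra).
set e := Rmin (d / 2) r.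
have er : 0 < e <= r by split; [apply: Rmin_pos; lra|exact: Rmin_r].
have ed : e < d by have := Rmin_l (d / 2) r; rewrite /e; lra.
have inv := f_equal fst (circle_integral_invariant f p e r er hf).
change (RInt (fun t => fst (f (circ p e t))) 0 (2 * PI) = RInt (fun t => fst (f (circ p r t))) 0 (2 * PI)) in inv.
rewrite -inv.
have c0 : RInt (fun _ => fst (f p)) 0 (2 * PI) = 2 * PI * fst (f p).
  by rewrite RInt_const /scal /= /mult /=; ring.
rewrite -c0.
have E := RInt_minus (V := R_CompleteNormedModule) _ _ _ _ (ex e er) (ex_RInt_const 0 (2 * PI) (fst (f p))).
change (Rabs (minus (RInt (fun t => fst (f (circ p e t))) 0 (2 * PI)) (RInt (fun _ => fst (f p)) 0 (2 * PI))) < eps).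
rewrite -E.
apply: Rle_lt_trans (_ : (2 * PI - 0) * (eps / (4 * PI)) < _).
  apply: abs_RInt_le_const; first lra.
    apply: (ex_RInt_minus (V := R_NormedModule)); [exact: ex|exact: ex_RInt_const].
  move=> t _; left.
  apply: Rle_lt_trans (_ : Cmod (f (circ p e t) - f p) < _); first exact: (Cmod_fst (f (circ p e t) - f p)%C).
  by apply: hd; rewrite circ_dist //; lra.
have -> : (2 * PI - 0) * (eps / (4 * PI)) = eps / 2 by field; lra.
lra.
Qed.

(** The term [eps * |z|^2] makes [|f|^2] strictly subharmonic, which excludes interior maxima. *)
Lemma max_principle (f : C -> C) (c : C) (R0 M : R) : 0 < R0 -> 0 <= M ->
  (forall z, Cmod (z - c) <= R0 -> ccont f z) ->
  (forall p, Cmod (p - c) < R0 -> exists r, 0 < r /\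
     forall z, 0 < Cmod (z - p) < r -> exists w, cder f z w) ->
  (forall z, Cmod (z - c) = R0 -> Cmod (f z) <= M) ->
  forall z, Cmod (z - c) <= R0 -> Cmod (f z) <= M.
Proof.
move=> R00 M0 hc hh hb z hz.
have pi := PI_RGT_0.
(* A value above [M] would contradict this bound for one explicit [eps], proportional to the
   excess. *)
suff key : forall eps, 0 < eps -> Cmod (f z) ^ 2 <= M ^ 2 + eps * R0 ^ 2.
  apply: Rnot_lt_le => lt.
  have d0 : 0 < (Cmod (f z) ^ 2 - M ^ 2) / (2 * R0 ^ 2) by apply: Rdiv_lt_0_compat; nra.
  have := key _ d0.
  have -> : (Cmod (f z) ^ 2 - M ^ 2) / (2 * R0 ^ 2) * R0 ^ 2 = (Cmod (f z) ^ 2 - M ^ 2) / 2 by field; lra.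
  nra.
move=> eps e0.
pose s (x : C) := Cmod (f x) ^ 2 + eps * Cmod (x - c) ^ 2.
have [p [hp1 hp2]] : exists p, Cmod (p - c) <= R0 /\ forall q, Cmod (q - c) <= R0 -> s q <= s p.
  apply: (compact_max (fun x => Cmod (x - c) <= R0) s (R0 + Cmod c)).
  - by exists z.
  - move=> x hx; have := Cmod_triangle (x - c) c; have -> : (x - c + c = x)%C by ring.
    lra.
  - move=> x hx; apply: Rnot_lt_le => lt.
    have [w [w1 w2]] := hx (Cmod (x - c) - R0) ltac:(lra).
    have := Cmod_triangle (w - c) (x - w); have -> : (w - c + (x - w) = x - c)%C by ring.
    rewrite (Cmod_minus_sym x w); lra.
  - move=> x hx e1 e10.
    set K := Cmod (f x) + 1; have K1 : 1 <= K by have := Cmod_ge_0 (f x); rewrite /K; lra.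
    have [d [d0 hd]] := hc x hx (Rmin 1 (e1 / (4 * K))) ltac:(apply: Rmin_pos; [lra|apply: Rdiv_lt_0_compat; lra]).
    exists (Rmin d (e1 / (8 * eps * R0))); split.
      apply: Rmin_pos => //; apply: Rdiv_lt_0_compat => //; nra.
    move=> w hw hwx.
    have h1 := hd w (Rlt_le_trans _ _ _ hwx (Rmin_l _ _)).
    have h2 := Rlt_le_trans _ _ _ hwx (Rmin_r _ _).
    have h3 := Rlt_le_trans _ _ _ h1 (Rmin_l _ _).
    have h4 := Rlt_le_trans _ _ _ h1 (Rmin_r _ _).
    have g0 := Cmod_ge_0 (f x); have g1 := Cmod_ge_0 (f w).
    have g2 := Cmod_ge_0 (w - c); have g3 := Cmod_ge_0 (x - c).
    have t1 := Cmod_triangle_rev (f w) (f x); have t2 := Cmod_triangle_rev (f x) (f w).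
    rewrite (Cmod_minus_sym (f x)) in t2.
    have t3 := Cmod_triangle_rev (w - c) (x - c); have t4 := Cmod_triangle_rev (x - c) (w - c).
    have ew : (w - c - (x - c) = w - x)%C by ring.
    have ex : (x - c - (w - c) = x - w)%C by ring.
    rewrite ew in t3; rewrite ex (Cmod_minus_sym x w) in t4.
    have -> : s w - s x = (Cmod (f w) - Cmod (f x)) * (Cmod (f w) + Cmod (f x)) + eps * ((Cmod (w - c) - Cmod (x - c)) * (Cmod (w - c) + Cmod (x - c))) by rewrite /s; ring.
    apply: Rle_lt_trans (Rabs_triang _ _) _; rewrite !Rabs_mult (Rabs_pos_eq eps); last lra.
    rewrite (Rabs_pos_eq (Cmod (f w) + Cmod (f x))); last lra.
    rewrite (Rabs_pos_eq (Cmod (w - c) + Cmod (x - c))); last lra.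
    have q1 : Rabs (Cmod (f w) - Cmod (f x)) <= e1 / (4 * K) by apply: Rabs_le; lra.
    have q2 : Rabs (Cmod (w - c) - Cmod (x - c)) <= e1 / (8 * eps * R0) by apply: Rabs_le; lra.
    have r1 : Rabs (Cmod (f w) - Cmod (f x)) * (Cmod (f w) + Cmod (f x)) <= e1 / (4 * K) * (2 * K).
      apply: Rmult_le_compat => //; [exact: Rabs_pos|lra|rewrite /K; lra].
    have r2 : Rabs (Cmod (w - c) - Cmod (x - c)) * (Cmod (w - c) + Cmod (x - c)) <= e1 / (8 * eps * R0) * (2 * R0).
      apply: Rmult_le_compat => //; [exact: Rabs_pos|lra|lra].
    have x1 : e1 / (4 * K) * (2 * K) = e1 / 2 by field; lra.
    have x2 : eps * (e1 / (8 * eps * R0) * (2 * R0)) = e1 / 4 by field; lra.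
    have := Rmult_le_compat_l eps _ _ (Rlt_le _ _ e0) r2; lra.
have sz := hp2 z hz.
have b1 : Cmod (f z) ^ 2 <= s p by apply: Rle_trans sz; rewrite /s; have := Cmod_ge_0 (z - c); nra.
apply: Rle_trans b1 _.
case: (Rle_lt_or_eq_dec _ _ hp1) => [lt|e]; last first.
  rewrite /s e; have := hb p e; have := Cmod_ge_0 (f p); nra.
exfalso.
have [r1 [r10 hr1]] := hh p lt.
set r := Rmin (r1 / 2) (R0 - Cmod (p - c)).
have r0 : 0 < r by apply: Rmin_pos; lra.
have rr1 : r < r1 by have := Rmin_l (r1 / 2) (R0 - Cmod (p - c)); rewrite /r; lra.
have rr2 : r <= R0 - Cmod (p - c) by exact: Rmin_r.
(* [F] linearises [s] at the maximum point [p]: [|f q|^2 + |f p|^2] is at least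
   [2 Re (conj (f p) f q)], and [|q - c|^2] expands exactly with [r^2] left over. Maximality forces
   [Re F <= Re (F p) - eps r^2] on the circle, against the mean value property. *)
pose F (x : C) := (2 * Cconj (f p) * f x + RtoC (2 * eps) * Cconj (p - c) * (x - p))%C.
have cF : forall x, cder (fun x => RtoC (2 * eps) * Cconj (p - c) * (x - p))%C x (RtoC (2 * eps) * Cconj (p - c))%C.
  move=> x; apply: cderiv_eq.
    apply: cderiv_mult; first exact: cderiv_const.
    by apply: cderiv_minus; [exact: cderiv_id|exact: cderiv_const].
  by cbv beta; ring.
have dF : forall x v, cder f x v -> cder F x (2 * Cconj (f p) * v + RtoC (2 * eps) * Cconj (p - c))%C.
  move=> x v hv; apply: cderiv_plus (cF x); apply: cderiv_eq.
    by apply: cderiv_mult; [exact: cderiv_const|exact: hv].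
  by cbv beta; ring.
have contF : ccont F p.
  move=> e1 e10.
  set K := Cmod (2 * Cconj (f p)) + 1; have K1 : 1 <= K by have := Cmod_ge_0 (2 * Cconj (f p)); rewrite /K; lra.
  have [d1 [d10 h1]] := hc p hp1 (e1 / (2 * K)) ltac:(apply: Rdiv_lt_0_compat; lra).
  have [d2 [d20 h2]] := cderiv_ccont _ _ _ (cF p) (e1 / 2) ltac:(lra).
  exists (Rmin d1 d2); split; first exact: Rmin_pos.
  move=> w hw.
  have {}h1 := h1 w (Rlt_le_trans _ _ _ hw (Rmin_l _ _)).
  have {}h2 := h2 w (Rlt_le_trans _ _ _ hw (Rmin_r _ _)).
  have -> : (F w - F p = 2 * Cconj (f p) * (f w - f p) + (RtoC (2 * eps) * Cconj (p - c) * (w - p) - RtoC (2 * eps) * Cconj (p - c) * (p - p)))%C by rewrite /F; ring.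
  apply: Rle_lt_trans (Cmod_triangle _ _) _; rewrite Cmod_mult.
  have : Cmod (2 * Cconj (f p)) * Cmod (f w - f p) <= K * (e1 / (2 * K)).
    by apply: Rmult_le_compat; [exact: Cmod_ge_0|exact: Cmod_ge_0|rewrite /K; lra|lra].
  have -> : K * (e1 / (2 * K)) = e1 / 2 by field; lra.
  lra.
have [exI mv] := mean_value_re F p r r0 contF ltac:(move=> x hx; have [w hw] := hr1 x ltac:(lra); eexists; exact: dF hw).
have pw : forall t, fst (F (circ p r t)) <= fst (F p) - eps * r ^ 2.
  move=> t; set q := circ p r t.
  have dq : Cmod (q - p) = r by exact: circ_dist.
  have hq : Cmod (q - c) <= R0.
    have -> : (q - c = (q - p) + (p - c))%C by ring.
    apply: Rle_trans (Cmod_triangle _ _) _; lra.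
  have := hp2 q hq; rewrite /s.
  have i1 : fst (2 * Cconj (f p) * f q)%C <= Cmod (f q) ^ 2 + Cmod (f p) ^ 2.
    rewrite !Cmod_sq /=; have := pow2_ge_0 (fst (f q) - fst (f p)); have := pow2_ge_0 (snd (f q) - snd (f p)); lra.
  have i2 : fst (2 * Cconj (f p) * f p)%C = 2 * Cmod (f p) ^ 2.
    by rewrite !Cmod_sq /=; ring.
  have i3 : eps * Cmod (q - c) ^ 2 = eps * Cmod (p - c) ^ 2 + eps * r ^ 2 + fst (RtoC (2 * eps) * Cconj (p - c) * (q - p))%C.
    by rewrite -dq !Cmod_sq /=; ring.
  have i4 : fst (F q) = fst (2 * Cconj (f p) * f q)%C + fst (RtoC (2 * eps) * Cconj (p - c) * (q - p))%C by [].
  have i5 : fst (F p) = 2 * Cmod (f p) ^ 2.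
    rewrite -i2; have -> : F p = (2 * Cconj (f p) * f p)%C by rewrite /F; ring.
    by [].
  rewrite i4 i5 i3; lra.
have := RInt_le _ _ 0 (2 * PI) ltac:(lra) exI (ex_RInt_const 0 (2 * PI) (fst (F p) - eps * r ^ 2)) (fun t _ => pw t).
rewrite mv RInt_const /scal /= /mult /=.
have P0 : 0 < PI * (eps * (r * (r * 1))).
  by rewrite Rmult_1_r; apply: Rmult_lt_0_compat => //; apply: Rmult_lt_0_compat => //; exact: Rmult_lt_0_compat.
lra.
Qed.

Lemma Cminus_eq0 (z w : C) : (z - w = 0)%C -> z = w.
Proof.
move=> e; have -> : z = (z - w + w)%C by ring.
by rewrite e; ring.
Qed.

Lemma Cminus_neq0 (z w : C) : z <> w -> (z - w)%C <> 0%C.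
Proof. by move=> n /Cminus_eq0. Qed.

Lemma ccont_mult (f g : C -> C) (z : C) : ccont f z -> ccont g z -> ccont (fun x => f x * g x)%C z.
Proof.
move=> hf hg eps e0.
set A := Cmod (f z) + 1; set B := Cmod (g z) + 1.
have A1 : 1 <= A by have := Cmod_ge_0 (f z); rewrite /A; lra.
have B1 : 1 <= B by have := Cmod_ge_0 (g z); rewrite /B; lra.
have [d1 [d10 h1]] := hf (Rmin 1 (eps / (2 * B))) ltac:(apply: Rmin_pos; [lra|apply: Rdiv_lt_0_compat; lra]).
have [d2 [d20 h2]] := hg (eps / (2 * A)) ltac:(apply: Rdiv_lt_0_compat; lra).
exists (Rmin d1 d2); split; first exact: Rmin_pos.
move=> w hw.
have {}h1 := h1 w (Rlt_le_trans _ _ _ hw (Rmin_l _ _)).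
have {}h2 := h2 w (Rlt_le_trans _ _ _ hw (Rmin_r _ _)).
have a1 := Rlt_le_trans _ _ _ h1 (Rmin_l _ _); have a2 := Rlt_le_trans _ _ _ h1 (Rmin_r _ _).
have -> : (f w * g w - f z * g z = f w * (g w - g z) + (f w - f z) * g z)%C by ring.
apply: Rle_lt_trans (Cmod_triangle _ _) _; rewrite !Cmod_mult.
have fw : Cmod (f w) <= A by have := Cmod_triangle_rev (f w) (f z); rewrite /A; lra.
have p1 : Cmod (f w) * Cmod (g w - g z) <= A * Cmod (g w - g z) by apply: Rmult_le_compat_r => //; exact: Cmod_ge_0.
have p2 : A * Cmod (g w - g z) < A * (eps / (2 * A)) by apply: Rmult_lt_compat_l => //; lra.
have p3 : Cmod (f w - f z) * Cmod (g z) <= eps / (2 * B) * B.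
  by apply: Rmult_le_compat; [exact: Cmod_ge_0|exact: Cmod_ge_0|lra|rewrite /B; lra].
have x1 : A * (eps / (2 * A)) = eps / 2 by field; lra.
have x2 : eps / (2 * B) * B = eps / 2 by field; lra.
lra.
Qed.

Lemma ccont_inv (f : C -> C) (z : C) : ccont f z -> f z <> 0%C -> ccont (fun x => / f x)%C z.
Proof.
move=> hf n eps e0.
have [d [d0 hd]] := cderiv_ccont _ _ _ (cderiv_inv_id _ n) eps e0.
by have [d' [d'0 hd']] := hf d d0; exists d'; split => // w hw; apply: hd; exact: hd'.
Qed.

(** The difference quotient at [w], completed by [a] at [w] itself. For [a = f' w] it is continuous
    there, which is all that the maximum principle asks at an isolated point. *)
Definition dquot (f : C -> C) (w a x : C) : C :=
  match excluded_middle_informative (x = w) with left _ => a | right _ => ((f x - f w) / (x - w))%C end.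

Lemma dquot_at (f : C -> C) (w a : C) : dquot f w a w = a.
Proof. by rewrite /dquot; case: excluded_middle_informative. Qed.

Lemma dquot_ne (f : C -> C) (w a x : C) : x <> w -> dquot f w a x = ((f x - f w) / (x - w))%C.
Proof. by rewrite /dquot; case: excluded_middle_informative. Qed.

Lemma dquot_ccont_at (f : C -> C) (w a : C) : cder f w a -> ccont (dquot f w a) w.
Proof.
move=> h eps e0; have [d [d0 hd]] := h (eps / 2) ltac:(lra); exists d; split => // x hx.
rewrite dquot_at; case: (excluded_middle_informative (x = w)) => [->|n].
  rewrite dquot_at; have -> : (a - a = 0)%C by ring.
  by rewrite Cmod_0.
rewrite dquot_ne //.
have p : 0 < Cmod (x - w) by apply: Cmod_pos_neq; exact: Cminus_neq0.
have -> : ((f x - f w) / (x - w) - a = (f x - f w - a * (x - w)) / (x - w))%C by field; exact: Cminus_neq0.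
rewrite Cmod_div; last exact: Cminus_neq0.
have := hd (x - w)%C (conj p hx).
change (Cmod (f (w + (x - w))%C - f w - a * (x - w))%C <= eps / 2 * Cmod (x - w)%C -> Cmod (f x - f w - a * (x - w)) / Cmod (x - w) < eps).
have -> : (w + (x - w) = x)%C by ring.
move=> le; apply: (Rmult_lt_reg_r (Cmod (x - w))) => //.
have -> : Cmod (f x - f w - a * (x - w)) / Cmod (x - w) * Cmod (x - w) = Cmod (f x - f w - a * (x - w)) by field; lra.
nra.
Qed.

Lemma dquot_cder (f : C -> C) (w a x v : C) : x <> w -> cder f x v -> exists b, cder (dquot f w a) x b.
Proof.
move=> n h.
have p : 0 < Cmod (x - w) by apply: Cmod_pos_neq; exact: Cminus_neq0.
have k := cderiv_div _ _ _ _ _ (cderiv_minus _ _ _ _ _ h (cderiv_const (f w) x))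
  (cderiv_minus _ _ _ _ _ (cderiv_id x) (cderiv_const w x)) (Cminus_neq0 _ _ n).
eexists; apply: cderiv_ext_loc p _ k => y hy; rewrite dquot_ne // => e.
by subst y; rewrite Cmod_minus_sym in hy; lra.
Qed.

(** * Injective holomorphic maps *)

Definition holo (U : C -> Prop) (f : C -> C) : Prop := forall z, U z -> exists w, cder f z w.
Definition inj_on (U : C -> Prop) (f : C -> C) : Prop :=
  forall z1 z2, U z1 -> U z2 -> f z1 = f z2 -> z1 = z2.
Definition openC (U : C -> Prop) : Prop :=
  forall z, U z -> exists r, 0 < r /\ forall w, Cmod (w - z) < r -> U w.

(** By the maximum principle applied to [(z - w) / (f z - f w)] for nearby [w] with [f' w <> 0],
  [f] is expanding up to a constant; in particular its derivative cannot vanish. *)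
Lemma inj_expanding (U : C -> Prop) (f : C -> C) (z0 : C) :
  openC U -> holo U f -> inj_on U f -> U z0 ->
  exists r c, 0 < r /\ 0 < c /\ (forall z, Cmod (z - z0) <= r -> U z) /\
    forall z, Cmod (z - z0) <= r -> c * Cmod (z - z0) <= Cmod (f z - f z0).
Proof.
move=> oU hf inj hz0.
have [r2 [r20 hr2]] := oU z0 hz0.
set r := r2 / 2; have r0 : 0 < r by rewrite /r; lra.
have hU : forall z, Cmod (z - z0) <= r -> U z by move=> z hz; apply: hr2; rewrite /r in hz; lra.
have cf : forall z, Cmod (z - z0) <= r -> ccont f z by move=> z /hU /hf [w]; exact: cderiv_ccont.
(* The minimum of [|f - f z0|] on the circle, as a maximum of the negative; it is positive by
   injectivity. *)
have [p [hp1 hp2]] : exists p, Cmod (p - z0) = r /\ forall q, Cmod (q - z0) = r -> - Cmod (f q - f z0) <= - Cmod (f p - f z0).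
  apply: (compact_max (fun x => Cmod (x - z0) = r) (fun x => - Cmod (f x - f z0)) (r + Cmod z0)).
  - by exists (circ z0 r 0); exact: circ_dist.
  - move=> x hx; have := Cmod_triangle (x - z0) z0; have -> : (x - z0 + z0 = x)%C by ring.
    lra.
  - move=> x hx; apply: NNPP => ne.
    have ap : 0 < Rabs (Cmod (x - z0) - r) by apply: Rabs_pos_lt; lra.
    have [w [w1 w2]] := hx _ ap.
    have t1 := Cmod_triangle_rev (x - z0) (w - z0); have t2 := Cmod_triangle_rev (w - z0) (x - z0).
    have e1 : (x - z0 - (w - z0) = x - w)%C by ring.
    have e2 : (w - z0 - (x - z0) = w - x)%C by ring.
    rewrite e1 (Cmod_minus_sym x w) in t1; rewrite e2 in t2.
    have : Rabs (Cmod (x - z0) - r) <= Cmod (w - x) by apply: Rabs_le; lra.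
    lra.
  - move=> x hx e1 e10.
    have [d [d0 hd]] := cf x ltac:(lra) e1 e10; exists d; split => // w hw hwx.
    have h1 := hd w hwx.
    have t1 := Cmod_triangle_rev (f w - f z0) (f x - f z0); have t2 := Cmod_triangle_rev (f x - f z0) (f w - f z0).
    have e3 : (f w - f z0 - (f x - f z0) = f w - f x)%C by ring.
    have e4 : (f x - f z0 - (f w - f z0) = f x - f w)%C by ring.
    rewrite e3 in t1; rewrite e4 (Cmod_minus_sym (f x) (f w)) in t2.
    by apply: Rabs_def1; lra.
set m := Cmod (f p - f z0).
have m0 : 0 < m.
  apply: Cmod_pos_neq; apply: Cminus_neq0 => e.
  have pz : p = z0 by apply: inj => //; apply: hU; lra.
  have q : (p - z0 = 0)%C by rewrite pz; ring.
  rewrite q Cmod_0 in hp1; lra.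
have [d [d0 hd]] := cf z0 ltac:(have -> : (z0 - z0 = 0)%C by [ring]; rewrite Cmod_0; lra) (m / 2) ltac:(lra).
(* On the circle [|f x - f w| >= m / 2], because [f w] is within [m / 2] of [f z0], and
   [|x - w| <= 2 r]; so the difference quotient is at least [c] there. *)
set c := m / (4 * r); have c0 : 0 < c by apply: Rdiv_lt_0_compat; lra.
set d' := Rmin d r; have d'0 : 0 < d' by exact: Rmin_pos.
(* If [f' w] is not 0, the difference quotient at [w] has no zero in the disc by injectivity; its
   reciprocal is bounded on the circle, hence inside. *)
have key : forall w a, Cmod (w - z0) < d' -> cder f w a -> a <> 0%C ->
    forall z, Cmod (z - z0) <= r -> c * Cmod (z - w) <= Cmod (f z - f w).
  move=> w a hw ha na.
  have hwd : Cmod (w - z0) < d := Rlt_le_trans _ _ _ hw (Rmin_l _ _).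
  have hwr : Cmod (w - z0) < r := Rlt_le_trans _ _ _ hw (Rmin_r _ _).
  have nq : forall x, Cmod (x - z0) <= r -> dquot f w a x <> 0%C.
    move=> x hx; case: (excluded_middle_informative (x = w)) => [->|n]; first by rewrite dquot_at.
    rewrite dquot_ne // => e; apply: (n); apply: inj; [by apply: hU|by apply: hU; lra|].
    apply: Cminus_eq0.
    have -> : (f x - f w = (f x - f w) / (x - w) * (x - w))%C by field; exact: Cminus_neq0.
    by rewrite e; ring.
  have mp : forall x, Cmod (x - z0) <= r -> Cmod (/ dquot f w a x)%C <= / c.
    apply: max_principle => //.
    - by left; apply: Rinv_0_lt_compat.
    - move=> x hx; apply: ccont_inv; last exact: nq.
      case: (excluded_middle_informative (x = w)) => [->|n]; first exact: dquot_ccont_at.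
      have [v hv] := hf x (hU x hx).
      have [b hb] := dquot_cder f w a x v n hv; exact: cderiv_ccont hb.
    - move=> x hx.
      have good : forall y, Cmod (y - z0) <= r -> y <> w -> exists b, cder (fun y => / dquot f w a y)%C y b.
        move=> y hy n; have [v hv] := hf y (hU y hy).
        have [b hb] := dquot_cder f w a y v n hv; eexists; apply: cderiv_inv hb _; exact: nq.
      have tri : forall y, Cmod (y - x) <= r - Cmod (x - z0) -> Cmod (y - z0) <= r.
        move=> y hy; have := Cmod_triangle (y - x) (x - z0); have -> : (y - x + (x - z0) = y - z0)%C by ring.
        lra.
      case: (excluded_middle_informative (x = w)) => [e|n].
        exists (r - Cmod (x - z0)); split; first lra.
        move=> y [y0 y1]; apply: good; first by apply: tri; lra.
        by move=> e'; subst; have q : (w - w = 0)%C by [ring]; rewrite q Cmod_0 in y0; lra.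
      exists (Rmin (r - Cmod (x - z0)) (Cmod (x - w))); split.
        by apply: Rmin_pos; [lra|apply: Cmod_pos_neq; exact: Cminus_neq0].
      move=> y [y0 y1]; apply: good; first by apply: tri; left; exact: Rlt_le_trans y1 (Rmin_l _ _).
      move=> e'; subst y; have := Rlt_le_trans _ _ _ y1 (Rmin_r _ _).
      by rewrite Cmod_minus_sym; lra.
    - move=> x hx.
      have n : x <> w by move=> e; subst; lra.
      have fx := hp2 x hx; rewrite -/m in fx.
      have fw := hd w hwd.
      have t := Cmod_triangle_rev (f x - f z0) (f w - f z0).
      have e3 : (f x - f z0 - (f w - f z0) = f x - f w)%C by ring.
      rewrite e3 in t.
      have t2 := Cmod_triangle (x - z0) (z0 - w).
      have e4 : (x - z0 + (z0 - w) = x - w)%C by ring.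
      rewrite e4 (Cmod_minus_sym z0 w) in t2.
      rewrite dquot_ne // Cmod_inv; last by have := nq x ltac:(lra); rewrite dquot_ne.
      rewrite Cmod_div; last exact: Cminus_neq0.
      have px : 0 < Cmod (x - w) by apply: Cmod_pos_neq; exact: Cminus_neq0.
      apply: Rinv_le_contravar => //.
      rewrite /c; apply: (Rmult_le_reg_r (Cmod (x - w))) => //.
      have -> : Cmod (f x - f w) / Cmod (x - w) * Cmod (x - w) = Cmod (f x - f w) by field; lra.
      have : m / (4 * r) * Cmod (x - w) <= m / (4 * r) * (2 * r) by apply: Rmult_le_compat_l; [left|lra].
      have -> : m / (4 * r) * (2 * r) = m / 2 by field; lra.
      lra.
  move=> z hz; case: (excluded_middle_informative (z = w)) => [->|n].
    have -> : (w - w = 0)%C by ring.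
    by rewrite Cmod_0 Rmult_0_r; exact: Cmod_ge_0.
  have := mp z hz; rewrite Cmod_inv; last exact: nq.
  rewrite dquot_ne // Cmod_div; last exact: Cminus_neq0.
  have px : 0 < Cmod (z - w) by apply: Cmod_pos_neq; exact: Cminus_neq0.
  move=> le.
  have fp : 0 < Cmod (f z - f w).
    apply: Cmod_pos_neq; apply: Cminus_neq0 => e; apply: n; apply: inj => //; apply: hU => //; lra.
  rewrite Rinv_div in le.
  have := Rmult_le_compat_l (c * Cmod (f z - f w)) _ _ ltac:(nra) le.
  have -> : c * Cmod (f z - f w) * (Cmod (z - w) / Cmod (f z - f w)) = c * Cmod (z - w) by field; lra.
  have -> : c * Cmod (f z - f w) * / c = Cmod (f z - f w) by field; lra.
  by [].
(* Otherwise the derivative would vanish on a whole disc about [z0], and [f] would be constant on a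
   segment, against injectivity. *)
have dense : forall e, 0 < e -> exists w a, Cmod (w - z0) < e /\ cder f w a /\ a <> 0%C.
  move=> e e0; apply: NNPP => no.
  set e' := Rmin (e / 2) r; have e'0 : 0 < e' by apply: Rmin_pos; lra.
  have zero : forall w, Cmod (w - z0) <= e' -> cder f w 0%C.
    move=> w hw; have [a ha] := hf w (hU w (Rle_trans _ _ _ hw (Rmin_r _ _))).
    case: (excluded_middle_informative (a = 0%C)) => [<- //|na].
    exfalso; apply: no; exists w, a; repeat split => //.
    have := Rle_trans _ _ _ hw (Rmin_l _ _); lra.
  have eq : f z0 = f (z0 + RtoC e')%C.
    apply: cderiv_zero_segment => t ht; apply: zero.
    have -> : (z0 + RtoC t * (z0 + RtoC e' - z0) - z0 = RtoC t * RtoC e')%C by ring.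
    rewrite Cmod_mult !Cmod_R !Rabs_pos_eq; nra.
  have m1 : Cmod (z0 + RtoC e' - z0) = e'.
    have -> : (z0 + RtoC e' - z0 = RtoC e')%C by ring.
    rewrite Cmod_R Rabs_pos_eq //; lra.
  have := inj _ _ hz0 (hU (z0 + RtoC e')%C ltac:(rewrite m1; exact: Rmin_r)) eq => e2.
  have : Cmod (z0 + RtoC e' - z0) = 0.
    rewrite -e2; have -> : (z0 - z0 = 0)%C by ring.
    exact: Cmod_0.
  lra.
exists r, c; do 3 split => //.
move=> z hz; apply: Rnot_lt_le => lt.
(* Limit [w -> z0]: if the inequality failed at [z0] by the amount [g], a point [w] from [dense]
   close to [z0] would violate [key]. *)
set g := c * Cmod (z - z0) - Cmod (f z - f z0).
have g0 : 0 < g by rewrite /g; lra.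
have [d2 [d20 hd2]] := cf z0 ltac:(have -> : (z0 - z0 = 0)%C by [ring]; rewrite Cmod_0; lra) (g / 2) ltac:(lra).
have [w [a [h1 [h2 h3]]]] := dense (Rmin d' (Rmin d2 (g / (4 * c)))) ltac:(do ! apply: Rmin_pos => //; apply: Rdiv_lt_0_compat; lra).
have w1 := Rlt_le_trans _ _ _ h1 (Rmin_l _ _); have w' := Rlt_le_trans _ _ _ h1 (Rmin_r _ _).
have w2 := Rlt_le_trans _ _ _ w' (Rmin_l _ _); have w3 := Rlt_le_trans _ _ _ w' (Rmin_r _ _).
have K := key w a w1 h2 h3 z hz.
have {}hd2 := hd2 w w2.
have t1 := Cmod_triangle (z - w) (w - z0).
have e1 : (z - w + (w - z0) = z - z0)%C by ring.
rewrite e1 in t1.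
have t2 := Cmod_triangle (f z - f z0) (f z0 - f w).
have e2 : (f z - f z0 + (f z0 - f w) = f z - f w)%C by ring.
rewrite e2 (Cmod_minus_sym (f z0)) in t2.
have q1 : c * Cmod (z - z0) <= c * Cmod (z - w) + c * Cmod (w - z0) by nra.
have q2 : c * Cmod (w - z0) < c * (g / (4 * c)) by apply: Rmult_lt_compat_l.
have q3 : c * (g / (4 * c)) = g / 4 by field; lra.
rewrite /g in q2 q3 hd2 *; lra.
Qed.

Lemma cder_bound (f : C -> C) (z a : C) (eps : R) : cder f z a -> 0 < eps -> exists del, 0 < del /\
  forall x, Cmod (x - z) < del -> Cmod (f x - f z - a * (x - z)) <= eps * Cmod (x - z).
Proof.
move=> h e0; have [d [d0 hd]] := h eps e0; exists d; split => // x hx.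
case: (Req_dec (Cmod (x - z)) 0) => [e|n].
  have -> : x = z by apply: Cminus_eq0; exact: Cmod_eq_0.
  have -> : (f z - f z - a * (z - z) = 0)%C by ring.
  rewrite Cmod_0; have := Cmod_ge_0 (z - z); nra.
have := hd (x - z)%C ltac:(have := Cmod_ge_0 (x - z); split; [change (0 < Cmod (x - z)); lra|exact: hx]).
change (Cmod (f (z + (x - z))%C - f z - a * (x - z))%C <= eps * Cmod (x - z)%C -> Cmod (f x - f z - a * (x - z)) <= eps * Cmod (x - z)).
by have -> : (z + (x - z) = x)%C by ring.
Qed.

(** A displacement by [s t F z / a] multiplies [F z] by [1 + s t], up to half of that change. With
    [s = -1] the modulus drops, with [s = 1] it grows; [e] keeps the displaced point in a prescribed
    disc. *)
Lemma cder_move (F : C -> C) (z a : C) (s : R) : cder F z a -> a <> 0%C -> F z <> 0%C ->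
  forall e, 0 < e -> exists t, 0 < t <= 1 /\ t / Cmod a * Cmod (F z) < e /\
   Cmod (F (z + RtoC (s * t) * (F z / a))%C - F z - RtoC (s * t) * F z) <= Rabs s * t / 2 * Cmod (F z).
Proof.
move=> h na nF e e0.
have ma := Cmod_pos_neq _ na; have mF := Cmod_pos_neq _ nF.
have [d [d0 hd]] := cder_bound F z a (Cmod a / 2) h ltac:(lra).
have rs := Rabs_pos s.
set m := Cmod (F z) / Cmod a; have m0 : 0 < m by apply: Rdiv_lt_0_compat.
set t := Rmin 1 (Rmin (e / (2 * m)) (d / (2 * m * (Rabs s + 1)))).
have t0 : 0 < t by do ! apply: Rmin_pos; try lra; apply: Rdiv_lt_0_compat => //; nra.
have t1 : t <= 1 by exact: Rmin_l.
have t' : t <= Rmin (e / (2 * m)) (d / (2 * m * (Rabs s + 1))) by exact: Rmin_r.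
have t2 := Rle_trans _ _ _ t' (Rmin_l _ _); have t3 := Rle_trans _ _ _ t' (Rmin_r _ _).
exists t; split; [lra|split].
  have -> : t / Cmod a * Cmod (F z) = t * m by rewrite /m; field; lra.
  have : t * m <= e / (2 * m) * m by apply: Rmult_le_compat_r; lra.
  have -> : e / (2 * m) * m = e / 2 by field; lra.
  lra.
set x := (z + RtoC (s * t) * (F z / a))%C.
have ex : (x - z = RtoC (s * t) * (F z / a))%C by rewrite /x; ring.
have mx : Cmod (x - z) = Rabs s * t * m.
  rewrite ex Cmod_mult Cmod_R Rabs_mult (Rabs_pos_eq t) ?Cmod_div //; lra.
have := hd x.
have -> : (a * (x - z) = RtoC (s * t) * F z)%C by rewrite ex; field.
rewrite mx => H.
have -> : Rabs s * t / 2 * Cmod (F z) = Cmod a / 2 * (Rabs s * t * m) by rewrite /m; field; lra.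
apply: H.
apply: Rle_lt_trans (_ : (Rabs s + 1) * (d / (2 * m * (Rabs s + 1))) * m < _).
  apply: Rmult_le_compat_r; first lra.
  by apply: Rmult_le_compat; lra.
have -> : (Rabs s + 1) * (d / (2 * m * (Rabs s + 1))) * m = d / 2 by field; lra.
lra.
Qed.

Lemma inj_cder_neq0 (U : C -> Prop) (f : C -> C) (z0 a : C) :
  openC U -> holo U f -> inj_on U f -> U z0 -> cder f z0 a -> a <> 0%C.
Proof.
move=> oU hf inj hz0 ha e; subst a.
have [r [c [r0 [c0 [_ h]]]]] := inj_expanding U f z0 oU hf inj hz0.
have [d [d0 hd]] := cder_bound f z0 0%C (c / 2) ha ltac:(lra).
set t := Rmin r (d / 2); have t0 : 0 < t by apply: Rmin_pos; lra.
have td : t < d by have := Rmin_r r (d / 2); rewrite -/t; lra.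
have tr : t <= r by exact: Rmin_l.
have m : Cmod (z0 + RtoC t - z0) = t.
  have -> : (z0 + RtoC t - z0 = RtoC t)%C by ring.
  by rewrite Cmod_R Rabs_pos_eq; lra.
have := h (z0 + RtoC t)%C; have := hd (z0 + RtoC t)%C; rewrite m.
have -> : (f (z0 + RtoC t) - f z0 - 0 * (z0 + RtoC t - z0) = f (z0 + RtoC t) - f z0)%C by ring.
move=> h1 h2; have {}h1 := h1 td; have {}h2 := h2 tr; nra.
Qed.

(** Minimise [|f - w|] over a closed disc. The expansion property keeps the minimiser off the
    boundary, and at an interior minimiser with non-zero derivative the minimum can only be 0. *)
Lemma inj_open (U : C -> Prop) (f : C -> C) (z0 : C) (eps : R) :
  openC U -> holo U f -> inj_on U f -> U z0 -> 0 < eps ->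
  exists del, 0 < del /\ forall w, Cmod (w - f z0) < del -> exists z, U z /\ Cmod (z - z0) < eps /\ f z = w.
Proof.
move=> oU hf inj hz0 e0.
have [r' [c [r'0 [c0 [hU' h']]]]] := inj_expanding U f z0 oU hf inj hz0.
set r := Rmin r' (eps / 2); have r0 : 0 < r by apply: Rmin_pos; lra.
have rr : r <= r' by exact: Rmin_l.
have re : r < eps by have := Rmin_r r' (eps / 2); rewrite -/r; lra.
have hU : forall z, Cmod (z - z0) <= r -> U z by move=> z hz; apply: hU'; lra.
have h : forall z, Cmod (z - z0) <= r -> c * Cmod (z - z0) <= Cmod (f z - f z0) by move=> z hz; apply: h'; lra.
(* On the boundary [f] is at distance at least [c r] from [f z0], hence farther from [w] than [f z0]
   is. *)
exists (c * r / 2); split; first by have := Rmult_lt_0_compat _ _ c0 r0; lra.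
move=> w hw.
have z00 : Cmod (z0 - z0) = 0.
  have -> : (z0 - z0 = 0)%C by ring.
  exact: Cmod_0.
have [p [hp1 hp2]] : exists p, Cmod (p - z0) <= r /\ forall q, Cmod (q - z0) <= r -> - Cmod (f q - w) <= - Cmod (f p - w).
  apply: (compact_max (fun x => Cmod (x - z0) <= r) (fun x => - Cmod (f x - w)) (r + Cmod z0)).
  - by exists z0; lra.
  - move=> x hx; have := Cmod_triangle (x - z0) z0; have -> : (x - z0 + z0 = x)%C by ring.
    lra.
  - move=> x hx; apply: Rnot_lt_le => lt.
    have [y [w1 w2]] := hx (Cmod (x - z0) - r) ltac:(lra).
    have := Cmod_triangle (y - z0) (x - y); have -> : (y - z0 + (x - y) = x - z0)%C by ring.
    rewrite (Cmod_minus_sym x y); lra.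
  - move=> x hx e1 e10.
    have [v hv] := hf x (hU x hx).
    have [d [d0 hd]] := cderiv_ccont _ _ _ hv e1 e10; exists d; split => // y _ hyx.
    have h1 := hd y hyx.
    have t1 := Cmod_triangle_rev (f y - w) (f x - w); have t2 := Cmod_triangle_rev (f x - w) (f y - w).
    have e3 : (f y - w - (f x - w) = f y - f x)%C by ring.
    have e4 : (f x - w - (f y - w) = f x - f y)%C by ring.
    rewrite e3 in t1; rewrite e4 (Cmod_minus_sym (f x) (f y)) in t2.
    by apply: Rabs_def1; lra.
have pw := hp2 z0 ltac:(lra); rewrite (Cmod_minus_sym (f z0)) in pw.
have pint : Cmod (p - z0) < r.
  case: (Rle_lt_or_eq_dec _ _ hp1) => // e; exfalso.
  have := h p hp1; rewrite e.
  have := Cmod_triangle (f p - w) (w - f z0).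
  have -> : (f p - w + (w - f z0) = f p - f z0)%C by ring.
  have := Rmult_lt_0_compat _ _ c0 r0; lra.
exists p; split; first exact: hU; split; first lra.
apply: NNPP => n.
have [a ha] := hf p (hU p hp1).
have na := inj_cder_neq0 U f p a oU hf inj (hU p hp1) ha.
have hF : cder (fun x => f x - w)%C p a.
  by apply: cderiv_eq (cderiv_minus _ _ _ _ _ ha (cderiv_const w p)) _; ring.
(* A damped Newton step towards [w] that stays in the disc and lowers [|f - w|], against minimality
   of [p]. *)
have [t [t0 [t1 t2]]] := cder_move _ p a (-1) hF na (Cminus_neq0 _ _ n) (r - Cmod (p - z0)) ltac:(lra).
set x := (p + RtoC (-1 * t) * ((f p - w) / a))%C in t2.
have mF := Cmod_pos_neq _ (Cminus_neq0 _ _ n).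
have hx : Cmod (x - z0) <= r.
  have -> : (x - z0 = RtoC (-1 * t) * ((f p - w) / a) + (p - z0))%C by rewrite /x; ring.
  apply: Rle_trans (Cmod_triangle _ _) _; rewrite Cmod_mult Cmod_R Cmod_div // Rabs_mult Rabs_Ropp Rabs_R1 (Rabs_pos_eq t); last lra.
  have -> : 1 * t * (Cmod (f p - w) / Cmod a) = t / Cmod a * Cmod (f p - w) by field; have := Cmod_pos_neq _ na; lra.
  lra.
have := hp2 x hx.
have := Cmod_triangle (f x - w - (f p - w) - RtoC (-1 * t) * (f p - w)) (RtoC (1 - t) * (f p - w)).
have -> : (f x - w - (f p - w) - RtoC (-1 * t) * (f p - w) + RtoC (1 - t) * (f p - w) = f x - w)%C.
  by apply: C_ext => /=; ring.
rewrite (Cmod_mult (RtoC (1 - t))) Cmod_R (Rabs_pos_eq (1 - t)); last lra.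
have e1 : Rabs (-1) = 1 by rewrite Rabs_Ropp Rabs_R1.
rewrite e1 in t2; nra.
Qed.

(** Openness provides a preimage of [f z0 + k] near [z0], and the expansion property bounds its
    distance from [z0] by [|k| / c]; the linear estimate of [f] can then be inverted. *)
Lemma inj_inverse_cder (U : C -> Prop) (f g : C -> C) (z0 a : C) :
  openC U -> holo U f -> inj_on U f -> U z0 -> cder f z0 a ->
  (forall z, U z -> g (f z) = z) -> cder g (f z0) (/ a)%C.
Proof.
move=> oU hf inj hz0 ha hg eps e0.
have na := inj_cder_neq0 U f z0 a oU hf inj hz0 ha.
have ma := Cmod_pos_neq _ na.
have [r [c [r0 [c0 [hU h]]]]] := inj_expanding U f z0 oU hf inj hz0.
have [d [d0 hd]] := cder_bound f z0 a (eps * c * Cmod a) ha ltac:(do ! apply: Rmult_lt_0_compat => //).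
have [d' [d'0 hd']] := inj_open U f z0 (Rmin r d) oU hf inj hz0 ltac:(exact: Rmin_pos).
exists d'; split => // k [k0 kd]; change (0 < Cmod k) in k0; change (Cmod k < d') in kd.
have [|z [Uz [hz e]]] := hd' (f z0 + k)%C.
  by have -> : (f z0 + k - f z0 = k)%C by [ring].
change (Cmod (g (f z0 + k)%C - g (f z0) - / a * k) <= eps * Cmod k).
rewrite -e !hg //.
have ek : (f z - f z0)%C = k by rewrite e; ring.
have h1 := hd z (Rlt_le_trans _ _ _ hz (Rmin_r _ _)).
have h2 := h z (Rlt_le _ _ (Rlt_le_trans _ _ _ hz (Rmin_l _ _))).
rewrite ek in h1 h2.
have -> : (z - z0 - / a * k = - (/ a * (k - a * (z - z0))))%C by field.
rewrite Cmod_opp Cmod_mult Cmod_inv //.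
apply: Rle_trans (_ : / Cmod a * (eps * c * Cmod a * Cmod (z - z0)) <= _).
  by apply: Rmult_le_compat_l => //; left; apply: Rinv_0_lt_compat.
have -> : / Cmod a * (eps * c * Cmod a * Cmod (z - z0)) = eps * (c * Cmod (z - z0)) by field; lra.
by apply: Rmult_le_compat_l => //; lra.
Qed.

(** * Automorphisms of the upper half-plane *)

Lemma UHP_open : openC UHP.
Proof.
move=> z hz; exists (snd z); split => // w hw; rewrite /UHP /Cim in hz *.
have := Cmod_snd (w - z)%C; rewrite /=.
have := Rle_abs (- (snd w + - snd z)); rewrite Rabs_Ropp; lra.
Qed.

Lemma UHP_conj_neq (z w : C) : UHP z -> UHP w -> (z - Cconj w)%C <> 0%C.
Proof. by rewrite /UHP /Cim => hz hw e; have /= := f_equal snd e; lra. Qed.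

Lemma pseudo_le (z w : C) : UHP z -> UHP w -> Cmod (z - w) <= Cmod (z - Cconj w).
Proof. rewrite /UHP /Cim /Cmod => hz hw; apply: sqrt_le_1_alt => /=; nra. Qed.

(** The factor [(T x - T w) / (T x - conj (T w))] divided by [(x - w) / (x - conj w)], whose modulus
    compares pseudo-hyperbolic distances; [dquot] gives it a value at [x = w]. *)
Definition schwarz_quot (T : C -> C) (w a x : C) : C :=
  (dquot T w a x * ((x - Cconj w) / (T x - Cconj (T w))))%C.

Lemma schwarz_quot_ne (T : C -> C) (w a x : C) : UHP w -> UHP x -> UHP (T w) -> UHP (T x) -> x <> w ->
  schwarz_quot T w a x = ((T x - T w) * (x - Cconj w) / ((T x - Cconj (T w)) * (x - w)))%C.
Proof.
move=> h1 h2 h3 h4 n; rewrite /schwarz_quot dquot_ne //; field.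
by split; first [exact: UHP_conj_neq|exact: Cminus_neq0].
Qed.

(** Shows that the pseudo-hyperbolic disc [|z - w| <= r |z - conj w|] is a Euclidean disc with
    explicit centre and radius, the shape required by the maximum principle. *)
Lemma pseudo_disc_gen (z w : C) (r : R) : 0 < r < 1 -> UHP w ->
  (Cmod (z - (fst w, snd w * (1 + r ^ 2) / (1 - r ^ 2))) ^ 2 - (2 * r * snd w / (1 - r ^ 2)) ^ 2) * (1 - r ^ 2) =
  Cmod (z - w) ^ 2 - r ^ 2 * Cmod (z - Cconj w) ^ 2.
Proof.
by move=> hr hw; rewrite !Cmod_sq /=; field; nra.
Qed.

(** Maximum principle on the pseudo-hyperbolic disc of radius [r] about [w]: on its boundary the
    second factor contributes [/ r] and the first is at most 1. Then [r] tends to 1. *)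
Lemma schwarz_pick (T : C -> C) (w a : C) : (forall x, UHP x -> UHP (T x)) -> holo UHP T ->
  UHP w -> cder T w a -> forall z, UHP z -> Cmod (schwarz_quot T w a z) <= 1.
Proof.
move=> hT dT hw ha z hz.
have dF : forall x, UHP x -> x <> w -> exists b, cder (schwarz_quot T w a) x b.
  move=> x hx n; have [v hv] := dT x hx.
  have [b hb] := dquot_cder T w a x v n hv.
  eexists; apply: cderiv_mult hb _; apply: cderiv_div.
  - by apply: cderiv_minus; [exact: cderiv_id|exact: cderiv_const].
  - by apply: cderiv_minus; [exact: hv|exact: cderiv_const].
  - by apply: UHP_conj_neq; auto.
have cF : forall x, UHP x -> ccont (schwarz_quot T w a) x.
  move=> x hx; case: (excluded_middle_informative (x = w)) => [->|n]; last first.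
    by have [b hb] := dF x hx n; exact: cderiv_ccont hb.
  apply: ccont_mult; first exact: dquot_ccont_at.
  apply: cderiv_ccont; apply: cderiv_div.
  - by apply: cderiv_minus; [exact: cderiv_id|exact: cderiv_const].
  - by apply: cderiv_minus; [exact: ha|exact: cderiv_const].
  - by apply: UHP_conj_neq; auto.
have mz : 0 < Cmod (z - Cconj w) by apply: Cmod_pos_neq; exact: UHP_conj_neq.
have lt1 : Cmod (z - w) < Cmod (z - Cconj w).
  rewrite /Cmod; apply: sqrt_lt_1_alt; rewrite /UHP /Cim in hz hw; have P0 := Rmult_lt_0_compat _ _ hz hw.
  split; [by apply: Rplus_le_le_0_compat; exact: pow2_ge_0|move=> /=; lra].
set q := Cmod (z - w) / Cmod (z - Cconj w).
have q1 : q < 1.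
  apply: (Rmult_lt_reg_r (Cmod (z - Cconj w))) => //; rewrite /q.
  have -> : Cmod (z - w) / Cmod (z - Cconj w) * Cmod (z - Cconj w) = Cmod (z - w) by field; lra.
  lra.
have q0 : 0 <= q by apply: Rdiv_le_0_compat => //; exact: Cmod_ge_0.
have key : forall r, q < r < 1 -> Cmod (schwarz_quot T w a z) <= / r.
  move=> r hr.
  have r0 : 0 < r by lra.
  have rr : 0 < 1 - r ^ 2 by nra.
  have hw' : 0 < snd w by [].
  set c : C := (fst w, snd w * (1 + r ^ 2) / (1 - r ^ 2)).
  set rho := 2 * r * snd w / (1 - r ^ 2).
  have rho0 : 0 < rho by apply: Rdiv_lt_0_compat => //; apply: Rmult_lt_0_compat => //; lra.
  have gen : forall x, (Cmod (x - c) ^ 2 - rho ^ 2) * (1 - r ^ 2) = Cmod (x - w) ^ 2 - r ^ 2 * Cmod (x - Cconj w) ^ 2.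
    by move=> x; apply: pseudo_disc_gen => //; lra.
  have inH : forall x, Cmod (x - c) <= rho -> UHP x.
    move=> x hx; rewrite /UHP /Cim.
    have := Cmod_snd (x - c)%C; rewrite /=.
    have := Rle_abs (- (snd x + - (snd w * (1 + r * (r * 1)) / (1 - r * (r * 1))))); rewrite Rabs_Ropp.
    have : 2 * r * snd w / (1 - r ^ 2) < snd w * (1 + r ^ 2) / (1 - r ^ 2).
      apply: Rmult_lt_compat_r; first exact: Rinv_0_lt_compat.
      have : 0 < snd w * ((1 - r) * (1 - r)) by apply: Rmult_lt_0_compat => //; apply: Rmult_lt_0_compat; lra.
      lra.
    rewrite /= /rho /= in hx *; rewrite /=; lra.
  have c0 : forall x, 0 <= Cmod x := Cmod_ge_0.
  apply: (max_principle (schwarz_quot T w a) c rho) => //.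
  - by left; apply: Rinv_0_lt_compat.
  - by move=> x /inH; exact: cF.
  - move=> p hp.
    have hp' := inH p ltac:(lra).
    have tri : forall y, Cmod (y - p) < rho - Cmod (p - c) -> UHP y.
      move=> y hy; apply: inH; have := Cmod_triangle (y - p) (p - c).
      have -> : (y - p + (p - c) = y - c)%C by ring.
      lra.
    case: (excluded_middle_informative (p = w)) => [e|n].
      exists (rho - Cmod (p - c)); split; first lra.
      move=> y [y0 y1]; apply: dF; first exact: tri.
      by move=> e'; subst; have e2 : (w - w = 0)%C by [ring]; rewrite e2 Cmod_0 in y0; lra.
    exists (Rmin (rho - Cmod (p - c)) (Cmod (p - w))); split.
      by apply: Rmin_pos; [lra|apply: Cmod_pos_neq; exact: Cminus_neq0].
    move=> y [y0 y1]; apply: dF; first by apply: tri; exact: Rlt_le_trans y1 (Rmin_l _ _).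
    move=> e'; subst y; have := Rlt_le_trans _ _ _ y1 (Rmin_r _ _).
    by rewrite Cmod_minus_sym; lra.
  - move=> x hx.
    have hx' := inH x ltac:(lra).
    have g := gen x; rewrite hx Rminus_diag_eq // Rmult_0_l in g.
    have mx : 0 < Cmod (x - Cconj w) by apply: Cmod_pos_neq; exact: UHP_conj_neq.
    have e : Cmod (x - w) = r * Cmod (x - Cconj w).
      have g1 : Cmod (x - w) ^ 2 = (r * Cmod (x - Cconj w)) ^ 2 by rewrite Rpow_mult_distr; lra.
      have := c0 (x - w)%C; have : 0 < r * Cmod (x - Cconj w) by nra.
      nra.
    have n : x <> w.
      move=> e'; subst x; have e2 : (w - w = 0)%C by [ring].
      rewrite e2 Cmod_0 in e; nra.
    have mT : 0 < Cmod (T x - Cconj (T w)) by apply: Cmod_pos_neq; apply: UHP_conj_neq; auto.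
    have pT := pseudo_le (T x) (T w) (hT x hx') (hT w hw).
    rewrite schwarz_quot_ne; auto.
    rewrite Cmod_div; last by apply: Cmult_neq_0; [apply: UHP_conj_neq; auto|exact: Cminus_neq0].
    rewrite !Cmod_mult e.
    apply: (Rmult_le_reg_r (Cmod (T x - Cconj (T w)))) => //.
    have -> : Cmod (T x - T w) * Cmod (x - Cconj w) / (Cmod (T x - Cconj (T w)) * (r * Cmod (x - Cconj w))) * Cmod (T x - Cconj (T w)) = / r * Cmod (T x - T w) by field; repeat split; lra.
    by apply: Rmult_le_compat_l => //; left; apply: Rinv_0_lt_compat.
  - have g := gen z.
    have e : Cmod (z - w) <= r * Cmod (z - Cconj w).
      have -> : Cmod (z - w) = q * Cmod (z - Cconj w) by rewrite /q; field; lra.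
      by apply: Rmult_le_compat_r; lra.
    have g2 : (Cmod (z - c) ^ 2 - rho ^ 2) * (1 - r ^ 2) <= 0.
      rewrite g; have := c0 (z - w)%C; have : 0 < r * Cmod (z - Cconj w) by nra.
      have -> : r ^ 2 * Cmod (z - Cconj w) ^ 2 = (r * Cmod (z - Cconj w)) ^ 2 by ring.
      nra.
    have g3 : Cmod (z - c) ^ 2 - rho ^ 2 <= 0.
      by apply: Rnot_lt_le => l; have := Rmult_lt_0_compat _ _ l rr; lra.
    apply: Rnot_lt_le => l; nra.
apply: Rnot_lt_le => lt.
set m := Cmod (schwarz_quot T w a z) in lt key.
(* This [r] exceeds [q], so that [z] lies in the disc, and [/ m], so that the bound [/ r] is below
   [m]. *)
set r := Rmax ((q + 1) / 2) ((/ m + 1) / 2).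
have im : / m < 1 by rewrite -Rinv_1; apply: Rinv_lt_contravar; lra.
have im0 : 0 < / m by apply: Rinv_0_lt_compat; lra.
have r1 : q < r < 1.
  split; [apply: Rlt_le_trans (Rmax_l _ _); lra|apply: Rmax_lub_lt; lra].
have r2 : / m < r by apply: Rlt_le_trans (Rmax_r _ _); lra.
have := key r r1.
have : / r < m by rewrite -(Rinv_inv m); apply: Rinv_lt_contravar => //; apply: Rmult_lt_0_compat => //; lra.
lra.
Qed.

(** With a non-zero derivative, [cder_move] with [s = 1] would find a nearby value of larger
    modulus. *)
Lemma const_modulus_cder (F : C -> C) (z a : C) (e : R) : 0 < e -> cder F z a ->
  (forall x, Cmod (x - z) < e -> Cmod (F x) = 1) -> a = 0%C.
Proof.
move=> e0 ha h; apply: NNPP => na.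
have z0 : Cmod (F z) = 1.
  apply: h; have -> : (z - z = 0)%C by ring.
  by rewrite Cmod_0.
have nF : F z <> 0%C by move=> e'; rewrite e' Cmod_0 in z0; lra.
have [t [t0 [t1 t2]]] := cder_move F z a 1 ha na nF e e0.
set x := (z + RtoC (1 * t) * (F z / a))%C in t2.
have mx : Cmod (F x) = 1.
  apply: h; have -> : (x - z = RtoC (1 * t) * (F z / a))%C by rewrite /x; ring.
  rewrite Cmod_mult Cmod_R Cmod_div // Rabs_mult Rabs_R1 (Rabs_pos_eq t); last lra.
  by have -> : 1 * t * (Cmod (F z) / Cmod a) = t / Cmod a * Cmod (F z) by field; have := Cmod_pos_neq _ na; lra.
have := Cmod_triangle (F x) (- (F x - F z - RtoC (1 * t) * F z)).
have -> : (F x + - (F x - F z - RtoC (1 * t) * F z) = RtoC (1 + t) * F z)%C.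
  by apply: C_ext => /=; ring.
rewrite Cmod_opp Cmod_mult Cmod_R (Rabs_pos_eq (1 + t)); last lra.
rewrite Rabs_R1 in t2; rewrite z0 mx; rewrite z0 in t2; lra.
Qed.

(** By Schwarz-Pick for [T] and for its inverse, the quotient and its reciprocal have modulus at
    most 1. So the modulus is 1, the derivative of the quotient vanishes off [w], and the constant
    value is the one at [w], namely [kap]. *)
Lemma UHP_auto_moebius (T S : C -> C) (w a : C) :
  (forall x, UHP x -> UHP (T x)) -> (forall x, UHP x -> UHP (S x)) -> holo UHP T -> holo UHP S ->
  (forall x, UHP x -> S (T x) = x) -> (forall x, UHP x -> T (S x) = x) ->
  UHP w -> cder T w a ->
  let kap := (a * ((w - Cconj w) / (T w - Cconj (T w))))%C in
  Cmod kap = 1 /\ forall z, UHP z -> ((T z - T w) * (z - Cconj w) = kap * ((T z - Cconj (T w)) * (z - w)))%C.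
Proof.
move=> hT hS dT dS ST TS hw ha kap.
suff main : forall z, UHP z -> z <> w -> kap = schwarz_quot T w a z /\ Cmod (schwarz_quot T w a z) = 1.
  split.
    have hz : UHP (w + Ci)%C by rewrite /UHP /Cim /= in hw *; lra.
    have [|-> //] := main _ hz.
    by move=> e; have /= := f_equal snd e; lra.
  move=> z hz; case: (excluded_middle_informative (z = w)) => [->|n].
    have -> : (T w - T w = 0)%C by ring.
    have -> : (w - w = 0)%C by ring.
    ring.
  have [-> _] := main z hz n.
  rewrite (schwarz_quot_ne T w a z); auto; field.
  by split; first [exact: Cminus_neq0|apply: UHP_conj_neq; auto].
move=> z hz n.
have inj : forall x y, UHP x -> UHP y -> x <> y -> T x <> T y.
  by move=> x y hx hy nxy e; apply: nxy; rewrite -(ST x hx) -(ST y hy) e.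
have unit : forall x, UHP x -> x <> w -> Cmod (schwarz_quot T w a x) = 1.
  move=> x hx nx.
  have le1 := schwarz_pick T w a hT dT hw ha x hx.
  have [b hb] := dS (T w) (hT w hw).
  have le2 := schwarz_pick S (T w) b hS dS (hT w hw) hb (T x) (hT x hx).
  have nT := inj x w hx hw nx.
  rewrite schwarz_quot_ne ?ST // in le2; auto; rewrite schwarz_quot_ne // in le1 *; auto.
  set A := ((T x - T w) * (x - Cconj w))%C in le1 le2 *; set B := ((T x - Cconj (T w)) * (x - w))%C in le1 le2 *.
  have nA : A <> 0%C by apply: Cmult_neq_0; [exact: Cminus_neq0|exact: UHP_conj_neq].
  have nB : B <> 0%C by apply: Cmult_neq_0; [apply: UHP_conj_neq; auto|exact: Cminus_neq0].
  have e2 : ((x - w) * (T x - Cconj (T w)) / ((x - Cconj w) * (T x - T w)) = / (A / B))%C.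
    rewrite /A /B; field; repeat split; first [exact: Cminus_neq0|apply: UHP_conj_neq; auto].
  rewrite e2 in le2.
  have nAB : (A / B)%C <> 0%C.
    apply/Cmod_gt_0; rewrite Cmod_div //; apply: Rdiv_lt_0_compat; exact: Cmod_pos_neq.
  rewrite Cmod_inv // in le2.
  have p := Cmod_pos_neq _ nAB.
  have := Rmult_le_compat_l _ _ _ (Rlt_le _ _ p) le2; rewrite Rinv_r; lra.
have zero : forall x, UHP x -> x <> w -> cder (schwarz_quot T w a) x 0%C.
  move=> x hx nx.
  have [v hv] := dT x hx.
  have [b hb] := dquot_cder T w a x v nx hv.
  have [b2 hb2] : exists b2, cder (schwarz_quot T w a) x b2.
    eexists; apply: cderiv_mult hb _; apply: cderiv_div.
    - by apply: cderiv_minus; [exact: cderiv_id|exact: cderiv_const].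
    - by apply: cderiv_minus; [exact: hv|exact: cderiv_const].
    - by apply: UHP_conj_neq; auto.
  have [r [r0 hr]] := UHP_open x hx.
  have nxw := Cmod_pos_neq _ (Cminus_neq0 _ _ nx).
  have <- // : b2 = 0%C.
  apply: (const_modulus_cder (schwarz_quot T w a) x b2 (Rmin r (Cmod (x - w)))) => //; first exact: Rmin_pos.
  move=> y hy; apply: unit; first by apply: hr; exact: Rlt_le_trans hy (Rmin_l _ _).
  move=> e; subst y; have := Rlt_le_trans _ _ _ hy (Rmin_r _ _); rewrite Cmod_minus_sym; lra.
have cF : ccont (schwarz_quot T w a) w.
  apply: ccont_mult; first exact: dquot_ccont_at.
  apply: cderiv_ccont; apply: cderiv_div.
  - by apply: cderiv_minus; [exact: cderiv_id|exact: cderiv_const].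
  - by apply: cderiv_minus; [exact: ha|exact: cderiv_const].
  - by apply: UHP_conj_neq; auto.
pose seg (t : R) : C := (w + RtoC t * (z - w))%C.
have segH : forall t, 0 <= t <= 1 -> UHP (seg t).
  by move=> t ht; rewrite /UHP /Cim /seg /= in hz hw *; nra.
have segn : forall t, 0 < t <= 1 -> seg t <> w.
  move=> t ht e; have : (RtoC t * (z - w) = 0)%C by have -> : (RtoC t * (z - w) = seg t - w)%C by [rewrite /seg; ring]; rewrite e; ring.
  apply: Cmult_neq_0; last exact: Cminus_neq0.
  by move=> e'; have := f_equal fst e' => /=; lra.
have const : forall t, 0 < t <= 1 -> schwarz_quot T w a (seg t) = schwarz_quot T w a z.
  move=> t ht; apply: cderiv_zero_segment => s hs.
  have -> : (seg t + RtoC s * (z - seg t) = seg (t + s * (1 - t))%R)%C by apply: C_ext; rewrite /seg /=; ring.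
  by apply: zero; [apply: segH; nra|apply: segn; nra].
(* The segment argument does not reach [w], where the quotient is only known to be continuous;
   continuity identifies the constant with the value at [w]. *)
have lim : schwarz_quot T w a w = schwarz_quot T w a z.
  apply: NNPP => ne.
  have p := Cmod_pos_neq _ (Cminus_neq0 _ _ ne).
  have [d [d0 hd]] := cF _ p.
  have mzw := Cmod_pos_neq _ (Cminus_neq0 _ _ n).
  set t := Rmin 1 (d / (2 * Cmod (z - w))).
  have t0 : 0 < t by apply: Rmin_pos; [lra|apply: Rdiv_lt_0_compat; lra].
  have t1 : t <= 1 by exact: Rmin_l.
  have := hd (seg t); rewrite (const t); last lra.
  rewrite (Cmod_minus_sym (schwarz_quot T w a z)) => H.
  suff : Cmod (seg t - w) < d by move=> /H; lra.
  have -> : (seg t - w = RtoC t * (z - w))%C by rewrite /seg; ring.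
  rewrite Cmod_mult Cmod_R Rabs_pos_eq; last lra.
  apply: Rle_lt_trans (_ : d / (2 * Cmod (z - w)) * Cmod (z - w) < _).
    by apply: Rmult_le_compat_r; [exact: Cmod_ge_0|exact: Rmin_r].
  have -> : d / (2 * Cmod (z - w)) * Cmod (z - w) = d / 2 by field; lra.
  lra.
split; last exact: unit.
by rewrite -lim /schwarz_quot dquot_at.
Qed.

(** * Ordinary differential equations *)

Lemma is_derive_continuous (f : R -> R) (t v : R) : is_derive f t v -> continuous f t.
Proof. by move=> h; apply: (ex_derive_continuous (K := R_AbsRing) (V := R_NormedModule)); exists v. Qed.

Lemma continuous_continuity_pt (f : R -> R) (t : R) : continuous f t -> continuity_pt f t.
Proof. by move=> h; apply/continuity_pt_filterlim. Qed.

Lemma derive_nonpos_le (f f' : R -> R) (a b : R) : a <= b ->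
  (forall t, a < t < b -> is_derive f t (f' t)) -> (forall t, a <= t <= b -> continuous f t) ->
  (forall t, a < t < b -> f' t <= 0) -> f b <= f a.
Proof.
move=> ab hd hc hn; case: (Rle_lt_or_eq_dec _ _ ab) => [lt|<-]; last lra.
have [c [P e]] := MVT f id a b
  (fun c P => exist _ (f' c) (proj1 (is_derive_Reals f c (f' c)) (hd c P)))
  (fun c P => exist _ 1 (derivable_pt_lim_id c)) lt
  (fun c P => continuous_continuity_pt _ _ (hc c P))
  (fun c P => derivable_continuous_pt id c (derivable_pt_id c)).
rewrite /= /id in e; have := hn c P; nra.
Qed.

Lemma gronwall (f f' : R -> R) (a b K : R) : a <= b ->
  (forall t, a < t < b -> is_derive f t (f' t)) -> (forall t, a <= t <= b -> continuous f t) ->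
  (forall t, a < t < b -> f' t <= K * f t) -> f b <= f a * exp (K * (b - a)).
Proof.
move=> ab hd hc hn.
have hE : forall t, is_derive (fun t => exp (- K * (t - a))) t (- K * exp (- K * (t - a))).
  by move=> t; auto_derive => //; rewrite /Rminus; ring.
have := derive_nonpos_le (fun t => f t * exp (- K * (t - a)))
  (fun t => f' t * exp (- K * (t - a)) + f t * (- K * exp (- K * (t - a)))) a b ab
  (fun t ht => is_derive_Rmult _ _ _ _ _ (hd t ht) (hE t))
  (fun t ht => continuous_mult (K := R_AbsRing) _ _ _ (hc t ht) (is_derive_continuous _ _ _ (hE t))).
cbv beta => h.
have : f b * exp (- K * (b - a)) <= f a * exp (- K * (a - a)).
  apply: h => t ht; have p := exp_pos (- K * (t - a)).
  have := Rmult_le_compat_r _ _ _ (Rlt_le _ _ p) (hn t ht); lra.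
have -> : - K * (a - a) = 0 by ring.
rewrite exp_0 Rmult_1_r => {}h.
have e : exp (- K * (b - a)) * exp (K * (b - a)) = 1.
  by rewrite -exp_plus; have -> : - K * (b - a) + K * (b - a) = 0 by [ring]; exact: exp_0.
have := Rmult_le_compat_r _ _ _ (Rlt_le _ _ (exp_pos (K * (b - a)))) h.
by rewrite Rmult_assoc e Rmult_1_r.
Qed.

(** Continuity method: a bound that holds up to time [s] improves to a strict one at [s], so the
    supremum of the good times can only be [T]. *)
Lemma bootstrap (phi : R -> R) (T c : R) : (forall t, 0 <= t <= T -> continuous phi t) -> phi 0 <= c ->
  (forall s, 0 <= s <= T -> (forall r, 0 <= r <= s -> phi r <= c) -> phi s < c) ->
  forall s, 0 <= s <= T -> phi s < c.
Proof.
move=> hc h0 h s1 hs1.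
pose E s := 0 <= s <= T /\ forall r, 0 <= r <= s -> phi r <= c.
have E0 : E 0 by split; [lra|move=> r hr; have -> : r = 0 by lra].
have [sig [ub lub]] := completeness E ltac:(exists T => x [hx _]; lra) (ex_intro _ 0 E0).
have sig0 : 0 <= sig by exact: ub.
have sigT : sig <= T by apply: lub => x [hx _]; lra.
have below : forall r, 0 <= r < sig -> phi r <= c.
  move=> r hr; apply: NNPP => n.
  have : sig <= r; last lra.
  by apply: lub => x [hx1 hx2]; apply: Rnot_lt_le => l; apply: n; apply: hx2; lra.
have at_sig : phi sig <= c.
  case: (Rle_lt_or_eq_dec _ _ sig0) => [lt|<- //].
  apply: Rnot_lt_le => l.
  have [d [d0 hd]] := proj1 (continuous_eps _ _) (hc sig (conj sig0 sigT)) (phi sig - c) ltac:(lra).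
  set r := Rmax 0 (sig - d / 2).
  have r1 : 0 <= r < sig by split; [exact: Rmax_l|apply: Rmax_lub_lt; lra].
  have r2 : sig - d / 2 <= r by exact: Rmax_r.
  have := below r r1; have := hd r ltac:(apply: Rabs_def1; lra).
  move=> /Rabs_def2; lra.
have all : forall r, 0 <= r <= sig -> phi r <= c.
  move=> r hr; case: (Rle_lt_or_eq_dec _ _ (proj2 hr)) => [l|-> //]; apply: below; lra.
have lt := h sig (conj sig0 sigT) all.
have sT : sig = T.
  apply: Rle_antisym => //; apply: Rnot_lt_le => l.
  have [d [d0 hd]] := proj1 (continuous_eps _ _) (hc sig (conj sig0 sigT)) (c - phi sig) ltac:(lra).
  set r := Rmin T (sig + d / 2).
  have r1 : sig < r by apply: Rmin_glb_lt; lra.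
  have : r <= sig; last lra.
  apply: ub; split; first by split; [lra|exact: Rmin_l].
  move=> x hx; case: (Rle_dec x sig) => [l'|l']; first by apply: all; lra.
  have r2 : r <= sig + d / 2 by exact: Rmin_r.
  have := hd x ltac:(apply: Rabs_def1; lra).
  move=> /Rabs_def2; lra.
apply: h => // r hr; apply: all; lra.
Qed.

(** Truncation to [[a, b]]. Being 1-Lipschitz, it makes global objects of functions and fields that
    are controlled only on an interval or a box. *)
Definition clamp (a b x : R) : R := Rmax a (Rmin b x).

Lemma clamp_in (a b x : R) : a <= b -> a <= clamp a b x <= b.
Proof. by move=> h; rewrite /clamp; split; [exact: Rmax_l|apply: Rmax_lub => //; exact: Rmin_l]. Qed.

Lemma clamp_id (a b x : R) : a <= x <= b -> clamp a b x = x.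
Proof. by move=> h; rewrite /clamp Rmin_right ?Rmax_right; lra. Qed.

Lemma clamp_lip (a b x y : R) : Rabs (clamp a b x - clamp a b y) <= Rabs (x - y).
Proof.
have h := Rabs_pos (x - y); rewrite /clamp /Rmax /Rmin; case: (Rle_dec b x) => [?|/Rnot_le_lt ?]; case: (Rle_dec b y) => [?|/Rnot_le_lt ?]; repeat case: Rle_dec => [?|/Rnot_le_lt ?]; apply: Rabs_le; have p := Rle_abs (x - y);
  have q := Rle_abs (- (x - y)); rewrite Rabs_Ropp in q; split; lra.
Qed.

Lemma continuous_lip (f g : R -> R) (K s : R) : 0 <= K ->
  (forall t, Rabs (f t - f s) <= K * Rabs (g t - g s)) -> continuous g s -> continuous f s.
Proof.
move=> K0 h /continuous_eps hg; apply/continuous_eps => eps e0.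
have [d [d0 hd]] := hg (eps / (K + 1)) ltac:(apply: Rdiv_lt_0_compat; lra).
exists d; split => // y hy; have := hd y hy; have := h y; have := Rabs_pos (g y - g s) => p1 p2 p3.
have : (K + 1) * Rabs (g y - g s) < (K + 1) * (eps / (K + 1)) by apply: Rmult_lt_compat_l; lra.
have -> : (K + 1) * (eps / (K + 1)) = eps by field; lra.
nra.
Qed.

Lemma clamp_continuous (a b : R) (f : R -> R) (s : R) : continuous f s -> continuous (fun t => clamp a b (f t)) s.
Proof.
by apply: (continuous_lip _ _ 1) => [|t]; [lra|rewrite Rmult_1_l; exact: clamp_lip].
Qed.

Lemma Rmax0_continuous (s : R) : continuous (fun t => Rmax 0 t) s.
Proof.
apply: (continuous_lip _ (fun t => t) 1) => [|t|]; [lra| |exact: continuous_id].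
have h := Rabs_pos (t - s); rewrite Rmult_1_l /Rmax; repeat case: Rle_dec => [?|/Rnot_le_lt ?]; apply: Rabs_le; have p := Rle_abs (t - s);
  have q := Rle_abs (- (t - s)); rewrite Rabs_Ropp in q; split; lra.
Qed.

(** In the weight [exp (2 L s)] one integration gains [1 / (2 L)], which halves a bound multiplied
    by [L]. Picard iteration therefore contracts on every [[0, t]], without subdividing time. *)
Lemma RInt_exp_bound (h : R -> R) (K L t : R) : 0 <= t -> 1 <= L -> 0 <= K ->
  (forall s, continuous h s) -> (forall s, 0 <= s <= t -> Rabs (h s) <= L * (K * exp (2 * L * s))) ->
  Rabs (RInt h 0 t) <= K * exp (2 * L * t) / 2.
Proof.
move=> t0 L1 K0 hc hb.
have ex : ex_RInt h 0 t by apply: (ex_RInt_continuous (V := R_CompleteNormedModule)) => s _; exact: hc.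
have I : is_RInt (fun s => L * (K * exp (2 * L * s))) 0 t (K * exp (2 * L * t) / 2 - K * exp (2 * L * 0) / 2).
  apply: (is_RInt_derive (V := R_CompleteNormedModule) (fun s => K * exp (2 * L * s) / 2)) => s _.
    by auto_derive => //; field.
  apply: (is_derive_continuous _ _ (L * (K * (2 * L * exp (2 * L * s))))).
  by auto_derive => //; ring.
apply: Rle_trans (abs_RInt_le h 0 t t0 ex) _.
apply: Rle_trans (RInt_le _ _ 0 t t0 _ (ex_intro _ _ I) _) _.
- exact: (ex_RInt_norm h).
- by move=> s hs; apply: hb; lra.
rewrite (is_RInt_unique _ _ _ _ I) Rmult_0_r exp_0; lra.
Qed.

(** * Picard iteration for bounded, globally Lipschitz fields *)

Section Picard.

Variables (I : Type) (F : R -> (I -> R) -> I -> R) (x0 : I -> R) (L B : R).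
Hypothesis L1 : 1 <= L.
Hypothesis B0 : 0 <= B.
Hypothesis F_lip : forall s x y d, (forall i, Rabs (x i - y i) <= d) -> forall i, Rabs (F s x i - F s y i) <= L * d.
Hypothesis F_bound : forall s x i, Rabs (F s x i) <= B.
Hypothesis F_cont : forall x : R -> I -> R, (forall i s, continuous (fun r => x r i) s) ->
  forall i s, continuous (fun r => F r (x r) i) s.

(** Time is held at 0 for negative [s], so that the solution has a two-sided derivative at 0
    although the equation is posed for [t >= 0] only. *)
Let frozen (x : R -> I -> R) (s : R) (i : I) : R := F (Rmax 0 s) (x (Rmax 0 s)) i.

Fixpoint picard_iter (n : nat) (t : R) (i : I) : R :=
  match n with
  | O => x0 i
  | S k => x0 i + RInt (fun s => frozen (picard_iter k) s i) 0 t
  end.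

Let frozen_cont (x : R -> I -> R) : (forall i s, continuous (fun r => x (Rmax 0 r) i) s) ->
  forall i s, continuous (fun r => frozen x r i) s.
Proof.
move=> hx i s.
have h := F_cont (fun r => x (Rmax 0 r)) hx i.
have := continuous_comp (fun r => Rmax 0 r) (fun r => F r (x (Rmax 0 r)) i) s (Rmax0_continuous s) (h _).
by apply: continuous_ext => r; rewrite /frozen (Rmax_right 0 (Rmax 0 r)) //; exact: Rmax_l.
Qed.

Let ex_RInt_cont (h : R -> R) (a b : R) : (forall s, continuous h s) -> ex_RInt h a b.
Proof. by move=> hc; apply: (ex_RInt_continuous (V := R_CompleteNormedModule)) => s _; exact: hc. Qed.

Let primitive (h : R -> R) (c t : R) : (forall s, continuous h s) -> is_derive (fun t => c + RInt h 0 t) t (h t).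
Proof.
move=> hc; apply: is_derive_eq.
  apply: (is_derive_plus (K := R_AbsRing)); first exact: is_derive_const.
  apply: (is_derive_RInt h (fun t => RInt h 0 t) 0); last exact: hc.
  by exists (mkposreal 1 Rlt_0_1) => y _; apply: (RInt_correct (V := R_CompleteNormedModule)); exact: ex_RInt_cont.
by rewrite /plus /zero /=; ring.
Qed.

Lemma picard_iter_cont (n : nat) (i : I) (s : R) : continuous (fun t => picard_iter n t i) s.
Proof.
elim: n i s => [|n ih] i s /=; first exact: continuous_const.
apply: is_derive_continuous; apply: primitive => r.
apply: frozen_cont => j q.
exact: (continuous_comp (fun r => Rmax 0 r) (fun r => picard_iter n r j) q (Rmax0_continuous q) (ih _ _)).
Qed.

Let iter_frozen_cont (n : nat) (i : I) (s : R) : continuous (fun t => picard_iter n (Rmax 0 t) i) s.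
Proof. exact: (continuous_comp (fun r => Rmax 0 r) (fun r => picard_iter n r i) s (Rmax0_continuous s) (picard_iter_cont _ _ _)). Qed.

(** The contraction step: a weighted distance at most [K] becomes at most [K / 2]. *)
Lemma picard_diff (x y : R -> I -> R) (K : R) : 0 <= K ->
  (forall i s, continuous (fun r => x (Rmax 0 r) i) s) -> (forall i s, continuous (fun r => y (Rmax 0 r) i) s) ->
  (forall s i, 0 <= s -> Rabs (x s i - y s i) <= K * exp (2 * L * s)) ->
  forall t i, 0 <= t -> Rabs (RInt (fun s => frozen x s i) 0 t - RInt (fun s => frozen y s i) 0 t) <= K * exp (2 * L * t) / 2.
Proof.
move=> K0 hx hy h t i t0.
have E := RInt_minus (V := R_CompleteNormedModule) _ _ 0 t (ex_RInt_cont _ 0 t (frozen_cont x hx i)) (ex_RInt_cont _ 0 t (frozen_cont y hy i)).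
change (Rabs (minus (RInt (fun s => frozen x s i) 0 t) (RInt (fun s => frozen y s i) 0 t)) <= K * exp (2 * L * t) / 2).
rewrite -E; apply: RInt_exp_bound => // s.
  by apply: (continuous_minus (V := R_NormedModule)); exact: frozen_cont.
move=> hs; rewrite /frozen Rmax_right; last lra.
by apply: F_lip => j; apply: h; lra.
Qed.

Lemma picard_step (n : nat) (t : R) (i : I) : 0 <= t ->
  Rabs (picard_iter (S n) t i - picard_iter n t i) <= B / 2 ^ n * exp (2 * L * t).
Proof.
elim: n t i => [|n ih] t i t0.
  change (Rabs (x0 i + RInt (fun s => frozen (picard_iter 0) s i) 0 t - x0 i) <= B / 2 ^ 0 * exp (2 * L * t)).
  have -> : x0 i + RInt (fun s => frozen (picard_iter 0) s i) 0 t - x0 i = RInt (fun s => frozen (picard_iter 0) s i) 0 t by ring.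
  have := abs_RInt_le_const (fun s => frozen (picard_iter 0) s i) 0 t B t0 (ex_RInt_cont _ 0 t (frozen_cont _ (iter_frozen_cont 0) i)) (fun s _ => F_bound _ _ _).
  have := exp_ineq1_le (2 * L * t) => h1 h2; apply: Rle_trans h2 _.
  have : t <= exp (2 * L * t) by nra.
  rewrite /=; nra.
have p2 : 0 < 2 ^ n by apply: pow_lt; lra.
have := picard_diff (picard_iter (S n)) (picard_iter n) (B / 2 ^ n) ltac:(by apply: Rdiv_le_0_compat)
  (iter_frozen_cont _) (iter_frozen_cont _) ih t i t0.
set a := RInt _ _ _; set b := RInt _ _ _ => h.
have -> : picard_iter (S (S n)) t i - picard_iter (S n) t i = a - b.
  by change (x0 i + a - (x0 i + b) = a - b); ring.
apply: Rle_trans h _; right; rewrite /=; field; lra.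
Qed.

Lemma picard_cauchy (n k : nat) (t : R) (i : I) : 0 <= t ->
  Rabs (picard_iter (n + k) t i - picard_iter n t i) <= 2 * B / 2 ^ n * exp (2 * L * t).
Proof.
move=> t0.
have p2 : forall m, 0 < 2 ^ m by move=> m; apply: pow_lt; lra.
have E := exp_pos (2 * L * t).
suff : Rabs (picard_iter (n + k) t i - picard_iter n t i) <= (2 * B / 2 ^ n - 2 * B / 2 ^ (n + k)) * exp (2 * L * t).
  move=> h; apply: Rle_trans h _; apply: Rmult_le_compat_r; first lra.
  have : 0 <= 2 * B / 2 ^ (n + k) by apply: Rdiv_le_0_compat => //; lra.
  lra.
elim: k => [|k ih].
  rewrite Nat.add_0_r !Rminus_diag_eq // Rabs_R0; lra.
rewrite -plus_n_Sm.
have -> : picard_iter (S (n + k)) t i - picard_iter n t i = (picard_iter (S (n + k)) t i - picard_iter (n + k) t i) + (picard_iter (n + k) t i - picard_iter n t i) by ring.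
apply: Rle_trans (Rabs_triang _ _) _.
have := picard_step (n + k) t i t0.
have -> : 2 * B / 2 ^ S (n + k) = B / 2 ^ (n + k) by rewrite /=; field; have := p2 (n + k)%nat; lra.
have e : 2 * B / 2 ^ (n + k) = 2 * (B / 2 ^ (n + k)) by rewrite /Rdiv; ring.
rewrite e in ih; lra.
Qed.

Let y (t : R) (i : I) : R := real (Lim_seq (fun n => picard_iter n t i)).

Let y_lim (t : R) (i : I) : 0 <= t -> is_lim_seq (fun n => picard_iter n t i) (y t i).
Proof.
move=> t0; apply: Lim_seq_correct'; apply/ex_lim_seq_cauchy_corr => eps.
have [n hn] := pow2_arch (2 * B * exp (2 * L * t)) (eps / 2) ltac:(have := cond_pos eps; lra).
exists n => p q hp hq.
have c : forall m, (n <= m)%nat -> Rabs (picard_iter m t i - picard_iter n t i) < eps / 2.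
  move=> m hm; have -> : m = (n + (m - n))%nat by lia.
  apply: Rle_lt_trans (picard_cauchy _ _ _ _ t0) _.
  by have -> : 2 * B / 2 ^ n * exp (2 * L * t) = 2 * B * exp (2 * L * t) / 2 ^ n by rewrite /Rdiv; ring.
have -> : picard_iter p t i - picard_iter q t i = (picard_iter p t i - picard_iter n t i) + - (picard_iter q t i - picard_iter n t i) by ring.
apply: Rle_lt_trans (Rabs_triang _ _) _; rewrite Rabs_Ropp.
have := c p hp; have := c q hq; lra.
Qed.

Let y_close (n : nat) (t : R) (i : I) : 0 <= t ->
  Rabs (y t i - picard_iter n t i) <= 2 * B / 2 ^ n * exp (2 * L * t).
Proof.
move=> t0.
have h1 : is_lim_seq (fun k => Rabs (picard_iter (k + n) t i - picard_iter n t i)) (Rabs (y t i - picard_iter n t i)).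
  apply: (is_lim_seq_abs _ (Finite _)).
  apply: is_lim_seq_minus'; last exact: is_lim_seq_const.
  exact: (proj1 (is_lim_seq_incr_n (fun k => picard_iter k t i) n _) (y_lim t i t0)).
have := is_lim_seq_le _ (fun _ => 2 * B / 2 ^ n * exp (2 * L * t)) _ _ (fun k => _) h1 (is_lim_seq_const _).
apply => k; rewrite Nat.add_comm; exact: picard_cauchy.
Qed.

Let y_cont (i : I) (s : R) : continuous (fun t => y (Rmax 0 t) i) s.
Proof.
apply/continuous_eps => eps e0.
set T := Rmax 0 s + 1.
have [n hn] := pow2_arch (2 * B * exp (2 * L * T)) (eps / 4) ltac:(lra).
have [d [d0 hd]] := proj1 (continuous_eps _ _) (iter_frozen_cont n i s) (eps / 4) ltac:(lra).
exists (Rmin 1 d); split; first by apply: Rmin_pos; lra.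
move=> r hr.
have hr1 := Rlt_le_trans _ _ _ hr (Rmin_l _ _); have hr2 := Rlt_le_trans _ _ _ hr (Rmin_r _ _).
have cl : forall q, q <= s + 1 -> Rabs (y (Rmax 0 q) i - picard_iter n (Rmax 0 q) i) < eps / 4.
  move=> q hq; apply: Rle_lt_trans (y_close n _ i (Rmax_l 0 q)) _; apply: Rle_lt_trans hn.
  have -> : 2 * B * exp (2 * L * T) / 2 ^ n = 2 * B / 2 ^ n * exp (2 * L * T) by rewrite /Rdiv; ring.
  apply: Rmult_le_compat_l; first by apply: Rdiv_le_0_compat; [lra|apply: pow_lt; lra].
  have le : Rmax 0 q <= T.
    by rewrite /T; apply: Rmax_lub; [have := Rmax_l 0 s|have := Rmax_r 0 s]; lra.
  have : 2 * L * Rmax 0 q <= 2 * L * T by apply: Rmult_le_compat_l; lra.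
  by case=> [l|->]; [left; exact: exp_increasing|right].
have a1 := cl r ltac:(move: hr1 => /Rabs_def2; lra).
have a2 := cl s ltac:(lra).
have a3 := hd r hr2.
have -> : y (Rmax 0 r) i - y (Rmax 0 s) i = (y (Rmax 0 r) i - picard_iter n (Rmax 0 r) i) + (picard_iter n (Rmax 0 r) i - picard_iter n (Rmax 0 s) i) + - (y (Rmax 0 s) i - picard_iter n (Rmax 0 s) i) by ring.
apply: Rle_lt_trans (Rabs_triang _ _) _; rewrite Rabs_Ropp.
have := Rabs_triang (y (Rmax 0 r) i - picard_iter n (Rmax 0 r) i) (picard_iter n (Rmax 0 r) i - picard_iter n (Rmax 0 s) i).
lra.
Qed.

(** The limit [y] of the iterates is not known to be differentiable at first. The curve [x] is
    defined as the integral of the field along [y], shown to equal [y] for [t >= 0], and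
    differentiable as a primitive. *)
Theorem picard : exists x : R -> I -> R, (forall i, x 0 i = x0 i) /\
  forall t, 0 <= t -> forall i, is_derive (fun r => x r i) t (F t (x t) i).
Proof.
pose x t i := x0 i + RInt (fun s => frozen y s i) 0 t.
have xy : forall t i, 0 <= t -> x t i = y t i.
  move=> t i t0.
  have lim : is_lim_seq (fun n => picard_iter (S n) t i) (x t i).
    apply/is_lim_seq_spec => eps.
    have [N hN] := pow2_arch (2 * B * exp (2 * L * t)) eps (cond_pos eps).
    exists N => n hn.
    have p2 : forall m, 0 < 2 ^ m by move=> m; apply: pow_lt; lra.
    have h := picard_diff (picard_iter n) y (2 * B / 2 ^ n) ltac:(apply: Rdiv_le_0_compat; [lra|exact: p2])
      (iter_frozen_cont n) y_cont (fun s j hs => eq_ind _ (fun v => v <= _) (y_close n s j hs) _ (Rabs_minus_sym _ _)) t i t0.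
    have -> : picard_iter (S n) t i - x t i = RInt (fun s => frozen (picard_iter n) s i) 0 t - RInt (fun s => frozen y s i) 0 t.
      by rewrite /x /=; ring.
    apply: Rle_lt_trans h _; apply: Rle_lt_trans hN.
    have E := exp_pos (2 * L * t).
    have mono : / 2 ^ n <= / 2 ^ N by apply: Rinv_le_contravar; [exact: p2|apply: Rle_pow; [lra|exact: hn]].
    have q : 0 <= 2 * B * exp (2 * L * t) by nra.
    have h1 : 2 * B * exp (2 * L * t) * / 2 ^ n <= 2 * B * exp (2 * L * t) * / 2 ^ N by apply: Rmult_le_compat_l.
    have h2 : 0 <= 2 * B * exp (2 * L * t) * / 2 ^ n by apply: Rmult_le_pos => //; left; apply: Rinv_0_lt_compat; exact: p2.
    have -> : 2 * B / 2 ^ n * exp (2 * L * t) / 2 = (2 * B * exp (2 * L * t) * / 2 ^ n) / 2 by rewrite /Rdiv; ring.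
    rewrite /Rdiv in h1 h2 *; lra.
  have := is_lim_seq_unique _ _ lim.
  by rewrite (is_lim_seq_unique _ _ (proj1 (is_lim_seq_incr_1 _ _) (y_lim t i t0))) => -[].
exists x; split; first by move=> i; rewrite /x RInt_point /zero /=; ring.
move=> t t0 i.
have := primitive (fun s => frozen y s i) (x0 i) t (frozen_cont y y_cont i).
rewrite /frozen Rmax_right // => h; apply: is_derive_eq h _.
(* The Lipschitz bound with distance 0 does the work of extensionality: [F] takes equal values at
   states that agree at every index. *)
apply: cond_eq => eps e0.
have := F_lip t (y t) (x t) 0 (fun j => Req_le _ _ _) i; rewrite Rmult_0_r => h.
apply: Rle_lt_trans (h _) e0 => j; rewrite xy // Rminus_diag_eq // Rabs_R0 //.
Qed.

End Picard.

(** * A calculus of bounded Lipschitz fields *)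

Section Regular.

Variables (I : Type) (S : (I -> R) -> Prop).

(** What Picard iteration needs of one component: boundedness, a Lipschitz bound, and continuity
    along continuous curves, on [S] only. The class is closed under the field operations, so
    explicit rational fields can be checked term by term. *)
Definition regular (G : R -> (I -> R) -> R) : Prop :=
  (exists B, 0 <= B /\ forall s x, S x -> Rabs (G s x) <= B) /\
  (exists L, 0 <= L /\ forall s x y d, 0 <= d -> S x -> S y -> (forall i, Rabs (x i - y i) <= d) ->
     Rabs (G s x - G s y) <= L * d) /\
  (forall x : R -> I -> R, (forall i s, continuous (fun r => x r i) s) -> (forall r, S (x r)) ->
     forall s, continuous (fun r => G r (x r)) s).

Lemma regular_ext (G H : R -> (I -> R) -> R) : (forall s x, S x -> G s x = H s x) -> regular G -> regular H.
Proof.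
move=> e [[B [B0 hB]] [[L [L0 hL]] hc]]; split; last split.
- by exists B; split => // s x hx; rewrite -e //; exact: hB.
- by exists L; split => // s x y d d0 hx hy h; rewrite -!e //; exact: hL.
- move=> x hx hS s; apply: continuous_ext (hc x hx hS s) => r; exact: e.
Qed.

Lemma regular_time (g : R -> R) (B : R) : (forall s, continuous g s) -> (forall s, Rabs (g s) <= B) ->
  regular (fun s _ => g s).
Proof.
move=> hg hB; split; last split.
- by exists B; split; [exact: Rle_trans (Rabs_pos _) (hB 0)|].
- exists 0; split; first lra; move=> s x y d d0 _ _ _.
  rewrite Rminus_diag_eq // Rabs_R0; lra.
- by move=> x _ _ s.
Qed.

Lemma regular_const (c : R) : regular (fun _ _ => c).
Proof. by apply: (regular_time (fun _ => c) (Rabs c)) => s; [exact: continuous_const|lra]. Qed.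

Lemma regular_coord (i : I) (B : R) : 0 <= B -> (forall x, S x -> Rabs (x i) <= B) -> regular (fun _ x => x i).
Proof.
move=> B0 hB; split; last split.
- by exists B; split => // s x hx; exact: hB.
- by exists 1; split; [lra|] => s x y d d0 _ _ h; rewrite Rmult_1_l.
- by move=> x hx _ s; exact: hx.
Qed.

Lemma regular_plus (G H : R -> (I -> R) -> R) : regular G -> regular H -> regular (fun s x => G s x + H s x).
Proof.
move=> [[B [B0 hB]] [[L [L0 hL]] hc]] [[B' [B'0 hB']] [[L' [L'0 hL']] hc']]; split; last split.
- exists (B + B'); split; first lra; move=> s x hx; apply: Rle_trans (Rabs_triang _ _) _.
  by have := hB s x hx; have := hB' s x hx; lra.
- exists (L + L'); split; first lra; move=> s x y d d0 hx hy h.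
  have -> : G s x + H s x - (G s y + H s y) = (G s x - G s y) + (H s x - H s y) by ring.
  apply: Rle_trans (Rabs_triang _ _) _.
  by have := hL s x y d d0 hx hy h; have := hL' s x y d d0 hx hy h; lra.
- by move=> x hx hS s; apply: (continuous_plus (V := R_NormedModule)); [exact: hc|exact: hc'].
Qed.

Lemma regular_mult (G H : R -> (I -> R) -> R) : regular G -> regular H -> regular (fun s x => G s x * H s x).
Proof.
move=> [[B [B0 hB]] [[L [L0 hL]] hc]] [[B' [B'0 hB']] [[L' [L'0 hL']] hc']]; split; last split.
- exists (B * B'); split; first nra; move=> s x hx; rewrite Rabs_mult.
  by apply: Rmult_le_compat; [exact: Rabs_pos|exact: Rabs_pos|exact: hB|exact: hB'].
- exists (B * L' + L * B'); split; first nra; move=> s x y d d0 hx hy h.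
  have -> : G s x * H s x - (G s y * H s y) = G s x * (H s x - H s y) + (G s x - G s y) * H s y by ring.
  apply: Rle_trans (Rabs_triang _ _) _; rewrite !Rabs_mult.
  have h1 : Rabs (G s x) * Rabs (H s x - H s y) <= B * (L' * d).
    by apply: Rmult_le_compat; [exact: Rabs_pos|exact: Rabs_pos|exact: hB|exact: hL'].
  have h2 : Rabs (G s x - G s y) * Rabs (H s y) <= L * d * B'.
    by apply: Rmult_le_compat; [exact: Rabs_pos|exact: Rabs_pos|exact: hL|exact: hB'].
  lra.
- by move=> x hx hS s; apply: (continuous_mult (K := R_AbsRing)); [exact: hc|exact: hc'].
Qed.

Lemma regular_opp (G : R -> (I -> R) -> R) : regular G -> regular (fun s x => - G s x).
Proof.
move=> h; apply: regular_ext (regular_mult _ _ (regular_const (-1)) h) => s x _; ring.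
Qed.

Lemma regular_minus (G H : R -> (I -> R) -> R) : regular G -> regular H -> regular (fun s x => G s x - H s x).
Proof. by move=> h k; exact: regular_plus h (regular_opp _ k). Qed.

Lemma regular_pow (G : R -> (I -> R) -> R) (n : nat) : regular G -> regular (fun s x => G s x ^ n).
Proof.
move=> h; elim: n => [|n ih]; first exact: regular_const.
exact: regular_mult h ih.
Qed.

Lemma regular_inv (G : R -> (I -> R) -> R) (c : R) : 0 < c -> (forall s x, S x -> c <= Rabs (G s x)) ->
  regular G -> regular (fun s x => / G s x).
Proof.
move=> c0 hge [[B [B0 hB]] [[L [L0 hL]] hc]].
have nz : forall s x, S x -> G s x <> 0.
  by move=> s x hx e; have := hge s x hx; rewrite e Rabs_R0; lra.
split; last split.
- exists (/ c); split; first by left; apply: Rinv_0_lt_compat.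
  by move=> s x hx; rewrite Rabs_inv; apply: Rinv_le_contravar => //; exact: hge.
- exists (L / (c * c)); split; first by apply: Rdiv_le_0_compat => //; nra.
  move=> s x y d d0 hx hy h.
  have nx := nz s x hx; have ny := nz s y hy.
  have -> : / G s x - / G s y = - (G s x - G s y) * (/ G s x * / G s y) by field.
  rewrite Rabs_mult Rabs_Ropp Rabs_mult !Rabs_inv.
  have i1 : / Rabs (G s x) <= / c by apply: Rinv_le_contravar => //; exact: hge.
  have i2 : / Rabs (G s y) <= / c by apply: Rinv_le_contravar => //; exact: hge.
  have p1 : 0 < / Rabs (G s x) by apply: Rinv_0_lt_compat; exact: Rabs_pos_lt.
  have p2 : 0 < / Rabs (G s y) by apply: Rinv_0_lt_compat; exact: Rabs_pos_lt.
  have -> : L / (c * c) * d = (L * d) * (/ c * / c) by field; lra.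
  apply: Rmult_le_compat; [exact: Rabs_pos|nra|exact: hL|].
  by apply: Rmult_le_compat; lra.
- move=> x hx hS s; apply: (continuous_comp (fun r => G r (x r)) Rinv).
    exact: hc.
  by apply: continuous_Rinv; exact: nz.
Qed.

Lemma regular_div (G H : R -> (I -> R) -> R) (c : R) : 0 < c -> (forall s x, S x -> c <= Rabs (H s x)) ->
  regular G -> regular H -> regular (fun s x => G s x / H s x).
Proof. by move=> c0 h hG hH; apply: regular_mult => //; exact: (regular_inv _ c). Qed.

End Regular.

Section PicardBox.

Variables (I : Type) (enum : list I) (lo hi : I -> R).
Hypothesis full : forall i, In i enum.
Hypothesis lohi : forall i, lo i <= hi i.

Definition box (x : I -> R) : Prop := forall i, lo i <= x i <= hi i.

Lemma uniform_bound (P : I -> R -> Prop) : (forall i, exists B, 0 <= B /\ P i B) ->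
  (forall i B B', B <= B' -> P i B -> P i B') -> exists B, 0 <= B /\ forall i, P i B.
Proof.
move=> h mono.
have [B [B0 hB]] : exists B, 0 <= B /\ forall i, In i enum -> P i B.
  elim: enum => [|j l [B [B0 hB]]]; first by exists 0; split; [lra|].
  have [B' [B'0 hB']] := h j; exists (Rmax B B'); split; first exact: Rle_trans B0 (Rmax_l _ _).
  move=> i [<-|hi']; first by apply: mono hB'; exact: Rmax_r.
  by apply: mono (hB i hi'); exact: Rmax_l.
by exists B; split => // i; apply: hB.
Qed.

(** The field is composed with the clamp to the box, which makes it globally Lipschitz. The solution
    satisfies the original equation as long as it stays in the box. *)
Lemma picard_box (G : R -> (I -> R) -> I -> R) (x0 : I -> R) :
  (forall i, regular I box (fun s x => G s x i)) ->
  exists x : R -> I -> R, (forall i, x 0 i = x0 i) /\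
    forall t, 0 <= t -> forall i, is_derive (fun r => x r i) t (G t (fun j => clamp (lo j) (hi j) (x t j)) i).
Proof.
move=> hG.
have [B [B0 hB]] := uniform_bound (fun i B => forall s x, box x -> Rabs (G s x i) <= B)
  (fun i => proj1 (hG i)) (fun i B B' hle h s x hx => Rle_trans _ _ _ (h s x hx) hle).
have [L [L0 hL]] := uniform_bound (fun i L => forall s x y d, 0 <= d -> box x -> box y -> (forall j, Rabs (x j - y j) <= d) ->
     Rabs (G s x i - G s y i) <= L * d)
  (fun i => proj1 (proj2 (hG i)))
  (fun i K K' hle h s x y d d0 hx hy hd => Rle_trans _ _ _ (h s x y d d0 hx hy hd) (Rmult_le_compat_r _ _ _ d0 hle)).
pose cl (x : I -> R) (j : I) := clamp (lo j) (hi j) (x j).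
have clb : forall x, box (cl x) by move=> x j; exact: clamp_in.
apply: (picard I (fun s x => G s (cl x)) x0 (L + 1) B) => //.
- lra.
- move=> s x y d hd i.
  have d0 : 0 <= d := Rle_trans _ _ _ (Rabs_pos _) (hd i).
  apply: Rle_trans (hL i s (cl x) (cl y) d d0 (clb x) (clb y) _) _; last nra.
  by move=> j; exact: Rle_trans (clamp_lip _ _ _ _) (hd j).
- by move=> s x i; apply: hB.
- move=> x hx i s; apply: (proj2 (proj2 (hG i)) (fun r => cl (x r))) => // j r.
  exact: clamp_continuous.
Qed.

End PicardBox.

(** Outside [[0, T]] the curve is continued affinely with the prescribed end slopes, which turns
    one-sided derivatives into two-sided ones. *)
Lemma tder_extend (g : R -> C) (v : R -> C) (T : R) : 0 <= T ->
  (forall s, 0 <= s <= T -> has_tderiv_on (fun r => 0 <= r <= T) g s (v s)) ->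
  exists G, (forall s, 0 <= s <= T -> G s = g s) /\ forall s, 0 <= s <= T -> tder G s (v s).
Proof.
move=> T0 h.
pose G s := match Rlt_dec s 0 with
  | left _ => (g 0%R + RtoC s * v 0%R)%C
  | right _ => match Rlt_dec T s with
     | left _ => (g T + RtoC (s - T) * v T)%C
     | right _ => g s end end.
have Gin : forall s, 0 <= s <= T -> G s = g s.
  by move=> s hs; rewrite /G; case: Rlt_dec => [?|_]; [lra|case: Rlt_dec => [?|_]; [lra|]].
have Glo : forall s, s < 0 -> G s = (g 0%R + RtoC s * v 0%R)%C.
  by move=> s hs; rewrite /G; case: Rlt_dec.
have Ghi : forall s, T < s -> G s = (g T + RtoC (s - T) * v T)%C.
  by move=> s hs; rewrite /G; case: Rlt_dec => [?|_]; [lra|case: Rlt_dec].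
exists G; split => // s hs; apply/tder_eps => eps e0.
have [d [d0 hd]] := h s hs eps e0.
have In : forall r, 0 <= r <= T -> Rabs (r - s) < d -> Cmod (G r - G s - RtoC (r - s) * v s) <= eps * Rabs (r - s).
  move=> r hr hrs; rewrite !Gin //.
  case: (Req_dec r s) => [->|n].
    have -> : (g s - g s - RtoC (s - s) * v s = 0)%C by rewrite Rminus_diag_eq //; ring.
    rewrite Cmod_0 Rminus_diag_eq // Rabs_R0; lra.
  have := hd r hr (conj (Rabs_pos_lt _ (Rminus_eq_contra _ _ n)) hrs).
  change (Cmod ((g r - g s) - Cscal (r - s) (v s))%C <= eps * Rabs (r - s) -> Cmod (g r - g s - RtoC (r - s) * v s) <= eps * Rabs (r - s)).
  have -> // : Cscal (r - s) (v s) = (RtoC (r - s) * v s)%C.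
  by apply: C_ext => /=; ring.
have zero : forall r, Cmod 0 <= eps * Rabs (r - s) by move=> r; rewrite Cmod_0; have := Rabs_pos (r - s); nra.
(* Away from an end point the radius is at most the distance to it, so [r] lies outside [[0, T]]
   only when [s] is that end point; the value 1 is a default for this case. *)
exists (Rmin d (Rmin (match Rlt_dec 0 s with left _ => s | right _ => 1 end) (match Rlt_dec s T with left _ => T - s | right _ => 1 end))); split.
  by do 2 (try apply: Rmin_pos => //); case: Rlt_dec => ?; lra.
move=> r hr.
have h1 := Rlt_le_trans _ _ _ hr (Rmin_l _ _); have h' := Rlt_le_trans _ _ _ hr (Rmin_r _ _).
have h2 := Rlt_le_trans _ _ _ h' (Rmin_l _ _); have h3 := Rlt_le_trans _ _ _ h' (Rmin_r _ _).
have [ha hb] := Rabs_def2 _ _ h2; have [hc hd'] := Rabs_def2 _ _ h3.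
case: (Rlt_le_dec r 0) => r0.
  have s0 : s = 0.
    by move: ha hb; case: Rlt_dec => ? *; lra.
  subst s; rewrite Glo // Gin //.
  have -> : (g 0%R + RtoC r * v 0%R - g 0%R - RtoC (r - 0) * v 0%R = 0)%C by rewrite Rminus_0_r; ring.
  exact: zero.
case: (Rlt_le_dec T r) => rT.
  have s0 : s = T.
    by move: hc hd'; case: Rlt_dec => ? *; lra.
  subst s; rewrite Ghi // Gin //.
  have -> : (g T + RtoC (r - T) * v T - g T - RtoC (r - T) * v T = 0)%C by ring.
  exact: zero.
by apply: In.
Qed.

(** * Flows of fields with one real pole on the upper half-plane *)

Record coef : Type := Coef { cA : R; cy : R; cp0 : R; cp1 : R; cp2 : R }.

Definition vf (k : coef) (z : C) : C :=
  (RtoC (cA k) / (z - RtoC (cy k)) + RtoC (cp0 k) + RtoC (cp1 k) * z + RtoC (cp2 k) * (z * z))%C.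
Definition dvf (k : coef) (z : C) : C :=
  (- RtoC (cA k) / ((z - RtoC (cy k)) * (z - RtoC (cy k))) + RtoC (cp1 k) + RtoC (2 * cp2 k) * z)%C.
(** The divided difference of [vf k], with [dvf k] on the diagonal; it is the coefficient of the
    linear equation satisfied by the difference of two solutions. *)
Definition ddvf (k : coef) (z w : C) : C :=
  (- RtoC (cA k) / ((z - RtoC (cy k)) * (w - RtoC (cy k))) + RtoC (cp1 k) + RtoC (cp2 k) * (z + w))%C.

Lemma UHP_real_neq (z : C) (y : R) : UHP z -> (z - RtoC y)%C <> 0%C.
Proof. by rewrite /UHP /Cim => hz e; have /= := f_equal snd e; lra. Qed.

Lemma RtoC_mult2 (a : R) : RtoC (2 * a) = (RtoC a + RtoC a)%C.
Proof. by apply: C_ext => /=; ring. Qed.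

Lemma vf_diff (k : coef) (z w : C) : UHP z -> UHP w -> (vf k z - vf k w)%C = (ddvf k z w * (z - w))%C.
Proof.
move=> hz hw; rewrite /vf /ddvf; field.
by split; apply: UHP_real_neq.
Qed.

(** The bound [/ 2] on the pole makes [3 x^2 - 2 x y + 1] non-negative, which [height_derive] relies
    on; [B] bounds all other coefficients. *)
Definition admissible (k : R -> coef) (B : R) : Prop :=
  (forall s, continuous (fun t => cA (k t)) s /\ continuous (fun t => cy (k t)) s /\
     continuous (fun t => cp0 (k t)) s /\ continuous (fun t => cp1 (k t)) s /\ continuous (fun t => cp2 (k t)) s) /\
  (forall s, 0 <= cA (k s) <= B /\ Rabs (cy (k s)) <= / 2 /\
     Rabs (cp0 (k s)) <= B /\ Rabs (cp1 (k s)) <= B /\ Rabs (cp2 (k s)) <= B).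

Definition solves (k : R -> coef) (G : R -> C) (a b : R) : Prop :=
  forall s, a <= s <= b -> UHP (G s) /\ tder G s (vf (k s) (G s)).

Definition dist2 (G H : R -> C) (s : R) : R :=
  (fst (G s) - fst (H s)) * (fst (G s) - fst (H s)) + (snd (G s) - snd (H s)) * (snd (G s) - snd (H s)).

Lemma dist2_Cmod (G H : R -> C) (s : R) : dist2 G H s = Cmod (G s - H s) ^ 2.
Proof. by rewrite Cmod_sq /dist2 /=; ring. Qed.

Lemma is_derive_Rminus (f g : R -> R) (x a b : R) : is_derive f x a -> is_derive g x b ->
  is_derive (fun t => f t - g t) x (a - b).
Proof. by move=> h k; exact: (is_derive_minus (K := R_AbsRing)). Qed.

Lemma is_derive_Rplus (f g : R -> R) (x a b : R) : is_derive f x a -> is_derive g x b ->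
  is_derive (fun t => f t + g t) x (a + b).
Proof. by move=> h k; exact: (is_derive_plus (K := R_AbsRing)). Qed.

(** The difference is multiplied by [ddvf], and only the real part of this factor acts on the
    squared modulus. The square is used because it is differentiable at 0. *)
Lemma dist2_derive (k : coef) (G H : R -> C) (s : R) : UHP (G s) -> UHP (H s) ->
  tder G s (vf k (G s)) -> tder H s (vf k (H s)) ->
  is_derive (dist2 G H) s (2 * fst (ddvf k (G s) (H s)) * dist2 G H s).
Proof.
move=> hG hH [g1 g2] [h1 h2].
have e := vf_diff k _ _ hG hH.
have e1 := f_equal fst e; have e2 := f_equal snd e.
have d1 := is_derive_Rminus _ _ _ _ _ g1 h1; have d2 := is_derive_Rminus _ _ _ _ _ g2 h2.
apply: is_derive_eq.
  by apply: is_derive_Rplus; apply: is_derive_Rmult; eassumption.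
have -> : fst (vf k (G s)) - fst (vf k (H s)) = fst (ddvf k (G s) (H s) * (G s - H s))%C by rewrite -e1.
have -> : snd (vf k (G s)) - snd (vf k (H s)) = snd (ddvf k (G s) (H s) * (G s - H s))%C by rewrite -e2.
by rewrite /dist2 /=; ring.
Qed.

Lemma gronwall_back (f f' : R -> R) (a b K : R) : a <= b ->
  (forall t, a <= t <= b -> is_derive f t (f' t)) ->
  (forall t, a <= t <= b -> - K * f t <= f' t) -> f a <= f b * exp (K * (b - a)).
Proof.
move=> ab hd hn.
pose g t := f (a + b - t).
have hg : forall t, a <= t <= b -> is_derive g t (- f' (a + b - t)).
  move=> t ht; apply: is_derive_eq.
    apply: (is_derive_comp f (fun t => a + b - t)); first by apply: hd; lra.
    by auto_derive.
  by rewrite /scal /= /mult /=; ring.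
have := gronwall g (fun t => - f' (a + b - t)) a b K ab (fun t ht => hg t ltac:(lra))
  (fun t ht => is_derive_continuous _ _ _ (hg t ht)) _.
rewrite /g.
have -> : a + b - b = a by ring.
have -> : a + b - a = b by ring.
by apply => t ht; have := hn (a + b - t) ltac:(lra); lra.
Qed.

(** A bound on [height] without division, meaningful for continuity arguments even before the
    imaginary part is known to be positive. *)
Definition height_le (kap : R) (z : C) : Prop := UHP z /\ fst z * fst z + snd z * snd z + 1 <= kap * snd z.

Lemma height_bounds (kap : R) (z : C) : height_le kap z ->
  0 < kap /\ / kap <= snd z <= kap /\ Rabs (fst z) <= kap /\ Cmod z <= 2 * kap.
Proof.
move=> [hz h]; rewrite /UHP /Cim in hz.
have k0 : 0 < kap by nra.
have h1 : / kap <= snd z.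
  apply: (Rmult_le_reg_l kap) => //; rewrite Rinv_r; nra.
have h2 : snd z <= kap by nra.
have h3 : Rabs (fst z) <= kap.
  have : fst z * fst z <= kap * kap by nra.
  by move=> q; apply: Rabs_le; nra.
do 3 split => //.
apply: Rle_trans (Cmod_le_sum _) _; rewrite (Rabs_pos_eq (snd z)); lra.
Qed.

Lemma height_real_dist (kap y : R) (z : C) : height_le kap z -> / kap <= Cmod (z - RtoC y).
Proof.
move=> h; have [k0 [[h1 h2] _]] := height_bounds _ _ h.
apply: Rle_trans h1 _; have := Cmod_snd (z - RtoC y)%C; rewrite /=.
have := Rle_abs (snd z + - 0); lra.
Qed.

(** Twice the hyperbolic cosine of the hyperbolic distance from [Ci]; bounding it keeps [z] away
    from the real line and from infinity. *)
Definition height (z : C) : R := (fst z * fst z + snd z * snd z + 1) / snd z.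

Lemma height_leE (kap : R) (z : C) : UHP z -> height_le kap z <-> height z <= kap.
Proof.
rewrite /height_le /height /UHP /Cim => hz; split.
- move=> [_ h]; apply: (Rmult_le_reg_r (snd z)) => //.
  have -> : (fst z * fst z + snd z * snd z + 1) / snd z * snd z = fst z * fst z + snd z * snd z + 1 by field; lra.
  lra.
- move=> h; split => //; have := Rmult_le_compat_r _ _ _ (Rlt_le _ _ hz) h.
  have -> : (fst z * fst z + snd z * snd z + 1) / snd z * snd z = fst z * fst z + snd z * snd z + 1 by field; lra.
  lra.
Qed.

Lemma vf_re (k : coef) (z : C) : UHP z -> fst (vf k z) =
  cA k * (fst z - cy k) / ((fst z - cy k) ^ 2 + snd z ^ 2) + cp0 k + cp1 k * fst z + cp2 k * (fst z * fst z - snd z * snd z).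
Proof.
rewrite /UHP /Cim => hz; rewrite /vf /=; field.
by have := pow2_ge_0 (fst z - cy k); nra.
Qed.

Lemma vf_im (k : coef) (z : C) : UHP z -> snd (vf k z) =
  - (cA k * snd z) / ((fst z - cy k) ^ 2 + snd z ^ 2) + cp1 k * snd z + cp2 k * (2 * fst z * snd z).
Proof.
rewrite /UHP /Cim => hz; rewrite /vf /=; field.
by have := pow2_ge_0 (fst z - cy k); nra.
Qed.

(** The estimate is one-sided: forwards in time the pole attracts points to the real line and the
    height may blow up. As [A >= 0], the pole term is non-negative except for [- A v^2], which
    [Q >= v^2] absorbs at the cost of [B]. The quadratic polynomial costs another [3 B]. *)
Lemma height_derive (k : R -> coef) (B : R) (G : R -> C) (s : R) : admissible k B -> UHP (G s) ->
  tder G s (vf (k s) (G s)) ->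
  exists h', is_derive (fun r => height (G r)) s h' /\ - (4 * B) * height (G s) <= h'.
Proof.
move=> [_ hB] hz [g1 g2]; have {hB}[hA [hy [h0 [h1 h2]]]] := hB s.
rewrite vf_re // in g1; rewrite vf_im // in g2.
rewrite /UHP /Cim in hz.
set x := fst (G s) in g1 g2 *; set v := snd (G s) in g1 g2 hz *.
set A := cA (k s) in g1 g2 hA *; set y := cy (k s) in g1 g2 hy *.
set p0 := cp0 (k s) in g1 h0 *; set p1 := cp1 (k s) in g1 g2 h1 *; set p2 := cp2 (k s) in g1 g2 h2 *.
have Q0 : 0 < (x - y) ^ 2 + v ^ 2 by have := pow2_ge_0 (x - y); have : 0 < v ^ 2 by [apply: pow_lt]; lra.
set Q := (x - y) ^ 2 + v ^ 2 in g1 g2 Q0.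
(* The derivative of [height] in closed form, with the pole term and the quadratic polynomial kept
   apart. *)
exists (A * (3 * x ^ 2 - v ^ 2 - 2 * x * y + 1) / (v * Q) + (2 * p0 * x + p1 * (x ^ 2 + v ^ 2) - p1 - 2 * p2 * x) / v); split.
  have d := is_derive_div _ _ _ _ _ (is_derive_Rplus _ _ _ _ _ (is_derive_Rplus _ _ _ _ _ (is_derive_Rmult _ _ _ _ _ g1 g1) (is_derive_Rmult _ _ _ _ _ g2 g2)) (is_derive_const 1 s)) g2 (Rgt_not_eq _ _ hz).
  apply: is_derive_eq d _; rewrite -/x -/v /zero /= /Q; field.
  by split; [lra|rewrite -/v -/x; move: Q0; rewrite /Q /=; lra].
have [l1 l2] := proj1 (Rabs_le_between _ _) hy.
have [l3 l4] := proj1 (Rabs_le_between _ _) h0.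
have [l5 l6] := proj1 (Rabs_le_between _ _) h1.
have [l7 l8] := proj1 (Rabs_le_between _ _) h2.
have B0 : 0 <= B by lra.
have xx : 0 <= 3 * x ^ 2 - 2 * x * y + 1.
  have := pow2_ge_0 (x - y); have : y ^ 2 <= 1 by nra.
  by have := pow2_ge_0 x; lra.
have s1 : - B * ((x * x + v * v + 1) / v) <= A * (3 * x ^ 2 - v ^ 2 - 2 * x * y + 1) / (v * Q).
  have -> : - B * ((x * x + v * v + 1) / v) = (- B * (x * x + v * v + 1) * Q) / (v * Q) by field; lra.
  apply: Rmult_le_compat_r; first by left; apply: Rinv_0_lt_compat; exact: Rmult_lt_0_compat.
  have q1 : v ^ 2 <= Q by rewrite /Q; have := pow2_ge_0 (x - y); lra.
  have q2 : 0 <= A * (3 * x ^ 2 - 2 * x * y + 1) by apply: Rmult_le_pos; lra.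
  have q3 : A * v ^ 2 <= B * Q by apply: Rmult_le_compat; try lra; apply: pow2_ge_0.
  have q4 : 0 <= B * (x * x + v * v) * Q by apply: Rmult_le_pos; [apply: Rmult_le_pos => //; nra|lra].
  lra.
have s2 : - (3 * B) * ((x * x + v * v + 1) / v) <= (2 * p0 * x + p1 * (x ^ 2 + v ^ 2) - p1 - 2 * p2 * x) / v.
  have -> : - (3 * B) * ((x * x + v * v + 1) / v) = (- (3 * B) * (x * x + v * v + 1)) / v by field; lra.
  apply: Rmult_le_compat_r; first by left; apply: Rinv_0_lt_compat.
  have xa : 2 * Rabs x <= x * x + 1.
    have := pow2_ge_0 (Rabs x - 1); have := pow2_abs x; lra.
  have t1 : - (B * Rabs x) <= p0 * x.
    have : Rabs (p0 * x) <= B * Rabs x by rewrite Rabs_mult; apply: Rmult_le_compat_r => //; exact: Rabs_pos.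
    by move=> /Rabs_le_between; lra.
  have t2 : p2 * x <= B * Rabs x.
    have : Rabs (p2 * x) <= B * Rabs x by rewrite Rabs_mult; apply: Rmult_le_compat_r => //; exact: Rabs_pos.
    by move=> /Rabs_le_between; lra.
  have t3 : - (B * (x ^ 2 + v ^ 2)) <= p1 * (x ^ 2 + v ^ 2) by have := pow2_ge_0 x; have := pow2_ge_0 v; nra.
  have t4 : B * (2 * Rabs x) <= B * (x * x + 1) by apply: Rmult_le_compat_l.
  have t5 : 0 <= B * (v * v) by apply: Rmult_le_pos => //; nra.
  lra.
rewrite /height -/x -/v; lra.
Qed.

Lemma height_bound (k : R -> coef) (B : R) (G : R -> C) (a b : R) : admissible k B -> a <= b ->
  solves k G a b -> height (G a) <= height (G b) * exp (4 * B * (b - a)).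
Proof.
move=> adm ab hs.
pose h' s := epsilon (inhabits 0) (fun h' => is_derive (fun r => height (G r)) s h' /\ - (4 * B) * height (G s) <= h').
have sp : forall s, a <= s <= b -> is_derive (fun r => height (G r)) s (h' s) /\ - (4 * B) * height (G s) <= h' s.
  move=> s hs'; have [hu ht] := hs s hs'.
  exact: (epsilon_spec (inhabits 0) _ (height_derive k B G s adm hu ht)).
by apply: (gronwall_back (fun s => height (G s)) h') => // t ht; have [] := sp t ht.
Qed.

Lemma ddvf_bound (k : coef) (B kap : R) (z w : C) : 0 <= cA k <= B -> Rabs (cp1 k) <= B -> Rabs (cp2 k) <= B ->
  height_le kap z -> height_le kap w -> Cmod (ddvf k z w) <= B * (kap * kap + 1 + 4 * kap).
Proof.
move=> hA h1 h2 hz hw.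
have [k0 [_ [_ mz]]] := height_bounds _ _ hz; have [_ [_ [_ mw]]] := height_bounds _ _ hw.
have dz := height_real_dist kap (cy k) z hz; have dw := height_real_dist kap (cy k) w hw.
have ik : 0 < / kap by apply: Rinv_0_lt_compat.
rewrite /ddvf; apply: Rle_trans (Cmod_triangle _ _) _.
apply: Rle_trans (Rplus_le_compat_r _ _ _ (Cmod_triangle _ _)) _.
have nz : (z - RtoC (cy k))%C <> 0%C by apply: UHP_real_neq; case: hz.
have nw : (w - RtoC (cy k))%C <> 0%C by apply: UHP_real_neq; case: hw.
rewrite Cmod_div; last exact: Cmult_neq_0.
rewrite Cmod_opp !Cmod_mult !Cmod_R (Rabs_pos_eq (cA k)); last lra.
have a1 : cA k / (Cmod (z - RtoC (cy k)) * Cmod (w - RtoC (cy k))) <= B * (kap * kap).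
  rewrite /Rdiv Rinv_mult; apply: Rmult_le_compat; try lra.
    by apply: Rmult_le_pos; left; apply: Rinv_0_lt_compat; lra.
  have j1 : / Cmod (z - RtoC (cy k)) <= kap by rewrite -(Rinv_inv kap); apply: Rinv_le_contravar.
  have j2 : / Cmod (w - RtoC (cy k)) <= kap by rewrite -(Rinv_inv kap); apply: Rinv_le_contravar.
  by apply: Rmult_le_compat => //; left; apply: Rinv_0_lt_compat; lra.
have a2 : Rabs (cp2 k) * Cmod (z + w) <= B * (4 * kap).
  apply: Rmult_le_compat => //; [exact: Rabs_pos|exact: Cmod_ge_0|].
  by have := Cmod_triangle z w; lra.
lra.
Qed.

(** The forward bound gives uniqueness from the initial value; the backward one gives uniqueness
    from the end value and the Lipschitz dependence used in [bflow_cder]. *)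
Lemma solves_dist2 (k : R -> coef) (B kap : R) (G H : R -> C) (a b : R) : admissible k B -> a <= b ->
  solves k G a b -> solves k H a b ->
  (forall s, a <= s <= b -> height_le kap (G s) /\ height_le kap (H s)) ->
  let K := 2 * (B * (kap * kap + 1 + 4 * kap)) in
  dist2 G H b <= dist2 G H a * exp (K * (b - a)) /\ dist2 G H a <= dist2 G H b * exp (K * (b - a)).
Proof.
move=> adm ab hG hH hk K.
have d : forall s, a <= s <= b -> is_derive (dist2 G H) s (2 * fst (ddvf (k s) (G s) (H s)) * dist2 G H s).
  by move=> s hs; have [? ?] := hG s hs; have [? ?] := hH s hs; exact: dist2_derive.
have bd : forall s, a <= s <= b -> - K * dist2 G H s <= 2 * fst (ddvf (k s) (G s) (H s)) * dist2 G H s <= K * dist2 G H s.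
  move=> s hs; have [h1 h2] := hk s hs; have [_ ad] := adm; have [hA [_ [_ [q1 q2]]]] := ad s.
  have := Rle_trans _ _ _ (Cmod_fst _) (ddvf_bound _ B kap _ _ hA q1 q2 h1 h2) => /Rabs_le_between.
  have : 0 <= dist2 G H s by rewrite dist2_Cmod; exact: pow2_ge_0.
  rewrite /K; nra.
split.
- apply: (gronwall (dist2 G H) _ a b K ab (fun t ht => d t ltac:(lra))) => t ht.
    exact: is_derive_continuous (d t ht).
  by have := bd t ltac:(lra); lra.
- by apply: (gronwall_back (dist2 G H) _ a b K ab d) => t ht; have := bd t ht; lra.
Qed.

Lemma tder_height_cont (G : R -> C) (s : R) (v : C) : UHP (G s) -> tder G s v -> continuous (fun r => height (G r)) s.
Proof.
move=> hz [g1 g2].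
have d := is_derive_div _ _ _ _ _ (is_derive_Rplus _ _ _ _ _ (is_derive_Rplus _ _ _ _ _ (is_derive_Rmult _ _ _ _ _ g1 g1) (is_derive_Rmult _ _ _ _ _ g2 g2)) (is_derive_const 1 s)) g2 (Rgt_not_eq _ _ hz).
exact: is_derive_continuous d.
Qed.

Lemma solves_height_max (k : R -> coef) (G : R -> C) (a b : R) : a <= b -> solves k G a b ->
  exists kap, forall s, a <= s <= b -> height_le kap (G s).
Proof.
move=> ab h.
have [m [hm _]] := continuity_ab_maj (fun r => height (G r)) a b ab
  (fun s hs => continuous_continuity_pt _ _ (tder_height_cont _ _ _ (proj1 (h s hs)) (proj2 (h s hs)))).
by exists (height (G m)) => s hs; apply/height_leE; [have [] := h s hs|exact: hm].
Qed.

Lemma height_le_mono (k1 k2 : R) (z : C) : k1 <= k2 -> height_le k1 z -> height_le k2 z.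
Proof.
move=> h [hz hk]; split => //; rewrite /UHP /Cim in hz.
by have := Rmult_le_compat_r _ _ _ (Rlt_le _ _ hz) h; lra.
Qed.

Lemma solves_common_height (k : R -> coef) (G H : R -> C) (a b : R) : a <= b -> solves k G a b -> solves k H a b ->
  exists kap, forall s, a <= s <= b -> height_le kap (G s) /\ height_le kap (H s).
Proof.
move=> ab hG hH.
have [k1 h1] := solves_height_max k G a b ab hG; have [k2 h2] := solves_height_max k H a b ab hH.
exists (Rmax k1 k2) => s hs; split.
- exact: height_le_mono (Rmax_l _ _) (h1 s hs).
- exact: height_le_mono (Rmax_r _ _) (h2 s hs).
Qed.

Lemma dist2_0 (G H : R -> C) (s : R) : G s = H s -> dist2 G H s = 0.
Proof. by move=> e; rewrite /dist2 e; ring. Qed.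

Lemma dist2_eq0 (G H : R -> C) (s : R) : dist2 G H s <= 0 -> G s = H s.
Proof.
rewrite dist2_Cmod => h; apply: Cminus_eq0; apply: Cmod_eq_0.
have := Cmod_ge_0 (G s - H s); nra.
Qed.

Lemma solves_sub (k : R -> coef) (G : R -> C) (a b a' b' : R) : a <= a' -> b' <= b -> solves k G a b -> solves k G a' b'.
Proof. by move=> h1 h2 h s hs; apply: h; lra. Qed.

Lemma solves_unique_fwd (k : R -> coef) (B : R) (G H : R -> C) (a b : R) : admissible k B ->
  solves k G a b -> solves k H a b -> G a = H a -> forall s, a <= s <= b -> G s = H s.
Proof.
move=> adm hG hH e s hs.
have hG' := solves_sub k G a b a s ltac:(lra) ltac:(lra) hG.
have hH' := solves_sub k H a b a s ltac:(lra) ltac:(lra) hH.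
have [kap hk] := solves_common_height k G H a s ltac:(lra) hG' hH'.
have [h _] := solves_dist2 k B kap G H a s adm ltac:(lra) hG' hH' hk.
by apply: dist2_eq0; apply: Rle_trans h _; rewrite (dist2_0 _ _ _ e); lra.
Qed.

Lemma solves_unique_bwd (k : R -> coef) (B : R) (G H : R -> C) (a b : R) : admissible k B ->
  solves k G a b -> solves k H a b -> G b = H b -> forall s, a <= s <= b -> G s = H s.
Proof.
move=> adm hG hH e s hs.
have hG' := solves_sub k G a b s b ltac:(lra) ltac:(lra) hG.
have hH' := solves_sub k H a b s b ltac:(lra) ltac:(lra) hH.
have [kap hk] := solves_common_height k G H s b ltac:(lra) hG' hH'.
have [_ h] := solves_dist2 k B kap G H s b adm ltac:(lra) hG' hH' hk.
by apply: dist2_eq0; apply: Rle_trans h _; rewrite (dist2_0 _ _ _ e); lra.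
Qed.

Lemma admissible_regular (k : R -> coef) (B : R) (T : R) (S : (bool -> R) -> Prop) : admissible k B ->
  regular bool S (fun s _ => cA (k (T - s))) /\ regular bool S (fun s _ => cy (k (T - s))) /\
  regular bool S (fun s _ => cp0 (k (T - s))) /\ regular bool S (fun s _ => cp1 (k (T - s))) /\
  regular bool S (fun s _ => cp2 (k (T - s))).
Proof.
move=> [hc hb].
have rev : forall s, continuous (fun s => T - s) s.
  by move=> s; apply: (is_derive_continuous _ _ (-1)); auto_derive => //; ring.
have comp : forall (g : R -> R) s, (forall r, continuous g r) -> continuous (fun s => g (T - s)) s.
  by move=> g s hg; apply: (continuous_comp (fun s => T - s) g).
split; [|split; [|split; [|split]]].
- apply: (regular_time _ _ (fun s => cA (k (T - s))) B) => s; first by apply: (comp (fun t => cA (k t))) => r; have [] := hc r.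
  by have [h _] := hb (T - s); rewrite Rabs_pos_eq; lra.
- apply: (regular_time _ _ (fun s => cy (k (T - s))) (/ 2)) => s; first by apply: (comp (fun t => cy (k t))) => r; have [_ []] := hc r.
  by have [_ []] := hb (T - s).
- apply: (regular_time _ _ (fun s => cp0 (k (T - s))) B) => s; first by apply: (comp (fun t => cp0 (k t))) => r; have [_ [_ []]] := hc r.
  by have [_ [_ []]] := hb (T - s).
- apply: (regular_time _ _ (fun s => cp1 (k (T - s))) B) => s; first by apply: (comp (fun t => cp1 (k t))) => r; have [_ [_ [_ []]]] := hc r.
  by have [_ [_ [_ []]]] := hb (T - s).
- apply: (regular_time _ _ (fun s => cp2 (k (T - s))) B) => s; first by apply: (comp (fun t => cp2 (k t))) => r; have [_ [_ [_ []]]] := hc r.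
  by have [_ [_ [_ []]]] := hb (T - s).
Qed.

Definition backward_field (k : R -> coef) (T s : R) (x : bool -> R) (i : bool) : R :=
  let z : C := (x true, x false) in
  if i then - fst (vf (k (T - s)) z) else - snd (vf (k (T - s)) z).

(** Lower corner of [[- kap, kap] x [/ kap, kap]], a rectangle that contains all points of height at
    most [kap] by [height_bounds]. *)
Definition blo (kap : R) (i : bool) : R := if i then - kap else / kap.

Lemma backward_field_regular (k : R -> coef) (B T kap : R) (i : bool) : admissible k B -> 0 < kap ->
  regular bool (box bool (blo kap) (fun _ => kap)) (fun s x => backward_field k T s x i).
Proof.
move=> adm k0; set S := box _ _ _.
have [rA [ry [r0 [r1 r2]]]] := admissible_regular k B T S adm.
have ik : 0 < / kap by apply: Rinv_0_lt_compat.
have hx : regular bool S (fun _ x => x true).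
  by apply: (regular_coord _ _ true kap) => [|x /(_ true) /= h]; [lra|apply: Rabs_le].
have hv : regular bool S (fun _ x => x false).
  apply: (regular_coord _ _ false kap) => [|x /(_ false) /= h]; first lra.
  by rewrite Rabs_pos_eq; lra.
have pos : forall x, S x -> UHP (x true, x false).
  by move=> x /(_ false) /= h; rewrite /UHP /Cim /=; lra.
have rQ : regular bool S (fun s x => (x true - cy (k (T - s))) ^ 2 + x false ^ 2).
  by apply: regular_plus; apply: regular_pow => //; exact: regular_minus.
have Qlow : forall s x, S x -> / kap * / kap <= Rabs ((x true - cy (k (T - s))) ^ 2 + x false ^ 2).
  move=> s x /(_ false) /= h; rewrite Rabs_pos_eq; last first.
    by apply: Rplus_le_le_0_compat; apply: pow2_ge_0.
  have := pow2_ge_0 (x true - cy (k (T - s))).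
  have : / kap * / kap <= x false * x false by apply: Rmult_le_compat; lra.
  simpl; lra.
have ikk : 0 < / kap * / kap by exact: Rmult_lt_0_compat.
case: i.
- apply: (regular_ext _ _ (fun s x => - (cA (k (T - s)) * (x true - cy (k (T - s))) / ((x true - cy (k (T - s))) ^ 2 + x false ^ 2) + cp0 (k (T - s)) + cp1 (k (T - s)) * x true + cp2 (k (T - s)) * (x true * x true - x false * x false)))).
    by move=> s x hS; rewrite /backward_field vf_re //; exact: pos.
  apply: regular_opp; apply: regular_plus; last by apply: regular_mult => //; apply: regular_minus; exact: regular_mult.
  apply: regular_plus; last exact: regular_mult.
  apply: regular_plus => //; apply: (regular_div _ _ _ _ (/ kap * / kap)) => //.
  by apply: regular_mult => //; exact: regular_minus.
- apply: (regular_ext _ _ (fun s x => - (- (cA (k (T - s)) * x false) / ((x true - cy (k (T - s))) ^ 2 + x false ^ 2) + cp1 (k (T - s)) * x false + cp2 (k (T - s)) * (2 * x true * x false)))).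
    by move=> s x hS; rewrite /backward_field vf_im //; exact: pos.
  apply: regular_opp; apply: regular_plus; last first.
    apply: regular_mult => //; apply: regular_mult => //; apply: regular_mult => //; exact: regular_const.
  apply: regular_plus; last exact: regular_mult.
  apply: (regular_div _ _ _ _ (/ kap * / kap)) => //.
  by apply: regular_opp; exact: regular_mult.
Qed.

Lemma is_derive_rev (f : R -> R) (T s l : R) : is_derive f (T - s) l -> is_derive (fun r => f (T - r)) s (- l).
Proof.
move=> h; apply: is_derive_eq.
  by apply: (is_derive_comp f (fun t => T - t) s l (-1)) => //; auto_derive => //; ring.
by rewrite /scal /= /mult /=; ring.
Qed.

(** The height is controlled backwards in time, so backward solutions cannot reach the real line or infinity. *)
Lemma backward_exists (k : R -> coef) (B T : R) (z : C) : admissible k B -> 0 <= T -> UHP z ->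
  exists G, G T = z /\ solves k G 0 T.
Proof.
move=> adm T0 hz.
have B0 : 0 <= B by have [_ ad] := adm; have [? _] := ad 0; lra.
set K0 := height z.
have K00 : 0 < K0.
  by have := height_bounds K0 z ltac:(apply/height_leE => //; rewrite /K0; lra); case.
(* Twice the a priori bound, so that the height estimate gives at most [kap / 2] and the bootstrap
   gets its strict inequality. *)
set kap := 2 * (K0 * exp (4 * B * T)).
have E1 : 1 <= exp (4 * B * T) by have := exp_ineq1_le (4 * B * T); have : 0 <= 4 * B * T by [nra]; lra.
have k0 : 0 < kap by rewrite /kap; nra.
have ik : 0 < / kap by apply: Rinv_0_lt_compat.
have K2 : 2 <= K0.
  rewrite /K0 /height; rewrite /UHP /Cim in hz; apply: (Rmult_le_reg_r (snd z)) => //.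
  have -> : (fst z * fst z + snd z * snd z + 1) / snd z * snd z = fst z * fst z + snd z * snd z + 1 by field; lra.
  have := pow2_ge_0 (snd z - 1); have := pow2_ge_0 (fst z); lra.
have ikk : / kap <= kap.
  apply: Rle_trans (_ : 1 <= _); last by rewrite /kap; nra.
  by rewrite -Rinv_1; apply: Rinv_le_contravar; [lra|rewrite /kap; nra].
have [x [x0 hx]] := picard_box bool (true :: false :: nil) (blo kap) (fun _ => kap)
  ltac:(by case; [left|right; left]) ltac:(by case => /=; lra) (backward_field k T)
  (fun i : bool => if i then fst z else snd z) (fun i => backward_field_regular k B T kap i adm k0).
pose X (s : R) : C := (x s true, x s false).
(* [phi s <= 0] encodes height at most [kap] as a polynomial condition, continuous whether or not
   the curve is in the half-plane; it also forces the imaginary part to be positive. *)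
pose phi s := x s true * x s true + x s false * x s false + 1 - kap * x s false.
have good : forall s, 0 <= s -> phi s <= 0 -> height_le kap (X s).
  move=> s hs hp; rewrite /phi in hp; rewrite /height_le /UHP /Cim /=; split; last lra.
  apply: (Rmult_lt_reg_l kap) => //; rewrite Rmult_0_r; nra.
have fld : forall s, 0 <= s -> phi s <= 0 -> tder X s (- vf (k (T - s)%R) (X s))%C.
  move=> s hs hp; have [_ [[h1 h2] [h3 _]]] := height_bounds _ _ (good s hs hp).
  rewrite /= in h1 h2 h3; move: h3 => /Rabs_le_between h3.
  have ht := hx s hs true; have hf := hx s hs false.
  rewrite /backward_field /= !clamp_id in ht hf; try lra.
  by split.
have sol : forall s, 0 <= s -> (forall r, 0 <= r <= s -> phi r <= 0) -> solves k (fun r => X (T - r)) (T - s) T.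
  move=> s hs hp r hr; have p := hp (T - r) ltac:(lra).
  split; first by have [] := good (T - r) ltac:(lra) p.
  have [f1 f2] := fld (T - r) ltac:(lra) p.
  have e : T - (T - r) = r by ring.
  rewrite e in f1 f2.
  split.
  - by apply: is_derive_eq (is_derive_rev (fun r => fst (X r)) T r _ f1) _ => /=; ring.
  - by apply: is_derive_eq (is_derive_rev (fun r => snd (X r)) T r _ f2) _ => /=; ring.
have X0 : X 0 = z by apply: C_ext; rewrite /= x0.
have bound : forall s, 0 <= s <= T -> phi s < 0.
  apply: bootstrap.
  - move=> t ht; apply: (is_derive_continuous _ _ _ _).
    apply: is_derive_Rminus; first apply: is_derive_Rplus; first apply: is_derive_Rplus.
    + by apply: is_derive_Rmult; apply: (hx t (proj1 ht) true).
    + by apply: is_derive_Rmult; apply: (hx t (proj1 ht) false).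
    + exact: (is_derive_const 1).
    + by apply: is_derive_Rmult; [exact: is_derive_const|apply: (hx t (proj1 ht) false)].
  - have [_ h] := proj2 (height_leE K0 z hz) (Rle_refl _).
    rewrite -X0 /X /= in h; rewrite /phi.
    have v0 : 0 <= x 0 false by rewrite x0; left.
    have : K0 * x 0 false <= kap * x 0 false by apply: Rmult_le_compat_r => //; rewrite /kap; nra.
    lra.
  - move=> s hs hp.
    have hb := height_bound k B (fun r => X (T - r)) (T - s) T adm ltac:(lra) (sol s (proj1 hs) hp).
    have e1 : T - (T - s) = s by ring.
    have e2 : T - T = 0 by ring.
    cbv beta in hb; rewrite e1 e2 X0 -/K0 in hb.
    have [hu _] := good s (proj1 hs) (hp s ltac:(lra)).
    have lek : height (X s) <= kap / 2.
      apply: Rle_trans hb _; rewrite /kap.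
      have : exp (4 * B * s) <= exp (4 * B * T).
        have : 4 * B * s <= 4 * B * T by apply: Rmult_le_compat_l; lra.
        by case=> [l|->]; [left; exact: exp_increasing|right].
      move=> h; have := Rmult_le_compat_l _ _ _ (Rlt_le _ _ K00) h; lra.
    have [_ h] := proj2 (height_leE _ _ hu) lek.
    rewrite /UHP /Cim in hu; rewrite /= in h hu; rewrite /phi; nra.
exists (fun r => X (T - r)); split; first by rewrite -X0; congr X; ring.
have := sol T T0 (fun r hr => Rlt_le _ _ (bound r hr)).
by have -> : T - T = 0 by ring.
Qed.

(** The inverse Loewner map: from the position at time [T] back to the starting point. Unlike the
    forward map it is meaningful on the whole half-plane. *)
Definition bflow (k : R -> coef) (T : R) (z : C) : C :=
  epsilon (inhabits (RtoC 0)) (fun w => exists G, G T = z /\ G 0 = w /\ solves k G 0 T).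

Lemma bflow_eq (k : R -> coef) (B T : R) (G : R -> C) : admissible k B -> 0 <= T -> solves k G 0 T ->
  bflow k T (G T) = G 0.
Proof.
move=> adm T0 hG.
have [H [h1 [h2 h3]]] := epsilon_spec (inhabits (RtoC 0)) (fun w => exists H, H T = G T /\ H 0 = w /\ solves k H 0 T)
  (ex_intro _ _ (ex_intro _ G (conj eq_refl (conj eq_refl hG)))).
rewrite /bflow -h2; apply: (solves_unique_bwd k B H G 0 T) => //; lra.
Qed.

Lemma bflow_inj (k : R -> coef) (B T : R) : admissible k B -> 0 <= T -> inj_on UHP (bflow k T).
Proof.
move=> adm T0 z w hz hw.
have [G [<- hG]] := backward_exists k B T z adm T0 hz; have [H [<- hH]] := backward_exists k B T w adm T0 hw.
rewrite !(bflow_eq k B) // => e.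
by apply: (solves_unique_fwd k B G H 0 T) => //; lra.
Qed.

Lemma ddvf_dvf (k : coef) (B kap : R) (z w : C) : 0 <= cA k <= B -> Rabs (cp2 k) <= B ->
  height_le kap z -> height_le kap w ->
  Cmod (ddvf k w z - dvf k z) <= B * (kap * kap * kap + 1) * Cmod (w - z).
Proof.
move=> hA h2 hz hw.
have [k0 _] := height_bounds _ _ hz.
have dz := height_real_dist kap (cy k) z hz; have dw := height_real_dist kap (cy k) w hw.
have ik : 0 < / kap by apply: Rinv_0_lt_compat.
have nz : (z - RtoC (cy k))%C <> 0%C by apply: UHP_real_neq; case: hz.
have nw : (w - RtoC (cy k))%C <> 0%C by apply: UHP_real_neq; case: hw.
have -> : (ddvf k w z - dvf k z = (RtoC (cA k) / ((z - RtoC (cy k)) * (z - RtoC (cy k)) * (w - RtoC (cy k))) + RtoC (cp2 k)) * (w - z))%C.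
  by rewrite /ddvf /dvf RtoC_mult2; field.
rewrite Cmod_mult; apply: Rmult_le_compat_r; first exact: Cmod_ge_0.
apply: Rle_trans (Cmod_triangle _ _) _.
rewrite Cmod_div; last by do ! apply: Cmult_neq_0.
rewrite !Cmod_mult !Cmod_R (Rabs_pos_eq (cA k)); last lra.
have j1 : / Cmod (z - RtoC (cy k)) <= kap by rewrite -(Rinv_inv kap); apply: Rinv_le_contravar.
have j2 : / Cmod (w - RtoC (cy k)) <= kap by rewrite -(Rinv_inv kap); apply: Rinv_le_contravar.
have p1 : 0 < / Cmod (z - RtoC (cy k)) by apply: Rinv_0_lt_compat; lra.
have p2 : 0 < / Cmod (w - RtoC (cy k)) by apply: Rinv_0_lt_compat; lra.
have a1 : cA k / (Cmod (z - RtoC (cy k)) * Cmod (z - RtoC (cy k)) * Cmod (w - RtoC (cy k))) <= B * (kap * kap * kap).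
  rewrite /Rdiv !Rinv_mult; apply: Rmult_le_compat; try lra.
    by apply: Rmult_le_pos; [apply: Rmult_le_pos|]; lra.
  apply: Rmult_le_compat; try lra; first by apply: Rmult_le_pos; lra.
  by apply: Rmult_le_compat; lra.
lra.
Qed.

Lemma derive_bound (f f' : R -> R) (T M : R) : 0 <= T -> (forall s, 0 <= s <= T -> is_derive f s (f' s)) ->
  (forall s, 0 <= s <= T -> Rabs (f' s) <= M) -> Rabs (f T - f 0) <= M * T.
Proof.
move=> T0 hd hb.
have [c [hc e]] := MVT_gen f 0 T f' (fun x hx => hd x ltac:(rewrite Rmin_left ?Rmax_right in hx; lra))
  (fun x hx => continuous_continuity_pt _ _ (is_derive_continuous _ _ _ (hd x ltac:(rewrite Rmin_left ?Rmax_right in hx; lra)))).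
rewrite e Rabs_mult Rminus_0_r (Rabs_pos_eq T) //; apply: Rmult_le_compat_r => //.
by apply: hb; rewrite Rmin_left ?Rmax_right in hc; lra.
Qed.

Lemma tder_opp (g : R -> C) (s : R) (v : C) : tder g s v -> tder (fun r => - g r)%C s (- v)%C.
Proof. by move=> [h1 h2]; split => /=; exact: (is_derive_opp (K := R_AbsRing)). Qed.

(** Linearised along [G], a displacement at time [T] is carried back to time 0 by the exponential of
    minus the integral of [dvf], and [J] is that integral. The quadratic remainder is controlled on
    a set of bounded height. *)
Lemma bflow_cder (k : R -> coef) (B T : R) (G J : R -> C) : admissible k B -> 0 <= T -> solves k G 0 T ->
  J 0 = 0%C -> (forall s, 0 <= s <= T -> tder J s (dvf (k s) (G s))) ->
  cder (bflow k T) (G T) (cexp (- J T)).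
Proof.
move=> adm T0 hG J0 hJ.
have [_ ad] := adm.
have B0 : 0 <= B by have [? _] := ad 0; lra.
have hz : UHP (G T) by have [] := hG T ltac:(lra).
set z := G T in hz *.
(* A point of the disc of radius [min (1, Im z / 2)] about [z] has modulus at most [|z| + 1] and
   imaginary part at least [Im z / 2]; this is the resulting bound on its height. *)
set kz := 2 * ((Cmod z + 1) ^ 2 + 1) / snd z.
have sz : 0 < snd z by [].
have kz0 : 0 < kz.
  apply: Rdiv_lt_0_compat => //; have := pow2_ge_0 (Cmod z + 1); lra.
have near : forall w, Cmod (w - z) < Rmin 1 (snd z / 2) -> height_le kz w.
  move=> w hw.
  have w1 := Rlt_le_trans _ _ _ hw (Rmin_l _ _); have w2 := Rlt_le_trans _ _ _ hw (Rmin_r _ _).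
  have := Rle_trans _ _ _ (Cmod_snd _) (Rlt_le _ _ w2) => /Rabs_le_between /= h.
  have sw : snd z / 2 <= snd w by lra.
  rewrite /height_le /UHP /Cim; split; first lra.
  have mw : Cmod w <= Cmod z + 1 by have := Cmod_triangle_rev w z; lra.
  have sq := Cmod_sq w.
  have q1 : Cmod w ^ 2 <= (Cmod z + 1) ^ 2 by have := Cmod_ge_0 w; nra.
  have q2 : kz * (snd z / 2) <= kz * snd w by apply: Rmult_le_compat_l; lra.
  have q3 : kz * (snd z / 2) = (Cmod z + 1) ^ 2 + 1 by rewrite /kz; field; lra.
  lra.
set kap := kz * exp (4 * B * T).
have hk : forall H, solves k H 0 T -> height_le kz (H T) -> forall s, 0 <= s <= T -> height_le kap (H s).
  move=> H hH hT s hs; have [hu _] := hH s hs; have [huT _] := hH T ltac:(lra).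
  apply/height_leE => //.
  have h1 := height_bound k B H s T adm ltac:(lra) (solves_sub k H 0 T s T ltac:(lra) ltac:(lra) hH).
  apply: Rle_trans h1 _; rewrite /kap.
  apply: Rmult_le_compat; [|by left; exact: exp_pos|exact: (proj1 (height_leE _ _ huT))|].
    apply: Rle_trans (_ : 0 <= _); first lra.
    by apply: Rdiv_le_0_compat => //; have := pow2_ge_0 (fst (H T)); have := pow2_ge_0 (snd (H T)); lra.
  have : 4 * B * (T - s) <= 4 * B * T by apply: Rmult_le_compat_l; lra.
  by case=> [l|->]; [left; exact: exp_increasing|right].
have zn : height_le kz z.
  by apply: near; have -> : (z - z = 0)%C by [ring]; rewrite Cmod_0; apply: Rmin_pos; lra.
have hkG := hk G hG zn.
have k0 : 0 < kap by have [] := height_bounds _ _ (hkG 0 ltac:(lra)).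
have [Mj hMj] : exists Mj, forall s, 0 <= s <= T -> exp (- fst (J s)) <= Mj.
  have [m [hm _]] := continuity_ab_maj (fun s => exp (- fst (J s))) 0 T T0
    (fun s hs => continuous_continuity_pt _ _ (is_derive_continuous (fun s => exp (- fst (J s))) s
      (- fst (dvf (k s) (G s)) * exp (- fst (J s)))
      (is_derive_comp exp (fun s => - fst (J s)) s _ _ (is_derive_exp _) (is_derive_opp (K := R_AbsRing) (fun s => fst (J s)) s _ (proj1 (hJ s hs)))))).
  by exists (exp (- fst (J m))).
have Mj0 : 0 < Mj by have := hMj 0 ltac:(lra); have := exp_pos (- fst (J 0)); lra.
set K := 2 * (B * (kap * kap + 1 + 4 * kap)).
set D := exp (K * T).
have D0 : 0 < D by exact: exp_pos.
set N := 2 * (B * (kap * kap * kap + 1) * (D * Mj * D) * T).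
have N0 : 0 <= N.
  have c : 0 <= kap * kap * kap by apply: Rmult_le_pos; [nra|lra].
  have d : 0 <= D * Mj * D by apply: Rmult_le_pos; [nra|lra].
  rewrite /N; apply: Rmult_le_pos; first lra; apply: Rmult_le_pos => //.
  by apply: Rmult_le_pos => //; apply: Rmult_le_pos; lra.
move=> eps e0.
exists (Rmin (Rmin 1 (snd z / 2)) (eps / (N + 1))); split.
  by apply: Rmin_pos; [apply: Rmin_pos; lra|apply: Rdiv_lt_0_compat; lra].
move=> h [h0 hd]; change (0 < Cmod h) in h0; change (Cmod h < Rmin (Rmin 1 (snd z / 2)) (eps / (N + 1))) in hd.
have hd1 := Rlt_le_trans _ _ _ hd (Rmin_l _ _); have hd2 := Rlt_le_trans _ _ _ hd (Rmin_r _ _).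
change (Cmod (bflow k T (z + h)%C - bflow k T z - cexp (- J T) * h) <= eps * Cmod h).
have whk : height_le kz (z + h)%C by apply: near; have -> : (z + h - z = h)%C by ring.
have [H [HT hH]] := backward_exists k B T (z + h)%C adm T0 (proj1 whk).
rewrite -HT in whk *.
have hkH := hk H hH whk.
rewrite /z !(bflow_eq k B) // -/z.
have dist : forall s, 0 <= s <= T -> Cmod (H s - G s) <= D * Cmod h.
  move=> s hs.
  have [_ d] := solves_dist2 k B kap H G s T adm ltac:(lra) (solves_sub k H 0 T s T ltac:(lra) ltac:(lra) hH)
    (solves_sub k G 0 T s T ltac:(lra) ltac:(lra) hG) (fun r hr => conj (hkH r ltac:(lra)) (hkG r ltac:(lra))).
  rewrite !dist2_Cmod HT in d; have e1 : (z + h - G T = h)%C by rewrite -/z; ring.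
  rewrite e1 -/K in d.
  have le : exp (K * (T - s)) <= D ^ 2.
    have -> : D ^ 2 = exp (2 * (K * T)) by rewrite /D /= Rmult_1_r -exp_plus; congr exp; ring.
    have K0 : 0 <= K by rewrite /K; have kk : 0 <= kap * kap by [nra]; apply: Rmult_le_pos; [lra|apply: Rmult_le_pos; lra].
    have : K * (T - s) <= 2 * (K * T) by nra.
    by case=> [l|->]; [left; exact: exp_increasing|right].
  have g0 := Cmod_ge_0 (H s - G s).
  have : Cmod (H s - G s) ^ 2 <= (D * Cmod h) ^ 2.
    rewrite Rpow_mult_distr; apply: Rle_trans d _; rewrite Rmult_comm; apply: Rmult_le_compat_r => //; exact: pow2_ge_0.
  have : 0 < D * Cmod h by nra.
  nra.
(* The factor [cexp (- J)] removes the linear part of the equation for [H - G], so [q] varies by a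
   multiple of [|h|^2] only. Its end values are [H 0 - G 0] and [h cexp (- J T)]. *)
pose q s := ((H s - G s) * cexp (- J s))%C.
pose q' s := ((ddvf (k s) (H s) (G s) - dvf (k s) (G s)) * q s)%C.
have dq : forall s, 0 <= s <= T -> tder q s (q' s).
  move=> s hs; have [u1 t1] := hH s hs; have [u2 t2] := hG s hs.
  apply: tder_eq.
    apply: tder_mult; first by apply: tder_minus; eassumption.
    apply: (tder_cderiv cexp (fun s => - J s)%C) (cder_cexp _).
    by apply: tder_opp; exact: hJ.
  by rewrite (vf_diff _ _ _ u1 u2) /q' /q; ring.
have bq : forall s, 0 <= s <= T -> Cmod (q' s) <= B * (kap * kap * kap + 1) * (D * Mj * D) * (Cmod h * Cmod h).
  move=> s hs; rewrite /q' /q !Cmod_mult Cmod_cexp.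
  have [hA [_ [_ [_ h2]]]] := ad s.
  have b1 := ddvf_dvf (k s) B kap (G s) (H s) hA h2 (hkG s hs) (hkH s hs).
  have b2 := dist s hs; have b3 := hMj s hs.
  have g0 := Cmod_ge_0 (H s - G s).
  have cp0 : 0 <= B * (kap * kap * kap + 1) by have c : 0 <= kap * kap * kap by [apply: Rmult_le_pos; [nra|lra]]; apply: Rmult_le_pos; lra.
  have b4 : Cmod (ddvf (k s) (H s) (G s) - dvf (k s) (G s)) <= B * (kap * kap * kap + 1) * (D * Cmod h).
    by apply: Rle_trans b1 _; apply: Rmult_le_compat_l.
  have b5 : Cmod (H s - G s) * exp (fst (- J s)%C) <= D * Cmod h * Mj.
    by apply: Rmult_le_compat => //; left; exact: exp_pos.
  have -> : B * (kap * kap * kap + 1) * (D * Mj * D) * (Cmod h * Cmod h) = B * (kap * kap * kap + 1) * (D * Cmod h) * (D * Cmod h * Mj) by ring.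
  apply: Rmult_le_compat => //; first exact: Cmod_ge_0.
  by apply: Rmult_le_pos => //; left; exact: exp_pos.
have r1 := derive_bound (fun s => fst (q s)) (fun s => fst (q' s)) T _ T0 (fun s hs => proj1 (dq s hs)) (fun s hs => Rle_trans _ _ _ (Cmod_fst _) (bq s hs)).
have r2 := derive_bound (fun s => snd (q s)) (fun s => snd (q' s)) T _ T0 (fun s hs => proj2 (dq s hs)) (fun s hs => Rle_trans _ _ _ (Cmod_snd _) (bq s hs)).
have e1 : (H 0%R - G 0%R - cexp (- J T) * h = q 0%R - q T)%C.
  rewrite /q HT -/z J0; have -> : (- 0 = 0)%C by ring.
  rewrite cexp_0; ring.
rewrite e1 Cmod_minus_sym.
apply: Rle_trans (Cmod_le_sum _) _; rewrite /Rminus in r1 r2.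
change (Rabs (fst (q T) + - fst (q 0)) + Rabs (snd (q T) + - snd (q 0)) <= eps * Cmod h).
have fin : N * Cmod h <= eps.
  have : (N + 1) * Cmod h <= (N + 1) * (eps / (N + 1)) by apply: Rmult_le_compat_l; lra.
  have -> : (N + 1) * (eps / (N + 1)) = eps by field; lra.
  lra.
have := Rmult_le_compat_r _ _ _ (Rlt_le _ _ h0) fin; rewrite /N.
lra.
Qed.

(** * Change of fields by time-dependent Moebius maps *)

(** Coefficients of [b = 2 l_{-2} + pm1 l_{-1} + pb0 l_0 + pb1 l_1] and [sigma = l_{-1} + ps0 l_0 + ps1 l_1]. *)
Record param : Type := Param { pm1 : R; pb0 : R; pb1 : R; ps0 : R; ps1 : R }.

(** [pc p y] is the Loewner field whose pole sits at [y], expanded in powers of [z - y]. *)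
Definition w0 (p : param) (y : R) : R := 1 + ps0 p * y + ps1 p * y ^ 2.
(** [e0], [e1], [e2] come from [Vfield_identity] with [k = ps1 p * y] and [w = w0 p y]: the
    polynomial part of [b] pulled back by the flow of [sigma]. *)
Definition e0 (p : param) (y : R) : R := 6 * w0 p y * (ps1 p * y) + pm1 p * w0 p y.
Definition e1 (p : param) (y : R) : R := 6 * (ps1 p * y) ^ 2 + 2 * pm1 p * (ps1 p * y) + pb0 p.
Definition e2 (p : param) (y : R) : R :=
  (2 * (ps1 p * y) ^ 3 + pm1 p * (ps1 p * y) ^ 2 + pb0 p * (ps1 p * y) + pb1 p) / w0 p y.
Definition pc (p : param) (y : R) : coef :=
  Coef (2 * w0 p y ^ 2) y (e0 p y - e1 p y * y + e2 p y * y ^ 2) (e1 p y - 2 * e2 p y * y) (e2 p y).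

Lemma vf_pc (p : param) (y : R) (z : C) :
  vf (pc p y) z = (RtoC (2 * w0 p y ^ 2) / (z - RtoC y) + RtoC (e0 p y) + RtoC (e1 p y) * (z - RtoC y)
    + RtoC (e2 p y) * ((z - RtoC y) * (z - RtoC y)))%C.
Proof.
rewrite /vf /=.
set A := (RtoC (2 * (w0 p y * (w0 p y * 1))) / (z - RtoC y))%C.
by rewrite !(RtoC_plus, RtoC_minus, RtoC_mult); ring.
Qed.

(** On the imaginary axis the even and the odd real coefficients separate, and three points
    determine each group. *)
Lemma poly4_zero (P0 P1 P2 P3 P4 : R) :
  (forall n : R, n = 1 \/ n = 2 \/ n = 3 ->
    let x : C := (0, n) in
    (RtoC P0 + RtoC P1 * x + RtoC P2 * (x * x) + RtoC P3 * (x * x * x) + RtoC P4 * (x * x * x * x) = 0)%C) ->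
  P0 = 0 /\ P1 = 0 /\ P2 = 0 /\ P3 = 0 /\ P4 = 0.
Proof.
move=> h.
have h1 := h 1 ltac:(by left); have h2 := h 2 ltac:(by right; left); have h3 := h 3 ltac:(by right; right).
have r1 := f_equal fst h1; have i1 := f_equal snd h1; have r2 := f_equal fst h2; have i2 := f_equal snd h2.
have r3 := f_equal fst h3; have i3 := f_equal snd h3.
rewrite /= in r1 i1 r2 i2 r3 i3.
repeat split; lra.
Qed.

(** For [M] of determinant 1 with rows [(a, b)] and [(c, d)], the two Loewner equations match when the new pole is
  the image [mpole] of the old one, [lambda' = mrate] (equality of residues), and [M^-1 M'] is the matrix of the
  quadratic field with coefficients [mq0], [mq1], [mq2] in powers of [z - y]. *)
Definition mnu (y c d : R) : R := c * y + d.
Definition mpole (y a b c d : R) : R := (a * y + b) / mnu y c d.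
Definition mrate (p q : param) (y a b c d : R) : R :=
  w0 p y ^ 2 / (w0 q (mpole y a b c d) ^ 2 * mnu y c d ^ 4).
Definition mq0 (p q : param) (y a b c d : R) : R :=
  let t := mpole y a b c d in let n := mnu y c d in
  mrate p q y a b c d * (6 * w0 q t ^ 2 * n ^ 3 * c + e0 q t * n ^ 2) - e0 p y.
Definition mq1 (p q : param) (y a b c d : R) : R :=
  let t := mpole y a b c d in let n := mnu y c d in
  mrate p q y a b c d * (6 * w0 q t ^ 2 * n ^ 2 * c ^ 2 + 2 * e0 q t * n * c + e1 q t) - e1 p y.
Definition mq2 (p q : param) (y a b c d : R) : R :=
  let t := mpole y a b c d in let n := mnu y c d in
  mrate p q y a b c d * (2 * w0 q t ^ 2 * n * c ^ 3 + e0 q t * c ^ 2 + e1 q t * c / n + e2 q t / n ^ 2) - e2 p y.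
Definition mQ0 (p q : param) (y a b c d : R) : R := mq0 p q y a b c d - mq1 p q y a b c d * y + mq2 p q y a b c d * y ^ 2.
Definition mQ1 (p q : param) (y a b c d : R) : R := mq1 p q y a b c d - 2 * mq2 p q y a b c d * y.

Lemma RtoC_neq0 (x : R) : x <> 0 -> RtoC x <> 0%C.
Proof. by move=> h e; apply: h; have := f_equal fst e. Qed.

Lemma UHP_lin_neq (c d : R) (z : C) : UHP z -> c <> 0 \/ d <> 0 -> (RtoC c * z + RtoC d)%C <> 0%C.
Proof.
rewrite /UHP /Cim => hz h e.
have /= i := f_equal snd e; have /= r := f_equal fst e.
have c0 : c = 0.
  have : c * snd z = 0 by lra.
  by case/Rmult_integral => //; lra.
by case: h => // k; apply: k; rewrite c0 in r; lra.
Qed.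

Lemma Cmult_cancel_r (w u v : C) : w <> 0%C -> (u * w = v * w)%C -> u = v.
Proof.
move=> n e; have -> : u = (u * w * / w)%C by field.
by rewrite e; field.
Qed.

(** Numerator of the time derivative of [(a z + b) / (c z + d)] at fixed [z], over the denominator
    [(c z + d)^2]. *)
Definition qmob (da db dc dd a b c d : R) (z : C) : C :=
  ((RtoC da * z + RtoC db) * (RtoC c * z + RtoC d) - (RtoC a * z + RtoC b) * (RtoC dc * z + RtoC dd))%C.

(** Cleared of denominators, the identity is a quartic polynomial in [z - y] with real coefficients,
    so all of them vanish. The constant one says that the pole goes to the pole, the next one
    compares residues and gives the rate, and the others give the quadratic field. *)
Lemma match_fields_rev (p q : param) (y yt lam a b c d da db dc dd : R) :
  a * d - b * c = 1 -> da * d + a * dd - db * c - b * dc = 0 -> w0 p y <> 0 -> w0 q yt <> 0 ->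
  (forall z, UHP z ->
    (RtoC lam * ((RtoC c * z + RtoC d) * (RtoC c * z + RtoC d)) *
       vf (pc q yt) ((RtoC a * z + RtoC b) / (RtoC c * z + RtoC d)) = qmob da db dc dd a b c d z + vf (pc p y) z)%C) ->
  (forall z, UHP z -> ((RtoC a * z + RtoC b) / (RtoC c * z + RtoC d) - RtoC yt)%C <> 0%C) ->
  mnu y c d <> 0 /\ yt = mpole y a b c d /\ lam = mrate p q y a b c d /\
  da = a * (mQ1 p q y a b c d / 2) - b * mq2 p q y a b c d /\
  db = a * mQ0 p q y a b c d - b * (mQ1 p q y a b c d / 2) /\
  dc = c * (mQ1 p q y a b c d / 2) - d * mq2 p q y a b c d /\
  dd = c * mQ0 p q y a b c d - d * (mQ1 p q y a b c d / 2).
Proof.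
move=> det tr nw nwt hid hne.
(* With [x = z - y] the denominator is [n + c x], and the numerator minus [yt] times the denominator
   is [A1 x + A0]. *)
set n := mnu y c d; set A0 := a * y + b - yt * n; set A1 := a - c * yt.
set W := w0 q yt; set E0 := e0 q yt; set E1 := e1 q yt; set E2 := e2 q yt.
set Q2 := da * c - a * dc; set Q1 := da * d + db * c - a * dd - b * dc; set Q0 := db * d - b * dd.
set q0 := Q0 + Q1 * y + Q2 * y ^ 2; set q1 := Q1 + 2 * Q2 * y.
have ncd : c <> 0 \/ d <> 0.
  case: (Req_dec c 0) => [c00|]; last by left.
  by right => d00; rewrite c00 d00 in det; lra.
have P : forall m : R, m = 1 \/ m = 2 \/ m = 3 -> let x : C := (0, m) in
  (RtoC lam * (RtoC (2 * W ^ 2) * x * ((RtoC n + RtoC c * x) * (RtoC n + RtoC c * x) * (RtoC n + RtoC c * x)) +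
    x * (RtoC A1 * x + RtoC A0) * (RtoC E0 * ((RtoC n + RtoC c * x) * (RtoC n + RtoC c * x)) +
      RtoC E1 * ((RtoC A1 * x + RtoC A0) * (RtoC n + RtoC c * x)) + RtoC E2 * ((RtoC A1 * x + RtoC A0) * (RtoC A1 * x + RtoC A0))))
   - (RtoC (2 * w0 p y ^ 2) * (RtoC A1 * x + RtoC A0) + x * (RtoC A1 * x + RtoC A0) *
      (RtoC (q0 + e0 p y) + RtoC (q1 + e1 p y) * x + RtoC (Q2 + e2 p y) * (x * x))) = 0)%C.
  move=> m hm x.
  set z := (RtoC y + x)%C.
  have hz : UHP z by rewrite /UHP /Cim /z /x /=; case: hm => [->|[->|->]]; lra.
  have nx : x <> 0%C by move=> e; have /= := f_equal snd e; case: hm => [->|[->|->]]; lra.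
  have ez : (z - RtoC y = x)%C by rewrite /z; ring.
  have eN : (RtoC c * z + RtoC d = RtoC n + RtoC c * x)%C by rewrite /z /n /mnu RtoC_plus RtoC_mult; ring.
  have nN := UHP_lin_neq c d z hz ncd.
  have eA : ((RtoC a * z + RtoC b) - RtoC yt * (RtoC c * z + RtoC d) = RtoC A1 * x + RtoC A0)%C.
    by rewrite /z /A1 /A0 /n /mnu !RtoC_minus !RtoC_plus !RtoC_mult ?RtoC_plus ?RtoC_mult; ring.
  have eM : ((RtoC a * z + RtoC b) / (RtoC c * z + RtoC d) - RtoC yt = (RtoC A1 * x + RtoC A0) / (RtoC c * z + RtoC d))%C.
    by rewrite -eA; field.
  have nM := hne z hz; rewrite eM in nM.
  have nA : (RtoC A1 * x + RtoC A0)%C <> 0%C.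
    by move=> e; apply: nM; rewrite e; field; rewrite -?eN.
  have := hid z hz; rewrite !vf_pc eM ez -/W -/E0 -/E1 -/E2.
  have -> : qmob da db dc dd a b c d z = (RtoC q0 + RtoC q1 * x + RtoC Q2 * (x * x))%C.
    rewrite /qmob /z /q0 /q1 /Q0 /Q1 /Q2 /=.
    by rewrite !(RtoC_minus, RtoC_plus, RtoC_mult); ring.
  rewrite eN => h; rewrite eN in nN.
  rewrite !(RtoC_plus q0) !(RtoC_plus q1) !(RtoC_plus Q2).
  set N := (RtoC n + RtoC c * x)%C in h nN *; set AA := (RtoC A1 * x + RtoC A0)%C in h nA *.
  have -> : (RtoC lam * (RtoC (2 * W ^ 2) * x * (N * N * N) + x * AA * (RtoC E0 * (N * N) + RtoC E1 * (AA * N) + RtoC E2 * (AA * AA))) =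
    x * AA * (RtoC lam * (N * N) * (RtoC (2 * W ^ 2) / (AA / N) + RtoC E0 + RtoC E1 * (AA / N) + RtoC E2 * (AA / N * (AA / N)))))%C.
    by field; split.
  by rewrite h; field.
have [P0 [P1 [P2 [P3 P4]]]] := poly4_zero (- (2 * w0 p y ^ 2 * A0))
  (lam * (2 * W ^ 2 * n ^ 3 + A0 * (E0 * n ^ 2 + E1 * A0 * n + E2 * A0 ^ 2)) - (2 * w0 p y ^ 2 * A1 + A0 * (q0 + e0 p y)))
  (lam * (2 * W ^ 2 * (3 * n ^ 2 * c) + A1 * (E0 * n ^ 2 + E1 * A0 * n + E2 * A0 ^ 2) + A0 * (2 * E0 * n * c + E1 * (A1 * n + A0 * c) + 2 * E2 * A0 * A1)) - (A1 * (q0 + e0 p y) + A0 * (q1 + e1 p y)))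
  (lam * (2 * W ^ 2 * (3 * n * c ^ 2) + A1 * (2 * E0 * n * c + E1 * (A1 * n + A0 * c) + 2 * E2 * A0 * A1) + A0 * (E0 * c ^ 2 + E1 * A1 * c + E2 * A1 ^ 2)) - (A1 * (q1 + e1 p y) + A0 * (Q2 + e2 p y)))
  (lam * (2 * W ^ 2 * c ^ 3 + A1 * (E0 * c ^ 2 + E1 * A1 * c + E2 * A1 ^ 2)) - A1 * (Q2 + e2 p y)) ltac:(
   move=> m hm x; rewrite -(P m hm) -/x; move: (x) => X; apply: C_ext; rewrite /=; ring).
have A00 : A0 = 0.
  have : w0 p y ^ 2 * A0 = 0 by lra.
  by case/Rmult_integral => // e; have := pow_nonzero _ 2 nw.
have nA1 : n * A1 = 1.
  have : n * A1 = a * n - c * (yt * n) by rewrite /A1; ring.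
  have -> : yt * n = a * y + b by rewrite /A0 in A00; lra.
  rewrite /n /mnu => ->; lra.
have nn : n <> 0 by move=> e; rewrite e in nA1; lra.
have yte : yt = mpole y a b c d.
  rewrite /mpole -/n; apply: (Rmult_eq_reg_r n) => //.
  have -> : (a * y + b) / n * n = a * y + b by field.
  by rewrite /A0 in A00; lra.
have eA1 : A1 = / n by apply: (Rmult_eq_reg_l n) => //; rewrite nA1; field.
rewrite A00 eA1 in P1 P2 P3 P4.
have lame : lam = mrate p q y a b c d.
  rewrite /mrate -yte -/n -/W.
  have : lam * (2 * W ^ 2 * n ^ 3) - 2 * w0 p y ^ 2 * / n = 0 by lra.
  move=> h; apply: (Rmult_eq_reg_r (W ^ 2 * n ^ 3)); last by apply: Rmult_integral_contrapositive_currified; apply: pow_nonzero.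
  have -> : w0 p y ^ 2 / (W ^ 2 * n ^ 4) * (W ^ 2 * n ^ 3) = w0 p y ^ 2 * / n by field.
  lra.
have Q2e : Q2 = mq2 p q y a b c d.
  rewrite /mq2 -yte -lame -/n -/W -/E0 -/E1 -/E2.
  have := f_equal (Rmult n) P4.
  have -> : n * (lam * (2 * W ^ 2 * c ^ 3 + / n * (E0 * c ^ 2 + E1 * / n * c + E2 * (/ n) ^ 2)) - / n * (Q2 + e2 p y)) =
    lam * (2 * W ^ 2 * n * c ^ 3 + E0 * c ^ 2 + E1 * c / n + E2 / n ^ 2) - (Q2 + e2 p y) by field.
  lra.
have q1e : q1 = mq1 p q y a b c d.
  rewrite /mq1 -yte -lame -/n -/W -/E0 -/E1.
  have := f_equal (Rmult n) P3.
  have -> : n * (lam * (2 * W ^ 2 * (3 * n * c ^ 2) + / n * (2 * E0 * n * c + E1 * (/ n * n + 0 * c) + 2 * E2 * 0 * / n) + 0 * (E0 * c ^ 2 + E1 * / n * c + E2 * (/ n) ^ 2)) - (/ n * (q1 + e1 p y) + 0 * (Q2 + e2 p y))) =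
    lam * (6 * W ^ 2 * n ^ 2 * c ^ 2 + 2 * E0 * n * c + E1) - (q1 + e1 p y) by field.
  lra.
have q0e : q0 = mq0 p q y a b c d.
  rewrite /mq0 -yte -lame -/n -/W -/E0.
  have := f_equal (Rmult n) P2.
  have -> : n * (lam * (2 * W ^ 2 * (3 * n ^ 2 * c) + / n * (E0 * n ^ 2 + E1 * 0 * n + E2 * 0 ^ 2) + 0 * (2 * E0 * n * c + E1 * (/ n * n + 0 * c) + 2 * E2 * 0 * / n)) - (/ n * (q0 + e0 p y) + 0 * (q1 + e1 p y))) =
    lam * (6 * W ^ 2 * n ^ 3 * c + E0 * n ^ 2) - (q0 + e0 p y) by field.
  lra.
have Q1e : mQ1 p q y a b c d = Q1 by rewrite /mQ1 -Q2e -q1e /q1; ring.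
have Q0e : mQ0 p q y a b c d = Q0 by rewrite /mQ0 -Q2e -q1e -q0e /q1 /q0; ring.
rewrite Q1e Q0e -Q2e; do 3 split => //.
(* The trace condition makes the two halves of [Q1] equal; together with determinant 1 this allows
   solving the definitions of [Q0], [Q1], [Q2] for the derivatives. *)
have h1 : Q1 / 2 = da * d - b * dc by rewrite /Q1; lra.
have h2 : Q1 / 2 = db * c - a * dd by rewrite /Q1; lra.
split; last split; last split.
- by rewrite h1 /Q2; transitivity (da * (a * d - b * c)); [rewrite det; ring|ring].
- by rewrite h2 /Q0; transitivity (db * (a * d - b * c)); [rewrite det; ring|ring].
- by rewrite h1 /Q2; transitivity (dc * (a * d - b * c)); [rewrite det; ring|ring].
- by rewrite h2 /Q0; transitivity (dd * (a * d - b * c)); [rewrite det; ring|ring].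
Qed.

(** In the local coordinate [x] at the pole, the distance from the image pole is
    [x / (n (n + c x))]. The pole term remains a simple pole, and what it leaves besides is
    polynomial. *)
Lemma match_fields_identity (l n c x K E0 E1 E2 u0 u1 u2 : C) :
  n <> 0%C -> x <> 0%C -> (n + c * x)%C <> 0%C ->
  (l * ((n + c * x) * (n + c * x)) *
   (K / (x / (n * (n + c * x))) + E0 + E1 * (x / (n * (n + c * x))) +
    E2 * (x / (n * (n + c * x)) * (x / (n * (n + c * x))))) =
   l * (3 * K * (n * (n * n)) * c + E0 * (n * n)) - u0 +
   (l * (3 * K * (n * n) * (c * c) + 2 * E0 * n * c + E1) - u1) * x +
   (l * (K * n * (c * (c * c)) + E0 * (c * c) + E1 * c / n + E2 / (n * n)) - u2) * (x * x) +
   (l * (K * (n * (n * (n * n)))) / x + u0 + u1 * x + u2 * (x * x)))%C.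
Proof.
move=> nn nx nN.
have t0 : (K / (x / (n * (n + c * x))) = K * n * (n + c * x) / x)%C by field.
have t1 : (E1 * (x / (n * (n + c * x))) * ((n + c * x) * (n + c * x)) = E1 * x + E1 * c / n * (x * x))%C by field.
have t2 : (E2 * (x / (n * (n + c * x)) * (x / (n * (n + c * x)))) * ((n + c * x) * (n + c * x)) = E2 / (n * n) * (x * x))%C by field.
transitivity (l * (((n + c * x) * (n + c * x)) * (K / (x / (n * (n + c * x))) + E0) +
  E1 * (x / (n * (n + c * x))) * ((n + c * x) * (n + c * x)) +
  E2 * (x / (n * (n + c * x)) * (x / (n * (n + c * x)))) * ((n + c * x) * (n + c * x))))%C; first ring.
rewrite t0 t1 t2.
set a := (E1 * c / n)%C; set b := (E2 / (n * n))%C.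
by field.
Qed.

Lemma qmob_eval (Q0 Q1 Q2 a b c d : R) (z : C) :
  qmob (a * (Q1 / 2) - b * Q2) (a * Q0 - b * (Q1 / 2)) (c * (Q1 / 2) - d * Q2) (c * Q0 - d * (Q1 / 2)) a b c d z =
  (RtoC (a * d - b * c) * (RtoC Q0 + RtoC (Q1 / 2 + Q1 / 2) * z + RtoC Q2 * (z * z)))%C.
Proof. by rewrite /qmob !(RtoC_minus, RtoC_plus, RtoC_mult); ring. Qed.

Lemma quadratic_shift (y q0 q1 q2 : R) (z : C) :
  (1 * (RtoC (q0 - q1 * y + q2 * y ^ 2) + RtoC (q1 - 2 * q2 * y) * z + RtoC q2 * (z * z)) =
   RtoC q0 + RtoC q1 * (z - RtoC y) + RtoC q2 * ((z - RtoC y) * (z - RtoC y)))%C.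
Proof. by rewrite /= !(RtoC_minus, RtoC_plus, RtoC_mult); ring. Qed.

(** Converse of [match_fields_rev], used for existence: the forced values of pole, rate and matrix
    derivative do make the fields correspond. *)
Lemma match_fields (p q : param) (y a b c d : R) (z : C) :
  a * d - b * c = 1 -> mnu y c d <> 0 -> w0 q (mpole y a b c d) <> 0 -> UHP z ->
  let Q1 := mQ1 p q y a b c d in let Q0 := mQ0 p q y a b c d in let Q2 := mq2 p q y a b c d in
  (RtoC (mrate p q y a b c d) * ((RtoC c * z + RtoC d) * (RtoC c * z + RtoC d)) *
     vf (pc q (mpole y a b c d)) ((RtoC a * z + RtoC b) / (RtoC c * z + RtoC d)) =
   qmob (a * (Q1 / 2) - b * Q2) (a * Q0 - b * (Q1 / 2)) (c * (Q1 / 2) - d * Q2) (c * Q0 - d * (Q1 / 2)) a b c d z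
   + vf (pc p y) z)%C.
Proof.
move=> det nn nw hz Q1 Q0 Q2.
set n := mnu y c d in nn *; set t := mpole y a b c d in nw *; set lam := mrate p q y a b c d.
set W := w0 q t in nw *; set E0 := e0 q t; set E1 := e1 q t; set E2 := e2 q t.
have ncd : c <> 0 \/ d <> 0.
  case: (Req_dec c 0) => [c00|]; last by left.
  by right => d00; rewrite c00 d00 in det; lra.
have nN := UHP_lin_neq c d z hz ncd.
set x := (z - RtoC y)%C.
have nx : x <> 0%C by exact: UHP_real_neq.
have nnC := RtoC_neq0 n nn.
have eN : (RtoC c * z + RtoC d = RtoC n + RtoC c * x)%C by rewrite /x /n /mnu RtoC_plus RtoC_mult; ring.
have tn : t * n = a * y + b by rewrite /t /mpole -/n; field.
have eM : ((RtoC a * z + RtoC b) / (RtoC c * z + RtoC d) - RtoC t = x / (RtoC n * (RtoC n + RtoC c * x)))%C.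
  rewrite -eN; apply: (Cmult_cancel_r (RtoC n * (RtoC c * z + RtoC d))%C); first exact: Cmult_neq_0.
  have -> : (x / (RtoC n * (RtoC c * z + RtoC d)) * (RtoC n * (RtoC c * z + RtoC d)) = x)%C by field; split.
  have -> : (((RtoC a * z + RtoC b) / (RtoC c * z + RtoC d) - RtoC t) * (RtoC n * (RtoC c * z + RtoC d)) =
     (RtoC a * z + RtoC b) * RtoC n - RtoC (t * n) * (RtoC c * z + RtoC d))%C by rewrite RtoC_mult; field.
  rewrite tn /n /mnu /x.
  have -> : ((RtoC a * z + RtoC b) * RtoC (c * y + d) - RtoC (a * y + b) * (RtoC c * z + RtoC d) = RtoC (a * d - b * c) * (z - RtoC y))%C.
    by rewrite !(RtoC_minus, RtoC_plus, RtoC_mult); ring.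
  by rewrite det; ring.
have eq : qmob (a * (Q1 / 2) - b * Q2) (a * Q0 - b * (Q1 / 2)) (c * (Q1 / 2) - d * Q2) (c * Q0 - d * (Q1 / 2)) a b c d z =
   (RtoC (mq0 p q y a b c d) + RtoC (mq1 p q y a b c d) * x + RtoC (mq2 p q y a b c d) * (x * x))%C.
  have h : qmob (a * (Q1 / 2) - b * Q2) (a * Q0 - b * (Q1 / 2)) (c * (Q1 / 2) - d * Q2) (c * Q0 - d * (Q1 / 2)) a b c d z =
     (RtoC (a * d - b * c) * (RtoC Q0 + RtoC (Q1 / 2 + Q1 / 2) * z + RtoC Q2 * (z * z)))%C.
    exact: qmob_eval.
  rewrite h det; have -> : Q1 / 2 + Q1 / 2 = Q1 by field.
  exact: quadratic_shift.
rewrite eq !vf_pc eM -/x eN -/W -/E0 -/E1 -/E2; rewrite eN in nN.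
have l1 : lam * (2 * W ^ 2 * n ^ 4) = 2 * w0 p y ^ 2.
  rewrite /lam /mrate -/n -/t -/W; field; split => //.
rewrite /mq0 /mq1 /mq2 -/lam -/n -/t -/W -/E0 -/E1 -/E2 -l1.
have d1 : RtoC (E1 * c / n) = (RtoC E1 * RtoC c / RtoC n)%C by rewrite RtoC_div // RtoC_mult.
have d2 : RtoC (E2 / n ^ 2) = (RtoC E2 / (RtoC n * RtoC n))%C.
  by rewrite RtoC_div /= ?Rmult_1_r ?RtoC_mult //; exact: Rmult_integral_contrapositive_currified.
have -> : 6 * W ^ 2 * n ^ 3 * c = 3 * (2 * W ^ 2) * n ^ 3 * c by ring.
have -> : 6 * W ^ 2 * n ^ 2 * c ^ 2 = 3 * (2 * W ^ 2) * n ^ 2 * c ^ 2 by ring.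
move: (2 * W ^ 2) (e0 p y) (e1 p y) (e2 p y) => K u0 u1 u2.
clear Q1 Q0 Q2 eq l1 eM tn eN; clearbody lam E0 E1 E2 x; move: E0 E1 E2 d1 d2 nN; clearbody n => E0 E1 E2 d1 d2 nN.
rewrite !RtoC_minus (RtoC_mult lam (3 * K * n ^ 3 * c + _)) (RtoC_mult lam (3 * K * n ^ 2 * c ^ 2 + _ + _)) (RtoC_mult lam (K * n * c ^ 3 + _ + _ + _)).
rewrite !RtoC_plus d1 d2 /= !Rmult_1_r !RtoC_mult.
exact: match_fields_identity.
Qed.

Lemma ccurve_plus (f g : R -> C) (s : R) : ccurve f s -> ccurve g s -> ccurve (fun t => f t + g t)%C s.
Proof. by move=> [h1 h2] [k1 k2]; split => /=; exact: (continuous_plus (V := R_NormedModule)). Qed.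

Lemma ccurve_mult (f g : R -> C) (s : R) : ccurve f s -> ccurve g s -> ccurve (fun t => f t * g t)%C s.
Proof.
move=> [h1 h2] [k1 k2]; split => /=.
- by apply: (continuous_minus (V := R_NormedModule)); apply: (continuous_mult (K := R_AbsRing)).
- by apply: (continuous_plus (V := R_NormedModule)); apply: (continuous_mult (K := R_AbsRing)).
Qed.

Lemma ccurve_real (f : R -> R) (s : R) : continuous f s -> ccurve (fun t => RtoC (f t)) s.
Proof. by move=> h; split => //=; exact: continuous_const. Qed.

Lemma ccurve_opp (f : R -> C) (s : R) : ccurve f s -> ccurve (fun t => - f t)%C s.
Proof. by move=> [h1 h2]; split => /=; exact: (continuous_opp (V := R_NormedModule)). Qed.

Lemma ccurve_inv (f : R -> C) (s : R) : ccurve f s -> f s <> 0%C -> ccurve (fun t => / f t)%C s.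
Proof.
move=> h n; apply: (ccont_comp_curve (fun z => / z)%C f) => //.
exact: cderiv_ccont (cderiv_inv_id _ n).
Qed.

Lemma dvf_ccurve (k : R -> coef) (B : R) (G : R -> C) (s : R) : admissible k B -> UHP (G s) ->
  ccurve G s -> ccurve (fun r => dvf (k r) (G r)) s.
Proof.
move=> [hc _] hz hG; have [hA [hy [_ [h1 h2]]]] := hc s.
have hzy : ccurve (fun r => G r - RtoC (cy (k r)))%C s by apply: ccurve_plus => //; apply: ccurve_opp; exact: ccurve_real.
have n := UHP_real_neq _ (cy (k s)) hz.
rewrite /dvf; apply: ccurve_plus.
  apply: ccurve_plus; last exact: ccurve_real.
  apply: ccurve_mult; first by apply: ccurve_opp; exact: ccurve_real.
  by apply: ccurve_inv; [exact: ccurve_mult|exact: Cmult_neq_0].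
apply: ccurve_mult => //; apply: ccurve_real.
by apply: (continuous_mult (K := R_AbsRing)) => //; exact: continuous_const.
Qed.

Lemma real_primitive (f : R -> R) (T : R) : 0 <= T -> (forall s, 0 <= s <= T -> continuous f s) ->
  exists F, F 0 = 0 /\ forall s, 0 <= s <= T -> is_derive F s (f s).
Proof.
move=> T0 h.
pose g s := f (clamp 0 T s).
have gc : forall s, continuous g s.
  move=> s; apply: (continuous_comp (fun s => clamp 0 T s) f).
    by apply: clamp_continuous; exact: continuous_id.
  by apply: h; exact: clamp_in.
have ex : forall a b, ex_RInt g a b.
  by move=> a b; apply: (ex_RInt_continuous (V := R_CompleteNormedModule)) => s _; exact: gc.
exists (fun s => RInt g 0 s); split; first by rewrite RInt_point.
move=> s hs; have <- : g s = f s by rewrite /g clamp_id.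
apply: (is_derive_RInt g (fun t => RInt g 0 t) 0); last exact: gc.
by exists (mkposreal 1 Rlt_0_1) => r _; apply: (RInt_correct (V := R_CompleteNormedModule)).
Qed.

Lemma complex_primitive (f : R -> C) (T : R) : 0 <= T -> (forall s, 0 <= s <= T -> ccurve f s) ->
  exists F : R -> C, F 0 = 0%C /\ forall s, 0 <= s <= T -> tder F s (f s).
Proof.
move=> T0 h.
have [F1 [e1 h1]] := real_primitive (fun s => fst (f s)) T T0 (fun s hs => proj1 (h s hs)).
have [F2 [e2 h2]] := real_primitive (fun s => snd (f s)) T T0 (fun s hs => proj2 (h s hs)).
exists (fun s => (F1 s, F2 s)); split; first by rewrite e1 e2.
by move=> s hs; split; [exact: h1|exact: h2].
Qed.

Lemma solves_log_derivative (k : R -> coef) (B T : R) (G : R -> C) : admissible k B -> 0 <= T -> solves k G 0 T ->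
  exists J : R -> C, J 0 = 0%C /\ forall s, 0 <= s <= T -> tder J s (dvf (k s) (G s)).
Proof.
move=> adm T0 hG; apply: complex_primitive => // s hs; have [hu ht] := hG s hs.
by apply: (dvf_ccurve k B) => //; exact: tder_ccurve ht.
Qed.

Lemma bflow_holo (k : R -> coef) (B T : R) : admissible k B -> 0 <= T -> holo UHP (bflow k T).
Proof.
move=> adm T0 z hz; have [G [<- hG]] := backward_exists k B T z adm T0 hz.
have [J [J0 hJ]] := solves_log_derivative k B T G adm T0 hG.
by eexists; apply: (bflow_cder k B T G J).
Qed.

(** * Surviving points and the transition maps between chains *)

Definition hsurv (k : R -> coef) (t : R) (z : C) : Prop := exists G, G 0 = z /\ solves k G 0 t.

(** Converts survival, a statement about forward solutions, into membership in the image of an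
    injective holomorphic map. *)
Lemma bflow_image (k : R -> coef) (B T : R) (z : C) : admissible k B -> 0 <= T ->
  hsurv k T z <-> exists w, UHP w /\ bflow k T w = z.
Proof.
move=> adm T0; split.
- move=> [G [<- hG]]; exists (G T); split; first by have [] := hG T ltac:(lra).
  exact: (bflow_eq k B).
- move=> [w [hw <-]]; have [G [<- hG]] := backward_exists k B T w adm T0 hw.
  by exists G; rewrite (bflow_eq k B).
Qed.

(** Equal images make [g^-1 f] an automorphism of the half-plane with inverse [f^-1 g]; both are
    holomorphic because derivatives of injective maps do not vanish. *)
Lemma conformal_transfer (f g : C -> C) : holo UHP f -> inj_on UHP f -> holo UHP g -> inj_on UHP g ->
  (forall z, (exists w, UHP w /\ g w = z) <-> (exists w, UHP w /\ f w = z)) ->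
  exists T : C -> C, (forall w, UHP w -> UHP (T w) /\ g (T w) = f w) /\
   forall w a b, UHP w -> cder f w a -> cder g (T w) b ->
   let kap := (a / b * ((w - Cconj w) / (T w - Cconj (T w))))%C in
   Cmod kap = 1 /\ forall z, UHP z -> ((T z - T w) * (z - Cconj w) = kap * ((T z - Cconj (T w)) * (z - w)))%C.
Proof.
move=> hf fi hg gi img.
pose gi' z := epsilon (inhabits (RtoC 0)) (fun w => UHP w /\ g w = z).
pose fi' z := epsilon (inhabits (RtoC 0)) (fun w => UHP w /\ f w = z).
have gs : forall z, (exists w, UHP w /\ g w = z) -> UHP (gi' z) /\ g (gi' z) = z by move=> z; exact: epsilon_spec.
have fs : forall z, (exists w, UHP w /\ f w = z) -> UHP (fi' z) /\ f (fi' z) = z by move=> z; exact: epsilon_spec.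
pose T z := gi' (f z); pose S z := fi' (g z).
have hT : forall w, UHP w -> UHP (T w) /\ g (T w) = f w.
  by move=> w hw; apply: gs; apply/img; exists w.
have hS : forall w, UHP w -> UHP (S w) /\ f (S w) = g w.
  by move=> w hw; apply: fs; apply/img; exists w.
have gg : forall w, UHP w -> gi' (g w) = w.
  by move=> w hw; have [h1 h2] := gs (g w) (ex_intro _ w (conj hw eq_refl)); exact: gi.
have ff : forall w, UHP w -> fi' (f w) = w.
  by move=> w hw; have [h1 h2] := fs (f w) (ex_intro _ w (conj hw eq_refl)); exact: fi.
have dT : forall w a b, UHP w -> cder f w a -> cder g (T w) b -> cder T w (a / b)%C.
  move=> w a b hw ha hb; have [h1 h2] := hT w hw.
  have := inj_inverse_cder UHP g gi' (T w) b UHP_open hg gi h1 hb gg; rewrite h2 => hd.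
  by apply: cderiv_eq (cderiv_comp gi' f w _ _ hd ha) _; rewrite /Cdiv Cmult_comm.
have dS : forall w a b, UHP w -> cder g w a -> cder f (S w) b -> cder S w (a / b)%C.
  move=> w a b hw ha hb; have [h1 h2] := hS w hw.
  have := inj_inverse_cder UHP f fi' (S w) b UHP_open hf fi h1 hb ff; rewrite h2 => hd.
  by apply: cderiv_eq (cderiv_comp fi' g w _ _ hd ha) _; rewrite /Cdiv Cmult_comm.
exists T; split => // w a b hw ha hb kap.
apply: (UHP_auto_moebius T S w (a / b)%C) => //.
- by move=> x hx; have [] := hT x hx.
- by move=> x hx; have [] := hS x hx.
- move=> x hx; have [c hc] := hf x hx; have [h1 _] := hT x hx; have [d hd] := hg _ h1.
  by eexists; exact: dT hc hd.
- move=> x hx; have [c hc] := hg x hx; have [h1 _] := hS x hx; have [d hd] := hf _ h1.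
  by eexists; exact: dS hc hd.
- by move=> x hx; have [h1 h2] := hT x hx; rewrite /S h2; exact: ff.
- by move=> x hx; have [h1 h2] := hS x hx; rewrite /T h2; exact: gg.
- exact: dT.
Qed.

Lemma conj_diff (z : C) : (z - Cconj z)%C = (2 * Ci * RtoC (snd z))%C.
Proof. by apply: C_ext => /=; ring. Qed.

(** For a real matrix of determinant 1 that sends [Z] to [X], the derivative at [Z] is [1 / J^2]
    with [J = c Z + d], and [a Z + b = X J]. Imaginary and real parts give back the coefficients.
    The condition on [kap] amounts to [|J|^2 Im X = Im Z], which is determinant 1. *)
Lemma moebius_real (Z X J : C) : UHP Z -> UHP X -> J <> 0%C ->
  let kap := (/ (J * J) * ((Z - Cconj Z) / (X - Cconj X)))%C in
  let c := snd J / snd Z in let d := fst J - c * fst Z in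
  let a := snd (X * J)%C / snd Z in let b := fst (X * J)%C - a * fst Z in
  Cmod kap = 1 ->
  a * d - b * c = 1 /\ forall z Tz, UHP z -> ((Tz - X) * (z - Cconj Z) = kap * ((Tz - Cconj X) * (z - Z)))%C ->
    (Tz * (RtoC c * z + RtoC d) = RtoC a * z + RtoC b)%C.
Proof.
move=> hZ hX nJ kap c d a b hk; rewrite /UHP /Cim in hZ hX.
have mJ := Cmod_pos_neq _ nJ.
have nI : (2 * Ci)%C <> 0%C by move=> e; have /= := f_equal snd e; lra.
have nX : RtoC (snd X) <> 0%C by apply: RtoC_neq0; lra.
have nZ : RtoC (snd Z) <> 0%C by apply: RtoC_neq0; lra.
have ek : kap = (/ (J * J) * (RtoC (snd Z) / RtoC (snd X)))%C.
  rewrite /kap !conj_diff; congr Cmult.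
  set i2 := (2 * Ci)%C; field; split => //.
have mod2 : Cmod J ^ 2 * snd X = snd Z.
  rewrite ek Cmod_mult Cmod_div // !Cmod_R Cmod_inv in hk; last exact: Cmult_neq_0.
  rewrite Cmod_mult in hk.
  rewrite !Rabs_pos_eq in hk; try lra.
  have : / (Cmod J * Cmod J) * (snd Z / snd X) * (Cmod J ^ 2 * snd X) = snd Z by field; lra.
  by rewrite hk Rmult_1_l.
have JJ : (J * Cconj J)%C = RtoC (Cmod J ^ 2) by rewrite Cmod2_conj.
have ek2 : (kap * J = Cconj J)%C.
  rewrite ek; apply: (Cmult_cancel_r (J * RtoC (snd X))%C); first exact: Cmult_neq_0.
  have -> : (/ (J * J) * (RtoC (snd Z) / RtoC (snd X)) * J * (J * RtoC (snd X)) = RtoC (snd Z))%C by field; split.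
  by rewrite -mod2 RtoC_mult -JJ; ring.
split.
  have e1 : a * d - b * c = (snd (X * J)%C * fst J - fst (X * J)%C * snd J) / snd Z.
    by rewrite /b /d /a /c; field; lra.
  rewrite e1; apply: (Rmult_eq_reg_r (snd Z)); last lra.
  have -> : (snd (X * J)%C * fst J - fst (X * J)%C * snd J) / snd Z * snd Z = snd (X * J)%C * fst J - fst (X * J)%C * snd J by field; lra.
  rewrite Rmult_1_l -mod2 Cmod_sq /=; ring.
move=> z Tz hz E.
apply: (Cmult_cancel_r (2 * Ci * RtoC (snd Z))%C); first exact: Cmult_neq_0.
have e1 : ((RtoC c * z + RtoC d) * (2 * Ci * RtoC (snd Z)) = J * (z - Cconj Z) - Cconj J * (z - Z))%C.
  by apply: C_ext; rewrite /d /c /=; field; lra.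
have e2 : ((RtoC a * z + RtoC b) * (2 * Ci * RtoC (snd Z)) = X * J * (z - Cconj Z) - Cconj X * Cconj J * (z - Z))%C.
  by apply: C_ext; rewrite /b /a /=; field; lra.
rewrite e2 -Cmult_assoc e1.
have -> : (Tz * (J * (z - Cconj Z) - Cconj J * (z - Z)) = ((Tz - X) * (z - Cconj Z)) * J + X * J * (z - Cconj Z) - Tz * Cconj J * (z - Z))%C by ring.
rewrite E.
have -> : (kap * ((Tz - Cconj X) * (z - Z)) * J = (kap * J) * ((Tz - Cconj X) * (z - Z)))%C by ring.
rewrite ek2; ring.
Qed.

(** Trajectories are compared on [[0, t]] only, so the derivatives at [t] are compared from the
    left. This requires [t > 0]. *)
Lemma left_derive_unique (f g : R -> R) (t u v : R) : 0 < t -> (forall s, 0 <= s <= t -> f s = g s) ->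
  is_derive f t u -> is_derive g t v -> u = v.
Proof.
move=> t0 e hf hg.
have h := is_derive_Rminus _ _ _ _ _ hf hg.
apply: Rminus_diag_uniq; apply: cond_eq => eps e0; rewrite Rminus_0_r.
have [d [d0 hd]] := proj1 (is_derive_eps _ _ _) h (eps / 2) ltac:(lra).
set r := Rmax 0 (t - d / 2).
have r1 : 0 <= r by exact: Rmax_l.
have r2 : r < t by apply: Rmax_lub_lt; lra.
have r3 : t - d / 2 <= r by exact: Rmax_r.
have := hd r ltac:(apply: Rabs_def1; lra).
rewrite !e; [|lra|lra].
have -> : g r - g r - (g t - g t) - (r - t) * (u - v) = (t - r) * (u - v) by ring.
rewrite Rabs_mult (Rabs_minus_sym r t) (Rabs_pos_eq (t - r)); last lra.
move=> q; have : Rabs (u - v) <= eps / 2; last lra.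
apply: (Rmult_le_reg_l (t - r)); lra.
Qed.

Lemma left_tder_unique (f g : R -> C) (t : R) (u v : C) : 0 < t -> (forall s, 0 <= s <= t -> f s = g s) ->
  tder f t u -> tder g t v -> u = v.
Proof.
move=> t0 e [f1 f2] [g1 g2]; apply: C_ext.
- by apply: (left_derive_unique _ _ t _ _ t0 _ f1 g1) => s hs; rewrite e.
- by apply: (left_derive_unique _ _ t _ _ t0 _ f2 g2) => s hs; rewrite e.
Qed.

(** [lam] is not assumed monotone. The solution surviving up to its maximum over [[0, T]] covers all
    times [lam s] at once. *)
Lemma reparam_solution (kt : R -> coef) (B T : R) (lam dlam : R -> R) (z : C) : admissible kt B -> 0 <= T ->
  (forall s, 0 <= s <= T -> is_derive lam s (dlam s)) -> (forall s, 0 <= s <= T -> 0 <= lam s) ->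
  (forall s, 0 <= s <= T -> hsurv kt (lam s) z) ->
  exists (g : R -> C) (L : R), 0 <= L /\ g 0 = z /\ solves kt g 0 L /\
    forall s, 0 <= s <= T -> 0 <= lam s <= L.
Proof.
move=> adm T0 hl l0 hs.
have [m [hm1 hm2]] := continuity_ab_maj lam 0 T T0 (fun s h => continuous_continuity_pt _ _ (is_derive_continuous _ _ _ (hl s h))).
have [g [g0 hg]] := hs m hm2.
exists g, (lam m); split; first exact: l0; split => //; split => // s h.
by split; [exact: l0|exact: hm1].
Qed.

(** * Two chains with the same domains: the transition matrices *)

Section UniquenessCore.

Variables (p q : param) (y yt : R -> R) (B T : R) (lam dlam : R -> R).
Let k s := pc p (y s).
Let kt s := pc q (yt s).
Hypothesis adm : admissible k B.
Hypothesis admt : admissible kt B.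
Hypothesis T0 : 0 <= T.
Hypothesis lam0 : lam 0 = 0.
Hypothesis dlamE : forall s, 0 <= s <= T -> is_derive lam s (dlam s).
Hypothesis lam_pos : forall s, 0 <= s <= T -> 0 <= lam s.
Hypothesis w0y : forall s, w0 p (y s) <> 0.
Hypothesis w0yt : forall s, w0 q (yt s) <> 0.
Hypothesis same : forall s, 0 <= s <= T -> forall z, hsurv kt (lam s) z <-> hsurv k s z.

Lemma solves_hsurv (G : R -> C) (s t : R) : 0 <= s <= t -> solves k G 0 t -> hsurv k s (G 0).
Proof. by move=> hs hG; exists G; split => //; apply: (solves_sub k G 0 t) => //; lra. Qed.

Lemma transition (s : R) : 0 <= s <= T ->
  exists Ts : C -> C, (forall w, UHP w -> UHP (Ts w) /\ bflow kt (lam s) (Ts w) = bflow k s w) /\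
   forall w a b, UHP w -> cder (bflow k s) w a -> cder (bflow kt (lam s)) (Ts w) b ->
   let kap := (a / b * ((w - Cconj w) / (Ts w - Cconj (Ts w))))%C in
   Cmod kap = 1 /\ forall z, UHP z -> ((Ts z - Ts w) * (z - Cconj w) = kap * ((Ts z - Cconj (Ts w)) * (z - w)))%C.
Proof.
move=> hs; have l0 := lam_pos s hs.
apply: conformal_transfer.
- by apply: (bflow_holo k B) => //; lra.
- by apply: (bflow_inj k B) => //; lra.
- exact: (bflow_holo kt B).
- exact: (bflow_inj kt B).
- move=> z; rewrite -(bflow_image kt B (lam s)) // -(bflow_image k B s) //; last lra.
  exact: same.
Qed.

(** Both points are carried to the same starting point by the inverse Loewner maps, and these are
    injective. *)
Lemma transition_solution (Ts : C -> C) (s t L : R) (Z g : R -> C) : 0 <= s <= t -> t <= T ->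
  (forall w, UHP w -> UHP (Ts w) /\ bflow kt (lam s) (Ts w) = bflow k s w) ->
  solves k Z 0 t -> solves kt g 0 L -> g 0 = Z 0 -> 0 <= lam s <= L -> Ts (Z s) = g (lam s).
Proof.
move=> hs ht hTs hZ hg e hl.
have hZs := solves_sub k Z 0 t 0 s ltac:(lra) ltac:(lra) hZ.
have hgs := solves_sub kt g 0 L 0 (lam s) ltac:(lra) ltac:(lra) hg.
have hu : UHP (Z s) by have [] := hZs s ltac:(lra).
have [h1 h2] := hTs _ hu.
have hv : UHP (g (lam s)) by have [] := hgs (lam s) ltac:(lra).
apply: (bflow_inj kt B (lam s)) => //; first lra.
rewrite h2 (bflow_eq k B) // ?(bflow_eq kt B) //; lra.
Qed.

(** The matrix at time [s] is built from the value and the derivative of the transition map at one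
    reference trajectory, hence is differentiable in [s]. Differentiating the Moebius relation along
    all other trajectories gives an identity of fields, to which [match_fields_rev] applies. *)
Theorem uniqueness_core :
  exists a b c d da db dc dd : R -> R,
    (a 0 = 1 /\ b 0 = 0 /\ c 0 = 0 /\ d 0 = 1) /\
    forall s, 0 <= s <= T ->
      (is_derive a s (da s) /\ is_derive b s (db s) /\ is_derive c s (dc s) /\ is_derive d s (dd s)) /\
      (0 < s ->
        yt (lam s) = mpole (y s) (a s) (b s) (c s) (d s) /\
        dlam s = mrate p q (y s) (a s) (b s) (c s) (d s) /\
        da s = a s * (mQ1 p q (y s) (a s) (b s) (c s) (d s) / 2) - b s * mq2 p q (y s) (a s) (b s) (c s) (d s) /\
        db s = a s * mQ0 p q (y s) (a s) (b s) (c s) (d s) - b s * (mQ1 p q (y s) (a s) (b s) (c s) (d s) / 2) /\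
        dc s = c s * (mQ1 p q (y s) (a s) (b s) (c s) (d s) / 2) - d s * mq2 p q (y s) (a s) (b s) (c s) (d s) /\
        dd s = c s * mQ0 p q (y s) (a s) (b s) (c s) (d s) - d s * (mQ1 p q (y s) (a s) (b s) (c s) (d s) / 2)).
Proof.
have iH : UHP Ci by rewrite /UHP /Cim /=; lra.
(* The reference trajectory: solved backwards from [Ci], it is alive on all of [[0, T]]. *)
have [Z [ZT hZ]] := backward_exists k B T Ci adm T0 iH.
have [g [L [L0 [g0 [hg hL]]]]] := reparam_solution kt B T lam dlam (Z 0) admt T0 dlamE lam_pos
  (fun s hs => proj2 (same s hs _) (solves_hsurv Z s T hs hZ)).
have [I [I0 hI]] := solves_log_derivative k B T Z adm T0 hZ.
have [It [It0 hIt]] := solves_log_derivative kt B L g admt L0 hg.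
pose X s := g (lam s).
have dX : forall s, 0 <= s <= T -> tder X s (RtoC (dlam s) * vf (kt (lam s)) (X s))%C.
  move=> s hs; apply: (tder_comp g lam); last exact: dlamE.
  by have [] := hg (lam s) (hL s hs).
have UX : forall s, 0 <= s <= T -> UHP (X s) by move=> s hs; have [] := hg (lam s) (hL s hs).
have UZ : forall s, 0 <= s <= T -> UHP (Z s) by move=> s hs; have [] := hZ s hs.
have dZ : forall s, 0 <= s <= T -> tder Z s (vf (k s) (Z s)) by move=> s hs; have [] := hZ s hs.
(* The transition map has derivative [1 / J^2] at [Z s]. Halving the exponent selects a square root
   that is differentiable in time and equals 1 at time 0. *)
pose J s := cexp (RtoC (/ 2) * (I s - It (lam s)))%C.
have JJ : forall s, (J s * J s)%C = cexp (I s - It (lam s))%C.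
  move=> s; rewrite /J -cexp_plus; congr cexp.
  have h2 : (RtoC (/ 2) + RtoC (/ 2) = 1)%C by apply: C_ext => /=; field.
  have -> : (RtoC (/ 2) * (I s - It (lam s)) + RtoC (/ 2) * (I s - It (lam s)) = (RtoC (/ 2) + RtoC (/ 2)) * (I s - It (lam s)))%C by ring.
  rewrite h2; ring.
have dJ : forall s, 0 <= s <= T -> exists v, tder J s v.
  move=> s hs; eexists; apply: (tder_cderiv cexp) (cder_cexp _).
  apply: tder_mult; first exact: tder_const.
  apply: tder_minus; first exact: hI.
  by apply: (tder_comp It lam); [exact: hIt (hL s hs)|exact: dlamE].
pose c s := snd (J s) / snd (Z s); pose d s := fst (J s) - c s * fst (Z s).
pose a s := snd (X s * J s)%C / snd (Z s); pose b s := fst (X s * J s)%C - a s * fst (Z s).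
have mob : forall s, 0 <= s <= T -> a s * d s - b s * c s = 1 /\
  exists Ts : C -> C, (forall w, UHP w -> UHP (Ts w) /\ bflow kt (lam s) (Ts w) = bflow k s w) /\
    forall z, UHP z -> (Ts z * (RtoC (c s) * z + RtoC (d s)) = RtoC (a s) * z + RtoC (b s))%C.
  move=> s hs; have [Ts [h1 h2]] := transition s hs.
  have eX : Ts (Z s) = X s by apply: (transition_solution Ts s T L) => //; [lra|exact: hL].
  have df : cder (bflow k s) (Z s) (cexp (- I s)).
    apply: (bflow_cder k B s Z I) => //; [lra| |move=> r hr; apply: hI; lra].
    by apply: (solves_sub k Z 0 T) => //; lra.
  have dg : cder (bflow kt (lam s)) (Ts (Z s)) (cexp (- It (lam s))).
    rewrite eX; apply: (bflow_cder kt B (lam s) g It) => //; [exact: lam_pos| |].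
      by apply: (solves_sub kt g 0 L) => //; [lra|have := hL s hs; lra].
    by move=> r hr; apply: hIt; have := hL s hs; lra.
  have [m1 m2] := h2 _ _ _ (UZ s hs) df dg.
  rewrite eX in m1 m2.
  have e : (cexp (- I s) / cexp (- It (lam s)) = / (J s * J s))%C.
    rewrite JJ; apply: (Cmult_cancel_r (cexp (I s - It (lam s)) * cexp (- It (lam s)))%C).
      by apply: Cmult_neq_0; exact: cexp_neq0.
    have -> : (cexp (- I s) / cexp (- It (lam s)) * (cexp (I s - It (lam s)) * cexp (- It (lam s))) = cexp (- I s) * cexp (I s - It (lam s)))%C by field; exact: cexp_neq0.
    have -> : (/ cexp (I s - It (lam s)) * (cexp (I s - It (lam s)) * cexp (- It (lam s))) = cexp (- It (lam s)))%C by field; exact: cexp_neq0.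
    by rewrite -cexp_plus; congr cexp; ring.
  rewrite e in m1 m2.
  have [det h3] := moebius_real (Z s) (X s) (J s) (UZ s hs) (UX s hs) (cexp_neq0 _) m1.
  split; first exact: det.
  by exists Ts; split => // z hz; apply: h3 => //; exact: m2.
have ex4 : forall s, exists w : R * R * R * R, 0 <= s <= T ->
   is_derive a s (fst (fst (fst w))) /\ is_derive b s (snd (fst (fst w))) /\ is_derive c s (snd (fst w)) /\ is_derive d s (snd w).
  move=> s; case: (classic (0 <= s <= T)) => [hs|n]; last by exists (0, 0, 0, 0).
  have [v hv] := dJ s hs; have [z1 z2] := dZ s hs; have [j1 j2] := hv.
  have [x1 x2] := tder_mult _ _ _ _ _ (dX s hs) hv.
  have nz : snd (Z s) <> 0 by have := UZ s hs; rewrite /UHP /Cim; lra.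
  have ha := is_derive_div _ _ _ _ _ x2 z2 nz.
  have hc := is_derive_div _ _ _ _ _ j2 z2 nz.
  have hb := is_derive_Rminus _ _ _ _ _ x1 (is_derive_Rmult _ _ _ _ _ ha z1).
  have hd := is_derive_Rminus _ _ _ _ _ j1 (is_derive_Rmult _ _ _ _ _ hc z1).
  by eexists (_, _, _, _) => _; split; [exact: ha|split; [exact: hb|split; [exact: hc|exact: hd]]].
pose D s := epsilon (inhabits (0, 0, 0, 0)) (fun w : R * R * R * R => 0 <= s <= T ->
   is_derive a s (fst (fst (fst w))) /\ is_derive b s (snd (fst (fst w))) /\ is_derive c s (snd (fst w)) /\ is_derive d s (snd w)).
have hD : forall s, 0 <= s <= T ->
   is_derive a s (fst (fst (fst (D s)))) /\ is_derive b s (snd (fst (fst (D s)))) /\ is_derive c s (snd (fst (D s))) /\ is_derive d s (snd (D s)).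
  by move=> s; exact: (epsilon_spec (inhabits (0, 0, 0, 0)) _ (ex4 s)).
exists a, b, c, d, (fun s => fst (fst (fst (D s)))), (fun s => snd (fst (fst (D s)))), (fun s => snd (fst (D s))), (fun s => snd (D s)).
split.
  have J1 : J 0 = 1%C.
    rewrite /J lam0 I0 It0; have -> : (RtoC (/ 2) * (0 - 0) = 0)%C by ring.
    exact: cexp_0.
  have X0 : X 0 = Z 0 by rewrite /X lam0.
  have z0 : snd (Z 0) <> 0 by have := UZ 0 ltac:(lra); rewrite /UHP /Cim; lra.
  by rewrite /b /d /a /c J1 X0 /=; do ! split; field.
move=> t ht; have [hda [hdb [hdc hdd]]] := hD t ht; split; first by [].
move=> t0.
have [det [Tt [hTt1 hTt2]]] := mob t ht.
(* The determinant is 1 on [[0, t]], so its left derivative at [t] vanishes. *)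
have tr : fst (fst (fst (D t))) * d t + a t * snd (D t) - snd (fst (fst (D t))) * c t - b t * snd (fst (D t)) = 0.
  have h1 := is_derive_Rminus _ _ _ _ _ (is_derive_Rmult _ _ _ _ _ hda hdd) (is_derive_Rmult _ _ _ _ _ hdb hdc).
  have := left_derive_unique _ _ t _ _ t0 _ h1 (is_derive_const 1 t).
  rewrite /zero /= => h; rewrite -h; first ring.
  by move=> s hs; have [e _] := mob s ltac:(lra).
suff key : forall z, UHP z ->
    (RtoC (dlam t) * ((RtoC (c t) * z + RtoC (d t)) * (RtoC (c t) * z + RtoC (d t))) *
       vf (pc q (yt (lam t))) ((RtoC (a t) * z + RtoC (b t)) / (RtoC (c t) * z + RtoC (d t))) =
     qmob (fst (fst (fst (D t)))) (snd (fst (fst (D t)))) (snd (fst (D t))) (snd (D t)) (a t) (b t) (c t) (d t) z + vf (pc p (y t)) z)%C.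
  have ncd : forall z, UHP z -> (RtoC (c t) * z + RtoC (d t))%C <> 0%C.
    move=> z hz; apply: UHP_lin_neq => //.
    case: (Req_dec (c t) 0) => [c00|]; last by left.
    by right => d00; rewrite c00 d00 in det; lra.
  have [|h1 h2] := match_fields_rev p q (y t) (yt (lam t)) (dlam t) _ _ _ _ _ _ _ _ det tr (w0y t) (w0yt _) key.
    move=> z hz; rewrite -hTt2 //.
    have -> : (Tt z * (RtoC (c t) * z + RtoC (d t)) / (RtoC (c t) * z + RtoC (d t)) = Tt z)%C by field; exact: ncd.
    by apply: UHP_real_neq; have [] := hTt1 z hz.
  exact: h2.
move=> z hz.
(* Every [z] is the position at time [t] of some trajectory, so differentiation along it yields the
   identity of fields at [z]. *)
have [G [GT hG]] := backward_exists k B t z adm ltac:(lra) hz.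
have [g' [L' [L'0 [g'0 [hg' hL']]]]] := reparam_solution kt B t lam dlam (G 0) admt ltac:(lra) (fun s hs => dlamE s ltac:(lra)) (fun s hs => lam_pos s ltac:(lra))
  (fun s hs => proj2 (same s ltac:(lra) _) (solves_hsurv G s t hs hG)).
have eq : forall s, 0 <= s <= t -> (g' (lam s) * (RtoC (c s) * G s + RtoC (d s)) = RtoC (a s) * G s + RtoC (b s))%C.
  move=> s hs; have [_ [Ts [h1 h2]]] := mob s ltac:(lra).
  have <- : Ts (G s) = g' (lam s) by apply: (transition_solution Ts s t L') => //; [lra|exact: hL'].
  by apply: h2; have [] := hG s hs.
have [_ dG] := hG t ltac:(lra).
have dg' : tder (fun s => g' (lam s)) t (RtoC (dlam t) * vf (kt (lam t)) (g' (lam t)))%C.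
  apply: (tder_comp g' lam); last exact: dlamE.
  by have [] := hg' (lam t) (hL' t ltac:(lra)).
have lin : forall (u v : R -> R) du dv, is_derive u t du -> is_derive v t dv ->
    tder (fun s => RtoC (u s) * G s + RtoC (v s))%C t (RtoC du * G t + RtoC (u t) * vf (k t) (G t) + RtoC dv)%C.
  move=> u v du dv hu hv; apply: tder_plus; last exact: tder_real.
  by apply: tder_mult => //; exact: tder_real.
have E := left_tder_unique _ _ t _ _ t0 eq (tder_mult _ _ _ _ _ dg' (lin _ _ _ _ hdc hdd)) (lin _ _ _ _ hda hdb).
have Et := eq t ltac:(lra).
rewrite GT in E Et.
have nN : (RtoC (c t) * z + RtoC (d t))%C <> 0%C.
  apply: UHP_lin_neq => //; case: (Req_dec (c t) 0) => [c00|]; last by left.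
  by right => d00; rewrite c00 d00 in det; lra.
rewrite -Et.
have -> : (g' (lam t) * (RtoC (c t) * z + RtoC (d t)) / (RtoC (c t) * z + RtoC (d t)) = g' (lam t))%C by field.
rewrite /qmob -Et.
set N := (RtoC (c t) * z + RtoC (d t))%C in E Et nN *.
set V := vf (k t) z in E *.
have detC : (RtoC (a t) * RtoC (d t) - RtoC (b t) * RtoC (c t) = 1)%C by rewrite -!RtoC_mult -RtoC_minus det.
have -> : (RtoC (dlam t) * (N * N) * vf (pc q (yt (lam t))) (g' (lam t)) = N * (RtoC (dlam t) * vf (kt (lam t)) (g' (lam t)) * N))%C by rewrite /kt; ring.
have -> : (RtoC (dlam t) * vf (kt (lam t)) (g' (lam t)) * N =
  (RtoC (fst (fst (fst (D t)))) * z + RtoC (a t) * V + RtoC (snd (fst (fst (D t))))) - g' (lam t) * (RtoC (snd (fst (D t))) * z + RtoC (c t) * V + RtoC (snd (D t))))%C.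
  by rewrite -E; ring.
have eV : (N * (RtoC (a t) * V) - g' (lam t) * N * (RtoC (c t) * V) = V)%C.
  rewrite Et /N.
  have -> : ((RtoC (c t) * z + RtoC (d t)) * (RtoC (a t) * V) - (RtoC (a t) * z + RtoC (b t)) * (RtoC (c t) * V) = (RtoC (a t) * RtoC (d t) - RtoC (b t) * RtoC (c t)) * V)%C by ring.
  rewrite detC; ring.
rewrite -[X in _ = (_ + X)%C]eV; ring.
Qed.

End UniquenessCore.

(** * The differential equation of the Moebius maps *)

Inductive midx : Type := Ma | Mb | Mc | Md.
Definition mid (i : midx) : R := match i with Ma | Md => 1 | Mb | Mc => 0 end.

(** [M] times the trace-free matrix with rows [(Q1 / 2, Q0)] and [(- Q2, - Q1 / 2)], the form found
    in [match_fields_rev]; trace zero keeps the determinant constant. *)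
Definition mrhs (p q : param) (y : R) (M : midx -> R) (i : midx) : R :=
  let a := M Ma in let b := M Mb in let c := M Mc in let d := M Md in
  let Q0 := mQ0 p q y a b c d in let Q1 := mQ1 p q y a b c d in let Q2 := mq2 p q y a b c d in
  match i with
  | Ma => a * (Q1 / 2) - b * Q2
  | Mb => a * Q0 - b * (Q1 / 2)
  | Mc => c * (Q1 / 2) - d * Q2
  | Md => c * Q0 - d * (Q1 / 2)
  end.

Definition psize (p q : param) : R := 1 + Rabs (ps0 p) + Rabs (ps1 p) + Rabs (ps0 q) + Rabs (ps1 q).
(** For poles and matrix deviations of this size the image pole is at most [10 * mrad p q], and up
    to that size [w0] stays in [[1/2, 2]] for both parameter sets; the factor 100 leaves room for
    both steps. *)
Definition mrad (p q : param) : R := / (100 * psize p q).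

Lemma psize_ge1 (p q : param) : 1 <= psize p q.
Proof.
rewrite /psize; have := Rabs_pos (ps0 p); have := Rabs_pos (ps1 p); have := Rabs_pos (ps0 q); have := Rabs_pos (ps1 q); lra.
Qed.

Lemma mrad_bounds (p q : param) : 0 < mrad p q <= / 100 /\ mrad p q * psize p q = / 100.
Proof.
have := psize_ge1 p q => h; split; last by rewrite /mrad; field; lra.
split; first by apply: Rinv_0_lt_compat; lra.
by apply: Rinv_le_contravar; lra.
Qed.

Lemma w0_near1 (p : param) (S t : R) : Rabs (ps0 p) + Rabs (ps1 p) <= S -> 0 <= S -> Rabs t <= 1 -> S * Rabs t <= / 10 ->
  / 2 <= w0 p t <= 2.
Proof.
move=> h S0 t1 hS; rewrite /w0.
have a0 := Rabs_pos (ps0 p); have a1 := Rabs_pos (ps1 p); have at0 := Rabs_pos t.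
have b0 : Rabs (ps0 p * t + ps1 p * t ^ 2) <= / 10.
  apply: Rle_trans (Rabs_triang _ _) _; rewrite (Rabs_mult (ps0 p)) (Rabs_mult (ps1 p)) -RPow_abs.
  have : Rabs t ^ 2 <= Rabs t by nra.
  move=> q; have : Rabs (ps1 p) * Rabs t ^ 2 <= Rabs (ps1 p) * Rabs t by apply: Rmult_le_compat_l.
  nra.
move: b0 => /Rabs_le_between; lra.
Qed.

Lemma w0_small (p q : param) (t : R) : Rabs t <= 10 * mrad p q -> / 2 <= w0 p t <= 2 /\ / 2 <= w0 q t <= 2.
Proof.
move=> ht; have [[r0 r1] rS] := mrad_bounds p q; have S1 := psize_ge1 p q.
have a0 := Rabs_pos (ps0 p); have a1 := Rabs_pos (ps1 p); have a2 := Rabs_pos (ps0 q); have a3 := Rabs_pos (ps1 q).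
have h : psize p q * Rabs t <= / 10.
  apply: Rle_trans (Rmult_le_compat_l _ _ _ _ ht) _; lra.
by split; apply: (w0_near1 _ (psize p q)) => //; rewrite /psize in S1 *; lra.
Qed.

Definition mbox (r : R) (M : midx -> R) : Prop := forall i, mid i - r <= M i <= mid i + r.

Lemma mbox_bounds (p q : param) (y : R) (M : midx -> R) : Rabs y <= mrad p q -> mbox (mrad p q) M ->
  / 2 <= mnu y (M Mc) (M Md) <= 2 /\ Rabs (mpole y (M Ma) (M Mb) (M Mc) (M Md)) <= 10 * mrad p q.
Proof.
have [[r0 r1] _] := mrad_bounds p q; set r := mrad p q in r0 r1 *.
move=> hy hM; have ha := hM Ma; have hb := hM Mb; have hc := hM Mc; have hd := hM Md.
rewrite /= in ha hb hc hd.
have [y1 y2] := proj1 (Rabs_le_between _ _) hy.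
have cy1 : Rabs (M Mc * y) <= r * r.
  by rewrite Rabs_mult; apply: Rmult_le_compat; try exact: Rabs_pos; try exact: hy; apply: Rabs_le; lra.
move: cy1 => /Rabs_le_between cy1.
have rr : r * r <= / 100 * r by apply: Rmult_le_compat_r; lra.
have n1 : / 2 <= mnu y (M Mc) (M Md) <= 2 by rewrite /mnu; lra.
split => //.
have ay1 : Rabs (M Ma * y) <= 2 * r.
  by rewrite Rabs_mult; apply: Rmult_le_compat; try exact: Rabs_pos; try exact: hy; apply: Rabs_le; lra.
move: ay1 => /Rabs_le_between ay1.
rewrite /mpole /Rdiv Rabs_mult Rabs_inv (Rabs_pos_eq (mnu _ _ _)); last lra.
have : Rabs (M Ma * y + M Mb) <= 3 * r by apply: Rabs_le; lra.
have : / mnu y (M Mc) (M Md) <= 2 by rewrite -(Rinv_inv 2); apply: Rinv_le_contravar; lra.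
have : 0 < / mnu y (M Mc) (M Md) by apply: Rinv_0_lt_compat; lra.
have := Rabs_pos (M Ma * y + M Mb); nra.
Qed.

Section RegularCoefficients.

Variables (I : Type) (S : (I -> R) -> Prop) (p : param) (t : R -> (I -> R) -> R).
Hypothesis ht : regular I S t.

Let rc (c : R) := regular_const I S c.

Lemma regular_w0 : regular I S (fun s x => w0 p (t s x)).
Proof.
apply: regular_plus; first by apply: regular_plus; [exact: rc|apply: regular_mult; [exact: rc|]].
by apply: regular_mult; [exact: rc|exact: regular_pow].
Qed.

Let rk : regular I S (fun s x => ps1 p * t s x).
Proof. by apply: regular_mult; [exact: rc|]. Qed.

Lemma regular_e0 : regular I S (fun s x => e0 p (t s x)).
Proof.
apply: regular_plus; apply: regular_mult; try exact: rc; try exact: rk; try exact: regular_w0.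
by apply: regular_mult; [exact: rc|exact: regular_w0].
Qed.

Lemma regular_e1 : regular I S (fun s x => e1 p (t s x)).
Proof.
apply: regular_plus; last exact: rc.
apply: regular_plus; apply: regular_mult; try exact: rc; try exact: rk.
by apply: (regular_pow _ _ _ 2); exact: rk.
Qed.

Lemma regular_e2 : (forall s x, S x -> / 2 <= w0 p (t s x)) -> regular I S (fun s x => e2 p (t s x)).
Proof.
move=> h; apply: (regular_div _ _ _ _ (/ 2)); [lra| | |exact: regular_w0].
  by move=> s x hx; have := h s x hx => q; rewrite Rabs_pos_eq; lra.
apply: regular_plus; last exact: rc.
apply: regular_plus; last by apply: regular_mult; [exact: rc|exact: rk].
by apply: regular_plus; apply: regular_mult; try exact: rc; apply: regular_pow; exact: rk.
Qed.

End RegularCoefficients.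

Ltac regular_tac := repeat first [assumption | match goal with h : forall i, regular _ _ _ |- _ => exact: h end
  | apply: regular_const | apply: regular_pow | apply: regular_minus | apply: regular_plus
  | apply: regular_opp | apply: regular_mult].

(** In the box all denominators, built from [mnu] and [w0], are bounded below, so the rational
    expressions remain in the regular class. *)
Lemma mrhs_regular (p q : param) (y : R -> R) (i : midx) : (forall s, continuous y s) -> (forall s, Rabs (y s) <= mrad p q) ->
  regular midx (mbox (mrad p q)) (fun s M => mrhs p q (y s) M i) /\
  regular midx (mbox (mrad p q)) (fun s M => mrate p q (y s) (M Ma) (M Mb) (M Mc) (M Md)).
Proof.
move=> yc yb; set S := mbox _.
have [[r0 r1] _] := mrad_bounds p q.
have coord : forall i, regular midx S (fun _ M => M i).
  move=> j; apply: (regular_coord _ _ j 2) => [|M /(_ j) hM]; first lra.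
  by apply: Rabs_le; case: j hM => /=; lra.
have ry : regular midx S (fun s _ => y s) by apply: (regular_time _ _ y (mrad p q)).
have rc := regular_const midx S.
have rn : regular midx S (fun s M => mnu (y s) (M Mc) (M Md)) by apply: regular_plus => //; exact: regular_mult.
have nb : forall s M, S M -> / 2 <= mnu (y s) (M Mc) (M Md) <= 2 by move=> s M hM; have [] := mbox_bounds p q (y s) M (yb s) hM.
have na : forall s M, S M -> / 2 <= Rabs (mnu (y s) (M Mc) (M Md)) by move=> s M hM; have h := nb s M hM; rewrite Rabs_pos_eq; lra.
have rt : regular midx S (fun s M => mpole (y s) (M Ma) (M Mb) (M Mc) (M Md)).
  by apply: (regular_div _ _ _ _ (/ 2)) => //; [lra|apply: regular_plus => //; exact: regular_mult].
have tb : forall s M, S M -> Rabs (mpole (y s) (M Ma) (M Mb) (M Mc) (M Md)) <= 10 * mrad p q by move=> s M hM; have [] := mbox_bounds p q (y s) M (yb s) hM.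
have wb : forall s M, S M -> / 2 <= w0 q (mpole (y s) (M Ma) (M Mb) (M Mc) (M Md)) by move=> s M hM; have [_ [? _]] := w0_small p q _ (tb s M hM).
have wy : forall s M, S M -> / 2 <= w0 p (y s) by move=> s M _; have [|[? _] _] := w0_small p q (y s); [have := yb s; lra|].
have rl : regular midx S (fun s M => mrate p q (y s) (M Ma) (M Mb) (M Mc) (M Md)).
  apply: (regular_div _ _ _ _ ((/ 2) ^ 2 * (/ 2) ^ 4)).
  - by have h : 0 < / 2 by [lra]; apply: Rmult_lt_0_compat; apply: pow_lt.
  - move=> s M hM; have h1 := nb s M hM; have h2 := wb s M hM.
    rewrite Rabs_pos_eq; last by apply: Rmult_le_pos; apply: pow_le; lra.
    apply: Rmult_le_compat; try (by apply: pow_le; lra); apply: pow_incr; lra.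
  - by apply: (regular_pow _ _ _ 2); exact: regular_w0.
  - by apply: regular_mult; apply: regular_pow => //; exact: regular_w0.
split => //.
have rW : regular midx S (fun s M => w0 q (mpole (y s) (M Ma) (M Mb) (M Mc) (M Md))) by exact: regular_w0.
have rE0 : regular midx S (fun s M => e0 q (mpole (y s) (M Ma) (M Mb) (M Mc) (M Md))) by exact: regular_e0.
have rE1 : regular midx S (fun s M => e1 q (mpole (y s) (M Ma) (M Mb) (M Mc) (M Md))) by exact: regular_e1.
have rE2 : regular midx S (fun s M => e2 q (mpole (y s) (M Ma) (M Mb) (M Mc) (M Md))) by exact: regular_e2.
have ru0 : regular midx S (fun s M => e0 p (y s)) by exact: regular_e0.
have ru1 : regular midx S (fun s M => e1 p (y s)) by exact: regular_e1.
have ru2 : regular midx S (fun s M => e2 p (y s)) by exact: regular_e2.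
have r_0 : regular midx S (fun s M => mq0 p q (y s) (M Ma) (M Mb) (M Mc) (M Md)) by rewrite /mq0; cbv zeta; regular_tac.
have r_1 : regular midx S (fun s M => mq1 p q (y s) (M Ma) (M Mb) (M Mc) (M Md)) by rewrite /mq1; cbv zeta; regular_tac.
have r_2 : regular midx S (fun s M => mq2 p q (y s) (M Ma) (M Mb) (M Mc) (M Md)).
  apply: regular_minus => //; apply: regular_mult => //; apply: regular_plus; first apply: regular_plus; first apply: regular_plus.
  - regular_tac.
  - regular_tac.
  - by apply: (regular_div _ _ _ _ (/ 2)) => //; [lra|regular_tac].
  - apply: (regular_div _ _ _ _ ((/ 2) ^ 2)) => //; [by apply: pow_lt; lra| |exact: regular_pow].
    by move=> s M hM; rewrite -RPow_abs; apply: pow_incr; have := na s M hM; lra.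
have rQ1 : regular midx S (fun s M => mQ1 p q (y s) (M Ma) (M Mb) (M Mc) (M Md) / 2).
  rewrite /mQ1; regular_tac.
have rQ0 : regular midx S (fun s M => mQ0 p q (y s) (M Ma) (M Mb) (M Mc) (M Md)).
  rewrite /mQ0; regular_tac.
by case: i; apply: regular_minus; apply: regular_mult.
Qed.

(** Lets the calculus of [regular] prove continuity and boundedness of functions of time alone,
    through a one-element index type with no constraint on the state. *)
Lemma regular_time_inv (g : R -> R) : regular unit (fun _ => True) (fun s _ => g s) ->
  (forall s, continuous g s) /\ exists B, forall s, Rabs (g s) <= B.
Proof.
move=> [[B [B0 hB]] [_ hc]]; split; last by exists B => s; exact: (hB s (fun _ => 0)).
by apply: (hc (fun _ _ => 0)) => //; move=> _ s; exact: continuous_const.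
Qed.

Lemma pc_admissible (p : param) (y : R -> R) : (forall s, continuous y s) -> (forall s, Rabs (y s) <= / 2) ->
  (forall s, / 2 <= w0 p (y s)) -> exists B, admissible (fun s => pc p (y s)) B.
Proof.
move=> yc yb wb.
have ry : regular unit (fun _ => True) (fun s _ => y s) by apply: (regular_time _ _ y (/ 2)).
have rc := regular_const unit (fun _ => True).
have rw := regular_w0 _ _ p _ ry; have r0 := regular_e0 _ _ p _ ry; have r1 := regular_e1 _ _ p _ ry.
have r2 := regular_e2 _ _ p _ ry (fun s x _ => wb s).
have [cA' [BA hA]] : (forall s, continuous (fun s => cA (pc p (y s))) s) /\ exists B, forall s, Rabs (cA (pc p (y s))) <= B.
  by apply: regular_time_inv; apply: regular_mult => //; exact: (regular_pow _ _ _ 2).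
have [c0' [B0 h0]] : (forall s, continuous (fun s => cp0 (pc p (y s))) s) /\ exists B, forall s, Rabs (cp0 (pc p (y s))) <= B.
  apply: regular_time_inv; apply: regular_plus; first by apply: regular_minus => //; exact: regular_mult.
  by apply: regular_mult => //; exact: (regular_pow _ _ _ 2).
have [c1' [B1 h1]] : (forall s, continuous (fun s => cp1 (pc p (y s))) s) /\ exists B, forall s, Rabs (cp1 (pc p (y s))) <= B.
  by apply: regular_time_inv; rewrite /=; regular_tac.
have [c2' [B2 h2]] := regular_time_inv _ r2.
exists (Rmax (Rmax BA B0) (Rmax B1 B2)); split.
  by move=> s; repeat split; [exact: cA'|exact: yc|exact: c0'|exact: c1'|exact: c2'].
move=> s; split; last split; last split; last split.
- split; first by rewrite /=; have := pow2_ge_0 (w0 p (y s)); rewrite /=; lra.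
  apply: Rle_trans (Rle_abs _) _; apply: Rle_trans (hA s) _; exact: Rle_trans (Rmax_l _ _) (Rmax_l _ _).
- exact: yb.
- apply: Rle_trans (h0 s) _; exact: Rle_trans (Rmax_r _ _) (Rmax_l _ _).
- apply: Rle_trans (h1 s) _; exact: Rle_trans (Rmax_l _ _) (Rmax_r _ _).
- apply: Rle_trans (h2 s) _; exact: Rle_trans (Rmax_r _ _) (Rmax_r _ _).
Qed.

Definition mlist : list midx := (Ma :: Mb :: Mc :: Md :: nil)%list.
Lemma mlist_full (i : midx) : In i mlist.
Proof. by rewrite /mlist /=; case: i; tauto. Qed.

(** Continuity at 0 keeps the solution of the clamped equation within half the radius for a short
    time, where the clamps are inactive. The other half is room for the competitor in
    [moebius_unique]. *)
Lemma moebius_exists (p q : param) (y : R -> R) : (forall s, continuous y s) -> (forall s, Rabs (y s) <= mrad p q) ->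
  exists T (M : R -> midx -> R), 0 < T /\ (forall i, M 0 i = mid i) /\
    forall t, 0 <= t <= T -> mbox (mrad p q / 2) (M t) /\
      forall i, is_derive (fun s => M s i) t (mrhs p q (y t) (M t) i).
Proof.
move=> yc yb; have [[r0 r1] _] := mrad_bounds p q; set r := mrad p q in r0 r1 yb *.
have [M [M0 hM]] := picard_box midx mlist (fun i => mid i - r) (fun i => mid i + r) mlist_full
  (fun i => ltac:(lra)) (fun s M i => mrhs p q (y s) M i) mid (fun i => proj1 (mrhs_regular p q y i yc yb)).
set e := r / 2; have e00 : 0 < e by rewrite /e; lra.
have near : forall i, exists d, 0 < d /\ forall t, Rabs t < d -> Rabs (M t i - mid i) < e.
  move=> i; have [d [d0 hd]] := proj1 (continuous_eps _ _) (is_derive_continuous _ _ _ (hM 0 (Rle_refl 0) i)) e e00.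
  by exists d; split => // t ht; rewrite -(M0 i); apply: hd; rewrite Rminus_0_r.
have [da [da0 ha]] := near Ma; have [db [db0 hb]] := near Mb; have [dc [dc0 hc]] := near Mc; have [dd [dd0 hd]] := near Md.
set T := Rmin (Rmin da db) (Rmin dc dd) / 2.
have m0 : 0 < Rmin (Rmin da db) (Rmin dc dd) by do ! apply: Rmin_pos.
have T1 : T < da /\ T < db /\ T < dc /\ T < dd.
  have a1 := Rmin_l (Rmin da db) (Rmin dc dd); have a2 := Rmin_r (Rmin da db) (Rmin dc dd).
  have a3 := Rmin_l da db; have a4 := Rmin_r da db; have a5 := Rmin_l dc dd; have a6 := Rmin_r dc dd.
  by rewrite /T; lra.
exists T, M; split; first by rewrite /T; lra.
split => // t ht.
have close : forall i, Rabs (M t i - mid i) < e.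
  by case; [apply: ha|apply: hb|apply: hc|apply: hd]; rewrite Rabs_pos_eq; lra.
have bx : mbox (r / 2) (M t) by move=> i; have := Rabs_def2 _ _ (close i); rewrite /e; lra.
split => // i; apply: is_derive_eq (hM t (proj1 ht) i) _.
have cl : forall j, clamp (mid j - r) (mid j + r) (M t j) = M t j by move=> j; apply: clamp_id; have := bx j; lra.
by rewrite /mrhs !cl.
Qed.

Definition mdist2 (X Y : midx -> R) : R :=
  (X Ma - Y Ma) * (X Ma - Y Ma) + (X Mb - Y Mb) * (X Mb - Y Mb) + (X Mc - Y Mc) * (X Mc - Y Mc) + (X Md - Y Md) * (X Md - Y Md).

Lemma mdist2_coord (X Y : midx -> R) (e : R) (i : midx) : 0 <= e -> mdist2 X Y <= e * e -> Rabs (X i - Y i) <= e.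
Proof.
move=> e0 h; have h2 : (X i - Y i) * (X i - Y i) <= e * e.
  have s := fun j => Rle_0_sqr (X j - Y j); rewrite /Rsqr in s.
  by have := s Ma; have := s Mb; have := s Mc; have := s Md; rewrite /mdist2 in h; case: i; lra.
by apply: Rabs_le; split; nra.
Qed.

(** [Y] is not assumed to stay where the field is Lipschitz. While its distance from [X] is at most
    [r / 4] it does, and Gronwall then gives distance 0; [bootstrap] propagates this. The equation
    for [Y] at positive times suffices. *)
Lemma moebius_unique (p q : param) (y : R -> R) (T : R) (X Y DY : R -> midx -> R) :
  (forall s, continuous y s) -> (forall s, Rabs (y s) <= mrad p q) -> (forall i, X 0 i = Y 0 i) ->
  (forall t, 0 <= t <= T -> mbox (mrad p q / 2) (X t) /\ forall i, is_derive (fun s => X s i) t (mrhs p q (y t) (X t) i)) ->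
  (forall t, 0 <= t <= T -> forall i, is_derive (fun s => Y s i) t (DY t i) /\ (0 < t -> DY t i = mrhs p q (y t) (Y t) i)) ->
  forall t, 0 <= t <= T -> forall i, X t i = Y t i.
Proof.
move=> yc yb XY hX hY; have [[r0 r1] _] := mrad_bounds p q; set r := mrad p q in r0 r1 yb hX.
have [L [L0 hL]] := uniform_bound midx mlist mlist_full
  (fun i L => forall s x z d, 0 <= d -> mbox r x -> mbox r z -> (forall j, Rabs (x j - z j) <= d) ->
     Rabs (mrhs p q (y s) x i - mrhs p q (y s) z i) <= L * d)
  (fun i => proj1 (proj2 (proj1 (mrhs_regular p q y i yc yb))))
  (fun i K K' hle h s x z d d0 hx hy hd => Rle_trans _ _ _ (h s x z d d0 hx hy hd) (Rmult_le_compat_r _ _ _ d0 hle)).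
pose E t := mdist2 (X t) (Y t).
have E0 : E 0 = 0 by rewrite /E /mdist2 !XY; ring.
have dd : forall t, 0 <= t <= T -> forall i, is_derive (fun s => (X s i - Y s i) * (X s i - Y s i)) t
    (2 * ((X t i - Y t i) * (mrhs p q (y t) (X t) i - DY t i))).
  move=> t ht i; have [_ h1] := hX t ht; have [h2 _] := hY t ht i.
  have d1 := is_derive_Rminus _ _ _ _ _ (h1 i) h2.
  by apply: is_derive_eq (is_derive_Rmult _ _ _ _ _ d1 d1) _; ring.
pose E' t := 2 * ((X t Ma - Y t Ma) * (mrhs p q (y t) (X t) Ma - DY t Ma)) + 2 * ((X t Mb - Y t Mb) * (mrhs p q (y t) (X t) Mb - DY t Mb))
  + 2 * ((X t Mc - Y t Mc) * (mrhs p q (y t) (X t) Mc - DY t Mc)) + 2 * ((X t Md - Y t Md) * (mrhs p q (y t) (X t) Md - DY t Md)).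
have dE : forall t, 0 <= t <= T -> is_derive E t (E' t).
  by move=> t ht; do 3 (apply: is_derive_Rplus; last exact: dd); exact: dd.
have Epos : forall t, 0 <= E t.
  by move=> t; rewrite /E /mdist2; do ! apply: Rplus_le_le_0_compat; exact: Rle_0_sqr.
set c := r / 4 * (r / 4); have cpos : 0 < c by rewrite /c; nra.
have zero : forall s, 0 <= s <= T -> (forall t, 0 <= t <= s -> E t <= c) -> E s <= 0.
  move=> s hs hc.
  have ybox : forall t, 0 <= t <= s -> mbox r (Y t).
    move=> t ht i; have [hb _] := hX t ltac:(lra); have hbi := hb i.
    have := mdist2_coord (X t) (Y t) (r / 4) i ltac:(lra) (hc t ht) => /Rabs_le_between; lra.
  have bound : forall t, 0 < t < s -> E' t <= 8 * L * E t.
    move=> t ht; have [hb _] := hX t ltac:(lra).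
    have xb : mbox r (X t) by move=> i; have := hb i; lra.
    set d := Rabs (X t Ma - Y t Ma) + Rabs (X t Mb - Y t Mb) + Rabs (X t Mc - Y t Mc) + Rabs (X t Md - Y t Md).
    have p1 := Rabs_pos (X t Ma - Y t Ma); have p2 := Rabs_pos (X t Mb - Y t Mb); have p3 := Rabs_pos (X t Mc - Y t Mc); have p4 := Rabs_pos (X t Md - Y t Md).
    have d0 : 0 <= d by rewrite /d; lra.
    have hd : forall j, Rabs (X t j - Y t j) <= d by case; rewrite /d; lra.
    have lip := fun i => hL i t (X t) (Y t) d d0 xb (ybox t ltac:(lra)) hd.
    have term : forall i, 2 * ((X t i - Y t i) * (mrhs p q (y t) (X t) i - DY t i)) <= 2 * (Rabs (X t i - Y t i) * (L * d)).
      move=> i; apply: Rmult_le_compat_l; first lra.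
      have [_ e] := hY t ltac:(lra) i; rewrite e; last lra.
      apply: Rle_trans (Rle_abs _) _; rewrite Rabs_mult; apply: Rmult_le_compat_l; [exact: Rabs_pos|exact: lip].
    have s1 : E' t <= 2 * (d * (L * d)).
      have -> : 2 * (d * (L * d)) = 2 * (Rabs (X t Ma - Y t Ma) * (L * d)) + 2 * (Rabs (X t Mb - Y t Mb) * (L * d)) + 2 * (Rabs (X t Mc - Y t Mc) * (L * d)) + 2 * (Rabs (X t Md - Y t Md) * (L * d)) by rewrite {1}/d; ring.
      by rewrite /E'; have := term Ma; have := term Mb; have := term Mc; have := term Md; lra.
    have s2 : d * d <= 4 * E t.
      have sq : forall x, x * x = Rabs x * Rabs x by exact: Rsqr_abs.
      rewrite /E /mdist2 (sq (X t Ma - Y t Ma)) (sq (X t Mb - Y t Mb)) (sq (X t Mc - Y t Mc)) (sq (X t Md - Y t Md)) /d.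
      move: (Rabs (X t Ma - Y t Ma)) (Rabs (X t Mb - Y t Mb)) (Rabs (X t Mc - Y t Mc)) (Rabs (X t Md - Y t Md)) => u v w z.
      have := Rle_0_sqr (u - v); have := Rle_0_sqr (u - w); have := Rle_0_sqr (u - z); have := Rle_0_sqr (v - w); have := Rle_0_sqr (v - z); have := Rle_0_sqr (w - z).
      rewrite /Rsqr; lra.
    have := Rmult_le_compat_l (2 * L) _ _ ltac:(lra) s2; lra.
  have := gronwall E E' 0 s (8 * L) (proj1 hs) (fun t ht => dE t ltac:(lra)) (fun t ht => is_derive_continuous _ _ _ (dE t ltac:(lra))) bound.
  by rewrite E0 Rmult_0_l.
have all : forall s, 0 <= s <= T -> E s < c.
  apply: bootstrap.
  - by move=> t ht; exact: is_derive_continuous (dE t ht).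
  - by rewrite E0; lra.
  - by move=> s hs h; have := zero s hs h; lra.
move=> t ht i.
have E00 : E t <= 0 by apply: zero => // s hs; left; apply: all; lra.
have := mdist2_coord (X t) (Y t) 0 i (Rle_refl 0) ltac:(rewrite Rmult_0_l; exact: E00).
move=> /Rabs_le_between; lra.
Qed.

Lemma increasing_expand (l r : R -> R) (m : R) : (forall t, is_derive l t (r t)) -> (forall t, m <= r t) ->
  forall s t, s <= t -> m * (t - s) <= l t - l s.
Proof.
move=> hd hm s t hst.
have d : forall x, is_derive (fun x => m * x - l x) x (m - r x).
  move=> x; apply: is_derive_Rminus => //.
  by apply: is_derive_eq (is_derive_Rmult _ _ _ _ _ (is_derive_const m x) (is_derive_id (K := R_AbsRing) x)) _; rewrite /zero /one /=; ring.
have := derive_nonpos_le (fun x => m * x - l x) (fun x => m - r x) s t hst (fun x _ => d x)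
  (fun x _ => is_derive_continuous _ _ _ (d x)) (fun x _ => ltac:(have := hm x; lra)).
lra.
Qed.

(** The lower bound [m] makes [l] expanding, hence bijective with a Lipschitz inverse, and the
    derivative estimate of [l] can be read backwards. *)
Lemma increasing_inverse (l r : R -> R) (m : R) : 0 < m -> (forall t, is_derive l t (r t)) -> (forall t, m <= r t) ->
  exists mu : R -> R, (forall s, l (mu s) = s) /\ (forall t, mu (l t) = t) /\ forall s, is_derive mu s (/ r (mu s)).
Proof.
move=> m0 hd hm.
have ex := increasing_expand l r m hd hm.
have inj : forall s t, l s = l t -> s = t.
  move=> s t e; case: (Rtotal_order s t) => [h|[//|h]].
    by have := ex s t ltac:(lra); rewrite e; nra.
  by have := ex t s ltac:(lra); rewrite e; nra.
have surj : forall s, exists t, l t = s.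
  move=> s; set K := Rabs (s - l 0) / m + 1.
  have K0 : 0 < K by have : 0 <= Rabs (s - l 0) / m by [apply: Rdiv_le_0_compat => //; exact: Rabs_pos]; rewrite /K; lra.
  have mK : m * K = Rabs (s - l 0) + m by rewrite /K; field; lra.
  have h1 := ex 0 K ltac:(lra); have h2 := ex (- K) 0 ltac:(lra).
  have a1 := Rle_abs (s - l 0); have a2 := Rle_abs (- (s - l 0)); rewrite Rabs_Ropp in a2.
  have [t [_ ht]] := IVT_gen l (- K) K s
    (fun x => continuous_continuity_pt _ _ (is_derive_continuous _ _ _ (hd x)))
    ltac:(split; [apply: Rle_trans (Rmin_l _ _) _|apply: Rle_trans _ (Rmax_r _ _)]; lra).
  by exists t.
pose mu s := epsilon (inhabits 0) (fun t => l t = s).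
have lm : forall s, l (mu s) = s by move=> s; exact: (epsilon_spec (inhabits 0) _ (surj s)).
have ml : forall t, mu (l t) = t by move=> t; apply: inj; exact: lm.
exists mu; split => //; split => // s; apply/is_derive_eps => eps e0.
have rp : 0 < r (mu s) by have := hm (mu s); lra.
have [d [d0 h]] := proj1 (is_derive_eps _ _ _) (hd (mu s)) (eps * m * r (mu s)) ltac:(do 2 (apply: Rmult_lt_0_compat => //)).
exists (m * d); split; first exact: Rmult_lt_0_compat.
move=> u hu.
have lipm : m * Rabs (mu u - mu s) <= Rabs (u - s).
  case: (Rle_dec (mu s) (mu u)) => c.
    have := ex _ _ c; rewrite !lm => q; rewrite (Rabs_pos_eq (mu u - mu s)); last lra.
    by apply: Rle_trans q _; exact: Rle_abs.
  have := ex (mu u) (mu s) ltac:(lra); rewrite !lm => q.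
  rewrite Rabs_minus_sym (Rabs_pos_eq (mu s - mu u)); last lra.
  by apply: Rle_trans q _; rewrite Rabs_minus_sym; exact: Rle_abs.
have := h (mu u) ltac:(apply: (Rmult_lt_reg_l m) => //; lra); rewrite !lm => q.
have -> : mu u - mu s - (u - s) * / r (mu s) = - (u - s - (mu u - mu s) * r (mu s)) * / r (mu s) by field; lra.
rewrite Rabs_mult Rabs_Ropp (Rabs_pos_eq (/ r (mu s))); last by left; apply: Rinv_0_lt_compat.
apply: Rle_trans (_ : eps * m * r (mu s) * Rabs (mu u - mu s) * / r (mu s) <= _).
  by apply: Rmult_le_compat_r => //; left; apply: Rinv_0_lt_compat.
have -> : eps * m * r (mu s) * Rabs (mu u - mu s) * / r (mu s) = eps * (m * Rabs (mu u - mu s)) by field; lra.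
by apply: Rmult_le_compat_l => //; lra.
Qed.

(** * Matrices of determinant 1 acting on the half-plane *)

Definition mob (M : midx -> R) (z : C) : C := ((RtoC (M Ma) * z + RtoC (M Mb)) / (RtoC (M Mc) * z + RtoC (M Md)))%C.
Definition mdet (M : midx -> R) : R := M Ma * M Md - M Mb * M Mc.
(** The adjugate, which is the inverse at determinant 1. *)
Definition madj (M : midx -> R) (i : midx) : R := match i with Ma => M Md | Mb => - M Mb | Mc => - M Mc | Md => M Ma end.

Lemma mden_neq (M : midx -> R) (z : C) : mdet M = 1 -> UHP z -> (RtoC (M Mc) * z + RtoC (M Md))%C <> 0%C.
Proof.
rewrite /mdet => det hz; apply: UHP_lin_neq => //; case: (Req_dec (M Mc) 0) => [c00|]; last by left.
by right => d00; rewrite c00 d00 in det; lra.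
Qed.

Lemma mob_UHP (M : midx -> R) (z : C) : mdet M = 1 -> UHP z -> UHP (mob M z).
Proof.
move=> det hz; have n := mden_neq M z det hz.
have p : 0 < (M Mc * fst z + M Md) ^ 2 + (M Mc * snd z) ^ 2.
  have := Cmod_pos_neq _ n => q; have := Cmod_sq (RtoC (M Mc) * z + RtoC (M Md)).
  have : 0 < Cmod (RtoC (M Mc) * z + RtoC (M Md)) ^ 2 by apply: pow_lt.
  rewrite /=; lra.
have e : snd (mob M z) = (M Ma * M Md - M Mb * M Mc) * snd z / ((M Mc * fst z + M Md) ^ 2 + (M Mc * snd z) ^ 2).
  by rewrite /mob /=; field; move: p; rewrite /=; lra.
rewrite /UHP /Cim e; rewrite /mdet in det; rewrite det Rmult_1_l; exact: Rdiv_lt_0_compat.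
Qed.

Lemma mdet_adj (M : midx -> R) : mdet (madj M) = mdet M.
Proof. by rewrite /mdet /=; ring. Qed.

Lemma mob_adj (M : midx -> R) (z : C) : mdet M = 1 -> UHP z -> mob (madj M) (mob M z) = z.
Proof.
move=> det hz; have n := mden_neq M z det hz.
have n2 := mden_neq (madj M) (mob M z) ltac:(by rewrite mdet_adj) (mob_UHP M z det hz).
have detC : (RtoC (M Ma) * RtoC (M Md) - RtoC (M Mb) * RtoC (M Mc) = 1)%C by rewrite -!RtoC_mult -RtoC_minus; rewrite /mdet in det; rewrite det.
apply: (Cmult_cancel_r (RtoC (madj M Mc) * mob M z + RtoC (madj M Md))%C) => //.
have -> : (mob (madj M) (mob M z) * (RtoC (madj M Mc) * mob M z + RtoC (madj M Md)) = RtoC (madj M Ma) * mob M z + RtoC (madj M Mb))%C.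
  by rewrite {1}/mob; field.
rewrite /= !RtoC_opp.
apply: (Cmult_cancel_r (RtoC (M Mc) * z + RtoC (M Md))%C) => //.
have em : (mob M z * (RtoC (M Mc) * z + RtoC (M Md)) = RtoC (M Ma) * z + RtoC (M Mb))%C by rewrite /mob; field.
have -> : ((RtoC (M Md) * mob M z + - RtoC (M Mb)) * (RtoC (M Mc) * z + RtoC (M Md)) = RtoC (M Md) * (mob M z * (RtoC (M Mc) * z + RtoC (M Md))) - RtoC (M Mb) * (RtoC (M Mc) * z + RtoC (M Md)))%C by ring.
have -> : (z * (- RtoC (M Mc) * mob M z + RtoC (M Ma)) * (RtoC (M Mc) * z + RtoC (M Md)) = z * (- RtoC (M Mc) * (mob M z * (RtoC (M Mc) * z + RtoC (M Md))) + RtoC (M Ma) * (RtoC (M Mc) * z + RtoC (M Md))))%C by ring.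
rewrite em.
have -> : (RtoC (M Md) * (RtoC (M Ma) * z + RtoC (M Mb)) - RtoC (M Mb) * (RtoC (M Mc) * z + RtoC (M Md)) = (RtoC (M Ma) * RtoC (M Md) - RtoC (M Mb) * RtoC (M Mc)) * z)%C by ring.
have -> : (z * (- RtoC (M Mc) * (RtoC (M Ma) * z + RtoC (M Mb)) + RtoC (M Ma) * (RtoC (M Mc) * z + RtoC (M Md))) = (RtoC (M Ma) * RtoC (M Md) - RtoC (M Mb) * RtoC (M Mc)) * z)%C by ring.
by [].
Qed.

Lemma madjK (M : midx -> R) (z : C) : mob (madj (madj M)) z = mob M z.
Proof. by rewrite /mob /= !Ropp_involutive. Qed.

Lemma mob_adjr (M : midx -> R) (z : C) : mdet M = 1 -> UHP z -> mob M (mob (madj M) z) = z.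
Proof. by move=> det hz; rewrite -(madjK M); apply: mob_adj => //; rewrite mdet_adj. Qed.

(** Two contributions over the same denominator: the motion of the matrix gives [qmob], and the
    motion of the point is multiplied by the derivative [1 / N^2] of a map of determinant 1. *)
Lemma mob_tder (M DM : R -> midx -> R) (G : R -> C) (t : R) (v : C) : (forall i, is_derive (fun s => M s i) t (DM t i)) ->
  mdet (M t) = 1 -> UHP (G t) -> tder G t v ->
  let N := (RtoC (M t Mc) * G t + RtoC (M t Md))%C in
  tder (fun s => mob (M s) (G s)) t
   ((qmob (DM t Ma) (DM t Mb) (DM t Mc) (DM t Md) (M t Ma) (M t Mb) (M t Mc) (M t Md) (G t) + v) / (N * N))%C.
Proof.
move=> hM det hG hv N.
have n : N <> 0%C by exact: mden_neq.
have lin : forall i j, tder (fun s => RtoC (M s i) * G s + RtoC (M s j))%C t (RtoC (DM t i) * G t + RtoC (M t i) * v + RtoC (DM t j))%C.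
  move=> i j; apply: tder_plus; last by apply: tder_real; exact: hM.
  by apply: tder_mult => //; apply: tder_real; exact: hM.
apply: tder_eq (tder_div _ _ _ _ _ (lin Ma Mb) (lin Mc Md) n) _.
rewrite -/N; congr Cdiv; rewrite /qmob.
have detC : (RtoC (M t Ma) * RtoC (M t Md) - RtoC (M t Mb) * RtoC (M t Mc) = 1)%C by rewrite -!RtoC_mult -RtoC_minus; rewrite /mdet in det; rewrite det.
have -> : v = ((RtoC (M t Ma) * RtoC (M t Md) - RtoC (M t Mb) * RtoC (M t Mc)) * v)%C by rewrite detC; ring.
rewrite detC /N.
transitivity (((RtoC (DM t Ma) * G t + RtoC (DM t Mb)) * (RtoC (M t Mc) * G t + RtoC (M t Md)) -
  (RtoC (M t Ma) * G t + RtoC (M t Mb)) * (RtoC (DM t Mc) * G t + RtoC (DM t Md))) +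
  (RtoC (M t Ma) * RtoC (M t Md) - RtoC (M t Mb) * RtoC (M t Mc)) * (1 * v))%C; first ring.
by rewrite detC; ring.
Qed.

Lemma mdet_const (p q : param) (y : R -> R) (M : R -> midx -> R) (T : R) : 0 <= T -> mdet (M 0) = 1 ->
  (forall t, 0 <= t <= T -> forall i, is_derive (fun s => M s i) t (mrhs p q (y t) (M t) i)) ->
  forall t, 0 <= t <= T -> mdet (M t) = 1.
Proof.
move=> T0 m0 hM t ht.
have d : forall s, 0 <= s <= t -> is_derive (fun s => mdet (M s)) s 0.
  move=> s hs; have h := hM s ltac:(lra).
  apply: is_derive_eq (is_derive_Rminus _ _ _ _ _ (is_derive_Rmult _ _ _ _ _ (h Ma) (h Md)) (is_derive_Rmult _ _ _ _ _ (h Mb) (h Mc))) _.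
  by rewrite /mrhs; field.
have := derive_bound (fun s => mdet (M s)) (fun _ => 0) t 0 ltac:(lra) d (fun s _ => ltac:(rewrite Rabs_R0; lra)).
by rewrite Rmult_0_l m0 => /Rabs_le_between; lra.
Qed.

(** Infinitesimal form of [M^-1 M = id]: the adjugate of the derivative matrix drives the inverse
    family, and transported by [M] its field is the opposite one. *)
Lemma qmob_inverse (M D : midx -> R) (z : C) : mdet M = 1 -> UHP z ->
  let Y := mob M z in let N := (RtoC (M Mc) * z + RtoC (M Md))%C in
  ((RtoC (madj M Mc) * Y + RtoC (madj M Md)) * N = 1)%C /\
  (qmob (D Md) (- D Mb) (- D Mc) (D Ma) (madj M Ma) (madj M Mb) (madj M Mc) (madj M Md) Y * (N * N) =
   - qmob (D Ma) (D Mb) (D Mc) (D Md) (M Ma) (M Mb) (M Mc) (M Md) z)%C.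
Proof.
move=> det hz Y N.
have n : N <> 0%C by exact: mden_neq.
have detC : (RtoC (M Ma) * RtoC (M Md) - RtoC (M Mb) * RtoC (M Mc) = 1)%C by rewrite -!RtoC_mult -RtoC_minus; rewrite /mdet in det; rewrite det.
have eY : (Y * N = RtoC (M Ma) * z + RtoC (M Mb))%C by rewrite /Y /mob -/N; field.
have i1 : ((RtoC (madj M Mc) * Y + RtoC (madj M Md)) * N = 1)%C.
  rewrite /= RtoC_opp; have -> : ((- RtoC (M Mc) * Y + RtoC (M Ma)) * N = - RtoC (M Mc) * (Y * N) + RtoC (M Ma) * N)%C by ring.
  by rewrite eY -detC /N; ring.
have i2 : ((RtoC (madj M Ma) * Y + RtoC (madj M Mb)) * N = z)%C.
  rewrite /= RtoC_opp; have -> : ((RtoC (M Md) * Y + - RtoC (M Mb)) * N = RtoC (M Md) * (Y * N) - RtoC (M Mb) * N)%C by ring.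
  rewrite eY; transitivity ((RtoC (M Ma) * RtoC (M Md) - RtoC (M Mb) * RtoC (M Mc)) * z)%C; first by rewrite /N; ring.
  by rewrite detC; ring.
split => //; rewrite /qmob (RtoC_opp (D Mb)) (RtoC_opp (D Mc)).
set u := (RtoC (madj M Mc) * Y + RtoC (madj M Md))%C in i1 *; set w := (RtoC (madj M Ma) * Y + RtoC (madj M Mb))%C in i2 *.
have -> : (((RtoC (D Md) * Y + - RtoC (D Mb)) * u - w * (- RtoC (D Mc) * Y + RtoC (D Ma))) * (N * N) =
  (RtoC (D Md) * (Y * N) - RtoC (D Mb) * N) * (u * N) - (w * N) * (- RtoC (D Mc) * (Y * N) + RtoC (D Ma) * N))%C by ring.
rewrite i1 i2 eY /N; ring.
Qed.

(** * Conjugating a chain by the Moebius maps *)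

Section Conjugation.

Variables (p q : param) (y : R -> R) (M : R -> midx -> R) (T : R) (lam mu r : R -> R).
Hypothesis T0 : 0 <= T.
Hypothesis yb : forall s, Rabs (y s) <= mrad p q.
Hypothesis det1 : forall t, 0 <= t <= T -> mdet (M t) = 1.
Hypothesis hbox : forall t, 0 <= t <= T -> mbox (mrad p q / 2) (M t).
Hypothesis hM : forall t, 0 <= t <= T -> forall i, is_derive (fun s => M s i) t (mrhs p q (y t) (M t) i).
Hypothesis hr : forall t, 0 <= t <= T -> r t = mrate p q (y t) (M t Ma) (M t Mb) (M t Mc) (M t Md).
Hypothesis hlam : forall t, is_derive lam t (r t).
Hypothesis rpos : forall t, 0 < r t.
Hypothesis lam_mu : forall s, lam (mu s) = s.
Hypothesis mu_lam : forall t, mu (lam t) = t.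
Hypothesis hmu : forall s, is_derive mu s (/ r (mu s)).
Hypothesis lam0 : lam 0 = 0.

(** The image of the old pole, in the new time; the clamp has an effect only outside
    [[0, lam T]]. *)
Let yt (s : R) : R := let t := clamp 0 T (mu s) in mpole (y t) (M t Ma) (M t Mb) (M t Mc) (M t Md).
Let k s := pc p (y s).
Let kt s := pc q (yt s).

Lemma lam_increasing (s t : R) : s <= t -> lam s <= lam t.
Proof.
move=> hst; have := derive_nonpos_le (fun s => - lam s) (fun s => - r s) s t hst.
move=> h; have {}h := h (fun x _ => is_derive_opp (K := R_AbsRing) lam x (r x) (hlam x)).
have {}h := h (fun x _ => is_derive_continuous _ _ _ (is_derive_opp (K := R_AbsRing) lam x (r x) (hlam x))).
have {}h := h (fun x _ => ltac:(have := rpos x; lra)); lra.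
Qed.

Lemma lam_lt (s t : R) : s < t -> lam s < lam t.
Proof.
move=> h; case: (Rle_lt_or_eq_dec _ _ (lam_increasing s t ltac:(lra))) => // e.
by have := f_equal mu e; rewrite !mu_lam; lra.
Qed.

Lemma mu_range (s t : R) : 0 <= s <= lam t -> 0 <= mu s <= t.
Proof.
move=> [h1 h2]; split; apply: Rnot_lt_le => h.
  by have := lam_lt _ _ h; rewrite lam_mu lam0; lra.
by have := lam_lt _ _ h; rewrite lam_mu; lra.
Qed.

Let yt_lam (t : R) : 0 <= t <= T -> yt (lam t) = mpole (y t) (M t Ma) (M t Mb) (M t Mc) (M t Md).
Proof. by move=> ht; rewrite /yt mu_lam clamp_id. Qed.

Let fields (t : R) (z : C) : 0 <= t <= T -> UHP z ->
  let N := (RtoC (M t Mc) * z + RtoC (M t Md))%C in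
  (RtoC (r t) * (N * N) * vf (kt (lam t)) (mob (M t) z) =
   qmob (mrhs p q (y t) (M t) Ma) (mrhs p q (y t) (M t) Mb) (mrhs p q (y t) (M t) Mc) (mrhs p q (y t) (M t) Md)
     (M t Ma) (M t Mb) (M t Mc) (M t Md) z + vf (k t) z)%C.
Proof.
move=> ht hz N; rewrite /kt yt_lam // hr //.
have [r0 _] := mrad_bounds p q.
have [h1 h2] := mbox_bounds p q (y t) (M t) (yb t) ltac:(by move=> i; have := hbox t ht i; lra).
apply: match_fields => //.
- exact: det1.
- by lra.
- by have [_ ?] := w0_small p q _ h2; lra.
Qed.

(** [M_t (G t)], run in the time [lam t], solves the new equation: [fields] says that the motion of
    the matrix and the old field add up to the new field, and [hmu] supplies the factor [/ r]. *)
Lemma conjugate_fwd (t : R) (z : C) : M 0 Ma = 1 -> M 0 Mb = 0 -> M 0 Mc = 0 -> M 0 Md = 1 ->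
  0 <= t <= T -> hsurv k t z -> hsurv kt (lam t) z.
Proof.
move=> a0 b0 c0 d0 ht [G [G0 hG]].
exists (fun s => mob (M (mu s)) (G (mu s))); split.
  have -> : mu 0 = 0 by rewrite -{1}lam0 mu_lam.
  by rewrite /mob a0 b0 c0 d0 G0; field; apply: RtoC_neq0; lra.
move=> s hs; have hm := mu_range s t hs.
have [hu hd] := hG (mu s) hm.
have hmT : 0 <= mu s <= T by lra.
split; first by apply: mob_UHP => //; exact: det1.
have D := mob_tder M (fun t => mrhs p q (y t) (M t)) G (mu s) _ (hM (mu s) hmT) (det1 _ hmT) hu hd.
apply: tder_eq (tder_comp (fun s => mob (M s) (G s)) mu s _ _ D (hmu s)) _.
rewrite -fields // lam_mu RtoC_inv; last by have := rpos (mu s); lra.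
field; split; first by apply: mden_neq => //; exact: det1.
by apply: RtoC_neq0; have := rpos (mu s); lra.
Qed.

(** The same correspondence through the inverse matrices; [qmob_inverse] turns the identity in
    [fields] around. *)
Lemma conjugate_bwd (t : R) (z : C) : M 0 Ma = 1 -> M 0 Mb = 0 -> M 0 Mc = 0 -> M 0 Md = 1 ->
  0 <= t <= T -> hsurv kt (lam t) z -> hsurv k t z.
Proof.
move=> a0 b0 c0 d0 ht [g [g0 hg]].
pose G s := mob (madj (M s)) (g (lam s)).
have hl : forall s, 0 <= s <= t -> 0 <= lam s <= lam t.
  by move=> s hs; split; [rewrite -lam0; apply: lam_increasing; lra|apply: lam_increasing; lra].
have UG : forall s, 0 <= s <= t -> UHP (G s).
  move=> s hs; apply: mob_UHP; first by rewrite mdet_adj; apply: det1; lra.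
  by have [] := hg (lam s) (hl s hs).
exists G; split.
  rewrite /G lam0 g0 /mob /= a0 b0 c0 d0; rewrite !Ropp_0; field.
move=> s hs; split; first exact: UG.
have hsT : 0 <= s <= T by lra.
have [hu hd] := hg (lam s) (hl s hs).
have dY := tder_comp g lam s _ _ hd (hlam s).
pose DA s i := match i with Ma => mrhs p q (y s) (M s) Md | Mb => - mrhs p q (y s) (M s) Mb | Mc => - mrhs p q (y s) (M s) Mc | Md => mrhs p q (y s) (M s) Ma end.
have hA : forall i, is_derive (fun s => madj (M s) i) s (DA s i).
  by case => /=; try (apply: (is_derive_opp (K := R_AbsRing))); exact: hM.
have dG := mob_tder (fun s => madj (M s)) DA (fun s => g (lam s)) s _ hA ltac:(rewrite mdet_adj; exact: det1) hu dY.
apply: tder_eq dG _.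
have eY : mob (M s) (G s) = g (lam s) by apply: mob_adjr => //; exact: det1.
have n := mden_neq (M s) (G s) (det1 _ hsT) (UG s hs).
have f := fields s (G s) hsT (UG s hs); cbv zeta in f; rewrite eY in f.
have inv := qmob_inverse (M s) (mrhs p q (y s) (M s)) (G s) (det1 _ hsT) (UG s hs); cbv zeta in inv; rewrite eY in inv.
move: inv f n; set N := (RtoC (M s Mc) * G s + RtoC (M s Md))%C.
move=> [i1 i2] f n.
set N' := (RtoC (madj (M s) Mc) * g (lam s) + RtoC (madj (M s) Md))%C in i1 *.
have n' : N' <> 0%C by apply: mden_neq => //; rewrite mdet_adj; exact: det1.
rewrite -/(k s); apply: (Cmult_cancel_r (N' * N')%C); first exact: Cmult_neq_0.
have cancel : (forall u : C, u / (N' * N') * (N' * N') = u)%C by move=> u; field.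
rewrite cancel.
apply: (Cmult_cancel_r (N * N)%C); first exact: Cmult_neq_0.
have -> : (vf (k s) (G s) * (N' * N') * (N * N) = vf (k s) (G s) * ((N' * N) * (N' * N)))%C by ring.
rewrite i1.
have -> : (vf (k s) (G s) * (1 * 1) = RtoC (r s) * (N * N) * vf (kt (lam s)) (g (lam s)) - qmob (mrhs p q (y s) (M s) Ma) (mrhs p q (y s) (M s) Mb) (mrhs p q (y s) (M s) Mc) (mrhs p q (y s) (M s) Md)
     (M s Ma) (M s Mb) (M s Mc) (M s Md) (G s))%C by rewrite f; ring.
have sum : (forall u v w : C, w * (N * N) = - v -> (w + u) * (N * N) = u * (N * N) - v)%C.
  by move=> u v w e; have -> : ((w + u) * (N * N) = w * (N * N) + u * (N * N))%C by [ring]; rewrite e; ring.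
rewrite (sum _ _ _ i2); ring.
Qed.

End Conjugation.

(** * The flow of [sigma] and the transfer to the half-plane *)

Lemma derive_zero_const (f : R -> R) : (forall t, is_derive f t 0) -> forall a b, f a = f b.
Proof.
move=> h a b; have [c [_ e]] := MVT_gen f a b (fun _ => 0) (fun x _ => h x)
  (fun x _ => continuous_continuity_pt _ _ (is_derive_continuous _ _ _ (h x))).
lra.
Qed.

(** Circular functions for [kap < 0], the pair [1, t] for [kap = 0], hyperbolic ones for [kap > 0].
    This treats elliptic, parabolic and hyperbolic [sigma] alike; the last identity is a conserved
    quantity of the system. *)
Lemma hyp_trig (kap : R) : exists c s : R -> R, c 0 = 1 /\ s 0 = 0 /\
  (forall t, is_derive c t (kap * s t)) /\ (forall t, is_derive s t (c t)) /\ forall t, c t * c t - kap * (s t * s t) = 1.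
Proof.
suff [c [s [h1 [h2 [h3 h4]]]]] : exists c s : R -> R, c 0 = 1 /\ s 0 = 0 /\
  (forall t, is_derive c t (kap * s t)) /\ (forall t, is_derive s t (c t)).
  exists c, s; do 4 split => //.
  move=> t.
  have d : forall t, is_derive (fun t => c t * c t - kap * (s t * s t)) t 0.
    move=> r; apply: is_derive_eq.
      apply: is_derive_Rminus; first exact: is_derive_Rmult.
      apply: is_derive_Rmult; first exact: is_derive_const.
      exact: is_derive_Rmult.
    by rewrite /zero /=; ring.
  by rewrite (derive_zero_const _ d t 0) h1 h2; ring.
case: (Rtotal_order kap 0) => [lt|[->|gt]].
- set w := sqrt (- kap); have w0 : 0 < w by apply: sqrt_lt_R0; lra.
  have ww : w * w = - kap by apply: sqrt_sqrt; lra.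
  exists (fun t => cos (w * t)), (fun t => sin (w * t) / w); split; first by rewrite Rmult_0_r cos_0.
  split; first by rewrite Rmult_0_r sin_0; field; lra.
  split => t; auto_derive => //.
    have -> : kap = - (w * w) by lra.
    by field; lra.
  by field; lra.
- exists (fun _ => 1), (fun t => t); do 2 split => //.
  split => t; first by rewrite Rmult_0_l; exact: is_derive_const.
  exact: (is_derive_id (K := R_AbsRing)).
- set w := sqrt kap; have w0 : 0 < w by apply: sqrt_lt_R0; lra.
  have ww : w * w = kap by apply: sqrt_sqrt; lra.
  exists (fun t => (exp (w * t) + exp (- (w * t))) / 2), (fun t => (exp (w * t) - exp (- (w * t))) / (2 * w)).
  split; first by rewrite Rmult_0_r Ropp_0 exp_0; field.
  split; first by rewrite Rmult_0_r Ropp_0 exp_0; field; lra.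
  split => t; auto_derive => //.
    by rewrite -ww; field; lra.
  by field; lra.
Qed.

(** [exp (u S)] for the trace-free matrix [S] of the vector field [sigma] on the half-plane; as [S^2] is the scalar [kap],
  it is [c u + s u S] with the (hyperbolic) trigonometric functions of [is_trig]. *)
Definition flowmx (p : param) (c s : R -> R) (u : R) (i : midx) : R :=
  match i with
  | Ma => c u - s u * (ps0 p / 2)
  | Mb => - s u
  | Mc => s u * ps1 p
  | Md => c u + s u * (ps0 p / 2)
  end.

Definition is_trig (p : param) (c s : R -> R) : Prop :=
  let kap := ps0 p / 2 * (ps0 p / 2) - ps1 p in
  c 0 = 1 /\ s 0 = 0 /\
  (forall t, is_derive c t (kap * s t)) /\ (forall t, is_derive s t (c t)) /\ forall t, c t * c t - kap * (s t * s t) = 1.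

Lemma flowmx_det (p : param) (c s : R -> R) (u : R) : is_trig p c s -> mdet (flowmx p c s u) = 1.
Proof. by move=> [_ [_ [_ [_ h]]]]; rewrite -(h u) /mdet /=; ring. Qed.

Definition sigH (p : param) (z : C) : C := (- (1 + RtoC (ps0 p) * z + RtoC (ps1 p) * (z * z)))%C.
Definition bH (p : param) (z : C) : C := (- (2 / z + RtoC (pm1 p) + RtoC (pb0 p) * z + RtoC (pb1 p) * (z * z)))%C.

(** Pulled back by the inverse of the candidate flow, a trajectory has zero derivative. *)
Lemma flowmx_unique (p : param) (c s : R -> R) (Y : R -> C) : is_trig p c s ->
  (forall t, UHP (Y t)) -> (forall t, tder Y t (sigH p (Y t))) -> forall t, Y t = mob (flowmx p c s t) (Y 0).
Proof.
move=> trig hY dY.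
have [c0 [s0 [dc [ds det]]]] := trig.
set kap := ps0 p / 2 * (ps0 p / 2) - ps1 p in dc det.
pose E t := flowmx p c s t.
pose DA t i := match i with
  | Ma => kap * s t + c t * (ps0 p / 2) | Mb => c t | Mc => - (c t * ps1 p) | Md => kap * s t - c t * (ps0 p / 2) end.
have dlin : forall t (a : R), is_derive (fun t => s t * a) t (c t * a).
  move=> t a; apply: is_derive_eq (is_derive_Rmult _ _ _ _ _ (ds t) (is_derive_const a t)) _.
  by rewrite /zero /=; ring.
have dE : forall t i, is_derive (fun t => madj (E t) i) t (DA t i).
  move=> t; case => /=.
  - exact: is_derive_Rplus.
  - by apply: is_derive_eq (is_derive_opp (K := R_AbsRing) _ _ _ (is_derive_opp (K := R_AbsRing) _ _ _ (ds t))) _; rewrite /opp /=; ring.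
  - by apply: is_derive_eq (is_derive_opp (K := R_AbsRing) _ _ _ (dlin t (ps1 p))) _.
  - exact: is_derive_Rminus.
have detE : forall t, mdet (E t) = 1 by move=> t; exact: flowmx_det.
have dG : forall t, tder (fun t => mob (madj (E t)) (Y t)) t 0%C.
  move=> t.
  have h := mob_tder (fun t => madj (E t)) DA Y t _ (dE t) ltac:(by rewrite mdet_adj) (hY t) (dY t).
  apply: tder_eq h _.
  have -> : (qmob (DA t Ma) (DA t Mb) (DA t Mc) (DA t Md) (madj (E t) Ma) (madj (E t) Mb) (madj (E t) Mc) (madj (E t) Md) (Y t) + sigH p (Y t) = 0)%C.
    have e1 := det t.
    have -> : sigH p (Y t) = (- (RtoC (c t * c t - kap * (s t * s t)) * (1 + RtoC (ps0 p) * Y t + RtoC (ps1 p) * (Y t * Y t))))%C.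
      by rewrite e1 /sigH; ring.
    rewrite /qmob /DA /E /= /kap.
    have -> : ps0 p = ps0 p / 2 + ps0 p / 2 by field.
    have -> : (ps0 p / 2 + ps0 p / 2) / 2 = ps0 p / 2 by field.
    move: (ps0 p / 2) (ps1 p) (c t) (s t) (Y t) => h0 s1 C0 S0 y.
    by rewrite !(RtoC_minus, RtoC_plus, RtoC_opp, RtoC_mult); ring.
  by rewrite /Cdiv; ring.
have cst : forall t, mob (madj (E t)) (Y t) = mob (madj (E 0)) (Y 0).
  move=> t; apply: C_ext.
  - by apply: (derive_zero_const (fun t => fst (mob (madj (E t)) (Y t)))) => r; have [] := dG r.
  - by apply: (derive_zero_const (fun t => snd (mob (madj (E t)) (Y t)))) => r; have [] := dG r.
have e0' : mob (madj (E 0)) (Y 0) = Y 0.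
  rewrite /mob /E /= c0 s0 !Rmult_0_l !Ropp_0 Rminus_0_r Rplus_0_r.
  by field; apply: RtoC_neq0; lra.
by move=> t; rewrite -{1}(mob_adjr (E t) (Y t)) // cst e0'.
Qed.

Lemma mob_cder (M : midx -> R) (z : C) : mdet M = 1 -> UHP z ->
  let N := (RtoC (M Mc) * z + RtoC (M Md))%C in cder (mob M) z (/ (N * N))%C.
Proof.
move=> det hz N; have n : N <> 0%C by exact: mden_neq.
have lin : forall i j, cder (fun x => RtoC (M i) * x + RtoC (M j))%C z (RtoC (M i)).
  move=> i j; apply: cderiv_eq.
    apply: cderiv_plus; last exact: cderiv_const.
    by apply: cderiv_mult; [exact: cderiv_const|exact: cderiv_id].
  by cbv beta; ring.
apply: cderiv_eq (cderiv_div _ _ _ _ _ (lin Ma Mb) (lin Mc Md) n) _.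
have detC : (RtoC (M Ma) * RtoC (M Md) - RtoC (M Mb) * RtoC (M Mc) = 1)%C by rewrite -!RtoC_mult -RtoC_minus; rewrite /mdet in det; rewrite det.
rewrite -/N; have -> : (RtoC (M Ma) * N - (RtoC (M Ma) * z + RtoC (M Mb)) * RtoC (M Mc) = RtoC (M Ma) * RtoC (M Md) - RtoC (M Mb) * RtoC (M Mc))%C by rewrite /N; ring.
by rewrite detC; field.
Qed.

(** The Loewner right-hand side [- b (h z) / h' z] on the half-plane, where [h] is the Moebius map
    of [flowmx], with derivative [1 / N^2]. *)
Definition Vfield (p : param) (c s : R -> R) (u : R) (z : C) : C :=
  let M := flowmx p c s u in let N := (RtoC (M Mc) * z + RtoC (M Md))%C in
  (- (bH p (mob M z) * (N * N)))%C.

(** The preimage of 0, the pole of [bH], under the Moebius map of [flowmx]. *)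
Definition polepos (p : param) (c s : R -> R) (u : R) : R := s u / flowmx p c s u Ma.

(** The flow preserves [sigH], whose values at 0 and at the preimage of 0 are [-1] and [- w0], and
    the derivative of the map at that preimage is the square of the entry [Ma]. It is computed here
    from the determinant identity. *)
Lemma polepos_w0 (p : param) (c s : R -> R) (u : R) : is_trig p c s -> flowmx p c s u Ma <> 0 ->
  flowmx p c s u Ma ^ 2 * w0 p (polepos p c s u) = 1.
Proof.
move=> [_ [_ [_ [_ det]]]] n; rewrite -(det u) /polepos; set al := flowmx p c s u Ma in n *.
have -> : al ^ 2 * w0 p (s u / al) = al ^ 2 + ps0 p * s u * al + ps1 p * s u ^ 2 by rewrite /w0; field.
by rewrite /al /=; field.
Qed.

Lemma Vfield_identity (z y k w al b m g : C) : (z - y <> 0)%C -> (w + k * (z - y) <> 0)%C -> al <> 0%C -> w <> 0%C ->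
  (al * al * w = 1)%C ->
  let N := (al * (w + k * (z - y)))%C in let W := (al * (z - y) / N)%C in
  (- (- (2 / W + m + b * W + g * (W * W)) * (N * N)) =
   (2 * (w * w)) / (z - y) + (6 * w * k + m * w) + (6 * (k * k) + 2 * m * k + b) * (z - y) +
   ((2 * (k * k * k) + m * (k * k) + b * k + g) / w) * ((z - y) * (z - y)))%C.
Proof.
move=> nz nw nal w0n e N W.
have ew : (al * al = / w)%C by apply: (Cmult_cancel_r w) => //; rewrite e; field.
have eW : W = ((z - y) / (w + k * (z - y)))%C by rewrite /W /N; field; split.
have eN : (N * N = / w * ((w + k * (z - y)) * (w + k * (z - y))))%C by rewrite -ew /N; ring.
rewrite eW eN.
move: nz nw; move: (z - y)%C => x nz nw.
by field.
Qed.

Lemma Vfield_pc (p : param) (c s : R -> R) (u : R) (z : C) : is_trig p c s -> flowmx p c s u Ma <> 0 -> UHP z ->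
  Vfield p c s u z = vf (pc p (polepos p c s u)) z.
Proof.
move=> trig n hz.
have hw := polepos_w0 p c s u trig n.
set y := polepos p c s u in hw *.
set al := flowmx p c s u Ma in n hw *.
have nw : w0 p y <> 0 by move=> e; rewrite e Rmult_0_r in hw; lra.
have es : s u = y * al by rewrite /y /polepos -/al; field.
have ec : c u = al * (1 + y * (ps0 p / 2)).
  have h : c u = al + s u * (ps0 p / 2) by rewrite /al /=; ring.
  by rewrite h es; ring.
have det := flowmx_det p c s u trig.
have nden := mden_neq _ z det hz.
have eN : (RtoC (flowmx p c s u Mc) * z + RtoC (flowmx p c s u Md) = RtoC al * (RtoC (w0 p y) + RtoC (ps1 p * y) * (z - RtoC y)))%C.
  have -> : flowmx p c s u Mc = al * (ps1 p * y) by rewrite /= es; ring.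
  have -> : flowmx p c s u Md = al * (w0 p y - ps1 p * y * y) by rewrite /= ec es /w0; field.
  by rewrite !(RtoC_mult al) RtoC_minus (RtoC_mult (ps1 p * y)); ring.
have eP : (RtoC (flowmx p c s u Ma) * z + RtoC (flowmx p c s u Mb) = RtoC al * (z - RtoC y))%C.
  have -> : flowmx p c s u Mb = - (al * y) by rewrite /= es; ring.
  by rewrite -/al RtoC_opp RtoC_mult; ring.
rewrite /Vfield /mob; cbv zeta; rewrite eP eN /bH vf_pc.
rewrite eN in nden.
have nalC := RtoC_neq0 _ n.
have nL : (RtoC (w0 p y) + RtoC (ps1 p * y) * (z - RtoC y) <> 0)%C.
  by move=> e; apply: nden; rewrite e; ring.
rewrite (Vfield_identity z (RtoC y) (RtoC (ps1 p * y)) (RtoC (w0 p y)) (RtoC al)) //; last first.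
- by rewrite -!RtoC_mult -hw; congr RtoC; ring.
- exact: RtoC_neq0.
- exact: UHP_real_neq.
congr Cplus; [congr Cplus; [congr Cplus|]|].
- by congr Cdiv; rewrite /= Rmult_1_r !RtoC_mult.
- by rewrite /e0 RtoC_plus !RtoC_mult; ring.
- by rewrite /e1 /=; rewrite !(RtoC_plus, RtoC_mult); ring.
- congr Cmult; rewrite /e2 RtoC_div //; congr Cdiv.
  by rewrite /=; rewrite !(RtoC_plus, RtoC_mult); ring.
Qed.

Definition cdv (f : C -> C) (z : C) : C := cderiv f z.

Lemma cderiv_val (f : C -> C) (z a : C) : cder f z a -> cdv f z = a.
Proof.
move=> h; apply: (cderiv_unique f z) => //.
exact: (epsilon_spec (inhabits C0) (fun w => has_cderiv f z w) (ex_intro _ a h)).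
Qed.

(** * From the domain [D] to the half-plane *)

Section Transfer.

Variables (D : C -> Prop) (phi : C -> C).
Hypothesis openD : Defs.open_set D.
Hypothesis Hphi : conformal_onto phi UHP D.

Let inv : C -> C := finv phi UHP.

Lemma phi_holo : holo UHP phi.
Proof. by have [h _] := Hphi; exact: h. Qed.

Lemma phi_inj : inj_on UHP phi.
Proof. by have [_ [h _]] := Hphi; exact: h. Qed.

Lemma phi_D (z : C) : UHP z -> D (phi z).
Proof. by have [_ [_ [h _]]] := Hphi; exact: h. Qed.

Lemma inv_spec (w : C) : D w -> UHP (inv w) /\ phi (inv w) = w.
Proof.
move=> hw; have [_ [_ [_ h]]] := Hphi.
exact: (epsilon_spec (inhabits C0) (fun z => UHP z /\ phi z = w) (h w hw)).
Qed.

Lemma inv_phi (z : C) : UHP z -> inv (phi z) = z.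
Proof. by move=> hz; have [h1 h2] := inv_spec _ (phi_D z hz); exact: phi_inj. Qed.

Lemma phi_cder (z : C) : UHP z -> cder phi z (cdv phi z) /\ cdv phi z <> 0%C.
Proof.
move=> hz; have [a ha] := phi_holo z hz; rewrite (cderiv_val _ _ _ ha); split => //.
exact: (inj_cder_neq0 UHP phi z a UHP_open phi_holo phi_inj hz ha).
Qed.

Lemma inv_cder (z : C) : UHP z -> cder inv (phi z) (/ cdv phi z)%C.
Proof.
move=> hz; have [h _] := phi_cder z hz.
exact: (inj_inverse_cder UHP phi inv z _ UHP_open phi_holo phi_inj hz h inv_phi).
Qed.

Lemma ell_phi (n : Z) (z : C) : UHP z -> ell phi n (phi z) = (cdv phi z * ellH n z)%C.
Proof. by move=> hz; rewrite /ell /pushforward -/inv inv_phi. Qed.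

Lemma CscalE (a : R) (z : C) : Cscal a z = (RtoC a * z)%C.
Proof. by apply: C_ext => /=; ring. Qed.

Lemma sigma_field_phi (p : param) (z : C) : UHP z ->
  sigma_field phi (ps0 p) (ps1 p) (phi z) = (cdv phi z * sigH p z)%C.
Proof.
move=> hz; rewrite /sigma_field !ell_phi // !CscalE.
change ((cdv phi z * - (1, 0) + (RtoC (ps0 p) * (cdv phi z * - (z * (1, 0))) + RtoC (ps1 p) * (cdv phi z * - (z * (z * (1, 0))))))%C = (cdv phi z * sigH p z)%C).
have -> : (1, 0) = RtoC 1 by [].
by rewrite /sigH; ring.
Qed.

Lemma b_field_phi (p : param) (z : C) : UHP z ->
  b_field phi (pm1 p) (pb0 p) (pb1 p) (phi z) = (cdv phi z * bH p z)%C.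
Proof.
move=> hz; rewrite /b_field !ell_phi // !CscalE.
have nz : z <> 0%C by move=> e; have := UHP_real_neq z 0 hz; rewrite e; apply; ring.
change ((RtoC 2 * (cdv phi z * - (/ (z * (1, 0)))) + (RtoC (pm1 p) * (cdv phi z * - (1, 0)) + (RtoC (pb0 p) * (cdv phi z * - (z * (1, 0))) + RtoC (pb1 p) * (cdv phi z * - (z * (z * (1, 0)))))))%C = (cdv phi z * bH p z)%C).
have -> : (1, 0) = RtoC 1 by [].
have -> : (z * 1 = z)%C by ring.
by rewrite /bH /Cdiv; ring.
Qed.

Variables (p : param) (c s : R -> R) (h : R -> C -> C).
Hypothesis trig : is_trig p c s.
Hypothesis Hh : is_flow D (sigma_field phi (ps0 p) (ps1 p)) h.

(** [h] is only known to be some flow of [sigma] in [D]. Its trajectories, pulled back to the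
    half-plane, solve the equation of [sigH] for all times and so coincide with the explicit Moebius
    flow. *)
Lemma flow_phi (t : R) (z : C) : UHP z -> h t (phi z) = phi (mob (flowmx p c s t) z).
Proof.
move=> hz; have [h1 [h2 h3]] := Hh.
have hD := phi_D z hz.
pose Y r := inv (h r (phi z)).
have YU : forall r, UHP (Y r) /\ phi (Y r) = h r (phi z) by move=> r; apply: inv_spec; exact: h1.
have dY : forall r, tder Y r (sigH p (Y r)).
  move=> r; have [u e] := YU r.
  have dh : tder (fun r => h r (phi z)) r (cdv phi (Y r) * sigH p (Y r))%C.
    apply: (tderiv_on_tder _ _ _ (fun _ => True) 1) => //; first lra.
    by rewrite -sigma_field_phi // e; exact: h3.
  have [_ na] := phi_cder (Y r) u.
  have di := inv_cder (Y r) u; rewrite e in di.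
  apply: tder_eq (tder_cderiv inv _ _ _ _ dh di) _.
  by field.
have Y0 : Y 0 = z by rewrite /Y h2 // inv_phi.
have [_ <-] := YU t.
by rewrite (flowmx_unique p c s Y trig (fun r => proj1 (YU r)) dY t) Y0.
Qed.

(** As [D] is open, [h (u t)] agrees near [phi z] with the conjugated Moebius map, and the chain
    rule gives its derivative; one factor [cdv phi z] remains after cancellation. *)
Lemma loewner_rhs_phi (u : R -> R) (t : R) (z : C) : UHP z ->
  loewner_rhs (b_field phi (pm1 p) (pb0 p) (pb1 p)) h u t (phi z) = (cdv phi z * Vfield p c s (u t) z)%C.
Proof.
move=> hz; set M := flowmx p c s (u t).
have det : mdet M = 1 by exact: flowmx_det.
set N := (RtoC (M Mc) * z + RtoC (M Md))%C.
have n : N <> 0%C by exact: mden_neq.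
have uW := mob_UHP M z det hz.
have [a2 n2] := phi_cder (mob M z) uW; have [a1 n1] := phi_cder z hz.
have dh : cder (h (u t)) (phi z) (cdv phi (mob M z) * (/ (N * N) * / cdv phi z))%C.
  have [r [r0 hr]] := openD (phi z) (phi_D z hz).
  apply: (cderiv_ext_loc (fun w => phi (mob M (inv w))) (h (u t)) (phi z) _ r r0).
    by move=> w hw; have [h1 h2] := inv_spec w (hr w hw); rewrite -{2}h2 flow_phi.
  apply: (cderiv_comp phi (fun w => mob M (inv w))); first by rewrite inv_phi.
  apply: (cderiv_comp (mob M) inv); last exact: inv_cder.
  by rewrite inv_phi //; exact: mob_cder.
rewrite /loewner_rhs flow_phi // -/M b_field_phi //.
have e := cderiv_val _ _ _ dh; rewrite {1}/cdv in e; rewrite e.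
change ((- (cdv phi (mob M z) * bH p (mob M z) / (cdv phi (mob M z) * (/ (N * N) * / cdv phi z))))%C = (cdv phi z * Vfield p c s (u t) z)%C).
rewrite /Vfield; cbv zeta; rewrite -/M -/N; field.
by repeat split.
Qed.

Definition vsurv (F : R -> C -> C) (t : R) (z : C) : Prop :=
  exists G : R -> C, G 0 = z /\ forall s, 0 <= s <= t -> UHP (G s) /\ tder G s (F s (G s)).

(** [loewner_domain] uses derivatives relative to [[0, t]] and [vsurv] two-sided ones; [tder_extend]
    reconciles them at the end points. *)
Lemma loewner_domain_phi (u : R -> R) (t : R) (z : C) : 0 <= t -> UHP z ->
  loewner_domain D (b_field phi (pm1 p) (pb0 p) (pb1 p)) h u t (phi z) <-> vsurv (fun r => Vfield p c s (u r)) t z.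
Proof.
move=> t0 hz; split.
- move=> [_ [_ [g [g0 [gD dg]]]]].
  have [G [eG dG]] := tder_extend g (fun r => loewner_rhs (b_field phi (pm1 p) (pb0 p) (pb1 p)) h u r (g r)) t t0 dg.
  exists (fun r => inv (G r)); split; first by rewrite eG ?g0 ?inv_phi //; lra.
  move=> r hr; rewrite eG //; have [u1 u2] := inv_spec _ (gD r hr); split => //.
  have d := dG r hr; rewrite -u2 loewner_rhs_phi // in d.
  have [_ na] := phi_cder _ u1.
  have di := inv_cder _ u1; rewrite u2 -eG // in di.
  apply: tder_eq (tder_cderiv inv G r _ _ d di) _.
  by rewrite eG //; field; rewrite -eG // in na *; rewrite eG.
- move=> [G [G0 hG]]; split => //; split; first exact: phi_D.
  exists (fun r => phi (G r)); split; first by rewrite G0.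
  split; first by move=> r hr; apply: phi_D; have [] := hG r hr.
  move=> r hr; have [u1 d] := hG r hr; apply: tder_tderiv_on.
  rewrite loewner_rhs_phi //; apply: tder_cderiv => //.
  by have [] := phi_cder _ u1.
Qed.

Lemma loewner_domain_D (u : R -> R) (t : R) (w : C) :
  loewner_domain D (b_field phi (pm1 p) (pb0 p) (pb1 p)) h u t w -> exists z, UHP z /\ w = phi z.
Proof. by move=> [_ [hw _]]; have [h1 h2] := inv_spec w hw; exists (inv w). Qed.

End Transfer.

Lemma vsurv_ext (F H : R -> C -> C) (t : R) (z : C) :
  (forall s w, 0 <= s <= t -> UHP w -> F s w = H s w) -> vsurv F t z -> vsurv H t z.
Proof.
move=> e [G [G0 hG]]; exists G; split => // s hs; have [u d] := hG s hs; split => //.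
by rewrite -e.
Qed.

(** The numerator in the quotient rule is the conserved quantity 1. So the pole moves strictly with
    the driving value, which can be recovered from it near 0. *)
Lemma polepos_derive (p : param) (c s : R -> R) (u : R) : is_trig p c s -> flowmx p c s u Ma <> 0 ->
  is_derive (polepos p c s) u (/ flowmx p c s u Ma ^ 2).
Proof.
move=> [_ [_ [dc [ds det]]]] n.
have da : is_derive (fun u => flowmx p c s u Ma) u ((ps0 p / 2 * (ps0 p / 2) - ps1 p) * s u - c u * (ps0 p / 2)).
  apply: is_derive_eq (is_derive_Rminus _ _ _ _ _ (dc u) (is_derive_Rmult _ _ _ _ _ (ds u) (is_derive_const (ps0 p / 2) u))) _.
  by rewrite /zero /=; ring.
apply: is_derive_eq (is_derive_div _ _ _ _ _ (ds u) da n) _.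
have num : c u * flowmx p c s u Ma - s u * ((ps0 p / 2 * (ps0 p / 2) - ps1 p) * s u - c u * (ps0 p / 2)) = 1.
  by rewrite -(det u) /=; ring.
by rewrite num /Rdiv Rmult_1_l.
Qed.

Lemma small_pole (p : param) (c s : R -> R) (e : R) : is_trig p c s -> 0 < e ->
  exists r0, 0 < r0 /\ forall u, Rabs u <= r0 -> / 2 <= flowmx p c s u Ma <= 2 /\ Rabs (polepos p c s u) <= e.
Proof.
move=> trig ep0; have [c0 [s0 [dc [ds _]]]] := trig.
have a0 : flowmx p c s 0 Ma = 1 by rewrite /= c0 s0; ring.
have p0 : polepos p c s 0 = 0 by rewrite /polepos s0; rewrite /Rdiv Rmult_0_l.
have ca : continuous (fun u => flowmx p c s u Ma) 0.
  apply: (is_derive_continuous _ _ _ (is_derive_Rminus _ _ _ _ _ (dc 0) (is_derive_Rmult _ _ _ _ _ (ds 0) (is_derive_const (ps0 p / 2) 0)))).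
have cp := is_derive_continuous _ _ _ (polepos_derive p c s 0 trig ltac:(rewrite a0; lra)).
have [d1 [d10 h1]] := proj1 (continuous_eps _ _) ca (/ 2) ltac:(lra).
have [d2 [d20 h2]] := proj1 (continuous_eps _ _) cp e ep0.
exists (Rmin d1 d2 / 2); have m := Rmin_pos _ _ d10 d20; split; first lra.
have m1 := Rmin_l d1 d2; have m2 := Rmin_r d1 d2.
move=> u hu; have := h1 u ltac:(rewrite Rminus_0_r; lra); have := h2 u ltac:(rewrite Rminus_0_r; lra).
rewrite a0 p0 Rminus_0_r => k2 /Rabs_def2 k1; split; [lra|by left].
Qed.

Lemma derive_zero_near (f : R -> R) (r0 : R) : (forall x, Rabs x <= r0 -> is_derive f x 0) ->
  forall u, Rabs u <= r0 -> f u = f 0.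
Proof.
move=> h u hu.
have hx : forall x, Rmin 0 u <= x <= Rmax 0 u -> Rabs x <= r0.
  move=> x; move: hu => /Rabs_le_between hu; rewrite /Rmin /Rmax; case: Rle_dec => [?|/Rnot_le_lt ?] hx; apply: Rabs_le; lra.
have [x [_ e]] := MVT_gen f 0 u (fun _ => 0) (fun x hx' => h x (hx x ltac:(lra)))
  (fun x hx' => continuous_continuity_pt _ _ (is_derive_continuous _ _ _ (h x (hx x hx')))).
lra.
Qed.

Lemma primitive_R (f : R -> R) : (forall s, continuous f s) -> exists F, F 0 = 0 /\ forall t, is_derive F t (f t).
Proof.
move=> fc; have ex : forall a b, ex_RInt f a b.
  by move=> a b; apply: (ex_RInt_continuous (V := R_CompleteNormedModule)) => s _; exact: fc.
exists (fun s => RInt f 0 s); split; first by rewrite RInt_point.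
move=> s; apply: (is_derive_RInt f (fun t => RInt f 0 t) 0); last exact: fc.
by exists (mkposreal 1 Rlt_0_1) => r _; apply: (RInt_correct (V := R_CompleteNormedModule)).
Qed.

(** The derivative of [polepos] on [[- r0, r0]] is continued by its end values, and its primitive is
    a diffeomorphism of the line. Thus [Rq] is continuous everywhere, although it inverts [polepos]
    only in the stated range. *)
Lemma polepos_inverse (p : param) (c s : R -> R) (r0 : R) : is_trig p c s -> 0 < r0 ->
  (forall u, Rabs u <= r0 -> / 2 <= flowmx p c s u Ma <= 2) ->
  exists Rq : R -> R, (forall y, continuous Rq y) /\ (forall u, Rabs u <= r0 -> Rq (polepos p c s u) = u) /\
    (forall y, Rabs (Rq y) <= r0 -> polepos p c s (Rq y) = y).
Proof.
move=> trig r00 hr; have [c0 [s0 [dc [ds _]]]] := trig.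
pose cl u := clamp (- r0) r0 u.
have clr : forall u, Rabs (cl u) <= r0.
  by move=> u; apply: Rabs_le; apply: clamp_in; lra.
have cli : forall u, Rabs u <= r0 -> cl u = u by move=> u /Rabs_le_between hu; apply: clamp_id; lra.
pose rho u := / flowmx p c s (cl u) Ma ^ 2.
have cmx : forall u, continuous (fun u => flowmx p c s u Ma) u.
  move=> u; exact: (is_derive_continuous _ _ _ (is_derive_Rminus _ _ _ _ _ (dc u) (is_derive_Rmult _ _ _ _ _ (ds u) (is_derive_const (ps0 p / 2) u)))).
have rc : forall u, continuous rho u.
  move=> u; apply: (continuous_comp (fun u => flowmx p c s (cl u) Ma ^ 2) Rinv); last first.
    by apply: continuous_Rinv; apply: pow_nonzero; have := hr _ (clr u); lra.
  apply: (continuous_comp (fun u => flowmx p c s (cl u) Ma) (fun x => x ^ 2)).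
    apply: (continuous_comp cl (fun u => flowmx p c s u Ma)); last exact: cmx.
    by apply: clamp_continuous; exact: continuous_id.
  apply: (is_derive_continuous _ _ (2 * flowmx p c s (cl u) Ma)); auto_derive => //; ring.
have rlow : forall u, / 4 <= rho u.
  move=> u; have h := hr _ (clr u); rewrite /rho; apply: Rinv_le_contravar; first by apply: pow_lt; lra.
  have -> : 4 = 2 ^ 2 by ring.
  by apply: pow_incr; lra.
have [l [l0 dl]] := primitive_R rho rc.
have [mu [h1 [h2 h3]]] := increasing_inverse l rho (/ 4) ltac:(lra) dl rlow.
have el : forall u, Rabs u <= r0 -> l u = polepos p c s u.
  move=> u hu.
  have h := derive_zero_near (fun x => l x - polepos p c s x) r0 _ u hu.
  have z0 : polepos p c s 0 = 0 by rewrite /polepos s0 /Rdiv Rmult_0_l.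
  rewrite l0 z0 in h; have {}h := h _; suff : l u - polepos p c s u = 0 - 0 by lra.
  apply: h => x hx; apply: is_derive_eq.
    apply: is_derive_Rminus; first exact: dl.
    by apply: polepos_derive => //; have := hr x hx; lra.
  by rewrite /rho cli //; ring.
exists mu; split; first by move=> y; exact: is_derive_continuous (h3 y).
split; first by move=> u hu; rewrite -el.
by move=> y hy; rewrite -el.
Qed.

Lemma clamp_cont_set (I : R -> Prop) (f : R -> R) (a b : R) : continuous_on_set I f -> (forall x, I (clamp a b x)) ->
  forall x, continuous (fun x => f (clamp a b x)) x.
Proof.
move=> hf hI x; apply/continuous_eps => eps ep0.
have [d [d0 hd]] := hf _ (hI x) eps ep0; exists d; split => // y hy.
by apply: hd => //; exact: Rle_lt_trans (clamp_lip _ _ _ _) hy.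
Qed.

Lemma is_derive_on_set (I : R -> Prop) (f df : R -> R) : (forall t, I t -> is_derive f t (df t)) -> has_deriv_on_set I f df.
Proof.
move=> h t ht eps ep0; have [d [d0 hd]] := proj1 (is_derive_eps _ _ _) (h t ht) (eps / 2) ltac:(lra).
exists d; split => // s _ [s0 hs].
have n : s - t <> 0 by move=> e; rewrite e Rabs_R0 in s0; lra.
have -> : (f s - f t) / (s - t) - df t = (f s - f t - (s - t) * df t) / (s - t) by field.
rewrite Rabs_div //; apply: (Rmult_lt_reg_r (Rabs (s - t))) => //.
have -> : Rabs (f s - f t - (s - t) * df t) / Rabs (s - t) * Rabs (s - t) = Rabs (f s - f t - (s - t) * df t) by field; lra.
have := hd s hs; nra.
Qed.

Lemma continuous_on_set_cont (I : R -> Prop) (f : R -> R) : (forall t, I t -> continuous f t) -> continuous_on_set I f.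
Proof.
move=> h t ht eps ep0; have [d [d0 hd]] := proj1 (continuous_eps _ _) (h t ht) eps ep0.
by exists d; split => // s _ hs; exact: hd.
Qed.

Lemma deriv_on_set_extend (I : R -> Prop) (f df : R -> R) (T : R) : 0 <= T -> (forall s, 0 <= s <= T -> I s) ->
  has_deriv_on_set I f df ->
  exists F, (forall s, 0 <= s <= T -> F s = f s) /\ forall s, 0 <= s <= T -> is_derive F s (df s).
Proof.
move=> T0 hI h.
have [G [eG dG]] := tder_extend (fun s => RtoC (f s)) (fun s => RtoC (df s)) T T0 (fun s hs => ltac:(
  move=> eps ep0; have [d [d0 hd]] := h s (hI s hs) eps ep0; exists d; split => // r hr [r0 hrs];
  have := hd r (hI r hr) (conj r0 hrs);
  have n : r - s <> 0 by [move=> e; rewrite e Rabs_R0 in r0; lra];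
  change (Rabs ((f r - f s) / (r - s) - df s) < eps -> Cmod ((RtoC (f r) - RtoC (f s)) - Cscal (r - s) (RtoC (df s)))%C <= eps * Rabs (r - s));
  have -> : ((RtoC (f r) - RtoC (f s)) - Cscal (r - s) (RtoC (df s)))%C = RtoC (((f r - f s) / (r - s) - df s) * (r - s)) by [apply: C_ext => /=; field];
  rewrite Cmod_R Rabs_mult => q; apply: Rmult_le_compat_r; [exact: Rabs_pos|lra])).
exists (fun s => fst (G s)); split; first by move=> s hs; rewrite eG.
by move=> s hs; have [] := dG s hs.
Qed.

Lemma admissible_mono (k : R -> coef) (B B' : R) : B <= B' -> admissible k B -> admissible k B'.
Proof.
by move=> hB [h1 h2]; split => // s; have [? [? [? [? ?]]]] := h2 s; repeat split; lra.
Qed.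

Lemma IVT_image (f : R -> R) (t x : R) : 0 <= t -> (forall s, 0 <= s <= t -> continuous f s) ->
  f 0 <= x <= f t -> exists s, 0 <= s <= t /\ f s = x.
Proof.
move=> t0 hf hx.
have [s [hs e]] := IVT_gen (fun s => f (clamp 0 t s)) 0 t x
  (fun s => continuous_continuity_pt _ _ (continuous_comp (fun s => clamp 0 t s) f s
     (clamp_continuous 0 t (fun s => s) s (continuous_id s)) (hf _ (clamp_in 0 t s t0))))
  ltac:(cbv beta; rewrite !clamp_id; [split; [apply: Rle_trans (Rmin_l _ _) _|apply: Rle_trans _ (Rmax_r _ _)]; lra|lra|lra]).
rewrite Rmin_left // Rmax_right // in hs.
by exists s; split => //; cbv beta in e; rewrite clamp_id in e.
Qed.

(** * Reparametrization of chains in the half-plane *)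

Lemma mpole_continuous (y : R -> R) (M : R -> midx -> R) (t : R) : continuous y t -> (forall i, continuous (fun s => M s i) t) ->
  mnu (y t) (M t Mc) (M t Md) <> 0 -> continuous (fun s => mpole (y s) (M s Ma) (M s Mb) (M s Mc) (M s Md)) t.
Proof.
move=> hy hM n.
have lin : forall i j, continuous (fun s => M s i * y s + M s j) t.
  move=> i j; apply: (continuous_plus (V := R_NormedModule)); last exact: hM.
  by apply: (continuous_mult (K := R_AbsRing)).
apply: (continuous_mult (K := R_AbsRing)); first exact: lin.
by apply: (continuous_comp (fun s => mnu (y s) (M s Mc) (M s Md)) Rinv); [exact: lin|apply: continuous_Rinv].
Qed.

Section HalfPlane.

Variables (p q : param) (cp sp cq sq : R -> R).
Hypothesis trigp : is_trig p cp sp.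
Hypothesis trigq : is_trig q cq sq.

(** [y] is the pole of the given chain, [pole] that of the new one, and [Rq] is inverse to [polepos q cq sq] near 0. *)
Variables (r0 T : R) (y : R -> R) (M : R -> midx -> R) (Rq : R -> R).
Let r := mrad p q.
Let pole t := mpole (y t) (M t Ma) (M t Mb) (M t Mc) (M t Md).
Let rate t := mrate p q (y t) (M t Ma) (M t Mb) (M t Mc) (M t Md).
Hypothesis r00 : 0 < r0.
Hypothesis T0 : 0 < T.
Hypothesis smallq : forall u, Rabs u <= r0 -> / 2 <= flowmx q cq sq u Ma <= 2 /\ Rabs (polepos q cq sq u) <= r.
Hypothesis yc : forall s, continuous y s.
Hypothesis yb : forall s, Rabs (y s) <= r.
Hypothesis M0 : forall i, M 0 i = mid i.
Hypothesis hM : forall t, 0 <= t <= T -> mbox (r / 2) (M t) /\ forall i, is_derive (fun s => M s i) t (mrhs p q (y t) (M t) i).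
Hypothesis Rc : forall x, continuous Rq x.
Hypothesis Rpole : forall u, Rabs u <= r0 -> Rq (polepos q cq sq u) = u.

Let k s := pc p (y s).

Lemma r_small : 0 < r <= / 100.
Proof. by have [] := mrad_bounds p q. Qed.

Lemma w0y : forall s, / 2 <= w0 p (y s).
Proof. by move=> s; have := r_small => h; have [|[]] := w0_small p q (y s); [have := yb s; rewrite /r in h *; lra|]. Qed.

(** [uniqueness_core] provides matrices for the competitor that solve the equation of [M] with the
    same start; [moebius_unique] identifies them with [M], which forces the pole and the rate.
    Smallness of the driving function is assumed here and obtained later by a bootstrap. *)
Lemma reparam_forced (S : R) (L dL tu : R -> R) : 0 <= S <= T ->
  (forall x, continuous tu x) -> L 0 = 0 -> (forall s, 0 <= s <= S -> is_derive L s (dL s)) ->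
  (forall s, 0 <= s <= S -> 0 <= L s) -> (forall s, 0 <= s <= S -> Rabs (tu (L s)) <= r0) ->
  (forall s, 0 <= s <= S -> forall z, UHP z ->
     vsurv (fun x => Vfield q cq sq (tu x)) (L s) z <-> hsurv k s z) ->
  forall s, 0 < s <= S -> tu (L s) = Rq (pole s) /\ dL s = rate s.
Proof.
move=> hS tuc L0 hL Lpos tus same.
have rs := r_small.
(* [tu] is controlled only at the times [L s]. The truncation makes the pole admissible at all times
   and changes nothing where it is used. *)
pose tc x := clamp (- r0) r0 (tu x).
have tcr : forall x, Rabs (tc x) <= r0 by move=> x; apply: Rabs_le; apply: clamp_in; lra.
pose yt x := polepos q cq sq (tc x).
have ytb : forall x, Rabs (yt x) <= r by move=> x; have [] := smallq _ (tcr x).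
have ytc : forall x, continuous yt x.
  move=> x; apply: (continuous_comp tc (polepos q cq sq)).
    by apply: clamp_continuous; exact: tuc.
  apply: is_derive_continuous (polepos_derive q cq sq _ trigq _).
  by have [h _] := smallq _ (tcr x); lra.
have w0yt : forall x, / 2 <= w0 q (yt x).
  by move=> x; have [|_ []] := w0_small p q (yt x); [have := ytb x; rewrite /r in rs *; lra|].
have [B1 ad1] := pc_admissible p y yc (fun s => ltac:(have := yb s; lra)) w0y.
have [B2 ad2] := pc_admissible q yt ytc (fun s => ltac:(have := ytb s; lra)) w0yt.
have adm := admissible_mono _ _ _ (Rmax_l B1 B2) ad1; have admt := admissible_mono _ _ _ (Rmax_r B1 B2) ad2.
(* [L] need not be monotone: each time in [[0, L s]] is some [L s'] by the intermediate value
   theorem. *)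
have below : forall s x, 0 <= s <= S -> 0 <= x <= L s -> Rabs (tu x) <= r0.
  move=> s x hs hx.
  have [s' [hs' <-]] := IVT_image L s x ltac:(lra) (fun v hv => is_derive_continuous _ _ _ (hL v ltac:(lra))) ltac:(rewrite L0; lra).
  by apply: tus; lra.
have eqv : forall s x w, 0 <= s <= S -> 0 <= x <= L s -> UHP w -> Vfield q cq sq (tu x) w = vf (pc q (yt x)) w.
  move=> s x w hs hx hw; have hb := below s x hs hx.
  have e : tc x = tu x by apply: clamp_id; apply/Rabs_le_between.
  rewrite /yt e Vfield_pc //; have [h _] := smallq _ hb; lra.
have hsurvU : forall k' t z, 0 <= t -> hsurv k' t z -> UHP z.
  by move=> k' t z t0 [G [<- hG]]; have [] := hG 0 ltac:(lra).
have same' : forall s, 0 <= s <= S -> forall z, hsurv (fun x => pc q (yt x)) (L s) z <-> hsurv k s z.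
  move=> s hs z; split => hz.
    have uz := hsurvU _ _ _ (Lpos s hs) hz.
    apply/(same s hs z uz); apply: (vsurv_ext (fun x => vf (pc q (yt x))) _ (L s) z _ hz) => x w hx hw; symmetry; exact: (eqv s).
  have uz := hsurvU _ _ _ (proj1 hs) hz.
  move/(same s hs z uz): hz => hz.
  by apply: (vsurv_ext (fun x => Vfield q cq sq (tu x)) (fun x => vf (pc q (yt x))) (L s) z _ hz) => x w hx hw; exact: (eqv s).
have [a [b [c [d [da [db [dc [dd [[a0 [b0 [c0 d0]]] H]]]]]]]]] := uniqueness_core p q y yt (Rmax B1 B2) S L dL adm admt (proj1 hS) L0 hL Lpos
  (fun s => ltac:(have := w0y s; lra)) (fun s => ltac:(have := w0yt s; lra)) same'.
pose Y s i := match i with Ma => a s | Mb => b s | Mc => c s | Md => d s end.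
pose DY s i := match i with Ma => da s | Mb => db s | Mc => dc s | Md => dd s end.
have MY : forall s, 0 <= s <= S -> forall i, M s i = Y s i.
  apply: (moebius_unique p q y S M Y DY) => //.
  - by case; rewrite M0 /= ?a0 ?b0 ?c0 ?d0.
  - by move=> t ht; exact: (hM t ltac:(lra)).
  - move=> t ht i; have [[h1 [h2 [h3 h4]]] hp] := H t ht; split; first by case: i.
    move=> t0; have [_ [_ [e1 [e2 [e3 e4]]]]] := hp t0.
    by case: i.
move=> s hs; have [_ hp] := H s ltac:(lra).
have [e1 [e2 _]] := hp ltac:(lra).
have my := MY s ltac:(lra).
have ep : pole s = yt (L s) by rewrite e1 /pole !my.
split; last by rewrite e2 /rate !my.
have e : tc (L s) = tu (L s) by apply: clamp_id; apply/Rabs_le_between; apply: tus; lra.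
by rewrite ep /yt Rpole // e.
Qed.

Hypothesis Rsmall : forall t, 0 <= t <= T -> Rabs (Rq (pole t)) < r0.
Hypothesis poleR : forall x, Rabs (Rq x) <= r0 -> polepos q cq sq (Rq x) = x.

Lemma pole_cont (t : R) : 0 <= t <= T -> continuous pole t.
Proof.
move=> ht; have [hb hd] := hM t ht; have rs := r_small.
apply: mpole_continuous => //.
  by move=> i; exact: is_derive_continuous (hd i).
have [h _] := mbox_bounds p q (y t) (M t) (yb t) ltac:(by move=> i; have := hb i; rewrite /r in rs *; lra); lra.
Qed.

(** [lam] is the primitive of the rate clamped to [[0, T]], a diffeomorphism of the line with
    inverse [mu]; [tu] is the driving value [Rq] of the transported pole. The domains agree by
    conjugation in both directions. *)
Lemma reparam_exists : exists lam rho mu tu : R -> R,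
  (forall t, is_derive lam t (rho t)) /\ (forall t, continuous rho t) /\ (forall t, 0 < rho t) /\ lam 0 = 0 /\
  (forall t, 0 <= t <= T -> rho t = rate t) /\
  (forall s, lam (mu s) = s) /\ (forall t, mu (lam t) = t) /\ (forall s t, s < t -> lam s < lam t) /\
  (forall x, continuous tu x) /\ (forall t, 0 <= t <= T -> tu (lam t) = Rq (pole t)) /\
  (forall t, 0 <= t <= T -> forall z, UHP z -> vsurv (fun x => Vfield q cq sq (tu x)) (lam t) z <-> hsurv k t z).
Proof.
have rs := r_small.
pose cl t := clamp 0 T t.
have clr : forall t, 0 <= cl t <= T by move=> t; apply: clamp_in; lra.
have clc : forall t, continuous cl t by move=> t; apply: clamp_continuous; exact: continuous_id.
have cb : forall t, mbox r (M (cl t)) by move=> t i; have [h _] := hM _ (clr t); have := h i; lra.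
pose rho t := rate (cl t).
have rc : forall t, continuous rho t.
  have [_ [_ [_ hreg]]] := mrhs_regular p q (fun s => y (cl s)) Ma
    (fun s => continuous_comp cl y s (clc s) (yc _)) (fun s => yb _).
  apply: (hreg (fun s => M (cl s))) => // i s.
  apply: (continuous_comp cl (fun s => M s i)) => //.
  by have [_ h] := hM _ (clr s); exact: is_derive_continuous (h i).
(* With [w0] and [mnu] in [[1/2, 2]], the rate is at least [(1/2)^2 / (2^2 2^4)]. *)
have rlow : forall t, / 256 <= rho t.
  move=> t; have [h1 h2] := mbox_bounds p q (y (cl t)) (M (cl t)) (yb _) (cb t).
  have [_ h3] := w0_small p q _ h2.
  have h4 := w0y (cl t).
  rewrite /rho /rate /mrate /Rdiv.
  have -> : / 256 = (/ 2) ^ 2 * / 64 by field.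
  apply: Rmult_le_compat; [by apply: pow_le; lra|lra|by apply: pow_incr; lra|].
  apply: Rinv_le_contravar; first by apply: Rmult_lt_0_compat; apply: pow_lt; lra.
  have -> : 64 = 2 ^ 2 * 2 ^ 4 by ring.
  by apply: Rmult_le_compat; try (by apply: pow_le; lra); apply: pow_incr; lra.
have [lam [lam0 hlam]] := primitive_R rho rc.
have [mu [h1 [h2 h3]]] := increasing_inverse lam rho (/ 256) ltac:(lra) hlam rlow.
have rpos : forall t, 0 < rho t by move=> t; have := rlow t; lra.
pose yt s := let t := clamp 0 T (mu s) in mpole (y t) (M t Ma) (M t Mb) (M t Mc) (M t Md).
have ytp : forall s, yt s = pole (cl (mu s)) by [].
have ytc : forall s, continuous yt s.
  move=> s; apply: (continuous_comp (fun s => cl (mu s)) pole); last exact: pole_cont.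
  by apply: clamp_continuous; exact: is_derive_continuous (h3 s).
pose tu s := Rq (yt s).
have det0 : mdet (M 0) = 1 by rewrite /mdet !M0 /=; ring.
have det := mdet_const p q y M T ltac:(lra) det0 (fun t ht => proj2 (hM t ht)).
have [a0 [b0 [c0 d0]]] : M 0 Ma = 1 /\ M 0 Mb = 0 /\ M 0 Mc = 0 /\ M 0 Md = 1 by rewrite !M0.
have rr : forall t, 0 <= t <= T -> rho t = rate t by move=> t ht; rewrite /rho /cl clamp_id.
have fwd := conjugate_fwd p q y M T lam mu rho yb det (fun t ht => proj1 (hM t ht)) (fun t ht => proj2 (hM t ht)) rr hlam rpos h1 h2 h3 lam0.
have bwd := conjugate_bwd p q y M T lam mu rho yb det (fun t ht => proj1 (hM t ht)) (fun t ht => proj2 (hM t ht)) rr hlam rpos h2 lam0.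
exists lam, rho, mu, tu; do 7 (split; first by []).
split; first by move=> s t; exact: (lam_lt lam mu rho hlam rpos h2).
split; first by move=> x; apply: (continuous_comp yt Rq).
split; first by move=> t ht; rewrite /tu ytp h2 /cl clamp_id.
have eqv : forall x w, UHP w -> Vfield q cq sq (tu x) w = vf (pc q (yt x)) w.
  move=> x w hw.
  have hs : Rabs (tu x) <= r0 by left; rewrite /tu ytp; apply: Rsmall.
  rewrite Vfield_pc //; last by have [h _] := smallq _ hs; lra.
  by rewrite /tu poleR.
move=> t ht z hz; split => hs.
  apply: (bwd t z) => //.
  by apply: (vsurv_ext (fun x => Vfield q cq sq (tu x)) (fun x => vf (pc q (yt x))) (lam t) z _ hs) => x w _ hw; exact: eqv.
have hs' := fwd t z a0 b0 c0 d0 ht hs.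
by apply: (vsurv_ext (fun x => vf (pc q (yt x))) (fun x => Vfield q cq sq (tu x)) (lam t) z _ hs') => x w _ hw; symmetry; exact: eqv.
Qed.

End HalfPlane.

(** Existence is [reparam_exists] on a short interval, with [Ttmax = lam T] so that [lam] is onto.
    Uniqueness is shown on each [[0, S]] with [S < T], where the competing time change attains a
    maximum below [lam T]. *)
Lemma halfplane_reparam (p q : param) (cp sp cq sq u : R -> R) : is_trig p cp sp -> is_trig q cq sq ->
  continuous_on_set (fun t => 0 <= t) u -> u 0 = 0 ->
  exists Tmax Ttmax : R, 0 < Tmax /\ 0 < Ttmax /\
  exists lam dlam tu : R -> R,
    has_deriv_on_set (fun t => 0 <= t < Tmax) lam dlam /\
    continuous_on_set (fun t => 0 <= t < Tmax) dlam /\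
    lam 0 = 0 /\
    (forall t, 0 <= t < Tmax -> 0 <= lam t < Ttmax) /\
    (forall s, 0 <= s < Ttmax -> exists t, 0 <= t < Tmax /\ lam t = s) /\
    continuous_on_set (fun s => 0 <= s < Ttmax) tu /\
    tu 0 = 0 /\
    (forall t, 0 <= t < Tmax -> forall z, UHP z ->
       vsurv (fun x => Vfield q cq sq (tu x)) (lam t) z <-> vsurv (fun x => Vfield p cp sp (u x)) t z) /\
    (forall t, 0 <= t < Tmax -> 0 < dlam t) /\
    (forall lam2 tu2 : R -> R,
       C1_on_set (fun t => 0 <= t < Tmax) lam2 -> lam2 0 = 0 ->
       (forall t, 0 <= t < Tmax -> 0 <= lam2 t < Ttmax) ->
       continuous_on_set (fun s => 0 <= s < Ttmax) tu2 -> tu2 0 = 0 ->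
       (forall t, 0 <= t < Tmax -> forall z, UHP z ->
          vsurv (fun x => Vfield q cq sq (tu2 x)) (lam2 t) z <-> vsurv (fun x => Vfield p cp sp (u x)) t z) ->
       (forall t, 0 <= t < Tmax -> lam2 t = lam t) /\
       (forall s, 0 <= s < Ttmax -> tu2 s = tu s)).
Proof.
move=> trigp trigq hu u0.
have [[r0' r1'] _] := mrad_bounds p q; set r := mrad p q in r0' r1'.
have [rp [rp0 hp]] := small_pole p cp sp r trigp r0'.
have [rq [rq0 hq]] := small_pole q cq sq r trigq r0'.
have [Rq [Rc [Rpole poleR]]] := polepos_inverse q cq sq rq trigq rq0 (fun u hu => proj1 (hq u hu)).
have [dT [dT0 hdT]] := hu 0 (Rle_refl 0) rp rp0.
set T1 := dT / 2; have T10 : 0 < T1 by rewrite /T1; lra.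
have usm : forall s, 0 <= s <= T1 -> Rabs (u s) <= rp.
  move=> s hs; have := hdT s (proj1 hs) ltac:(rewrite Rminus_0_r Rabs_pos_eq; rewrite /T1 in hs; lra).
  by rewrite u0 Rminus_0_r; left.
pose uc s := u (clamp 0 T1 s).
have ucc := clamp_cont_set _ u 0 T1 hu (fun x => proj1 (clamp_in 0 T1 x ltac:(lra))).
have ucs : forall s, Rabs (uc s) <= rp by move=> s; apply: usm; apply: clamp_in; lra.
pose y s := polepos p cp sp (uc s).
have yc : forall s, continuous y s.
  move=> s; apply: (continuous_comp uc (polepos p cp sp)) => //.
  apply: is_derive_continuous (polepos_derive p cp sp _ trigp _).
  by have [h _] := hp _ (ucs s); lra.
have yb : forall s, Rabs (y s) <= r by move=> s; have [] := hp _ (ucs s).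
have [T2 [M [T20 [M0 hM]]]] := moebius_exists p q y yc yb.
have y0 : y 0 = 0.
  rewrite /y /uc clamp_id ?u0; last lra.
  by have [_ [s0 _]] := trigp; rewrite /polepos s0 /Rdiv Rmult_0_l.
pose pole t := mpole (y t) (M t Ma) (M t Mb) (M t Mc) (M t Md).
have pole0 : pole 0 = 0 by rewrite /pole /mpole y0 !M0 /=; rewrite /Rdiv; ring.
have Rq0 : Rq 0 = 0.
  have h := Rpole 0 ltac:(rewrite Rabs_R0; lra).
  by move: h; have [_ [s0 _]] := trigq; rewrite /polepos s0 /Rdiv Rmult_0_l.
have pc0 : continuous (fun t => Rq (pole t)) 0.
  apply: (continuous_comp pole Rq) => //.
  by apply: (pole_cont p q T2 y M yc yb hM); lra.
have [d3 [d30 h3]] := proj1 (continuous_eps _ _) pc0 rq rq0.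
(* [T1] keeps the given pole small, [T2] is the time for which the matrices are available, and [d3]
   keeps the new driving value in the range where [Rq] inverts [polepos]. *)
set T := Rmin (Rmin T1 T2) (d3 / 2).
have T0 : 0 < T by do ! apply: Rmin_pos; lra.
have Ta : T <= T1 := Rle_trans _ _ _ (Rmin_l _ _) (Rmin_l _ _).
have Tb : T <= T2 := Rle_trans _ _ _ (Rmin_l _ _) (Rmin_r _ _).
have Tc : T <= d3 / 2 by exact: Rmin_r.
have Rsmall : forall t, 0 <= t <= T -> Rabs (Rq (pole t)) < rq.
  move=> t ht; have := h3 t ltac:(rewrite Rminus_0_r Rabs_pos_eq; lra).
  by rewrite pole0 Rq0 Rminus_0_r.
have hM' : forall t, 0 <= t <= T -> mbox (mrad p q / 2) (M t) /\ forall i, is_derive (fun s => M s i) t (mrhs p q (y t) (M t) i).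
  by move=> t ht; apply: hM; lra.
have [lam [rho [mu [tu [dlam [rc [rpos [lam0 [rr [lm [ml [lt [tuc [tul same]]]]]]]]]]]]]] :=
  reparam_exists p q cq sq trigq rq T y M Rq T0 hq yc yb M0 hM' Rc Rsmall poleR.
have usurv : forall t z, 0 <= t <= T -> vsurv (fun x => Vfield p cp sp (u x)) t z <-> hsurv (fun s => pc p (y s)) t z.
  have e : forall t s w, 0 <= t <= T -> 0 <= s <= t -> UHP w -> Vfield p cp sp (u s) w = vf (pc p (y s)) w.
    move=> t s w ht hs hw; have us := usm s ltac:(lra).
    rewrite Vfield_pc //; last by have [h _] := hp _ us; lra.
    by rewrite /y /uc clamp_id //; lra.
  move=> t z ht; split => h.
    by apply: (vsurv_ext (fun x => Vfield p cp sp (u x)) (fun s => vf (pc p (y s))) t z _ h) => s w hs hw; exact: (e t).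
  by apply: (vsurv_ext (fun s => vf (pc p (y s))) (fun x => Vfield p cp sp (u x)) t z _ h) => s w hs hw; symmetry; exact: (e t).
have tu0 : tu 0 = 0 by rewrite -{1}lam0 tul; [rewrite -/(pole 0) pole0|lra].
exists T, (lam T); split => //.
have mono : forall s t, s <= t -> lam s <= lam t by move=> s t [h| ->]; [left; exact: lt|right].
have lamT : 0 < lam T by rewrite -{1}lam0; exact: lt.
have lamr : forall t, 0 <= t < T -> 0 <= lam t < lam T by move=> t ht; split; [rewrite -{1}lam0; apply: mono; lra|apply: lt; lra].
have surj : forall s, 0 <= s < lam T -> exists t, 0 <= t < T /\ lam t = s.
  move=> s hs; exists (mu s); split => //; split.
    by apply: Rnot_lt_le => h; have := lt _ _ h; rewrite lm lam0; lra.
  by apply: Rnot_le_lt => h; have := mono _ _ h; rewrite lm; lra.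
split => //; exists lam, rho, tu.
split; first by apply: is_derive_on_set => t _; exact: dlam.
split; first by apply: continuous_on_set_cont => t _; exact: rc.
do 3 split => //.
split; first by apply: continuous_on_set_cont => t _; exact: tuc.
split; first exact: tu0.
split; first by move=> t ht z hz; rewrite usurv; [apply: same => //|]; lra.
split; first by [].
move=> lam2 tu2 [dl2 [hl2 _]] l20 l2r tu2c tu20 same2.
suff main : forall S, 0 <= S < T -> forall s, 0 <= s <= S -> lam2 s = lam s /\ tu2 (lam2 s) = tu (lam s).
  split; first by move=> t ht; have [] := main t ht t ltac:(lra).
  move=> s hs; have [t [ht <-]] := surj s hs; have [e1 e2] := main t ht t ltac:(lra).
  by rewrite -e2 e1.
move=> S hS.
have [L [eL dL]] := deriv_on_set_extend (fun t => 0 <= t < T) lam2 dl2 S (proj1 hS) (fun s hs => ltac:(lra)) hl2.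
have L0 : L 0 = 0 by rewrite eL //; lra.
have Lc : forall s, 0 <= s <= S -> continuous L s by move=> s hs; exact: is_derive_continuous (dL s hs).
have [m [hm1 hm2]] := continuity_ab_maj L 0 S (proj1 hS) (fun s hs => continuous_continuity_pt _ _ (Lc s hs)).
set Lam := L m in hm1.
have Lamr : 0 <= Lam < lam T by rewrite /Lam eL //; apply: l2r; lra.
have Lr : forall s, 0 <= s <= S -> 0 <= L s <= Lam.
  by move=> s hs; split; [rewrite eL //; have := l2r s ltac:(lra); lra|exact: hm1].
(* [tu2] is controlled only below [Ttmax]; it is frozen beyond the maximum [Lam] of [L], which
   leaves all times in use untouched. *)
pose tc x := tu2 (clamp 0 Lam x).
have tcc : forall x, continuous tc x.
  apply: clamp_cont_set tu2c _ => x; have := clamp_in 0 Lam x (proj1 Lamr); lra.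
have tce : forall x, 0 <= x <= Lam -> tc x = tu2 x by move=> x hx; rewrite /tc clamp_id.
have same3 : forall s, 0 <= s <= S -> forall z, UHP z ->
    vsurv (fun x => Vfield q cq sq (tc x)) (L s) z <-> hsurv (fun s => pc p (y s)) s z.
  move=> s hs z hz; rewrite -usurv; last lra.
  have := same2 s ltac:(lra) z hz; rewrite -eL // => <-.
  have := Lr s hs => hLs.
  split => h.
    by apply: (vsurv_ext (fun x => Vfield q cq sq (tc x)) (fun x => Vfield q cq sq (tu2 x)) (L s) z _ h) => x w hx hw; rewrite tce //; lra.
  by apply: (vsurv_ext (fun x => Vfield q cq sq (tu2 x)) (fun x => Vfield q cq sq (tc x)) (L s) z _ h) => x w hx hw; rewrite tce //; lra.
have forced : forall S', 0 <= S' <= S -> (forall s, 0 <= s <= S' -> Rabs (tc (L s)) <= rq) ->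
    forall s, 0 < s <= S' -> tc (L s) = Rq (pole s) /\ dl2 s = rho s.
  move=> S' hS' hsm s hs.
  have [e1 e2] := reparam_forced p q cq sq trigq rq T y M Rq rq0 hq yc yb M0 hM' Rpole S' L dl2 tc ltac:(lra) tcc L0
    (fun s hs => dL s ltac:(lra)) (fun s hs => proj1 (Lr s ltac:(lra))) hsm (fun s hs => same3 s ltac:(lra)) s hs.
  by rewrite e1 e2 rr //; lra.
have tc0 : tc (L 0) = 0 by rewrite L0 tce ?tu20 //; lra.
(* [reparam_forced] needs the bound [rq] along [L]. Where it holds, the value is [Rq (pole s)],
   strictly below [rq] by [Rsmall]; so the bound propagates from time 0. *)
have small : forall s, 0 <= s <= S -> Rabs (tc (L s)) < rq.
  apply: bootstrap.
  - move=> t ht; apply: (continuous_comp (fun t => tc (L t)) Rabs); last exact: continuous_Rabs.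
    by apply: (continuous_comp L tc) => //; exact: Lc.
  - by rewrite tc0 Rabs_R0; lra.
  - move=> s hs hsm; case: (Rle_lt_or_eq_dec _ _ (proj1 hs)) => [s0|<-]; last by rewrite tc0 Rabs_R0.
    have [-> _] := forced s hs hsm s ltac:(lra).
    by apply: Rsmall; lra.
have F := forced S ltac:(lra) (fun s hs => Rlt_le _ _ (small s hs)).
(* The derivatives are known to agree at positive times only; two monotonicity comparisons from the
   common value at 0 are enough. *)
have eq : forall s, 0 <= s <= S -> L s = lam s.
  move=> s hs; case: (Rle_lt_or_eq_dec _ _ (proj1 hs)) => [s0|<-]; last by rewrite L0 lam0.
  have d : forall x, 0 <= x <= s -> is_derive (fun x => L x - lam x) x (dl2 x - rho x).
    by move=> x hx; apply: is_derive_Rminus; [apply: dL; lra|exact: dlam].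
  have z : forall x, 0 < x < s -> dl2 x - rho x = 0 by move=> x hx; have [_ ->] := F x ltac:(lra); ring.
  have h1 := derive_nonpos_le (fun x => L x - lam x) (fun x => dl2 x - rho x) 0 s (Rlt_le _ _ s0) (fun x hx => d x ltac:(lra))
    (fun x hx => is_derive_continuous _ _ _ (d x hx)) (fun x hx => ltac:(have := z x hx; lra)).
  have d' : forall x, 0 <= x <= s -> is_derive (fun x => lam x - L x) x (rho x - dl2 x).
    by move=> x hx; apply: is_derive_Rminus; [exact: dlam|apply: dL; lra].
  have h2 := derive_nonpos_le (fun x => lam x - L x) (fun x => rho x - dl2 x) 0 s (Rlt_le _ _ s0) (fun x hx => d' x ltac:(lra))
    (fun x hx => is_derive_continuous _ _ _ (d' x hx)) (fun x hx => ltac:(have := z x hx; lra)).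
  rewrite L0 lam0 in h1 h2; lra.
move=> s hs; rewrite -eL // eq //; split => //.
rewrite -(eq s hs) -tce; last exact: Lr.
case: (Rle_lt_or_eq_dec _ _ (proj1 hs)) => [s0|<-].
  by have [-> _] := F s ltac:(lra); rewrite eq // tul //; lra.
by rewrite tc0 eq ?lam0 ?tu0 //; lra.
Qed.

Theorem mainTheorem7
  (D : CC -> Prop) (phi : CC -> CC)
  (HD : sc_hyperbolic_domain D)
  (Hphi : conformal_onto phi UHP D)
  (* the given normalized slit Loewner chain, driven by b, sigma, u *)
  (bm1 b0 b1 s0 s1 : R) (h : R -> CC -> CC) (u : R -> R)
  (Hh : is_flow D (sigma_field phi s0 s1) h)
  (Hu : continuous_on_set (fun t => 0 <= t) u) (Hu0 : u 0 = 0)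
  (* the other pair of normalized fields (tilde b, tilde sigma) *)
  (tbm1 tb0 tb1 ts0 ts1 : R) (th : R -> CC -> CC)
  (Hth : is_flow D (sigma_field phi ts0 ts1) th) :
  exists Tmax Ttmax : R, 0 < Tmax /\ 0 < Ttmax /\
  exists (lam dlam tu : R -> R),
    has_deriv_on_set (fun t => 0 <= t < Tmax) lam dlam /\
    continuous_on_set (fun t => 0 <= t < Tmax) dlam /\
    lam 0 = 0 /\
    (forall t, 0 <= t < Tmax -> 0 <= lam t < Ttmax) /\
    (forall s, 0 <= s < Ttmax -> exists t, 0 <= t < Tmax /\ lam t = s) /\
    continuous_on_set (fun s => 0 <= s < Ttmax) tu /\
    tu 0 = 0 /\
    (forall t, 0 <= t < Tmax -> forall z,
       loewner_domain D (b_field phi tbm1 tb0 tb1) th tu (lam t) z <->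
       loewner_domain D (b_field phi bm1 b0 b1) h u t z) /\
    (forall t, 0 <= t < Tmax -> 0 < dlam t) /\
    (* uniqueness of lam and tu *)
    (forall lam2 tu2 : R -> R,
       C1_on_set (fun t => 0 <= t < Tmax) lam2 ->
       lam2 0 = 0 ->
       (forall t, 0 <= t < Tmax -> 0 <= lam2 t < Ttmax) ->
       continuous_on_set (fun s => 0 <= s < Ttmax) tu2 ->
       tu2 0 = 0 ->
       (forall t, 0 <= t < Tmax -> forall z,
          loewner_domain D (b_field phi tbm1 tb0 tb1) th tu2 (lam2 t) z <->
          loewner_domain D (b_field phi bm1 b0 b1) h u t z) ->
       (forall t, 0 <= t < Tmax -> lam2 t = lam t) /\
       (forall s, 0 <= s < Ttmax -> tu2 s = tu s)).
Proof.
pose p := Param bm1 b0 b1 s0 s1; pose q := Param tbm1 tb0 tb1 ts0 ts1.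
have openD : Defs.open_set D by have [] := HD.
have [cp [sp trigp]] := hyp_trig (ps0 p / 2 * (ps0 p / 2) - ps1 p).
have [cq [sq trigq]] := hyp_trig (ps0 q / 2 * (ps0 q / 2) - ps1 q).
have domp := fun t z t0 hz => loewner_domain_phi D phi openD Hphi p cp sp h trigp Hh u t z t0 hz.
have domq := fun tu t z t0 hz => loewner_domain_phi D phi openD Hphi q cq sq th trigq Hth tu t z t0 hz.
have [Tm [Ttm [Tm0 [Ttm0 [lam [dlam [tu [h1 [h2 [h3 [h4 [h5 [h6 [h7 [h8 [h9 h10]]]]]]]]]]]]]]]] :=
  halfplane_reparam p q cp sp cq sq u trigp trigq Hu Hu0.
exists Tm, Ttm; do 2 split => //; exists lam, dlam, tu; do 7 split => //.
have key : forall t, 0 <= t < Tm -> forall z, UHP z ->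
    loewner_domain D (b_field phi tbm1 tb0 tb1) th tu (lam t) (phi z) <-> loewner_domain D (b_field phi bm1 b0 b1) h u t (phi z).
  move=> t ht z hz; have [l0 _] := h4 t ht; have t0 : 0 <= t by lra.
  have e1 := domp t z t0 hz; have e2 := domq tu (lam t) z l0 hz; have e3 := h8 t ht z hz.
  by split => hh; [apply/e1/e3/e2|apply/e2/e3/e1].
split.
  (* A point of either domain lies in [D], hence has the form [phi w] with [w] in the half-plane,
     where [key] applies. *)
  move=> t ht z; split => hz.
    by have [w [hw e]] := loewner_domain_D D phi Hphi q th _ _ _ hz; subst z; apply/(key t ht w hw).
  by have [w [hw e]] := loewner_domain_D D phi Hphi p h _ _ _ hz; subst z; apply/(key t ht w hw).
split => // lam2 tu2 g1 g2 g3 g4 g5 g6.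
apply: h10 => // t ht z hz; have l0 : 0 <= lam2 t by have [] := g3 t ht.
have t0 : 0 <= t by lra.
have e1 := domp t z t0 hz; have e2 := domq tu2 (lam2 t) z l0 hz; have e3 := g6 t ht (phi z).
by split => hh; [apply/e1/e3/e2|apply/e2/e3/e1].
Qed.
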